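(* Assume that $\gamma\in(0,2]$ and that the fragmentation kernel $\kappa$ is a function for which there exist $\underline\kappa,\overline\kappa>0$ with $\underline\kappa\le\kappa(z)\le\overline\kappa$ for all $z\in[0,1]$. Let $f:\mathbb R_+\to\mathbb R_+$ be of class $\mathcal C^1$ with $\limsup_{I\to\infty}f(I)<\mu$ and such that the set $\mathcal N:=\{I;\ f(I)=\mu\}$ is a singleton. Then the equation $$\frac{\partial}{\partial t}u(t,x)=-f\Big(\int_0^\infty x^pu(t,x)\,dx\Big)\frac{\partial}{\partial x}\big(x\,u(t,x)\big)-\mu\,u(t,x)+\mathcal F_\gamma u(t,x)$$ has a unique nontrivial steady state $u_\infty$. If additionally $f'\big(\int_0^\infty x^pu_\infty(x)\,dx\big)<0$, then $u_\infty$ is globally asymptotically stable in $\mathcal H^+\setminus\{0\}$.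
   Context: Here $\mathbb R_+=[0,\infty)$. Fixed constants: $\beta>0$, $\mu>0$, $p>0$, and $\gamma>0$. The kernel $\kappa\ge 0$ on $[0,1]$ satisfies $\int_0^1 z\,\kappa(z)\,dz=1$. The fragmentation operator is $$\mathcal F_\gamma u(x)=\int_x^\infty \beta y^{\gamma-1}\kappa\Big(\frac xy\Big)u(y)\,dy-\beta x^\gamma u(x),\qquad x>0.$$ Equations are posed for $t\ge0$, $x>0$, with boundary condition $u(t,0)=0$ and initial condition $u(0,\cdot)=u_0\ge0$. Functional space: $\mathcal H:=L^2\big((0,\infty);(x+x^r)\,dx\big)$ with $r$ large enough, and $\mathcal H^+$ is its cone of nonnegative functions. Precisely, $r\ge\max(\bar r,2p+1)$, where $\bar r\ge3$ is a constant such that the following known spectral gap theorem (Cáceres–Cañizo–Mischler) holds for $r\ge\bar r$: there exist $a>0$, $C>0$ such that every solution $v$ of the linear equation $\partial_tv=-\mu\,\partial_x(xv)-\mu v+\mathcal F_\gamma v$ with $v(0,\cdot)=v_0\in\mathcal H^+\setminus\{0\}$ satisfies $\|\varrho_0^{-1}v(t,\cdot)-\mathcal U_\mu\|_{\mathcal H}\le C\|\varrho_0^{-1}v_0-\mathcal U_\mu\|_{\mathcal H}e^{-at}$ for all $t>0$. Here $\mathcal U_\mu\ge0$, $\int_0^\infty\mathcal U_\mu\,dx=1$, is the stationary solution of that linear equation and $\varrho_0=\int_0^\infty x v_0\,dx\big/\int_0^\infty x\,\mathcal U_\mu\,dx$. Globally asymptotically stable in $\mathcal H^+\setminus\{0\}$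 means: Lyapunov stable for the norm of $\mathcal H$, and every solution with initial distribution in $\mathcal H^+\setminus\{0\}$ converges to $u_\infty$ in $\mathcal H$.
   Formalization: The single element of N is assumed positive: for N={0}, e.g. f(I)=μ/(1+I), no nontrivial steady state exists. The first moment is required to be finite on all of H^+, so that ϱ_0 is defined; this excludes only r=3. *)

(* Defs.v *)
From HB Require Import structures.
From mathcomp Require Import all_boot all_order all_algebra.
From mathcomp Require Import all_classical all_reals all_analysis.
Set Implicit Arguments.
Unset Strict Implicit.
Unset Printing Implicit Defensive.
Import Order.TTheory GRing.Theory Num.Theory.
Import numFieldNormedType.Exports.
Local Open Scope classical_set_scope.
Local Open Scope ring_scope.

(* A density is a function [h : R -> R], of which only the restriction to
   x > 0 matters, up to equality almost everywhere. *)

Definition ae_pos (R : realType) (P : R -> Prop) : Prop :=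
  {ae (@lebesgue_measure R), forall x, 0 < x -> P x}.

Definition finite_moment (R : realType) (q : R) (h : R -> R) : Prop :=
  (@lebesgue_measure R).-integrable `]0, +oo[ (fun x => (x `^ q * h x)%:E).

Definition moment (R : realType) (q : R) (h : R -> R) : R :=
  \int[@lebesgue_measure R]_(x in `]0, +oo[) (x `^ q * h x).

(* The space L^2((0,oo); (x + x^r) dx), its norm and its nonnegative cone. *)
Definition in_H (R : realType) (r : R) (h : R -> R) : Prop :=
  measurable_fun (`]0, +oo[ : set R) h /\
  (@lebesgue_measure R).-integrable `]0, +oo[
    (fun x => (h x ^+ 2 * (x + x `^ r))%:E).

Definition H_norm (R : realType) (r : R) (h : R -> R) : R :=
  Num.sqrt (\int[@lebesgue_measure R]_(x in `]0, +oo[)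
              (h x ^+ 2 * (x + x `^ r))).

Definition in_Hplus (R : realType) (r : R) (h : R -> R) : Prop :=
  in_H r h /\ ae_pos (fun x => 0 <= h x).

Definition nontrivial (R : realType) (h : R -> R) : Prop :=
  ~ ae_pos (fun x => h x = 0).

Definition frag (R : realType) (beta gamma : R) (kappa h : R -> R) (x : R) : R :=
  \int[@lebesgue_measure R]_(y in `]x, +oo[)
     (beta * y `^ (gamma - 1) * kappa (x / y) * h y)
  - beta * x `^ gamma * h x.

Definition test_function (R : realType) (phi : R -> R) : Prop :=
  [/\ forall x, derivable phi x 1,
      continuous (derive1 phi) &
      exists a b : R, 0 < a /\ forall x, phi x != 0 -> a <= x <= b].

(* [growth_frag_solution beta gamma kappa mu r g u]: u is a nonnegative
   solution, on [0, oo) in time, of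
     d_t u(t,x) = - g(t) d_x (x u(t,x)) - mu u(t,x) + F_gamma u(t,x),
     u(t,0) = 0,
   in C([0, oo); H), in the weak sense (tested against C^1 functions with
   compact support in (0, oo) and integrated in time); its initial
   distribution is [u 0].
   The transport speed g(t) x vanishes at x = 0, so no characteristic enters
   there: for densities in H the boundary condition puts no constraint beyond
   the choice of the value of the representative at the point 0.  In
   particular it does not say that u(t,x) tends to 0 as x -> 0. *)
Definition growth_frag_solution (R : realType) (beta gamma : R)
    (kappa : R -> R) (mu r : R) (g : R -> R) (u : R -> R -> R) : Prop :=
  [/\ forall t, 0 <= t -> in_Hplus r (u t),
      forall t0, 0 <= t0 ->
        H_norm r (u t \- u t0) @[t --> within `[0, +oo[ (nbhs t0)] --> (0 : R),
      forall t, 0 <= t -> u t 0 = 0 &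
      forall phi, test_function phi -> forall t, 0 <= t ->
        \int[@lebesgue_measure R]_(x in `]0, +oo[) (u t x * phi x) =
        \int[@lebesgue_measure R]_(x in `]0, +oo[) (u 0 x * phi x) +
        \int[@lebesgue_measure R]_(s in `[0, t])
          (g s * \int[@lebesgue_measure R]_(x in `]0, +oo[)
                    (x * u s x * derive1 phi x)
           - mu * \int[@lebesgue_measure R]_(x in `]0, +oo[) (u s x * phi x)
           + \int[@lebesgue_measure R]_(x in `]0, +oo[)
               (frag beta gamma kappa (u s) x * phi x))].

Definition linear_solution (R : realType) (beta gamma : R)
    (kappa : R -> R) (mu r : R) (u : R -> R -> R) : Prop :=
  growth_frag_solution beta gamma kappa mu r (fun=> mu) u.

(* The growth coefficient at time t is f(I(t)) with I(t) = \int x^p u(t,x) dx,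
   which is required to be a finite and continuous function of t. *)
Definition nonlinear_solution (R : realType) (beta gamma : R)
    (kappa : R -> R) (mu r p : R) (f : R -> R) (u : R -> R -> R) : Prop :=
  [/\ forall t, 0 <= t -> finite_moment p (u t),
      {within `[0, +oo[, continuous (fun t => moment p (u t))} &
      growth_frag_solution beta gamma kappa mu r
        (fun t => f (moment p (u t))) u].

Definition steady_state (R : realType) (beta gamma : R)
    (kappa : R -> R) (mu r p : R) (f : R -> R) (w : R -> R) : Prop :=
  nonlinear_solution beta gamma kappa mu r p f (fun=> w).

(* U is a normalized nonnegative stationary solution of the linear equation,
   in all the spaces H with exponent r >= rbar. *)
Definition stationary_profile (R : realType) (beta gamma : R)
    (kappa : R -> R) (mu rbar : R) (U : R -> R) : Prop :=
  [/\ ae_pos (fun x => 0 <= U x),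
      (@lebesgue_measure R).-integrable `]0, +oo[ (fun x => (U x)%:E),
      \int[@lebesgue_measure R]_(x in `]0, +oo[) U x = 1 &
      forall r, rbar <= r ->
        linear_solution beta gamma kappa mu r (fun=> U)].

Definition rho0 (R : realType) (U v0 : R -> R) : R := moment 1 v0 / moment 1 U.

(* The spectral gap property in H for the exponent r.  The first clause says
   that rho0 is well defined for every initial distribution in the cone. *)
Definition spectral_gap (R : realType) (beta gamma : R)
    (kappa : R -> R) (mu r : R) (U : R -> R) : Prop :=
  (forall v0, in_Hplus r v0 -> finite_moment 1 v0) /\
  exists a C : R, [/\ 0 < a, 0 < C &
    forall v, linear_solution beta gamma kappa mu r v -> nontrivial (v 0) ->
    forall t, 0 < t ->
      H_norm r (fun x => (rho0 U (v 0))^-1 * v t x - U x) <=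
      C * H_norm r (fun x => (rho0 U (v 0))^-1 * v 0 x - U x) * expR (- a * t)].

(* f is of class C^1 on [0, oo), with a one-sided derivative at 0. *)
Definition C1_Rplus (R : realType) (f : R -> R) : Prop :=
  exists df : R -> R, {within `[0, +oo[, continuous df} /\
    forall x, 0 <= x ->
      (f y - f x) / (y - x) @[y --> within `[0, +oo[ (dnbhs x)] --> df x.

Definition lyapunov_stable (R : realType) (beta gamma : R)
    (kappa : R -> R) (mu r p : R) (f : R -> R) (w : R -> R) : Prop :=
  forall eps : R, 0 < eps -> exists2 delta : R, 0 < delta &
    forall u, nonlinear_solution beta gamma kappa mu r p f u ->
      nontrivial (u 0) -> H_norm r (u 0 \- w) < delta ->
      forall t, 0 <= t -> H_norm r (u t \- w) < eps.

Definition globally_asymptotically_stable (R : realType) (beta gamma : R)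
    (kappa : R -> R) (mu r p : R) (f : R -> R) (w : R -> R) : Prop :=
  lyapunov_stable beta gamma kappa mu r p f w /\
  forall u, nonlinear_solution beta gamma kappa mu r p f u ->
    nontrivial (u 0) -> H_norm r (u t \- w) @[t --> +oo] --> (0 : R).

(* Main.v *)
Require Import Defs.
From HB Require Import structures.
From mathcomp Require Import all_boot all_order all_algebra.
From mathcomp Require Import all_classical all_reals all_analysis.
From mathcomp Require Import measurable_realfun ring lra.
Import Order.TTheory GRing.Theory Num.Theory.
Import numFieldNormedType.Exports.
Local Open Scope classical_set_scope.
Local Open Scope ring_scope.
Set Implicit Arguments.
Unset Strict Implicit.
Unset Printing Implicit Defensive.

(** Why the theorem is true.

    A solution u whose growth rate at time t is g(t) is a time-dependent dilation
    of a solution v of the linear equation, with the constant rate mu and the same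
    initial density, run in a new time h:
      u(t, x) = exp (a - 2 ell) v (h, exp (- ell) x), with
      a' = g - mu,  h' = exp (gamma ell),  ell' = g - mu exp (gamma ell).
    This is possible because fragmentation is homogeneous of degree gamma
    ([linearized_solution], [unlinearized]).  By the spectral gap v converges to
    the profile U times the ratio rho of the masses, so that only the scalars a
    and ell are left to be understood.

    The mass of v is constant: the spectral gap gives convergence to the profile
    from every starting time, with the mass of that time, so all the nonzero
    masses coincide, and the mass is continuous ([mass_conserved]).  Hence a
    steady state of the nonlinear equation has a = 0, its growth rate is mu, its
    moment of order p is the only point I0 where f equals mu, and it is a steady
    state of the linear equation, that is a multiple of U.  Conversely the
    multiple of U with the moment I0 is a steady state ([equilibrium_steady],
    [steady_unique]).

    Let q = a + (p - 1) ell + ln (rho M), M being the moment of order p of U: it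
    is the logarithm of the moment of u, up to an error that vanishes when v has
    the shape of U.  With psi = g - mu and drift(l) = mu (exp (gamma l) - 1),
      q' = p psi - (p - 1) drift(ell),   ell' = psi - drift(ell),
    where psi is phi(q) = f(exp q) - mu up to a small shift of q.  As f equals mu
    only at I0, is below mu at infinity, and decreases through mu at I0, phi(q)
    has the sign of ln I0 - q.  Therefore
      V = - int phi(q) + (p + 1) int drift(ell)
    is positive except at the equilibrium, and without error its derivative is
    - p (phi(q) - drift(ell))^2 - drift(ell)^2.  This gives attraction and
    stability of the equilibrium for perturbed trajectories
    ([dilation_converges], [dilation_stable]); attraction also needs an a priori
    bound on q ([q_bounded]), since phi is only uniformly continuous below a
    given level.

    What remains is to see that the moment of order p of v is close to that of
    rho U when v is close to rho U in norm ([moment_close]).  For p > 1 and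
    r = 2 p + 1 this moment is not continuous in norm.  It becomes small on the
    tail after an arbitrarily short time, because large particles fragment fast:
    the moment of the tail obeys y' <= - C y^2 up to small terms
    ([tail_absorption]), and such an inequality forgets the initial value.  The
    short time does no harm to stability, as q and ell move at bounded speed. *)

(** * One-variable calculus and integrals over the half-line *)

Section calculus.
Context {R : realType}.
Implicit Types (f g F : R -> R).

Lemma is_derive_cont f (x df : R) : is_derive x 1 f df -> {for x, continuous f}.
Proof. by move=> [/derivable1_diffP /differentiable_continuous]. Qed.

Lemma ftc2 f F (a b : R) : a < b ->
  (forall x : R, a <= x <= b -> is_derive x 1 F (f x)) ->
  (forall x : R, a <= x <= b -> {for x, continuous f}) ->
  (\int[@lebesgue_measure R]_(x in `[a, b]) (f x)%:E = (F b - F a)%:E)%E.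
Proof.
move=> ab dF cf; rewrite (@continuous_FTC2 _ f F)//.
- by apply: continuous_in_subspaceT => x; rewrite inE/= in_itv/=; exact: cf.
- split.
  + move=> x; rewrite in_itv/= => /andP[ax xb].
    by have [] := dF x; rewrite ?(ltW ax) ?ltW.
  + apply: cvg_at_right_filter; apply: (@is_derive_cont _ _ (f a)).
    by apply: dF; rewrite lexx ltW.
  + apply: cvg_at_left_filter; apply: (@is_derive_cont _ _ (f b)).
    by apply: dF; rewrite lexx ltW.
- move=> x; rewrite in_itv/= => /andP[ax xb]; rewrite derive1E.
  have xI : a <= x <= b by rewrite !ltW.
  by have [_ ->] := dF x xI.
Qed.

Lemma derE f (x a b : R) : is_derive x 1 f a -> a = b -> is_derive x 1 f b.
Proof. by move=> h <-. Qed.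

Lemma derC (c x : R) : is_derive x 1 (fun=> c) 0.
Proof. exact: is_derive_cst. Qed.

Lemma derI (x : R) : is_derive x 1 (fun y => y) 1.
Proof. exact: is_derive_id. Qed.

Lemma derD f g (x a b : R) : is_derive x 1 f a -> is_derive x 1 g b ->
  is_derive x 1 (fun y => f y + g y) (a + b).
Proof. exact: is_deriveD. Qed.

Lemma derN f (x a : R) : is_derive x 1 f a -> is_derive x 1 (fun y => - f y) (- a).
Proof. exact: is_deriveN. Qed.

Lemma derB f g (x a b : R) : is_derive x 1 f a -> is_derive x 1 g b ->
  is_derive x 1 (fun y => f y - g y) (a - b).
Proof. exact: is_deriveB. Qed.

Lemma derM f g (x a b : R) : is_derive x 1 f a -> is_derive x 1 g b ->
  is_derive x 1 (fun y => f y * g y) (a * g x + f x * b).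
Proof.
move=> hf hg; have h := is_deriveM hf hg; apply: (derE h).
by rewrite /GRing.scale/= addrC mulrC.
Qed.

Lemma der_sqr f (x a : R) : is_derive x 1 f a ->
  is_derive x 1 (fun y => f y ^+ 2) (2 * f x * a).
Proof. by move=> h; have h' := derM h h; apply: (derE h'); ring. Qed.

Lemma derZ c f (x a : R) : is_derive x 1 f a ->
  is_derive x 1 (fun y => c * f y) (c * a).
Proof.
by move=> h; have h' := derM (derC c x) h; apply: (derE h'); rewrite mul0r add0r.
Qed.

Lemma der_comp f g (x a b : R) : is_derive (g x) 1 f a -> is_derive x 1 g b ->
  is_derive x 1 (fun y => f (g y)) (a * b).
Proof. exact: is_derive1_comp. Qed.

Lemma der_exp f (x a : R) : is_derive x 1 f a ->
  is_derive x 1 (fun y => expR (f y)) (expR (f x) * a).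
Proof. by move=> h; apply: der_comp. Qed.

Lemma der_ln f (x a : R) : 0 < f x -> is_derive x 1 f a ->
  is_derive x 1 (fun y => ln (f y)) (a / f x).
Proof.
move=> f0 h; have h' := der_comp (is_derive1_ln f0) h; apply: (derE h').
by rewrite mulrC.
Qed.

Lemma der_pow c f (x a : R) : 0 < f x -> is_derive x 1 f a ->
  is_derive x 1 (fun y => f y `^ c) (c * f x `^ (c - 1) * a).
Proof. by move=> f0 h; exact: (der_comp (is_derive1_powR c f0) h). Qed.

Lemma derV f (x a : R) : f x != 0 -> is_derive x 1 f a ->
  is_derive x 1 (fun y => (f y)^-1) (- a / f x ^+ 2).
Proof.
move=> f0 h; have h' := is_deriveV f0 h; apply: (derE h').
by rewrite /GRing.scale/= !mulNr mulrC.
Qed.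

Lemma der_near f g (x a : R) : (\near x, f x = g x) ->
  is_derive x 1 f a -> is_derive x 1 g a.
Proof. exact: near_eq_is_derive. Qed.

Lemma derP f (x a : R) :
  is_derive x 1 f a <->
  forall e, 0 < e -> exists2 d, 0 < d & forall y, `|y - x| < d ->
    `|f y - f x - a * (y - x)| <= e * `|y - x|.
Proof.
split.
- move=> [df da] e e0.
  have : h^-1 *: (f (h *: 1 + x) - f x) @[h --> 0^'] --> a.
    by rewrite -da; exact: df.
  move/cvgrPdist_le => /(_ e e0); rewrite near_withinE.
  move=> /nbhs_ballP[d /= d0 hd]; exists d => // y yx.
  have [->|yx0] := eqVneq y x; first by rewrite !subrr mulr0 subrr normr0 mulr0.
  have yx1 : y - x != 0 by rewrite subr_eq0.
  have := hd (y - x); rewrite /ball/= sub0r normrN => /(_ yx yx1).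
  rewrite [_ *: 1]mulr1 subrK => h.
  have -> : f y - f x - a * (y - x) = - (a - (y - x)^-1 * (f y - f x)) * (y - x).
    by field.
  by rewrite normrM normrN ler_pM2r ?normr_gt0.
- move=> H; suff h : h^-1 *: (f (h *: 1 + x) - f x) @[h --> 0^'] --> a.
    by split; [apply/cvg_ex; exists a|apply/cvg_lim].
  apply/cvgrPdist_le => e e0; have [d d0 hd] := H e e0.
  rewrite near_withinE; apply/nbhs_ballP; exists d => //= h.
  rewrite /ball/= sub0r normrN => hd1 h0; rewrite [h *: 1]mulr1.
  have := hd (h + x); rewrite addrK => /(_ hd1).
  have -> : a - h^-1 *: (f (h + x) - f x) = - (f (h + x) - f x - a * h) / h.
    by rewrite /GRing.scale/=; field.
  by rewrite normrM normrN normfV ler_pdivrMr ?normr_gt0.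
Qed.

Lemma MVT_cc f (df : R -> R) (a b : R) : a <= b ->
  (forall x : R, a < x < b -> is_derive x 1 f (df x)) ->
  (forall x : R, a <= x <= b -> {for x, continuous f}) ->
  exists2 c, a <= c <= b & f b - f a = df c * (b - a).
Proof.
move=> ab dF cf.
have dF' (x : R) : x \in `]a, b[ -> is_derive x 1 f (df x).
  by rewrite in_itv; exact: dF.
have [|c] := MVT_segment ab dF'; last by rewrite in_itv => ? ?; exists c.
by apply: continuous_in_subspaceT => x; rewrite inE/= in_itv/=; exact: cf.
Qed.

Lemma MVT_lt f (df : R -> R) (a b : R) : a < b ->
  (forall x : R, a < x < b -> is_derive x 1 f (df x)) ->
  (forall x : R, a <= x <= b -> {for x, continuous f}) ->
  exists2 c, a < c < b & f b - f a = df c * (b - a).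
Proof.
move=> ab dF cf.
have dF' (x : R) : x \in `]a, b[ -> is_derive x 1 f (df x).
  by rewrite in_itv; exact: dF.
have [|c] := MVT ab dF'; last by rewrite in_itv => ? ?; exists c.
by apply: continuous_in_subspaceT => x; rewrite inE/= in_itv/=; exact: cf.
Qed.

Lemma incr_bound f (df : R -> R) (a b K : R) : a <= b ->
  (forall x : R, a < x < b -> is_derive x 1 f (df x)) ->
  (forall x : R, a <= x <= b -> {for x, continuous f}) ->
  (forall x : R, a < x < b -> df x <= K) ->
  f b - f a <= K * (b - a).
Proof.
rewrite le_eqVlt => /predU1P[->|ab] dF cf dK; first by rewrite !subrr mulr0.
have [c cab ->] := MVT_lt ab dF cf.
by rewrite ler_wpM2r ?subr_ge0 ?dK// ltW.
Qed.

Lemma zero_der_const f (a b : R) : a <= b ->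
  (forall x : R, a < x < b -> is_derive x 1 f 0) ->
  (forall x : R, a <= x <= b -> {for x, continuous f}) -> f b = f a.
Proof.
move=> ab dF cf; have [c _] := @MVT_cc f (fun=> 0) a b ab dF cf.
by rewrite mul0r => /eqP; rewrite subr_eq0 => /eqP.
Qed.

Lemma contP f (x : R) : {for x, continuous f} <->
  forall e, 0 < e -> exists2 d, 0 < d & forall y, `|y - x| < d -> `|f y - f x| <= e.
Proof.
split.
- move=> /cvgrPdist_le h e e0; have := h e e0; move=> /nbhs_ballP[d /= d0 hd].
  exists d => // y yx; rewrite distrC; apply: hd.
  by rewrite /ball/= distrC.
- move=> H; apply/cvgrPdist_le => e e0; have [d d0 hd] := H e e0.
  apply/nbhs_ballP; exists d => //= y; rewrite /ball/= distrC => /hd.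
  by rewrite distrC.
Qed.

End calculus.

Section halfline_integrals.
Context {R : realType}.
Implicit Types (f g h k : R -> R).
Local Notation D := (`]0, +oo[%classic : set R).

Definition integrablep f := (@lebesgue_measure R).-integrable D (EFin \o f).
Definition integralp f : R := \int[@lebesgue_measure R]_(x in D) f x.

Lemma Dgt0 (x : R) : D x -> 0 < x.
Proof. by rewrite /= in_itv/= andbT. Qed.

Lemma gt0D (x : R) : 0 < x -> D x.
Proof. by rewrite /= in_itv/= andbT. Qed.

Lemma mD : measurable (D : set (measurableTypeR R)).
Proof. exact: measurable_itv. Qed.

Lemma integrablep_meas f : integrablep f -> measurable_fun D f.
Proof. by move=> /measurable_int /measurable_EFinP. Qed.

Lemma eq_integrablep f g : (forall x : R, 0 < x -> f x = g x) ->
  integrablep f -> integrablep g.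
Proof.
move=> fg; apply: eq_integrable; first exact: mD.
by move=> x /[!inE] /Dgt0 x0 /=; rewrite fg.
Qed.

Lemma eq_integralp f g : (forall x : R, 0 < x -> f x = g x) ->
  integralp f = integralp g.
Proof. by move=> fg; apply: eq_Rintegral => x /[!inE] /Dgt0 /fg. Qed.

Lemma eq_measp f g : (forall x : R, 0 < x -> f x = g x) ->
  measurable_fun D f -> measurable_fun D g.
Proof.
by move=> fg; apply: eq_measurable_fun => x /[!inE] /Dgt0 /fg.
Qed.

Lemma integrablep_le f g : measurable_fun D f -> integrablep g ->
  (forall x : R, 0 < x -> `|f x| <= g x) -> integrablep f.
Proof.
move=> mf ig fg; apply: (le_integrable mD _ _ ig).
- exact/measurable_EFinP.
- move=> x /Dgt0 /fg; rewrite /= lee_fin => /le_trans; apply.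
  exact: ler_norm.
Qed.

Lemma integrablepD f g : integrablep f -> integrablep g ->
  integrablep (fun x => f x + g x).
Proof. by move=> hf hg; have := integrableD mD hf hg. Qed.

Lemma integrablepZ c f : integrablep f -> integrablep (fun x => c * f x).
Proof. by move=> hf; have := integrableZl mD c hf. Qed.

Lemma integrablepB f g : integrablep f -> integrablep g ->
  integrablep (fun x => f x - g x).
Proof. by move=> hf hg; have := integrableB mD hf hg. Qed.

Lemma integrablep_norm f : integrablep f -> integrablep (fun x => `|f x|).
Proof. by move=> /integrable_norm. Qed.

Lemma integralpD f g : integrablep f -> integrablep g ->
  integralp (fun x => f x + g x) = integralp f + integralp g.
Proof. exact: (RintegralD mD). Qed.

Lemma integralpB f g : integrablep f -> integrablep g ->
  integralp (fun x => f x - g x) = integralp f - integralp g.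
Proof. exact: (RintegralB mD). Qed.

Lemma integralpZ c f : integrablep f ->
  integralp (fun x => c * f x) = c * integralp f.
Proof. exact: RintegralZl mD. Qed.

Lemma integralp_ge0 f : (forall x : R, 0 < x -> 0 <= f x) -> 0 <= integralp f.
Proof. by move=> f0; apply: Rintegral_ge0 => x /Dgt0 /f0. Qed.

Lemma le_integralp f g : integrablep f -> integrablep g ->
  (forall x : R, 0 < x -> f x <= g x) -> integralp f <= integralp g.
Proof.
by move=> hf hg fg; apply: (le_Rintegral mD hf hg) => x /Dgt0 /fg.
Qed.

Lemma norm_integralp f : integrablep f ->
  `|integralp f| <= integralp (fun x => `|f x|).
Proof. exact: (le_normr_Rintegral mD). Qed.

Lemma norm_integralp_le f g : measurable_fun D f -> integrablep g ->
  (forall x : R, 0 < x -> `|f x| <= g x) -> `|integralp f| <= integralp g.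
Proof.
move=> mf ig fg; have hf := integrablep_le mf ig fg.
apply: (le_trans (norm_integralp hf)).
by apply: le_integralp => //; exact: integrablep_norm.
Qed.

Lemma integralpE f : integrablep f ->
  (\int[@lebesgue_measure R]_(x in D) (f x)%:E = (integralp f)%:E)%E.
Proof.
by move=> hf; rewrite /integralp /Rintegral fineK//; exact: (integrable_fin_num mD hf).
Qed.

Lemma ae_pos1 (P Q : R -> Prop) : (forall x : R, 0 < x -> P x -> Q x) ->
  ae_pos P -> ae_pos Q.
Proof.
move=> PQ; rewrite /ae_pos.
apply: filterS; first exact: (ae_filter_ringOfSetsType (@lebesgue_measure R)).
by move=> x Px x0; exact: PQ (Px x0).
Qed.

Lemma ae_posD (P : R -> Prop) : ae_pos P ->
  {ae @lebesgue_measure R, forall x, D x -> P x}.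
Proof.
rewrite /ae_pos; apply: filterS; first exact: (ae_filter_ringOfSetsType (@lebesgue_measure R)).
by move=> x Px /Dgt0.
Qed.

Lemma ae_Dpos (P : R -> Prop) :
  {ae @lebesgue_measure R, forall x, D x -> P x} -> ae_pos P.
Proof.
rewrite /ae_pos; apply: filterS; first exact: (ae_filter_ringOfSetsType (@lebesgue_measure R)).
by move=> x Px /gt0D.
Qed.

Lemma ae_integralp f g : measurable_fun D f -> measurable_fun D g ->
  ae_pos (fun x => f x = g x) -> integralp f = integralp g.
Proof.
move=> mf mg fg; rewrite /integralp /Rintegral; congr fine.
apply: ae_eq_integral; first exact: mD.
- exact/measurable_EFinP.
- exact/measurable_EFinP.
- by apply: ae_posD; apply: ae_pos1 fg => x _ /= ->.
Qed.

Lemma integralp_eq0 f : integrablep f -> (forall x : R, 0 < x -> 0 <= f x) ->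
  integralp f = 0 -> ae_pos (fun x => f x = 0).
Proof.
move=> hf f0 I0.
have mf : measurable_fun D (EFin \o f) by exact: measurable_int hf.
have [+ _] := ae_eq_integral_abs (@lebesgue_measure R) mD mf.
have -> : (\int[@lebesgue_measure R]_(x in D) `|(EFin \o f) x| = 0)%E.
  transitivity (\int[@lebesgue_measure R]_(x in D) (f x)%:E)%E.
    by apply: eq_integral => x; rewrite inE => /Dgt0 /f0 fx /=; rewrite ger0_norm.
  by rewrite (integralpE hf) I0.
move=> /(_ erefl) H.
have H' : {ae @lebesgue_measure R, forall x, D x -> (f x)%:E = 0%:E} by exact: H.
by apply: ae_pos1 (ae_Dpos H') => x _ [].
Qed.

Lemma ae_integralp_eq0 f : ae_pos (fun x => f x = 0) -> measurable_fun D f ->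
  integralp f = 0.
Proof.
move=> f0 mf; rewrite (@ae_integralp f (fun=> 0))//.
by rewrite /integralp /Rintegral; under eq_integral do []; rewrite integral0.
Qed.

(** Cauchy-Schwarz, in the form in which the two factors only have to dominate
    the square of the integrand. *)
Lemma integralp_CS f g k : measurable_fun D k ->
  integrablep f -> integrablep g ->
  (forall x : R, 0 < x -> [/\ 0 <= f x, 0 <= g x & k x ^+ 2 <= f x * g x]) ->
  integrablep k /\
  (integralp (fun x => `|k x|)) ^+ 2 <= integralp f * integralp g.
Proof.
move=> mk hf hg hk.
have key (s : R) : 0 < s -> forall x : R, 0 < x ->
    `|k x| <= 2^-1 * (s * f x + s^-1 * g x).
  move=> s0 x /hk[f0 g0 kfg].
  rewrite -(@ler_pXn2r _ 2)// ?nnegrE//; last first.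
    by rewrite mulr_ge0// addr_ge0// mulr_ge0// ?invr_ge0 ltW.
  rewrite real_normK ?num_real//; apply: (le_trans kfg).
  have -> : f x * g x = (s * f x) * (s^-1 * g x) by field; rewrite gt_eqF.
  set a := s * f x; set b := _ * g x.
  have : 0 <= (a - b) ^+ 2 by exact: sqr_ge0.
  by nra.
have hi s : integrablep (fun x => 2^-1 * (s * f x + s^-1 * g x)).
  by apply: integrablepZ; apply: integrablepD; exact: integrablepZ.
have hk' : integrablep k by apply: (integrablep_le mk (hi 1)); exact: key.
split => //; set K := integralp (fun x => `|k x|).
have K0 : 0 <= K by apply: integralp_ge0.
have F0 : 0 <= integralp f by apply: integralp_ge0 => x /hk[].
have G0 : 0 <= integralp g by apply: integralp_ge0 => x /hk[].
have key2 s : 0 < s -> 2 * K <= s * integralp f + s^-1 * integralp g.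
  move=> s0; have := le_integralp (integrablep_norm hk') (hi s) (key s s0).
  rewrite integralpZ; last by apply: integrablepD; exact: integrablepZ.
  rewrite integralpD; [|exact: integrablepZ..].
  by rewrite !integralpZ// -/K; lra.
have [K00|Kn0] := eqVneq K 0; first by rewrite K00 expr0n/= mulr_ge0.
have Kp : 0 < K by rewrite lt_neqAle eq_sym Kn0.
have [F00|Fn0] := eqVneq (integralp f) 0.
  have [G00|Gn0] := eqVneq (integralp g) 0.
    by have := key2 1 ltr01; rewrite F00 G00; lra.
  have Gp : 0 < integralp g by rewrite lt_neqAle eq_sym Gn0.
  have /key2 : 0 < integralp g / K by rewrite divr_gt0.
  rewrite F00 mulr0 add0r invf_div mulfVK//; lra.
have Fp : 0 < integralp f by rewrite lt_neqAle eq_sym Fn0.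
have /key2 : 0 < K / integralp f by rewrite divr_gt0.
rewrite mulfVK// invf_div => h.
have : K <= integralp f / K * integralp g by lra.
by rewrite mulrAC ler_pdivlMr// expr2.
Qed.

(** A nonnegative continuous function with a bounded primitive is integrable:
    the fundamental theorem on [1/n, n] and monotone convergence. *)
Lemma integrablep_primitive f (F : R -> R) (M : R) :
  (forall x : R, 0 < x -> 0 <= f x) ->
  (forall x : R, 0 < x -> {for x, continuous f}) ->
  (forall x : R, 0 < x -> is_derive x 1 F (f x)) ->
  (forall x y : R, 0 < x -> 0 < y -> F y - F x <= M) ->
  integrablep f /\ integralp f <= M.
Proof.
move=> f0 cf dF FM.
have mf : measurable_fun D f.
  apply: open_continuous_measurable_fun; first exact: interval_open.
  by move=> x; rewrite inE => /Dgt0 /cf.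
pose A (n : nat) : set R := `[n.+1%:R^-1, n.+1%:R]%classic.
have UA : \bigcup_n A n = D.
  apply/seteqP; split => x.
    move=> [n _]; rewrite /A /= !in_itv/= andbT => /andP[+ _].
    by apply: lt_le_trans; rewrite invr_gt0.
  move=> /Dgt0 x0; exists (Num.truncn (Num.max x x^-1)) => //.
  rewrite /A /= in_itv/=.
  have := truncnS_gt (Num.max x x^-1).
  set n := _.+1%:R; rewrite gt_max => /andP[h1 h2].
  have n0 : 0 < n by apply: lt_trans h1.
  by rewrite (ltW h1) andbT -[leRHS]invrK lef_pV2 ?posrE ?invr_gt0// ltW.
have ndA : nondecreasing_seq A.
  move=> m n mn; rewrite subsetEset; apply: subset_itv; rewrite bnd_simp.
    by rewrite lef_pV2 ?posrE// ler_nat ltnS.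
  by rewrite ler_nat ltnS.
have A0 n x : A n x -> 0 < x.
  by rewrite /A /= in_itv/= => /andP[+ _]; apply: lt_le_trans; rewrite invr_gt0.
have mA n : measurable (A n : set (measurableTypeR R)) by exact: measurable_itv.
have mfA n : measurable_fun (A n) (EFin \o f).
  apply/measurable_EFinP.
  by apply: (measurable_funS _ _ mf); [exact: mD|move=> x /A0 /gt0D].
have IA n : ((\int[@lebesgue_measure R]_(x in A n) (f x)%:E) <= M%:E)%E.
  have [n0|n0] := ltnP 0 n; last first.
    move: n0; rewrite leqn0 => /eqP ->; rewrite /A invr1 set_itv1 integral_set1.
    by rewrite lee_fin; have := FM 1 1 ltr01 ltr01; rewrite subrr.
  have n1 : n.+1%:R^-1 < n.+1%:R :> R.
    by rewrite (@lt_trans _ _ 1)// ?invf_lt1// ltr1n.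
  have dFn (x : R) : n.+1%:R^-1 <= x <= n.+1%:R -> is_derive x 1 F (f x).
    by move=> hx; apply: dF; apply: (A0 n); rewrite /A /= in_itv.
  have cfn (x : R) : n.+1%:R^-1 <= x <= n.+1%:R -> {for x, continuous f}.
    by move=> hx; apply: cf; apply: (A0 n); rewrite /A /= in_itv.
  by have := ftc2 n1 dFn cfn; rewrite /A => ->; rewrite lee_fin FM// invr_gt0.
have f0A n x : A n x -> (0%R <= (EFin \o f) x)%E by move=> /A0 /f0; rewrite lee_fin.
have cvA := ge0_nondecreasing_set_cvg_integral (mu := @lebesgue_measure R) ndA mA mfA f0A.
rewrite UA in cvA.
have IM : (\int[@lebesgue_measure R]_(x in D) (EFin \o f) x <= M%:E)%E.
  have <- := cvg_lim _ cvA; last by [].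
  apply: lime_le; first by apply/cvg_ex; eexists; exact: cvA.
  by apply: nearW => n; exact: IA.
have fi : integrablep f.
  apply/integrableP; split; first exact/measurable_EFinP.
  apply: (le_lt_trans _ (ltry M)); apply: le_trans IM.
  rewrite le_eqVlt; apply/predU1P; left; apply: eq_integral.
  by move=> x /[!inE] /Dgt0 /f0 hx /=; rewrite ger0_norm.
by split => //; move: IM; rewrite (integralpE fi) lee_fin.
Qed.
End halfline_integrals.

(** * The weighted space: dilations and pairings *)

Section dilation.
Context {R : realType}.
Implicit Types (f g h k : R -> R).
Local Notation D := (`]0, +oo[%classic : set R).
Local Notation mu := (@lebesgue_measure R).

Section pushforward_scale.
Variable c : R.
Hypothesis c0 : 0 < c.

Lemma measurable_scale : measurable_fun [set: measurableTypeR R]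
  ((fun x => c * x) : measurableTypeR R -> measurableTypeR R).
Proof. exact: measurable_funM. Qed.

Let mf_scale := isMeasurableFun.Build _ _ _ _ _ measurable_scale.
Let scale_mfun : {mfun measurableTypeR R >-> measurableTypeR R} :=
  HB.pack ((fun x => c * x) : measurableTypeR R -> measurableTypeR R) mf_scale.

Lemma lebesgue_measure_scale (A : set (measurableTypeR R)) : measurable A ->
  (mu A = c%:E * mu (scale_mfun @^-1` A))%E.
Proof.
move=> mA; pose m := mscale (NngNum (ltW c0)) (pushforward mu scale_mfun).
rewrite (@lebesgue_measure_unique R (m measurable_scale))//.
move=> X /= [[a b] _ <-]/=.
rewrite /m /mscale/= /pushforward/=.
have -> : scale_mfun @^-1` `]a, b]%classic = `]a / c, b / c]%classic.
  apply/seteqP; split => x; rewrite /= !in_itv/=.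
    by rewrite ltr_pdivrMr// ler_pdivlMr// ![x * c]mulrC.
  by rewrite ltr_pdivrMr// ler_pdivlMr// ![x * c]mulrC.
rewrite !lebesgue_measure_itv/= !lte_fin ltr_pM2r ?invr_gt0//.
case: ifP => _; last by rewrite mule0.
by rewrite -!EFinB -EFinM; congr EFin; field; rewrite gt_eqF.
Qed.

(** Lebesgue measure is divided by c under its pushforward by the dilation,
    so the change of variables holds for any measurable function, without
    smoothness. *)
Lemma ge0_integral_scale (f : R -> \bar R) : measurable_fun D f ->
  (forall x, D x -> (0 <= f x)%E) ->
  (\int[mu]_(x in D) f (c * x)%R = (c^-1)%:E * \int[mu]_(x in D) f x)%E.
Proof.
move=> mf f0; have DE : scale_mfun @^-1` D = D.
  by apply/seteqP; split => x; rewrite /= !in_itv/= !andbT pmulr_rgt0.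
have E : (\int[mu]_(x in D) f x = c%:E * \int[mu]_(x in D) f (c * x)%R)%E.
  rewrite -[in RHS]DE.
  rewrite -(@ge0_integral_pushforward _ _ _ _ R scale_mfun measurable_scale mu D f mD mf);
    last by move=> x /[!inE]; exact: f0.
  rewrite -(@ge0_integral_mscale _ _ R (pushforward mu scale_mfun) D mD
    (NngNum (ltW c0)) f)//.
  apply: eq_measure_integral => A mA _; exact: lebesgue_measure_scale.
by rewrite E muleA -EFinM mulVf ?gt_eqF// mul1e.
Qed.

Lemma meas_scale f : measurable_fun D f -> measurable_fun D (fun x => f (c * x)).
Proof.
move=> mf; apply: (@measurable_comp _ _ _ _ _ _ D) => //.
by move=> _ [x /Dgt0 x0 <-]; apply: gt0D; rewrite mulr_gt0.
Qed.

Let integralp_scale_ge0 f : integrablep f -> (forall x : R, 0 < x -> 0 <= f x) ->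
  integrablep (fun x => f (c * x)) /\
  integralp (fun x => f (c * x)) = c^-1 * integralp f.
Proof.
move=> hf f0; have mf : measurable_fun D (EFin \o f) by exact: measurable_int hf.
have f0' (x : R) : D x -> (0 <= (EFin \o f) x)%E by move=> /Dgt0 /f0; rewrite lee_fin.
have E := ge0_integral_scale mf f0'.
rewrite (integralpE hf) -EFinM in E.
have hi : integrablep (fun x => f (c * x)).
  apply/integrableP; split.
    by apply/measurable_EFinP; exact: (meas_scale (integrablep_meas hf)).
  apply: (@le_lt_trans _ _ (c^-1 * integralp f)%:E); last exact: ltry.
  rewrite le_eqVlt -E; apply/predU1P; left; apply: eq_integral.
  by move=> x /[!inE] /Dgt0 x0 /=; rewrite ger0_norm ?f0 ?mulr_gt0.
by split => //; move: E; rewrite (integralpE hi) => -[].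
Qed.

Lemma integralp_scale f : integrablep f ->
  integrablep (fun x => f (c * x)) /\
  integralp (fun x => f (c * x)) = c^-1 * integralp f.
Proof.
move=> hf; have hn := integrablep_norm hf; have hd := integrablepB hn hf.
have [i1 e1] := integralp_scale_ge0 hn (fun x _ => normr_ge0 (f x)).
have [|i2 e2] := integralp_scale_ge0 hd; first by move=> x _; rewrite subr_ge0 ler_norm.
have E (x : R) : 0 < x -> `|f (c * x)| - (`|f (c * x)| - f (c * x)) = f (c * x).
  by move=> _; rewrite subKr.
split; first by apply: (eq_integrablep E); exact: integrablepB.
rewrite -(eq_integralp E) (integralpB i1 i2) e1 e2 -mulrBr integralpB//.
by rewrite subKr.
Qed.

Lemma ae_pos_scale (P : R -> Prop) : ae_pos P -> ae_pos (fun x => P (c * x)).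
Proof.
move=> [A [mA A0 PA]]; exists (scale_mfun @^-1` A); split.
- rewrite -[X in measurable X]setTI; exact: measurable_scale.
- have := lebesgue_measure_scale mA; rewrite A0 => /esym/eqP.
  rewrite mule_eq0 => /orP[|/eqP //]; by rewrite eqe gt_eqF.
- move=> x Px; apply: PA => Q; apply: Px => x0.
  by apply: Q; rewrite mulr_gt0.
Qed.

End pushforward_scale.
End dilation.

Section weighted.
Context {R : realType}.
Implicit Types (f g h k psi : R -> R) (r : R).
Local Notation D := (`]0, +oo[%classic : set R).

(** Squared norm of the weighted space: all estimates are done with it, so that
    the crude inequality (a + b)^2 <= 2 a^2 + 2 b^2 replaces Minkowski. *)
Definition sqnorm r h : R := integralp (fun x => h x ^+ 2 * (x + x `^ r)).

Lemma weight_ge0 r (x : R) : 0 < x -> 0 <= x + x `^ r.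
Proof. by move=> x0; rewrite addr_ge0 ?powR_ge0// ltW. Qed.

Lemma sqw_ge0 r (a x : R) : 0 < x -> 0 <= a ^+ 2 * (x + x `^ r).
Proof. by move=> x0; apply: mulr_ge0; [exact: sqr_ge0|exact: weight_ge0]. Qed.

Lemma sqnorm_ge0 r h : 0 <= sqnorm r h.
Proof.
by apply: integralp_ge0 => x x0; exact: sqw_ge0.
Qed.

Lemma H_normE r h : H_norm r h = Num.sqrt (sqnorm r h).
Proof. by []. Qed.

Lemma sqr_H_norm r h : H_norm r h ^+ 2 = sqnorm r h.
Proof. by rewrite H_normE sqr_sqrtr ?sqnorm_ge0. Qed.

Lemma H_norm_ge0 r h : 0 <= H_norm r h.
Proof. by rewrite sqrtr_ge0. Qed.

Lemma in_H_meas r h : in_H r h -> measurable_fun D h.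
Proof. by case. Qed.

Lemma in_H_int r h : in_H r h -> integrablep (fun x => h x ^+ 2 * (x + x `^ r)).
Proof. by case. Qed.

Lemma measurable_weight r : measurable_fun D (fun x : R => x + x `^ r).
Proof.
apply: measurable_funD => //.
by apply: (measurable_funTS); exact: measurable_powR.
Qed.

Lemma eq_in_H r f g : (forall x : R, 0 < x -> f x = g x) -> in_H r f -> in_H r g.
Proof.
move=> fg [mf hf]; split; first exact: eq_measp mf.
by apply: (@eq_integrablep _ (fun x => f x ^+ 2 * (x + x `^ r))) => // x /fg ->.
Qed.

Lemma eq_sqnorm r f g : (forall x : R, 0 < x -> f x = g x) -> sqnorm r f = sqnorm r g.
Proof. by move=> fg; apply: eq_integralp => x /fg ->. Qed.

Lemma in_H_le r f g : measurable_fun D f -> in_H r g ->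
  (forall x : R, 0 < x -> `|f x| <= `|g x|) ->
  in_H r f /\ sqnorm r f <= sqnorm r g.
Proof.
move=> mf [mg hg] fg.
have sq (x : R) : 0 < x -> f x ^+ 2 <= g x ^+ 2.
  move=> /fg h; rewrite -(real_normK (num_real (f x))) -(real_normK (num_real (g x))).
  by rewrite lerXn2r// nnegrE.
have hf : integrablep (fun x => f x ^+ 2 * (x + x `^ r)).
  apply: (@integrablep_le _ _ (fun x => g x ^+ 2 * (x + x `^ r))) => //.
    apply: measurable_funM; last exact: measurable_weight.
    exact: measurable_funX.
  move=> x x0; rewrite ger0_norm ?sqw_ge0//.
  by rewrite ler_wpM2r ?weight_ge0 ?sq.
split => //; apply: le_integralp => // x x0.
by rewrite ler_wpM2r ?weight_ge0 ?sq.
Qed.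

Lemma in_HZ r c h : in_H r h -> in_H r (fun x => c * h x).
Proof.
move=> [mh hh]; split; first by apply: measurable_funM.
apply: (@eq_integrablep _ (fun x => c ^+ 2 * (h x ^+ 2 * (x + x `^ r)))).
  by move=> x _; rewrite exprMn mulrA.
exact: integrablepZ.
Qed.

Lemma sqnormZ r c h : in_H r h -> sqnorm r (fun x => c * h x) = c ^+ 2 * sqnorm r h.
Proof.
move=> [mh hh]; rewrite /sqnorm -integralpZ//; apply: eq_integralp => x _.
by rewrite exprMn mulrA.
Qed.

Lemma in_HD r f g : in_H r f -> in_H r g ->
  in_H r (fun x => f x + g x) /\
  sqnorm r (fun x => f x + g x) <= 2 * sqnorm r f + 2 * sqnorm r g.
Proof.
move=> [mf hf] [mg hg].
have key (x : R) : 0 < x -> (f x + g x) ^+ 2 * (x + x `^ r) <=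
    2 * (f x ^+ 2 * (x + x `^ r)) + 2 * (g x ^+ 2 * (x + x `^ r)).
  move=> x0; rewrite !mulrA -mulrDl ler_wpM2r ?weight_ge0//.
  by have := sqr_ge0 (f x - g x); rewrite sqrrB sqrrD; nra.
have hs : integrablep (fun x => 2 * (f x ^+ 2 * (x + x `^ r)) +
    2 * (g x ^+ 2 * (x + x `^ r))).
  by apply: integrablepD; apply: integrablepZ.
have ms : measurable_fun D (fun x => f x + g x) by apply: measurable_funD.
have hfg : integrablep (fun x => (f x + g x) ^+ 2 * (x + x `^ r)).
  apply: (integrablep_le _ hs).
    apply: measurable_funM; last exact: measurable_weight.
    exact: measurable_funX.
  move=> x x0; rewrite ger0_norm ?sqw_ge0//.
  exact: key.
split => //.
rewrite /sqnorm -!integralpZ// -integralpD; [|exact: integrablepZ..].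
exact: le_integralp.
Qed.

Lemma in_HB r f g : in_H r f -> in_H r g ->
  in_H r (fun x => f x - g x) /\
  sqnorm r (fun x => f x - g x) <= 2 * sqnorm r f + 2 * sqnorm r g.
Proof.
move=> hf hg; have [h1 h2] := in_HD hf (in_HZ (-1) hg).
rewrite sqnormZ// sqrrN expr1n mul1r in h2.
have E (x : R) : 0 < x -> f x + -1 * g x = f x - g x by move=> _; rewrite mulN1r.
by split; [exact: eq_in_H h1|rewrite -(eq_sqnorm r E)].
Qed.

Lemma sqnorm_eq0 r h : in_H r h -> sqnorm r h = 0 -> ae_pos (fun x => h x = 0).
Proof.
move=> [mh hh] h0.
have : ae_pos (fun x => h x ^+ 2 * (x + x `^ r) = 0).
  apply: integralp_eq0 => // x x0.
  exact: sqw_ge0.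
apply: ae_pos1 => x x0 /eqP; rewrite mulf_eq0 sqrf_eq0 => /orP[/eqP //|/eqP xr].
by have := @powR_ge0 _ x r; move: x0 xr; lra.
Qed.

(** The weight x + x^r is only quasi-homogeneous: under a dilation it changes
    by at most the sum of its two scaling factors. *)
Lemma in_H_scale r h (c : R) : 0 < c -> in_H r h ->
  in_H r (fun x => h (c * x)) /\
  sqnorm r (fun x => h (c * x)) <= c^-1 * (c^-1 + (c `^ r)^-1) * sqnorm r h.
Proof.
move=> c0 [mh hh]; have cr0 : 0 < c `^ r by rewrite powR_gt0.
pose F x := h x ^+ 2 * (x + x `^ r).
have [Fi Fe] := integralp_scale c0 hh.
have K0 : 0 <= c^-1 + (c `^ r)^-1 by rewrite addr_ge0// invr_ge0 ltW.
have key (x : R) : 0 < x -> h (c * x) ^+ 2 * (x + x `^ r) <=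
    (c^-1 + (c `^ r)^-1) * F (c * x).
  move=> x0; rewrite /F [leRHS]mulrCA; apply: ler_wpM2l; first exact: sqr_ge0.
  rewrite (powRM _ (ltW c0) (ltW x0)).
  have xr : 0 <= x `^ r by exact: powR_ge0.
  have -> : (c^-1 + (c `^ r)^-1) * (c * x + c `^ r * x `^ r) =
      x + x `^ r + (c^-1 * (c `^ r) * x `^ r + (c `^ r)^-1 * c * x).
    by field; rewrite !gt_eqF.
  by rewrite lerDl addr_ge0// !mulr_ge0// ?invr_ge0 ltW.
have mhc := meas_scale c0 mh.
have hi : integrablep (fun x => h (c * x) ^+ 2 * (x + x `^ r)).
  apply: (integrablep_le _ (integrablepZ (c^-1 + (c `^ r)^-1) Fi)).
    apply: measurable_funM; last exact: measurable_weight.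
    exact: measurable_funX.
  by move=> x x0; rewrite ger0_norm ?sqw_ge0//; exact: key.
split => //.
apply: (le_trans (le_integralp hi (integrablepZ (c^-1 + (c `^ r)^-1) Fi) key)).
rewrite (integralpZ _ Fi).
suff -> : c^-1 * (c^-1 + (c `^ r)^-1) * sqnorm r h =
    (c^-1 + (c `^ r)^-1) * integralp (fun x => F (c * x)) by [].
by rewrite Fe mulrCA mulrA.
Qed.

(** The kernels against which all power weights are compared: each one is the
    derivative of the bounded function -1/(s (1 + (x/b)^s)), so that its
    integral is at most 1/s, uniformly in the scale b. *)
Definition dkern (s b x : R) : R :=
  x^-1 * ((x / b) `^ s / (1 + (x / b) `^ s) ^+ 2).

Lemma dkern_ge0 (s b x : R) : 0 < x -> 0 <= dkern s b x.
Proof.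
by move=> x0; rewrite mulr_ge0 ?invr_ge0 ?(ltW x0)// divr_ge0 ?powR_ge0// sqr_ge0.
Qed.

Lemma integrable_dkern (s b : R) : 0 < s -> 0 < b ->
  integrablep (dkern s b) /\ integralp (dkern s b) <= s^-1.
Proof.
move=> s0 b0.
have pos (x : R) : 0 < 1 + (x / b) `^ s by rewrite ltr_pwDl ?powR_ge0.
have dxb (x : R) : is_derive x 1 (fun y : R => y / b) b^-1.
  by have h := derM (derI x) (derC b^-1 x); apply: (derE h); rewrite mul1r mulr0 addr0.
have dpow (x : R) : 0 < x -> is_derive x 1 (fun y => 1 + (y / b) `^ s)
    (s * (x / b) `^ s / x).
  move=> x0; have xb0 : 0 < x / b by rewrite divr_gt0.
  have h := derD (derC 1 x) (der_pow (f := fun y => y / b) s xb0 (dxb x)); apply: (derE h).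
  rewrite add0r powRB ?(gt_eqF xb0)//; last by apply/implyP.
  rewrite powRr1 ?ltW//; field; rewrite !gt_eqF//.
have [//| | | |fi le1] := @integrablep_primitive R (dkern s b)
  (fun x => - (s^-1 / (1 + (x / b) `^ s))) s^-1.
- by move=> x; exact: dkern_ge0.
- move=> x x0; have xb0 : 0 < x / b by rewrite divr_gt0.
  have px := pos x.
  have h1 := derV (lt0r_neq0 x0) (derI x).
  have h2 := der_pow (f := fun y => y / b) s xb0 (dxb x).
  have h3 := dpow x x0.
  have p2 : (1 + (x / b) `^ s) ^+ 2 != 0 by rewrite expf_neq0 ?lt0r_neq0.
  have h4 := derV (f := fun y => (1 + (y / b) `^ s) ^+ 2) p2 (der_sqr h3).
  have h5 := derM h1 (derM h2 h4).
  exact: is_derive_cont h5.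
- move=> x x0; have h3 := dpow x x0.
  have h4 := derN (derZ s^-1 (derV (f := fun y => 1 + (y / b) `^ s) (lt0r_neq0 (pos x)) h3)); apply: (derE h4).
  rewrite /dkern; have := pos x; set z := (x / b) `^ s => z0.
  by field; rewrite !gt_eqF.
- move=> x y x0 y0; rewrite opprK addrC.
  have h1 : s^-1 / (1 + (x / b) `^ s) <= s^-1.
    by rewrite ler_pdivrMr ?pos// ler_peMr ?invr_ge0 ?(ltW s0)// lerDl powR_ge0.
  have h2 : 0 <= s^-1 / (1 + (y / b) `^ s) by rewrite divr_ge0 ?invr_ge0 ?ltW// pos.
  by lra.
- by split.
Qed.

(** Cauchy-Schwarz, after writing the weight of the test function as the weight
    of the space times an integrable kernel. *)
Lemma pairing_dkern r (s b C : R) h psi : 0 < s -> 0 < b -> 0 <= C -> in_H r h ->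
  measurable_fun D psi ->
  (forall x : R, 0 < x -> psi x ^+ 2 <= C * (x + x `^ r) * dkern s b x) ->
  integrablep (fun x => h x * psi x) /\
  integralp (fun x => `|h x * psi x|) ^+ 2 <= C / s * sqnorm r h.
Proof.
move=> s0 b0 C0 [mh hh] mpsi hpsi.
have [ki kle] := integrable_dkern s0 b0.
have mk : measurable_fun D (fun x => h x * psi x) by apply: measurable_funM.
have [|i1 i2] := integralp_CS mk hh (integrablepZ C ki).
  move=> x x0; split.
  - exact: sqw_ge0.
  - by rewrite mulr_ge0// dkern_ge0.
  - rewrite exprMn -mulrA ler_wpM2l ?sqr_ge0// mulrCA mulrA.
    exact: hpsi.
split => //; apply: (le_trans i2); rewrite mulrC; apply: ler_wpM2r.
  exact: sqnorm_ge0.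
by rewrite integralpZ// ler_wpM2l.
Qed.

Lemma pow_dkern r (e : R) : 0 < e -> 2 * e < r - 1 ->
  exists2 s, 0 < s & forall x : R, 0 < x ->
    (x `^ e) ^+ 2 <= 4 * (x + x `^ r) * dkern s 1 x.
Proof.
move=> e0 er; pose s := Num.min (2 * e) (r - 1 - 2 * e).
have s0 : 0 < s by rewrite lt_min; apply/andP; split; lra.
have se : s <= 2 * e by rewrite ge_min lexx.
have sr : 2 * e + s <= r - 1 by have : s <= r - 1 - 2 * e; [rewrite ge_min lexx orbT|lra].
exists s => // x x0; rewrite /dkern divr1.
have xr : x `^ r = x * x `^ (r - 1).
  by rewrite -[X in _ = X * _](powRr1 (ltW x0)) -powRD ?(gt_eqF x0) ?implybT// addrC subrK.
have -> : (x `^ e) ^+ 2 = x `^ (2 * e).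
  by rewrite -powR_mulrn ?powR_ge0// -powRrM mulrC.
set y := x `^ s; have y0 : 0 < y by rewrite powR_gt0.
have -> : 4 * (x + x `^ r) * (x^-1 * (y / (1 + y) ^+ 2)) =
    4 * (1 + x `^ (r - 1)) * y / (1 + y) ^+ 2.
  by rewrite xr; field; rewrite !gt_eqF// ltr_wpDr// ltW.
have y1 : 0 < 1 + y by rewrite addr_gt0.
rewrite ler_pdivlMr ?exprn_gt0//.
have [x1|x1] := leP x 1.
- have y1' : y <= 1 by rewrite -(powRr0 x) /y; apply: ger_powR; rewrite ?x0// ltW.
  have h1 : x `^ (2 * e) <= y by apply: ger_powR; rewrite ?x0.
  have h2 : (1 + y) ^+ 2 <= 4 by rewrite expr2; nra.
  have h3 : 0 <= x `^ (r - 1) by exact: powR_ge0.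
  have h4 : 0 <= x `^ (2 * e) by exact: powR_ge0.
  apply: (@le_trans _ _ (y * 4)); first by rewrite ler_pM// sqr_ge0.
  by nra.
- have y1' : 1 <= y by rewrite -(powRr0 x) /y; apply: ler_powR; rewrite ltW.
  have h1 : x `^ (2 * e) * y <= x `^ (r - 1).
    by rewrite -powRD ?(gt_eqF x0) ?implybT//; apply: ler_powR; rewrite // ltW.
  have h2 : (1 + y) ^+ 2 <= 4 * y * y by rewrite expr2; nra.
  have h4 : 0 <= x `^ (2 * e) by exact: powR_ge0.
  apply: (@le_trans _ _ (x `^ (2 * e) * (4 * y * y))); first by rewrite ler_wpM2l.
  by nra.
Qed.

(** Moments of order e with 0 < e < (r-1)/2 are continuous on the space. *)
Lemma pairing_pow r (e : R) : 0 < e -> 2 * e < r - 1 ->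
  exists2 K, 0 < K & forall (C : R) h psi, 0 <= C -> in_H r h ->
    measurable_fun D psi ->
    (forall x : R, 0 < x -> `|psi x| <= C * x `^ e) ->
    integrablep (fun x => h x * psi x) /\
    integralp (fun x => `|h x * psi x|) ^+ 2 <= C ^+ 2 * K * sqnorm r h.
Proof.
move=> e0 er; have [s s0 hs] := pow_dkern e0 er.
exists (4 / s); first by rewrite divr_gt0.
move=> C h psi C0 hh mpsi hpsi.
have -> : C ^+ 2 * (4 / s) = (C ^+ 2 * 4) / s by rewrite mulrA.
apply: (@pairing_dkern r s 1 (C ^+ 2 * 4)) => //.
  by rewrite mulr_ge0// sqr_ge0.
move=> x x0; rewrite -(real_normK (num_real (psi x))).
apply: (@le_trans _ _ ((C * x `^ e) ^+ 2)).
  by rewrite lerXn2r ?nnegrE ?mulr_ge0 ?powR_ge0// hpsi.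
have hx := hs x x0; rewrite exprMn; have := sqr_ge0 C; nra.
Qed.

End weighted.

(** * Density of continuous functions and continuity of dilations *)

Section approximation.
Context {R : realType}.
Implicit Types (f g h : R -> R) (r : R).
Local Notation D := (`]0, +oo[%classic : set R).
Local Notation mu := (@lebesgue_measure R).

Lemma dkern11 (x : R) : 0 < x -> dkern 1 1 x = ((1 + x) ^+ 2)^-1.
Proof.
by move=> x0; rewrite /dkern divr1 powRr1 ?ltW//; field; rewrite !gt_eqF// addr_gt0.
Qed.

Lemma integrablep_bounded_support f (M b : R) : 0 <= M -> 0 <= b ->
  measurable_fun D f -> (forall x : R, 0 < x -> `|f x| <= M) ->
  (forall x : R, b < x -> f x = 0) -> integrablep f.
Proof.
move=> M0 b0 mf fM fb; have [ki _] := @integrable_dkern R 1 1 ltr01 ltr01.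
apply: (integrablep_le mf (integrablepZ (M * (1 + b) ^+ 2) ki)) => x x0.
rewrite dkern11//; have [bx|xb] := ltP b x.
  by rewrite fb// normr0 -mulrA mulr_ge0// divr_ge0// sqr_ge0.
apply: (le_trans (fM x x0)); rewrite -mulrA ler_peMr//.
rewrite ler_pdivlMr ?exprn_gt0 ?addr_gt0// mul1r lerXn2r ?nnegrE ?addr_ge0//.
- exact: ltW.
- by rewrite lerD2l.
Qed.

Lemma integralp_dominated_cvg (f_ : nat -> R -> R) g :
  (forall n, measurable_fun D (f_ n)) -> integrablep g ->
  (forall n (x : R), 0 < x -> `|f_ n x| <= g x) ->
  (forall x : R, 0 < x -> f_ n x @[n --> \oo] --> (0 : R)) ->
  integralp (f_ n) @[n --> \oo] --> (0 : R).
Proof.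
move=> mf ig fg fc.
have mf0 n : measurable_fun D (EFin \o f_ n) by exact/measurable_EFinP.
have c0 : measurable_fun D (EFin \o (fun=> 0 : R)) by exact/measurable_EFinP.
have ae1 : {ae mu, forall x, D x -> (EFin \o f_ n) x @[n --> \oo] --> (EFin \o (fun=> 0 : R)) x}.
  apply: aeW => x /Dgt0 x0 /=; apply: cvg_EFin; first exact: nearW.
  exact: fc.
have ae2 : {ae mu, forall x n, D x -> (`|(EFin \o f_ n) x| <= (EFin \o g) x)%E}.
  by apply: aeW => x n /Dgt0 x0 /=; rewrite lee_fin fg.
have [i0 _ cv] := dominated_convergence mD mf0 c0 ae1 ig ae2.
have I0 : (\int[mu]_(x in D) (EFin \o (fun _ : R => 0%R)) x = 0)%E.
  by under eq_integral do []; rewrite integral0.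
rewrite I0 in cv.
have fi n : integrablep (f_ n) by apply: (integrablep_le (mf n) ig) => x /fg.
have E : (fun n => \int[mu]_(x in D) (EFin \o f_ n) x)%E = (fun n => (integralp (f_ n))%:E).
  by apply/funext => n; exact: integralpE.
move: cv; rewrite E => /fine_cvgP [_]; exact.
Qed.

(** Truncating to |h| <= n on [1/n, n] approximates in norm. *)
Lemma in_H_truncate r h (e : R) : in_H r h -> 0 < e ->
  exists (k : R -> R) (N : R), [/\ 1 <= N, in_H r k, sqnorm r (fun x => h x - k x) <= e,
    forall x, `|k x| <= N & forall x, ~~ (N^-1 <= x <= N) -> k x = 0].
Proof.
move=> hh e0; have [mh hi] := hh.
pose A (n : nat) : set R := [set x | n.+1%:R^-1 <= x <= n.+1%:R /\ `|h x| <= n.+1%:R].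
pose k n := (fun x : R => if (n.+1%:R^-1 <= x <= n.+1%:R) && (`|h x| <= n.+1%:R) then h x else 0).
have mk n : measurable_fun D (k n).
  apply: measurable_fun_if => //.
  - apply: measurable_and; first by apply: measurable_and; apply: measurable_fun_ler.
    by apply: measurable_fun_ler => //; apply: measurableT_comp.
  - by apply: measurable_funS mh => //; move=> x [].
have kh n (x : R) : `|k n x| <= `|h x| by rewrite /k; case: ifP => // _; rewrite normr0.
have kH n : in_H r (k n) by have [] := in_H_le (mk n) hh (fun x _ => kh n x).
have dH n : in_H r (fun x => h x - k n x) by have [] := in_HB hh (kH n).
have : integralp (fun x => (h x - k n x) ^+ 2 * (x + x `^ r)) @[n --> \oo] --> (0 : R).
  apply: (@integralp_dominated_cvg _ (fun x => h x ^+ 2 * (x + x `^ r))) => //.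
  - by move=> n; exact: integrablep_meas (in_H_int (dH n)).
  - move=> n x x0; rewrite ger0_norm ?sqw_ge0// ler_wpM2r ?weight_ge0//.
    by rewrite /k; case: ifP => _; rewrite ?subrr ?expr0n ?subr0//= sqr_ge0.
  - move=> x x0; apply: cvg_near_cst.
    pose M := Num.max (Num.max x x^-1) `|h x|.
    near=> n.
    have : M <= n.+1%:R.
      by near: n; exists (Num.truncn M) => // n /= Mn;
         rewrite ltW// (lt_le_trans (truncnS_gt M))// ler_nat ltnS.
    rewrite !ge_max => /andP[/andP[h1 h2] h3].
    have nx : n.+1%:R^-1 <= x by rewrite -[leRHS]invrK lef_pV2 ?posrE ?invr_gt0.
    by rewrite /k h1 h3 nx/= subrr expr0n/= mul0r.
move=> /cvgrPdist_le /(_ e e0) [n _ /(_ n (leqnn n))] /=.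
rewrite sub0r normrN ger0_norm ?sqnorm_ge0// => hn.
exists (k n), n.+1%:R; split => //.
- by rewrite ler1n.
- by move=> x; rewrite /k; case: ifP => [/andP[_ //]|_]; rewrite normr0.
- by move=> x /negbTE xn; rewrite /k xn.
Unshelve. all: by end_near. Qed.

Lemma clip_dist (N a b : R) : `|a| <= N ->
  `|a - Num.max (- N) (Num.min N b)| <= `|a - b|.
Proof.
rewrite ler_norml => /andP[a1 a2].
have [h1|h1] := leP N b.
  rewrite max_r; last by lra.
  by rewrite !ler0_norm; lra.
have [h2|h2] := leP (- N) b; first by [].
by rewrite !ger0_norm; lra.
Qed.

Lemma clip_bound (N b : R) : 0 <= N -> `|Num.max (- N) (Num.min N b)| <= N.
Proof.
move=> N0; rewrite ler_norml le_max lexx/= ge_max ge_min lexx/= andbT.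
by lra.
Qed.

(** A continuous function equal to 1 on [1/N, N] and to 0 off [1/(2N), 2N]. *)
Definition trapezoid (N x : R) : R :=
  Num.max 0 (Num.min 1 (Num.min (2 * N * x - 1) (2 - x / N))).

Lemma trapezoid_cont (N x : R) : {for x, continuous (trapezoid N)}.
Proof.
have c1 : {for x, continuous (fun y : R => 2 * N * y - 1)}.
  have h := derB (derZ (2 * N) (derI x)) (derC 1 x); exact: is_derive_cont h.
have c2 : {for x, continuous (fun y : R => 2 - y / N)}.
  have h := derB (derC 2 x) (derM (derI x) (derC N^-1 x)); exact: is_derive_cont h.
rewrite /trapezoid; apply: continuous_max; first exact: cst_continuous.
apply: continuous_min; first exact: cst_continuous.
exact: continuous_min.
Qed.

Lemma trapezoid_01 (N x : R) : 0 <= trapezoid N x <= 1.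
Proof. by rewrite /trapezoid le_max lexx/= ge_max ler01/= ge_min lexx. Qed.

Lemma trapezoid1 (N x : R) : 0 < N -> N^-1 <= x <= N -> trapezoid N x = 1.
Proof.
move=> N0 /andP[h1 h2]; rewrite /trapezoid; have : 1 <= N * x.
  by rewrite -(mulfV (lt0r_neq0 N0)) ler_wpM2l// ltW.
have : x / N <= 1 by rewrite ler_pdivrMr// mul1r.
move=> h3 h4; rewrite (min_idPl _) ?(max_idPr _)//.
by rewrite le_min; apply/andP; split; [nra|lra].
Qed.

Lemma trapezoid0 (N x : R) : 0 < N -> ~~ ((2 * N)^-1 <= x <= 2 * N) -> trapezoid N x = 0.
Proof.
move=> N0; rewrite negb_and -!ltNge => h; rewrite /trapezoid; apply: max_l.
rewrite ge_min; apply/orP; right; rewrite ge_min; apply/orP; case/orP: h => h.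
  left; have N2 : 0 < 2 * N by rewrite mulr_gt0.
  suff : 2 * N * x < 1 by lra.
  by rewrite -ltr_pdivlMl// mulr1.
by right; have : 2 <= x / N; [rewrite ler_pdivlMr// ltW|lra].
Qed.

(** Continuous functions with compact support in the open half-line are
    dense. *)
Lemma in_H_dense r h (e : R) : 0 <= r -> in_H r h -> 0 < e ->
  exists (g : R -> R) (a b M : R), [/\ 0 < a, in_H r g, forall x, {for x, continuous g},
    (forall x, ~~ (a <= x <= b) -> g x = 0) /\ (forall x, `|g x| <= M) &
    sqnorm r (fun x => h x - g x) <= e].
Proof.
move=> r0 hh e0; have e40 : 0 < e / 4 by rewrite divr_gt0.
have [k [N [N1 kH hk kN k0]]] := in_H_truncate hh e40.
have N0 : 0 < N by lra.
pose a := (2 * N)^-1; pose b := 2 * N.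
have a0 : 0 < a by rewrite invr_gt0 mulr_gt0.
have b0 : 0 < b by rewrite mulr_gt0.
pose E : set R := `[a, b]%classic.
have mE : measurable (E : set (measurableTypeR R)) by exact: measurable_itv.
have ED : E `<=` D by move=> x; rewrite /E /= in_itv/= => /andP[ax _]; apply: gt0D; lra.
have mkE : measurable_fun E k.
  by apply: (measurable_funS mD ED); exact: in_H_meas kH.
have ki : integrablep k.
  apply: (@integrablep_bounded_support _ N N) => //; try lra.
  - exact: in_H_meas kH.
  - by move=> x Nx; apply: k0; rewrite negb_and orbC -ltNge Nx.
have kiE : mu.-integrable E (EFin \o k) by apply: (integrableS mD mE ED).
have muE : (mu E < +oo)%E.
  by rewrite /E lebesgue_measure_itv/=; case: ifP => _; rewrite ?ltry// -EFinB ltry.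
have [g_ [cg ig cvg_]] := approximation_continuous_integrable mE muE kiE.
pose W := b + b `^ r + 1.
have W0 : 0 < W by rewrite /W; have := powR_ge0 b r; lra.
pose e1 := e / (4 * (2 * N) * W).
have e10 : 0 < e1 by rewrite divr_gt0// !mulr_gt0.
have [n hn] : exists n, \int[mu]_(z in E) `|k z - g_ n z| <= e1.
  have /fine_cvgP[_ /cvgrPdist_le /(_ e1 e10) [n _ /(_ n (leqnn n))]] := cvg_.
  rewrite /= sub0r normrN => hn; exists n; apply: le_trans hn.
  exact: ler_norm.
pose G x := Num.max (- N) (Num.min N (g_ n x)).
have cG (x : R) : {for x, continuous G}.
  rewrite /G; apply: continuous_max; first exact: cst_continuous.
  by apply: continuous_min; [exact: cst_continuous|exact: cg].
have GN (x : R) : `|G x| <= N by apply: clip_bound; lra.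
pose g x := trapezoid N x * G x.
have cgg (x : R) : {for x, continuous g}.
  by apply: continuousM; [exact: trapezoid_cont|exact: cG].
have gN (x : R) : `|g x| <= N.
  have /andP[p0 p1] := trapezoid_01 N x.
  by rewrite normrM ger0_norm// (le_trans _ (GN x))// ler_piMl.
have g0 (x : R) : ~~ (a <= x <= b) -> g x = 0.
  by move=> xab; rewrite /g trapezoid0 ?mul0r.
have mcont (u : R -> R) : (forall x : R, {for x, continuous u}) -> measurable_fun D u.
  move=> cu; apply: measurable_funTS; apply: continuous_measurable_fun => x.
  exact: cu.
have Wx (x : R) : 0 < x -> x <= b -> x + x `^ r <= W.
  move=> x0 xb; rewrite /W; have : x `^ r <= b `^ r + 1.
    by have := @ge0_ler_powR R r r0 x b; rewrite !nnegrE; move=> /(_ (ltW x0) (ltW b0) xb); lra.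
  lra.
have NW0 : 0 <= N ^+ 2 * W by rewrite ltW// mulr_gt0// exprn_gt0.
have gH : in_H r g.
  split; first exact: mcont.
  apply: (@integrablep_bounded_support _ (N ^+ 2 * W) b); rewrite ?(ltW b0)//.
  - apply: measurable_funM; last exact: measurable_weight.
    by apply: measurable_funX; exact: mcont.
  - move=> x x0; rewrite ger0_norm ?sqw_ge0//; have [bx|xb] := ltP b x.
      rewrite g0 ?expr0n/= ?mul0r//.
      by rewrite negb_and orbC -ltNge bx.
    rewrite ler_pM ?sqr_ge0 ?weight_ge0 ?Wx//.
    by rewrite -(real_normK (num_real (g x))) lerXn2r ?nnegrE// ltW.
  - by move=> x bx; rewrite g0 ?expr0n/= ?mul0r// negb_and orbC -ltNge bx.
pose q : R -> R := (fun x => `|k x - G x|) \_ E.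
have qE (x : R) : a <= x <= b -> q x = `|k x - G x|.
  by move=> xab; rewrite /q patchE mem_set// /E /= in_itv.
have qE0 (x : R) : ~~ (a <= x <= b) -> q x = 0.
  by move=> xab; rewrite /q patchE memNset// /E /= in_itv/=; apply/negP.
have q0 (x : R) : 0 <= q x by rewrite /q patchE; case: ifP.
have mkG : measurable_fun D (fun x => `|k x - G x|).
  apply: measurableT_comp => //; apply: measurable_funB; last exact: mcont.
  exact: in_H_meas kH.
have mq : measurable_fun D q.
  apply/measurable_restrict => //.
  by apply: measurable_funS mkG => // x [].
have qi : integrablep q.
  apply: (@integrablep_bounded_support _ (2 * N) b); rewrite ?ltW//.
  - move=> x _; rewrite ger0_norm// /q patchE; case: ifP => _; last by rewrite mulr_ge0// ltW.
    by rewrite (le_trans (ler_normB _ _))//; have := kN x; have := GN x; lra.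
  - by move=> x bx; rewrite qE0// negb_and orbC -ltNge bx.
have Iq : integralp q <= e1.
  apply: le_trans hn; rewrite /integralp /q -Rintegral_mkcondr.
  have -> : D `&` E = E by apply: setIidr.
  have mgn : measurable_fun E (g_ n) by exact: measurable_funTS (continuous_measurable_fun (cg n)).
  apply: le_Rintegral => //.
  - apply: (@eq_integrable _ _ _ mu E mE (EFin \o q)); last exact: (integrableS mD mE ED).
    by move=> x; rewrite inE /E /= in_itv/= => xE; rewrite qE.
  - apply: (@integrable_norm _ _ _ mu E (fun x => k x - g_ n x)).
    by have := integrableB mE kiE (ig n).
  - by move=> x _; apply: clip_dist.
have dq (x : R) : 0 < x -> `|k x - g x| <= q x.
  move=> x0; have [xE|xE] := boolP (a <= x <= b); last first.
    rewrite qE0// g0// k0 ?subrr ?normr0//; apply: contra xE => /andP[h1 h2].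
    apply/andP; split; last by rewrite /b; lra.
    by apply: le_trans h1; rewrite /a lef_pV2 ?posrE ?mulr_gt0//; lra.
  rewrite qE//; have [xN|xN] := boolP (N^-1 <= x <= N).
    by rewrite /g trapezoid1// mul1r.
  rewrite k0// !sub0r !normrN /g normrM; have /andP[p0 p1] := trapezoid_01 N x.
  by rewrite ger0_norm// ler_piMl.
have [dH _] := in_HB kH gH.
have dle : sqnorm r (fun x => k x - g x) <= e / 4.
  have hi := integrablepZ (2 * N * W) qi.
  apply: (@le_trans _ _ (integralp (fun x => 2 * N * W * q x))).
    apply: (le_integralp (in_H_int dH) hi) => x x0.
    have [xE|xE] := boolP (a <= x <= b); last first.
      have := dq x x0; rewrite qE0// normr_le0 => /eqP ->.
      by rewrite expr0n/= mul0r mulr0.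
    have -> : 2 * N * W * q x = (2 * N * q x) * W by ring.
    have /andP[_ xb] := xE.
    rewrite ler_pM ?sqr_ge0 ?weight_ge0 ?Wx//.
    rewrite -(real_normK (num_real _)) expr2 ler_pM//; last exact: dq.
    by rewrite (le_trans (ler_normB _ _))//; have := kN x; have := gN x; lra.
  rewrite (integralpZ _ qi); have -> : e / 4 = 2 * N * W * e1.
    by rewrite /e1; field; rewrite !gt_eqF.
  by rewrite ler_pM2l// !mulr_gt0.
have [hkH _] := in_HB hh kH.
exists g, a, b, N; split => //.
have E1 (x : R) : 0 < x -> (h x - k x) + (k x - g x) = h x - g x by move=> _; ring.
have [_ h2] := in_HD hkH dH; rewrite (eq_sqnorm r E1) in h2.
by lra.
Qed.

(** Dilations act continuously: dense continuous functions plus dominated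
    convergence. *)
Lemma scale_continuous r h (e : R) : 0 <= r -> in_H r h -> 0 < e ->
  exists2 d, 0 < d & forall c : R, `|c - 1| < d -> [/\ 0 < c,
    in_H r (fun x => h (c * x) - h x) & sqnorm r (fun x => h (c * x) - h x) <= e].
Proof.
move=> r0 hh e0; pose K : R := 2 * (2 + 2 `^ r).
have K0 : 0 < K by rewrite mulr_gt0// addr_gt0// powR_gt0.
pose e1 := e / (4 * K + 4 + 4).
have D0 : 0 < 4 * K + 4 + 4 by lra.
have e10 : 0 < e1 by rewrite divr_gt0.
have [g [a [b [M [a0 gH cg [g0 gM] hg]]]]] := in_H_dense r0 hh e10.
have halfc (c : R) : `|c - 1| < 2^-1 -> 2^-1 < c < 2.
  by rewrite ltr_norml => /andP[h1 h2]; apply/andP; split; lra.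
have step (w : R -> R) (c : R) : in_H r w -> 2^-1 < c < 2 ->
    in_H r (fun x => w (c * x)) /\ sqnorm r (fun x => w (c * x)) <= K * sqnorm r w.
  move=> hw /andP[c1 c2]; have c0 : 0 < c by lra.
  have [h1 h2] := in_H_scale c0 hw; split => //; apply: (le_trans h2).
  apply: ler_wpM2r; first exact: sqnorm_ge0.
  have ci : c^-1 <= 2 by rewrite -[leRHS]invrK lef_pV2 ?posrE ?invr_gt0// ltW.
  have cri : (c `^ r)^-1 <= 2 `^ r.
    rewrite -[leLHS]mul1r ler_pdivrMr ?powR_gt0// -powRM ?(ltW c0)//.
    by rewrite -[leLHS](powRr0 (2 * c)); apply: ler_powR => //; lra.
  have ci0 : 0 <= c^-1 by rewrite invr_ge0 ltW.
  have cr0 : 0 <= (c `^ r)^-1 by rewrite invr_ge0 powR_ge0.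
  by rewrite /K ler_pM// ?addr_ge0// lerD.
have [d d0 hd] : exists2 d, 0 < d & forall c : R, `|c - 1| < d -> `|c - 1| < 2^-1 ->
    sqnorm r (fun x => g (c * x) - g x) <= e1.
  apply: contrapT => H.
  have bad n : exists c : R, [/\ `|c - 1| < n.+1%:R^-1, `|c - 1| < 2^-1 &
      e1 < sqnorm r (fun x => g (c * x) - g x)].
    apply: contrapT => Hn; apply: H; exists n.+1%:R^-1; first by rewrite invr_gt0.
    move=> c c1 c2; rewrite leNgt; apply/negP => c3; apply: Hn; exists c; split => //.
  have [c_ hc] := choice bad.
  have cc : c_ n @[n --> \oo] --> (1 : R).
    apply/cvgrPdist_le => z z0; near=> n.
    have [h1 _ _] := hc n; rewrite distrC (le_trans (ltW h1))//.
    near: n; exists (Num.truncn z^-1) => // n /= zn.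
    rewrite -[leRHS]invrK lef_pV2 ?posrE ?invr_gt0//.
    by rewrite ltW// (lt_le_trans (truncnS_gt _))// ler_nat ltnS.
  pose B := 2 * `|b|; have B0 : 0 <= B by rewrite mulr_ge0.
  have M0 : 0 <= M by apply: le_trans (gM 0).
  pose W := B + B `^ r; have W0 : 0 <= W by rewrite addr_ge0// powR_ge0.
  pose Q := (2 * M) ^+ 2 * W.
  have gcH n : in_H r (fun x => g (c_ n * x) - g x).
    have [_ h2 _] := hc n; have [gc _] := step _ _ gH (halfc _ h2).
    by have [] := in_HB gc gH.
  have [ki _] := @integrable_dkern R 1 1 ltr01 ltr01.
  have : integralp (fun x => (g (c_ n * x) - g x) ^+ 2 * (x + x `^ r)) @[n --> \oo] --> (0 : R).
    apply: (@integralp_dominated_cvg _ (fun x => Q * (1 + B) ^+ 2 * dkern 1 1 x)).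
    - by move=> n; exact: integrablep_meas (in_H_int (gcH n)).
    - exact: integrablepZ.
    - move=> n x x0; rewrite ger0_norm ?sqw_ge0//; have [Bx|xB] := ltP B x.
        have [_ h2 _] := hc n; have /andP[h3 _] := halfc _ h2.
        have nb := ler_norm b; have nb0 := normr_ge0 b.
        have bx : b < x by rewrite /B in Bx; lra.
        have bcx : b < c_ n * x by rewrite /B in Bx; nra.
        rewrite !g0 ?negb_and -?ltNge ?bx ?bcx ?orbT//.
        rewrite subrr expr0n/= mul0r mulr_ge0 ?dkern_ge0// mulr_ge0 ?sqr_ge0//.
        by rewrite /Q mulr_ge0// sqr_ge0.
      apply: (@le_trans _ _ Q).
        rewrite /Q ler_pM ?sqr_ge0 ?weight_ge0//.
          rewrite -(real_normK (num_real _)) lerXn2r ?nnegrE ?mulr_ge0//.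
          by rewrite (le_trans (ler_normB _ _))//; have := gM x; have := gM (c_ n * x); lra.
        by rewrite /W lerD//; apply: ge0_ler_powR; rewrite ?nnegrE ?(ltW x0).
      rewrite dkern11// -mulrA ler_peMr//; first by rewrite /Q mulr_ge0// sqr_ge0.
      rewrite ler_pdivlMr ?exprn_gt0 ?addr_gt0// mul1r lerXn2r ?nnegrE ?addr_ge0//.
        exact: ltW.
      by rewrite lerD2l.
    - move=> x x0.
      have h1 : g (c_ n * x) @[n --> \oo] --> g x.
        apply: continuous_cvg; first exact: cg.
        by rewrite -[X in _ --> X]mul1r; apply: cvgM cc (cvg_cst x).
      have h2 : (g (c_ n * x) - g x : R^o) @[n --> \oo] --> (g x - g x : R^o).
        by exact: cvgB h1 (cvg_cst (g x)).
      have h3 := cvgM (cvgM h2 h2) (cvg_cst (x + x `^ r)).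
      have Z : 0 = (g x - g x) * (g x - g x) * (x + x `^ r) by rewrite subrr !mul0r.
      by rewrite [X in _ --> X]Z; exact: h3.
  move=> /cvgrPdist_lt /(_ e1 e10) [n _ /(_ n (leqnn n))] /=.
  rewrite sub0r normrN ger0_norm ?sqnorm_ge0// => hn.
  by have [_ _ /lt_trans /(_ hn)] := hc n; rewrite ltxx.
exists (Num.min d 2^-1); first by rewrite lt_min d0 invr_gt0/=.
move=> c; rewrite lt_min => /andP[cd ch]; have c2 := halfc c ch.
have c0 : 0 < c by have /andP[] := c2; lra.
have [hgH _] := in_HB hh gH.
have [s1 s2] := step _ _ hgH c2.
have [gc _] := step _ _ gH c2.
have [t1 _] := in_HB gc gH.
have E (x : R) : 0 < x ->
  (h (c * x) - g (c * x) + (g (c * x) - g x)) - (h x - g x) = h (c * x) - h x.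
  by move=> _; ring.
have [u1 u2] := in_HD s1 t1.
have [v1 v2] := in_HB u1 hgH.
rewrite (eq_sqnorm r E) in v2; split => //; first exact: eq_in_H E v1.
have := hd c cd ch.
have -> : e = e1 * (4 * K + 4 + 4) by rewrite /e1 divfK// gt_eqF.
have : K * sqnorm r (fun x => h x - g x) <= K * e1 by rewrite ler_pM2l.
by lra.
Unshelve. all: by end_near. Qed.

End approximation.

(** * Exchange of integrals, and test functions *)

Section fubini_halfline.
Context {R : realType}.
Local Notation D := (`]0, +oo[%classic : set R).
Local Notation mu := (@lebesgue_measure R).

Let lam1 : {sigma_finite_measure set (measurableTypeR R) -> \bar R} := mu.

Lemma integralT_halfline (f : R -> \bar R) : (forall x, ~ D x -> f x = 0%E) ->
  (\int[mu]_x f x = \int[mu]_(x in D) f x)%E.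
Proof.
move=> f0; rewrite [RHS]integral_mkcond; apply: eq_integral => x _.
by rewrite patchE; case: ifPn => // /negP; rewrite inE => /f0.
Qed.

(** A bound on the inner integral of the absolute value is all that has to be
    checked in order to exchange two integrals over the half-line; the functions
    vanish off the quadrant, which reduces this to the product of two lines. *)
Lemma fubini_halfline (F : R -> R -> R) (B : R -> R) :
  measurable_fun [set: (measurableTypeR R) * (measurableTypeR R)]
    (fun p => F p.1 p.2) ->
  (forall x y, ~ D x -> F x y = 0) -> (forall x y, ~ D y -> F x y = 0) ->
  integrablep B ->
  (forall y : R, 0 < y -> integrablep (F^~ y) /\ integralp (fun x => `|F x y|) <= B y) ->
  integrablep (fun x => integralp (F x)) /\
  integralp (fun x => integralp (F x)) = integralp (fun y => integralp (F^~ y)).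
Proof.
move=> mF Fx Fy hB hF; pose f p := (F p.1 p.2)%:E.
have mf : measurable_fun setT f by exact/measurable_EFinP.
have maf : measurable_fun setT (abse \o f) by apply: measurableT_comp.
have fi : (lam1 \x lam1)%E.-integrable setT f.
  apply/integrableP; split => //.
  have af0 p : (0 <= (abse \o f) p)%E by exact: abse_ge0.
  rewrite (@fubini_tonelli2 _ _ _ _ _ lam1 lam1 (abse \o f) maf af0).
  rewrite /fubini_G integralT_halfline; last first.
    move=> y Dy; rewrite (eq_integral (cst 0%E)) ?integral0// => x _.
    by rewrite /f /= Fy// normr0.
  apply: (@le_lt_trans _ _ (integralp B)%:E); last exact: ltry.
  rewrite -(integralpE hB); apply: ge0_le_integral.
  - exact: mD.
  - by move=> y _; apply: integral_ge0 => x _; exact: abse_ge0.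
  - by apply: measurable_funTS; apply: measurable_fun_fubini_tonelli_G.
  - by apply/measurable_EFinP; exact: integrablep_meas.
  - move=> y /Dgt0 y0; have [h1 h2] := hF y y0.
    rewrite integralT_halfline; last by move=> x Dx; rewrite /f /= Fx// normr0.
    apply: (@le_trans _ _ (integralp (fun x => `|F x y|))%:E); last by rewrite lee_fin.
    by rewrite -(integralpE (integrablep_norm h1)).
have E1 x : (\int[lam1]_y f (x, y) = \int[mu]_(y in D) (F x y)%:E)%E.
  by rewrite integralT_halfline// => y Dy; rewrite /f /= Fy.
have E2 y : (\int[lam1]_x f (x, y) = \int[mu]_(x in D) (F x y)%:E)%E.
  by rewrite integralT_halfline// => x Dx; rewrite /f /= Fx.
have I1 := integrable_fubini_F fi.
have fin1 : ae_pos (fun x => (\int[mu]_(y in D) (F x y)%:E)%E =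
    (integralp (F x))%:E).
  have [N [mN N0 HN]] := integrable_ae measurableT I1.
  exists N; split => // x Hx; apply: HN => HxN; apply: Hx => x0.
  rewrite /integralp /Rintegral fineK// -E1; exact: HxN.
have mFx : measurable_fun setT (fun x => integralp (F x)).
  have -> : (fun x => integralp (F x)) = fine \o fubini_F lam1 f.
    by apply/funext => x; rewrite /integralp /Rintegral -E1.
  by apply: measurableT_comp; [exact: fine_measurable|exact: measurable_fubini_F fi].
have i1 : integrablep (fun x => integralp (F x)).
  have i1' : mu.-integrable D (fun x => \int[mu]_(y in D) (F x y)%:E)%E.
    have := integrableS measurableT mD (@subsetT _ D) I1.
    by apply: eq_integrable; [exact: mD|move=> x _; rewrite /fubini_F E1].
  apply/integrableP; split; first by apply/measurable_EFinP; exact: measurable_funTS.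
  have /integrableP[m1 l1] := i1'; apply: le_lt_trans l1.
  rewrite le_eqVlt; apply/predU1P; left; apply: ge0_ae_eq_integral.
  - exact: mD.
  - by apply: measurableT_comp => //; apply/measurable_EFinP; exact: measurable_funTS.
  - exact: measurableT_comp.
  - by [].
  - by [].
  - by apply: ae_posD; apply: ae_pos1 fin1 => x _ ->.
split; first exact: i1.
have Fub := Fubini fi; rewrite /fubini_F /fubini_G in Fub.
rewrite integralT_halfline in Fub; last first.
  by move=> x Dx; rewrite E1 (eq_integral (cst 0%E)) ?integral0// => y _; rewrite Fx.
rewrite [in RHS]integralT_halfline in Fub; last first.
  by move=> y Dy; rewrite E2 (eq_integral (cst 0%E)) ?integral0// => x _; rewrite Fy.
have E3 : {in D, (fun y => \int[lam1]_x f (x, y))%E =1 (fun y => (integralp (F^~ y))%:E)}.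
  by move=> y /[!inE] /Dgt0 y0; rewrite E2; have [h1 _] := hF y y0; exact: integralpE.
transitivity (fine (\int[mu]_(x in D) \int[lam1]_y f (x, y))%E); last first.
  rewrite [in LHS]Fub {1}/integralp /Rintegral; congr fine.
  by apply: eq_integral => y yD; exact: E3.
rewrite /integralp /Rintegral; congr fine; apply: ae_eq_integral.
- exact: mD.
- by apply/measurable_EFinP; exact: measurable_funTS.
- by apply: measurable_funTS; exact: measurable_fubini_F fi.
- by apply: ae_posD; apply: ae_pos1 fin1 => x _; rewrite E1 => ->.
Qed.

Lemma measurable_integralp (F : R -> R -> R) :
  measurable_fun [set: (measurableTypeR R) * (measurableTypeR R)]
    (fun p => F p.1 p.2) ->
  (forall x y, ~ D y -> F x y = 0) -> measurable_fun D (fun x => integralp (F x)).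
Proof.
move=> mF Fy; pose f p := (F p.1 p.2)%:E.
have mf : measurable_fun setT f by exact/measurable_EFinP.
have mp : measurable_fun setT (f^\+)%E by exact: measurable_funepos.
have mn : measurable_fun setT (f^\-)%E by exact: measurable_funeneg.
have m1 := measurable_fun_fubini_tonelli_F (m2 := lam1) _ mp (fun x => funepos_ge0 f x).
have m2 := measurable_fun_fubini_tonelli_F (m2 := lam1) _ mn (fun x => funeneg_ge0 f x).
have -> : (fun x => integralp (F x)) =
    fine \o (fun x => fubini_F lam1 (f^\+)%E x - fubini_F lam1 (f^\-)%E x)%E.
  apply/funext => x; rewrite /integralp /Rintegral /=; congr fine.
  rewrite -integralT_halfline; last by move=> y Dy; rewrite Fy.
  rewrite [LHS]integralE /fubini_F; congr (_ - _)%E; apply: eq_integral => y _.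
    by rewrite !funeposE.
  by rewrite !funenegE.
apply: measurable_funTS; apply: measurableT_comp; first exact: fine_measurable.
exact: emeasurable_funB.
Qed.

End fubini_halfline.

Section test_functions.
Context {R : realType}.
Implicit Types phi : R -> R.
Local Notation D := (`]0, +oo[%classic : set R).

Lemma cont_bounded_support (u : R -> R) (a b : R) :
  (forall x, {for x, continuous u}) -> (forall x, ~~ (a <= x <= b) -> u x = 0) ->
  exists2 M, 0 <= M & forall x, `|u x| <= M.
Proof.
move=> cu u0; have [ab|ab] := leP a b; last first.
  exists 0 => // x; rewrite u0 ?normr0//; apply/negP => /andP[h1 h2].
  by move: (le_trans h1 h2); rewrite leNgt ab.
have cu' : {within `[a, b], continuous (fun x => `|u x|)}.
  apply: continuous_subspaceT => x; apply: continuous_comp; first exact: cu.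
  exact: norm_continuous.
have [c _ hc] := EVT_max ab cu'; exists `|u c| => // x.
have [xab|xab] := boolP (a <= x <= b); first by apply: hc; rewrite in_itv.
by rewrite u0// normr0.
Qed.

Lemma cont_meas (u : R -> R) : (forall x, {for x, continuous u}) -> measurable_fun D u.
Proof. by move=> cu; apply: measurable_funTS; apply: continuous_measurable_fun. Qed.

(** What is used of a test function, with explicit support and bounds. *)
Record test_bounds phi (a b M : R) : Prop := TestBounds {
  tb_a : 0 < a;
  tb_ab : a <= b;
  tb_M : 0 <= M;
  tb_der : forall x : R, is_derive x 1 phi (derive1 phi x);
  tb_dcont : forall x : R, {for x, continuous (derive1 phi)};
  tb_cont : forall x : R, {for x, continuous phi};
  tb_supp : forall x : R, ~~ (a <= x <= b) -> phi x = 0;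
  tb_dsupp : forall x : R, ~~ (a <= x <= b) -> derive1 phi x = 0;
  tb_bound : forall x : R, `|phi x| <= M;
  tb_dbound : forall x : R, `|derive1 phi x| <= M }.

Lemma test_functionP phi : test_function phi -> exists a b M, test_bounds phi a b M.
Proof.
move=> [dphi cphi [a [b0 [a0 sphi]]]].
have dP (x : R) : is_derive x 1 phi (derive1 phi x).
  by rewrite derive1E; apply: derivableP.
have cP (x : R) : {for x, continuous phi} by exact: is_derive_cont (dP x).
pose b := Num.max a b0.
have ab : a <= b by rewrite le_max lexx.
have s0 (x : R) : ~~ (a <= x <= b) -> phi x = 0.
  move=> xab; apply/eqP; apply: contraNT xab => /sphi /andP[-> /= h].
  by rewrite /b le_max h orbT.
have s1 (x : R) : ~~ (a <= x <= b) -> derive1 phi x = 0.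
  move=> xab; have : is_derive x 1 (fun=> 0 : R) (derive1 phi x).
    apply: (der_near _ (dP x)).
    move: xab; rewrite negb_and -!ltNge => /orP[h|h].
      near=> y; rewrite s0// negb_and -ltNge; apply/orP; left.
      by near: y; exact: lt_nbhsl.
    near=> y; rewrite s0// negb_and -!ltNge; apply/orP; right.
    by near: y; exact: lt_nbhsr.
  by move=> [_ <-]; rewrite derive_cst.
have [M1 M10 hM1] := cont_bounded_support cP s0.
have [M2 M20 hM2] := cont_bounded_support cphi s1.
exists a, b, (Num.max M1 M2); split => //.
- by rewrite le_max M10.
- by move=> x; rewrite le_max hM1.
- by move=> x; rewrite le_max hM2 orbT.
Unshelve. all: by end_near. Qed.

End test_functions.

(** * The fragmentation operator and its adjoint *)

(** Standing assumptions on the fragmentation rate and kernel. *)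
Record frag_kernel (R : realType) (beta gamma : R) (kappa : R -> R) (k1 k2 : R) :
    Prop := FragKernel {
  fk_beta : 0 < beta;
  fk_gamma : 0 < gamma <= 2;
  fk_meas : measurable_fun (`[0, 1]%classic : set R) kappa;
  fk_k1 : 0 < k1;
  fk_k2 : 0 < k2;
  fk_bnd : forall z : R, 0 <= z <= 1 -> k1 <= kappa z <= k2;
  fk_mass : \int[@lebesgue_measure R]_(z in `[0, 1]) (z * kappa z) = 1 }.

Section fragmentation.
Context {R : realType} {beta gamma : R} {kappa : R -> R} {k1 k2 : R}.
Hypothesis fk : frag_kernel beta gamma kappa k1 k2.
Let beta_gt0 := fk_beta fk.
Let gamma_bnd := fk_gamma fk.
Let kappa_meas := fk_meas fk.
Let k1_gt0 := fk_k1 fk.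
Let k2_gt0 := fk_k2 fk.
Let kappa_mass := fk_mass fk.
Let kappa_bnd := @fk_bnd _ _ _ _ _ _ fk.
Local Notation D := (`]0, +oo[%classic : set R).
Local Notation mu := (@lebesgue_measure R).
Implicit Types (h phi psi : R -> R) (r : R).

(** The kernel extended by zero, so that every integral is over the
    half-line. *)
Definition kap (z : R) : R := if 0 < z < 1 then kappa z else 0.

Lemma kap_ge0 (z : R) : 0 <= kap z.
Proof.
rewrite /kap; case: ifP => // /andP[z0 z1].
have /kappa_bnd/andP[h _] : 0 <= z <= 1 by rewrite !ltW.
exact: le_trans (ltW k1_gt0) h.
Qed.

Lemma kap_le (z : R) : kap z <= k2.
Proof.
rewrite /kap; case: ifP => [/andP[z0 z1]|_]; last exact: ltW.
by have /kappa_bnd/andP[_ h] : 0 <= z <= 1 by rewrite !ltW.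
Qed.

Lemma kap_lb (z : R) : 0 < z < 1 -> k1 <= kap z.
Proof.
move=> z01; rewrite /kap z01; have /andP[z0 z1] := z01.
by have /kappa_bnd/andP[h _] : 0 <= z <= 1 by rewrite !ltW.
Qed.

Lemma kap0 (z : R) : 1 <= z -> kap z = 0.
Proof. by move=> z1; rewrite /kap [z < 1]ltNge z1 andbF. Qed.

Lemma measurable_kap : measurable_fun [set: R] kap.
Proof.
have -> : kap = kappa \_ `]0, 1[%classic.
  apply/funext => z; rewrite patchE /kap.
  have -> : (z \in `]0, 1[%classic) = (0 < z < 1).
    by apply/idP/idP; rewrite inE /= in_itv/=.
  by [].
apply/(measurable_restrictT kappa); first exact: measurable_itv.
apply: measurable_funS kappa_meas; first exact: measurable_itv.
by apply: subset_itv; rewrite bnd_simp.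
Qed.

Lemma measurable_kapD : measurable_fun D kap.
Proof. exact: measurable_funTS measurable_kap. Qed.

Lemma integrable_kapM (u : R -> R) (M : R) : 0 <= M -> measurable_fun D u ->
  (forall z : R, 0 < z < 1 -> `|u z| <= M) -> integrablep (fun z => kap z * u z).
Proof.
move=> M0 mu1 uM; apply: (@integrablep_bounded_support _ _ (k2 * M) 1) => //.
- by rewrite mulr_ge0// ltW.
- by apply: measurable_funM => //; exact: measurable_kapD.
- move=> z z0; have [z1|z1] := leP 1 z.
    by rewrite kap0// mul0r normr0 mulr_ge0// ltW.
  rewrite normrM ler_pM// ?uM ?z0//.
  by rewrite ger0_norm ?kap_ge0// kap_le.
- by move=> z z1; rewrite kap0 ?mul0r// ltW.
Qed.

Lemma pairing_lin r : 3 < r ->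
  exists2 K, 0 < K & forall (C : R) h psi, 0 <= C -> in_H r h ->
    measurable_fun D psi -> (forall x : R, 0 < x -> `|psi x| <= C * x) ->
    integrablep (fun x => h x * psi x) /\
    integralp (fun x => `|h x * psi x|) ^+ 2 <= C ^+ 2 * K * sqnorm r h.
Proof.
move=> r3; have [|K K0 hK] := @pairing_pow R r 1 ltr01; first by lra.
exists K => // C h psi C0 hh mpsi hpsi; apply: hK => // x x0.
by rewrite powRr1 ?hpsi// ltW.
Qed.

Lemma kap_mass : integralp (fun z => kap z * z) = 1.
Proof.
have hi : mu.-integrable `[0, 1]%classic (EFin \o (fun z => z * kappa z)).
  apply: measurable_bounded_integrable.
  - exact: measurable_itv.
  - have := @lebesgue_measure_itv R `[0, 1]; rewrite /= => ->.
    by rewrite lte_fin ltr01 -EFinB ltry.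
  - by apply: measurable_funM => //.
  - exists k2; split; first exact: num_real. move=> M k2M z /=; rewrite in_itv/= => /andP[z0 z1].
    have /kappa_bnd/andP[h1 h2] : 0 <= z <= 1 by rewrite z0 z1.
    have kz0 : 0 <= kappa z := le_trans (ltW k1_gt0) h1.
    by rewrite normrM !ger0_norm//; nra.
rewrite -kappa_mass -Rintegral_itv_obnd_cbnd; last first.
  apply: (integrableS _ _ _ hi); [exact: measurable_itv|exact: measurable_itv|].
  by apply: subset_itv; rewrite bnd_simp.
rewrite -Rintegral_itv_bndo_bndc; last first.
  apply: (integrableS _ _ _ hi); [exact: measurable_itv|exact: measurable_itv|].
  by apply: subset_itv; rewrite bnd_simp.
rewrite /integralp [in RHS]Rintegral_mkcond [in LHS]Rintegral_mkcond.
apply: eq_Rintegral => z _; rewrite !patchE /kap.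
have -> : (z \in `]0, 1[%classic) = (0 < z < 1).
  by apply/idP/idP; rewrite inE /= in_itv/=.
have -> : (z \in D) = (0 < z).
  by apply/idP/idP; rewrite inE /= in_itv/= andbT.
by case: (0 < z) => //=; case: (z < 1); rewrite ?mul0r// mulrC.
Qed.

Definition fragment_mean phi (y : R) : R := integralp (fun z => kap z * phi (z * y)).

Lemma fragment_mean_meas phi : (forall x : R, {for x, continuous phi}) ->
  measurable_fun D (fragment_mean phi).
Proof.
move=> cphi; have mphi : measurable_fun [set: R] phi.
  by apply: continuous_measurable_fun => x; exact: cphi.
apply: (@measurable_integralp _ (fun y z => kap z * phi (z * y))).
  apply: measurable_funM; first by apply: (measurableT_comp measurable_kap); exact: measurable_snd.
  apply: (measurableT_comp mphi).
  by apply: measurable_funM; [exact: measurable_snd|exact: measurable_fst].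
move=> y z Dz; rewrite /kap; case: ifP; rewrite ?mul0r// => /andP[z0 _].
by case: Dz; exact: gt0D.
Qed.

(** The adjoint of the fragmentation operator. *)
Definition frag_adj phi (y : R) : R :=
  beta * y `^ gamma * (fragment_mean phi y - phi y).

Lemma measurable_powRD (e : R) : measurable_fun D (fun y : R => y `^ e).
Proof. by apply: measurable_funTS; exact: measurable_powR. Qed.

(** Here gamma <= 2 enters: the kernel vanishes unless x < y, and
    then y^(gamma-2) <= x^(gamma-2), so the gain integral is controlled by the
    first moment. *)
Lemma gain_dominated h (x y : R) : 0 < x -> 0 < y ->
  `|y `^ (gamma - 1) * (kap (x / y) * h y)| <= `|h y * (k2 * x `^ (gamma - 2) * y)|.
Proof.
move=> x0 y0; have /andP[g0 g2] := gamma_bnd.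
have [yx|xy] := leP y x.
  by rewrite kap0 ?mul0r ?mulr0 ?normr0// ler_pdivlMr// mul1r.
have -> : y `^ (gamma - 1) = y `^ (gamma - 2) * y.
  rewrite -[X in _ * X](powRr1 (ltW y0)) -powRD ?(gt_eqF y0) ?implybT//.
  by congr (_ `^ _); ring.
rewrite !normrM (ger0_norm (powR_ge0 _ _)) (ger0_norm (powR_ge0 _ _)).
rewrite (gtr0_norm y0) (gtr0_norm k2_gt0) (ger0_norm (kap_ge0 _)).
have e1 : y `^ (gamma - 2) <= x `^ (gamma - 2).
  rewrite -[gamma - 2]opprK !(powRN _ (- (gamma - 2))) lef_pV2 ?posrE ?powR_gt0//.
  by apply: ge0_ler_powR => //; rewrite ?nnegrE ?(ltW x0) ?(ltW y0)//; lra.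
have -> : y `^ (gamma - 2) * y * (kap (x / y) * `|h y|) =
    (`|h y| * y) * (kap (x / y) * y `^ (gamma - 2)) by ring.
have -> : `|h y| * (k2 * x `^ (gamma - 2) * y) =
    (`|h y| * y) * (k2 * x `^ (gamma - 2)) by ring.
apply: ler_wpM2l; first by rewrite mulr_ge0// ltW.
by apply: ler_pM => //; [exact: kap_ge0|exact: powR_ge0|exact: kap_le].
Qed.

Lemma measurable_gain h (x : R) : 0 < x -> measurable_fun D h ->
  measurable_fun D (fun y => y `^ (gamma - 1) * (kap (x / y) * h y)).
Proof.
move=> x0 mh; apply: measurable_funM; first exact: measurable_powRD.
apply: measurable_funM => //.
apply: (@eq_measp _ (fun y => kap (x * y `^ (-1)))).
  by move=> y y0; rewrite powR_inv1// ltW.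
apply: (measurableT_comp measurable_kap).
by apply: measurable_funM => //; exact: measurable_powRD.
Qed.

Lemma gain_integrable r h (x : R) : 3 < r -> in_H r h -> 0 < x ->
  integrablep (fun y => y `^ (gamma - 1) * (kap (x / y) * h y)).
Proof.
move=> r3 hh x0; have [K K0 hK] := pairing_lin r3.
have [| | |i1 _] := hK (k2 * x `^ (gamma - 2)) h (fun y => k2 * x `^ (gamma - 2) * y) _ hh.
- by rewrite mulr_ge0 ?powR_ge0// ltW.
- by apply: measurable_funM.
- move=> y y0; rewrite ger0_norm//; apply: mulr_ge0; last exact: ltW.
  by apply: mulr_ge0; [exact: ltW|exact: powR_ge0].
apply: (integrablep_le _ (integrablep_norm i1)).
  by apply: measurable_gain => //; exact: in_H_meas hh.
by move=> y y0; exact: gain_dominated.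
Qed.

Lemma fragE h (x : R) : 0 < x -> integrablep (fun y => y `^ (gamma - 1) * (kap (x / y) * h y)) ->
  frag beta gamma kappa h x =
  beta * integralp (fun y => y `^ (gamma - 1) * (kap (x / y) * h y))
  - beta * x `^ gamma * h x.
Proof.
move=> x0 hi; rewrite /frag -(integralpZ beta hi); congr (_ - _).
rewrite /integralp [in LHS]Rintegral_mkcond [in RHS]Rintegral_mkcond.
apply: eq_Rintegral => y _; rewrite !patchE.
have -> : (y \in `]x, +oo[%classic) = (x < y).
  by apply/idP/idP; rewrite inE /= in_itv/= andbT.
have -> : (y \in D) = (0 < y).
  by apply/idP/idP; rewrite inE /= in_itv/= andbT.
have [xy|yx] := ltP x y.
  have y0 : 0 < y by apply: lt_trans xy.
  rewrite y0 /kap ltr_pdivrMr// mul1r xy divr_gt0//=; ring.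
by case: ltP => // y0; rewrite kap0 ?mul0r ?mulr0// ler_pdivlMr// mul1r.
Qed.

Section with_test.
Variables (r : R) (hr : 3 < r).
Variables (phi : R -> R) (a b M : R).
Hypothesis tb : test_bounds phi a b M.

Lemma test_lin : exists2 C, 0 <= C & forall x : R, 0 < x ->
  `|phi x| <= C * x /\ `|x * derive1 phi x| <= C * x.
Proof.
have a0 := tb_a tb; have M0 := tb_M tb; have ab := tb_ab tb.
exists (M / a + M); first by rewrite addr_ge0// divr_ge0// ltW.
move=> x x0; have Ma : 0 <= M / a by rewrite divr_ge0// ltW.
split; last first.
  rewrite normrM gtr0_norm// mulrC ler_pM2r//.
  by rewrite (le_trans (tb_dbound tb x))// lerDr.
have [xa|ax] := ltP x a.
  rewrite (tb_supp tb); last by rewrite negb_and -ltNge xa.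
  by rewrite normr0; apply: mulr_ge0; [exact: addr_ge0|exact: ltW].
rewrite (le_trans (tb_bound tb x))// mulrDl.
have : M <= M / a * x by rewrite mulrAC ler_pdivlMr// ler_wpM2l.
by have : 0 <= M * x by [rewrite mulr_ge0// ltW]; lra.
Qed.

Lemma measurable_phi : measurable_fun D phi.
Proof. exact: cont_meas (tb_cont tb). Qed.

Lemma measurable_xdphi : measurable_fun D (fun x => x * derive1 phi x).
Proof. by apply: measurable_funM => //; exact: cont_meas (tb_dcont tb). Qed.

Lemma phi_integrable : integrablep phi.
Proof.
apply: (@integrablep_bounded_support _ _ M b) => //.
- exact: tb_M tb.
- by have := tb_a tb; have := tb_ab tb; lra.
- exact: measurable_phi.
- by move=> x _; exact: tb_bound tb x.
- by move=> x bx; rewrite (tb_supp tb)// negb_and -!ltNge bx orbT.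
Qed.

Lemma kap_phi_integrable (y : R) : 0 < y ->
  integrablep (fun z => kap z * phi (z * y)).
Proof.
move=> y0; apply: (@integrable_kapM (fun z => phi (z * y)) M).
- exact: tb_M tb.
- have := meas_scale y0 measurable_phi.
  by apply: eq_measp => z _; rewrite mulrC.
- by move=> z _; exact: tb_bound tb _.
Qed.

(** The mean over fragments decays like 1/y: only fragments landing in the
    support of the test function count. *)
Lemma fragment_mean_norm (y : R) : 0 < y ->
  integralp (fun z => `|kap z * phi (z * y)|) <= k2 * integralp (fun x => `|phi x|) / y.
Proof.
move=> y0; have [i1 e1] := integralp_scale y0 (integrablep_norm phi_integrable).
rewrite mulrAC -mulrA -e1 -(integralpZ _ i1).
apply: le_integralp.
- exact: integrablep_norm (kap_phi_integrable y0).
- exact: integrablepZ.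
- move=> z z0; rewrite normrM mulrC [z * y]mulrC mulrC; apply: ler_wpM2r => //.
  by rewrite ger0_norm ?kap_ge0// kap_le.
Qed.

Lemma fragment_mean_small (y : R) : 0 < y -> y < a ->
  forall z : R, 0 < z -> kap z * phi (z * y) = 0.
Proof.
move=> y0 ya z z0; have [z1|z1] := leP 1 z; first by rewrite kap0// mul0r.
rewrite (tb_supp tb) ?mulr0// negb_and -ltNge; apply/orP; left.
by apply: lt_trans ya; rewrite gtr_pMl.
Qed.

(** Off the support of the test function only the gain is present, and it
    grows like y^gamma / y, which is at most linear again because gamma <= 2;
    so the adjoint of a test function pairs with every density of the space. *)
Lemma frag_adj_dom : exists2 C, 0 <= C & forall y : R, 0 < y ->
  [/\ y `^ gamma * integralp (fun z => `|kap z * phi (z * y)|) <= C * y,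
  `|frag_adj phi y| <= C * y & `|y `^ gamma * phi y| <= C * y].
Proof.
have a0 := tb_a tb; have M0 := tb_M tb; have ab := tb_ab tb.
have /andP[g0 g2] := gamma_bnd.
pose I := integralp (fun x => `|phi x|).
have I0 : 0 <= I by exact: integralp_ge0.
pose C1 := a `^ (gamma - 2) * (k2 * I).
pose C2 := b `^ gamma * (M / a).
have C10 : 0 <= C1 by rewrite mulr_ge0 ?powR_ge0// mulr_ge0// ltW.
have C20 : 0 <= C2 by rewrite mulr_ge0 ?powR_ge0// divr_ge0// ltW.
exists (C1 + beta * (C1 + C2) + C2).
  by rewrite !addr_ge0// mulr_ge0 ?addr_ge0// ltW.
move=> y y0; have yg : 0 <= y `^ gamma by exact: powR_ge0.
have key : y `^ gamma * integralp (fun z => `|kap z * phi (z * y)|) <= C1 * y.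
  have [ya|ay] := ltP y a.
    rewrite (@eq_integralp _ _ (fun=> 0)) ?[integralp _]Rintegral_cst ?mD//.
      by rewrite mul0r mulr0 mulr_ge0// ltW.
    by move=> z z0; rewrite fragment_mean_small ?normr0.
  apply: (@le_trans _ _ (y `^ gamma * (k2 * I / y))).
    by rewrite ler_wpM2l// fragment_mean_norm.
  have -> : y `^ gamma = y `^ (gamma - 2) * (y * y).
    rewrite -[X in _ * (X * _)](powRr1 (ltW y0)) -[X in _ * (_ * X)](powRr1 (ltW y0)).
    by rewrite -!powRD ?(gt_eqF y0) ?implybT//; congr (_ `^ _); ring.
  have -> : y `^ (gamma - 2) * (y * y) * (k2 * I / y) =
      (y `^ (gamma - 2) * (k2 * I)) * y by field; rewrite gt_eqF.
  rewrite ler_pM2r// ler_wpM2r ?mulr_ge0 ?(ltW k2_gt0)//.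
  rewrite -[gamma - 2]opprK !(powRN _ (- (gamma - 2))) lef_pV2 ?posrE ?powR_gt0//.
  by apply: ge0_ler_powR => //; rewrite ?nnegrE ?(ltW a0) ?(ltW y0)//; lra.
have key2 : y `^ gamma * `|phi y| <= C2 * y.
  have [yab|yab] := boolP (a <= y <= b); last first.
    by rewrite (tb_supp tb)// normr0 mulr0 mulr_ge0// ltW.
  have /andP[ay yb] := yab.
  rewrite /C2 -mulrA; apply: ler_pM => //.
    by apply: ge0_ler_powR; rewrite ?nnegrE ?(ltW y0) ?(ltW g0)//; lra.
  rewrite (le_trans (tb_bound tb y))// mulrAC ler_pdivlMr// ler_wpM2l//.
have bC : 0 <= beta * (C1 + C2) * y by rewrite !mulr_ge0 ?addr_ge0// ltW.
have C1y : 0 <= C1 * y by rewrite mulr_ge0// ltW.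
have C2y : 0 <= C2 * y by rewrite mulr_ge0// ltW.
split; first by rewrite !mulrDl; lra.
  2: by rewrite normrM (ger0_norm yg) !mulrDl; lra.
rewrite /frag_adj normrM ger0_norm ?mulr_ge0// ?(ltW beta_gt0)//.
have h1 : `|fragment_mean phi y| <= integralp (fun z => `|kap z * phi (z * y)|).
  exact: norm_integralp (kap_phi_integrable y0).
have h2 := ler_normB (fragment_mean phi y) (phi y).
apply: (@le_trans _ _ (beta * (C1 * y + C2 * y))); last by move: bC C1y C2y; lra.
rewrite -mulrA ler_pM2l//.
apply: (@le_trans _ _ (y `^ gamma * (integralp (fun z => `|kap z * phi (z * y)|) + `|phi y|))).
  by rewrite ler_wpM2l//; lra.
by rewrite mulrDr lerD.
Qed.

Lemma measurable_frag_adj : measurable_fun D (frag_adj phi).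
Proof.
apply: measurable_funM; first by apply: measurable_funM => //; exact: measurable_powRD.
apply: measurable_funB; last exact: measurable_phi.
exact: fragment_mean_meas (tb_cont tb).
Qed.

Let joint h (x y : R) : R :=
  phi x * (y `^ (gamma - 1) * (kap (x * y `^ (-1)) * (h \_ D) y)).

Lemma measurable_joint h : measurable_fun D h ->
  measurable_fun [set: (measurableTypeR R) * (measurableTypeR R)]
    (fun p => joint h p.1 p.2).
Proof.
move=> mh; have mphi : measurable_fun [set: R] phi.
  by apply: continuous_measurable_fun => x; exact: tb_cont tb x.
have mh0 : measurable_fun [set: R] (h \_ D) by apply/(measurable_restrictT h).
have m2 (e : R) : measurable_fun [set: (measurableTypeR R) * (measurableTypeR R)]
    (fun p => p.2 `^ e).
  by apply: (measurableT_comp (measurable_powR e)); exact: measurable_snd.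
apply: measurable_funM; first by apply: (measurableT_comp mphi); exact: measurable_fst.
apply: measurable_funM; first exact: m2.
apply: measurable_funM; last by apply: (measurableT_comp mh0); exact: measurable_snd.
apply: (measurableT_comp measurable_kap).
by apply: measurable_funM; [exact: measurable_fst|exact: m2].
Qed.

(** Fubini: the bound on the adjoint, applied to absolute values, is the
    integrability that it requires. *)
Lemma frag_pairing h : in_H r h ->
  integrablep (fun x => frag beta gamma kappa h x * phi x) /\
  integralp (fun x => frag beta gamma kappa h x * phi x) =
  integralp (fun y => h y * frag_adj phi y).
Proof.
move=> hh; have mh := in_H_meas hh.
have [K K0 hK] := pairing_lin hr.
have [C C0 hC] := frag_adj_dom.
have h0 (y : R) : 0 < y -> (h \_ D) y = h y.
  by move=> /gt0D y0; rewrite patchE mem_set.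
have [| |iB _] := hK C h (fun y => C * y) C0 hh.
- by apply: measurable_funM.
- by move=> y y0; rewrite ger0_norm// mulr_ge0// ltW.
have inner (y : R) : 0 < y -> [/\ integrablep (fun x => kap (x / y) * phi x),
    integralp (fun x => kap (x / y) * phi x) = y * fragment_mean phi y &
    integralp (fun x => `|kap (x / y) * phi x|) =
      y * integralp (fun z => `|kap z * phi (z * y)|)].
  move=> y0; have yi0 : 0 < y^-1 by rewrite invr_gt0.
  have E (x : R) : 0 < x -> kap (y^-1 * x) * phi (y^-1 * x * y) = kap (x / y) * phi x.
    by move=> x0; rewrite [y^-1 * x]mulrC divfK// gt_eqF.
  have [i1 e1] := integralp_scale yi0 (kap_phi_integrable y0).
  have [i2 e2] := integralp_scale yi0 (integrablep_norm (kap_phi_integrable y0)).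
  split.
  - exact: eq_integrablep E i1.
  - by rewrite -(eq_integralp E) e1 invrK.
  - rewrite invrK in e2; rewrite -e2; apply: eq_integralp => x x0.
    by rewrite (E x x0).
have JE (y : R) : 0 < y -> forall x : R, 0 < x ->
    joint h x y = (y `^ (gamma - 1) * h y) * (kap (x / y) * phi x).
  by move=> y0 x x0; rewrite /joint h0// powR_inv1 ?(ltW y0)//; ring.
have yg (y : R) : 0 < y -> y `^ (gamma - 1) * y = y `^ gamma.
  move=> y0; rewrite -[X in _ * X](powRr1 (ltW y0)) -powRD ?(gt_eqF y0) ?implybT//.
  by rewrite subrK.
have JI (y : R) : 0 < y -> integrablep ((joint h)^~ y) /\
    integralp (fun x => `|joint h x y|) <= `|h y * (C * y)|.
  move=> y0; have [i1 e1 e2] := inner y y0.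
  have JE' (x : R) : 0 < x -> (y `^ (gamma - 1) * h y) * (kap (x / y) * phi x) = joint h x y.
    by move=> x0; rewrite JE.
  split; first by apply: (eq_integrablep JE'); exact: integrablepZ.
  have -> : integralp (fun x => `|joint h x y|) =
      integralp (fun x => `|y `^ (gamma - 1) * h y| * `|kap (x / y) * phi x|).
    by apply: eq_integralp => x x0; rewrite JE// normrM.
  rewrite (integralpZ _ (integrablep_norm i1)) e2.
  have [h1 _ _] := hC y y0.
  rewrite normrM ger0_norm ?powR_ge0// [`|h y * _|]normrM [`|C * y|]ger0_norm; last first.
    by rewrite mulr_ge0// ltW.
  have -> : y `^ (gamma - 1) * `|h y| * (y * integralp (fun z => `|kap z * phi (z * y)|)) =
      `|h y| * (y `^ (gamma - 1) * y * integralp (fun z => `|kap z * phi (z * y)|)).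
    by ring.
  by rewrite yg// ler_wpM2l.
have [||F1 F2] := fubini_halfline (measurable_joint mh) _ _ (integrablep_norm iB) JI.
- move=> x y Dx; rewrite /joint (tb_supp tb) ?mul0r//.
  rewrite negb_and -ltNge; apply/orP; left.
  have := tb_a tb; apply: le_lt_trans; rewrite leNgt; apply/negP => x0.
  by apply: Dx; exact: gt0D.
- by move=> x y Dy; rewrite /joint patchE memNset// !mulr0.
have [| |iL _] := hK C h (fun y => y `^ gamma * phi y) C0 hh.
- by apply: measurable_funM; [exact: measurable_powRD|exact: measurable_phi].
- by move=> y y0; have [] := hC y y0.
have gainE (x : R) : 0 < x -> integralp (joint h x) =
    phi x * integralp (fun y => y `^ (gamma - 1) * (kap (x / y) * h y)).
  move=> x0; rewrite -(integralpZ _ (gain_integrable hr hh x0)).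
  by apply: eq_integralp => y y0; rewrite /joint (h0 y y0) (powR_inv1 (ltW y0)).
have [| |iA _] := hK C h (frag_adj phi) C0 hh.
- exact: measurable_frag_adj.
- by move=> y y0; have [] := hC y y0.
have FE (x : R) : 0 < x -> beta * integralp (joint h x) - beta * (h x * (x `^ gamma * phi x)) =
    frag beta gamma kappa h x * phi x.
  move=> x0; rewrite (gainE x x0) (fragE x0 (gain_integrable hr hh x0)).
  by clear; ring.
split; first by apply: (eq_integrablep FE); apply: integrablepB; exact: integrablepZ.
rewrite -(eq_integralp FE) integralpB; [|exact: integrablepZ..].
rewrite (integralpZ _ F1) F2 (integralpZ _ iL).
have GE (y : R) : 0 < y -> beta^-1 * (h y * frag_adj phi y) + h y * (y `^ gamma * phi y) =
    integralp ((joint h)^~ y).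
  move=> y0; have [i1 e1 _] := inner y y0.
  rewrite (eq_integralp (JE y y0)) (integralpZ _ i1) e1 /frag_adj -(yg y y0).
  by field; rewrite gt_eqF.
rewrite -(eq_integralp GE) (integralpD (integrablepZ _ iA) iL) (integralpZ _ iA).
by field; rewrite gt_eqF.
Qed.

End with_test.
End fragmentation.

Arguments kap {R} kappa z.
Arguments fragment_mean {R} kappa phi y.
Arguments frag_adj {R} beta gamma kappa phi y.

(** * Curves in the weighted space and the weak formulation *)

Section continuous_primitives.
Context {R : realType}.
Local Notation mu := (@lebesgue_measure R).
Implicit Types (c P K : R -> R).

Lemma cont_integrable c (a b : R) : (forall t : R, {for t, continuous c}) ->
  mu.-integrable `[a, b]%classic (EFin \o c).
Proof.
move=> cc; apply: continuous_compact_integrable; first exact: segment_compact.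
by apply: continuous_subspaceT => x; exact: cc.
Qed.

Lemma ftc_cont c P (a b : R) : a <= b -> (forall t : R, {for t, continuous c}) ->
  (forall t : R, a < t < b -> is_derive t 1 P (c t)) ->
  (forall t : R, a <= t <= b -> {for t, continuous P}) ->
  \int[mu]_(s in `[a, b]) c s = P b - P a.
Proof.
rewrite le_eqVlt => /predU1P[<-|ab] cc dP cP.
  by rewrite set_itv1 Rintegral_set1 subrr.
rewrite /Rintegral (@continuous_FTC2 _ c P)//.
- by apply: continuous_subspaceT => x; exact: cc.
- split.
  + move=> x; rewrite in_itv/= => xab.
    by have [] := dP x xab.
  + by apply: cvg_at_right_filter; apply: cP; rewrite lexx ltW.
  + by apply: cvg_at_left_filter; apply: cP; rewrite lexx ltW.
- move=> x; rewrite in_itv/= => xab; rewrite derive1E.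
  by have [_ ->] := dP x xab.
Qed.

(** A primitive that is two-sidedly differentiable at 0 as well. *)
Lemma primitive c : (forall t : R, {for t, continuous c}) ->
  exists P, [/\ P 0 = 0, forall t : R, -1 < t -> is_derive t 1 P (c t) &
    forall t : R, 0 <= t -> \int[mu]_(s in `[0, t]) c s = P t].
Proof.
move=> cc; pose Q t := \int[mu]_(s in `[-1, t]) c s.
have dQ (t : R) : -1 < t -> is_derive t 1 Q (c t).
  move=> t1; have tt : t < t + 1 by rewrite ltrDl.
  have [dt et] := continuous_FTC1_closed tt (@cont_integrable c (-1) (t + 1) cc) t1 (cc t).
  by split; [exact: dt|rewrite -derive1E; exact: et].
exists (fun t => Q t - Q 0); have d (t : R) : -1 < t -> is_derive t 1 (fun t => Q t - Q 0) (c t).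
  move=> t1; have h := derB (dQ t t1) (derC (Q 0) t).
  by apply: (derE h); rewrite subr0.
split => //; first by rewrite subrr.
move=> t t0; apply: (ftc_cont t0 cc).
- by move=> s /andP[s0 _]; apply: dQ; lra.
- move=> s /andP[s0 _]; have s1 : -1 < s by lra.
  exact: is_derive_cont (dQ s s1).
Qed.

(** Clamping times to the half-line turns one-sided continuity into two-sided
    continuity. *)
Definition clamp (t : R) : R := Num.max t 0.

Lemma clamp_ge0 t : 0 <= clamp t.
Proof. by rewrite le_max lexx orbT. Qed.

Lemma clampE t : 0 <= t -> clamp t = t.
Proof. by move=> /max_idPl. Qed.

Lemma clamp_dist s t : `|clamp s - clamp t| <= `|s - t|.
Proof.
rewrite /clamp; case: (leP s 0) => hs; case: (leP t 0) => ht.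
- by rewrite subrr normr0.
- rewrite distrC [leRHS]distrC subr0 ger0_norm ?(ltW ht)//.
  by rewrite ger0_norm; lra.
- by rewrite subr0 ger0_norm ?(ltW hs)// ger0_norm; lra.
- by [].
Qed.

End continuous_primitives.

Section curves.
Context {R : realType}.
Implicit Types (r : R) (u : R -> R -> R) (psi h : R -> R) (g : R -> R).
Local Notation D := (`]0, +oo[%classic : set R).

Definition pair h psi : R := integralp (fun x => h x * psi x).

Definition sublinear psi : Prop :=
  measurable_fun D psi /\ exists2 C, 0 <= C & forall x : R, 0 < x -> `|psi x| <= C * x.

Lemma pair_int r h psi : 3 < r -> in_H r h -> sublinear psi ->
  integrablep (fun x => h x * psi x).
Proof.
move=> r3 hh [mpsi [C C0 hC]]; have [K K0 hK] := pairing_lin r3.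
by have [] := hK C h psi C0 hh mpsi hC.
Qed.

(** Pairings with functions of at most linear growth are continuous on the
    space; this covers test functions, their images under the adjoint and the
    mass. *)
Lemma pair_bound r psi : 3 < r -> sublinear psi ->
  exists2 K, 0 <= K & forall h, in_H r h -> pair h psi ^+ 2 <= K * sqnorm r h.
Proof.
move=> r3 [mpsi [C C0 hC]]; have [K K0 hK] := pairing_lin r3.
exists (C ^+ 2 * K); first by rewrite mulr_ge0 ?sqr_ge0// ltW.
move=> h hh; have [i1 i2] := hK C h psi C0 hh mpsi hC.
apply: le_trans i2; rewrite -(real_normK (num_real _)) lerXn2r ?nnegrE//.
  exact: integralp_ge0.
exact: norm_integralp.
Qed.

Lemma pairBl r h1 h2 psi : 3 < r -> in_H r h1 -> in_H r h2 -> sublinear psi ->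
  pair (fun x => h1 x - h2 x) psi = pair h1 psi - pair h2 psi.
Proof.
move=> r3 i1 i2 spsi; have j1 := pair_int r3 i1 spsi; have j2 := pair_int r3 i2 spsi.
by rewrite /pair -(integralpB j1 j2); apply: eq_integralp => x _; rewrite mulrBl.
Qed.

Lemma pairZl r c h psi : 3 < r -> in_H r h -> sublinear psi ->
  pair (fun x => c * h x) psi = c * pair h psi.
Proof.
move=> r3 i1 spsi; have j1 := pair_int r3 i1 spsi.
by rewrite /pair -(integralpZ c j1); apply: eq_integralp => x _; rewrite mulrA.
Qed.

Lemma pairZr r c h psi : 3 < r -> in_H r h -> sublinear psi ->
  pair h (fun x => c * psi x) = c * pair h psi.
Proof.
move=> r3 i1 s1; have j1 := pair_int r3 i1 s1.
by rewrite /pair -(integralpZ c j1); apply: eq_integralp => x _; rewrite mulrCA.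
Qed.

Lemma eq_pair h1 h2 psi1 psi2 : (forall x : R, 0 < x -> h1 x = h2 x) ->
  (forall x : R, 0 < x -> psi1 x = psi2 x) -> pair h1 psi1 = pair h2 psi2.
Proof. by move=> e1 e2; apply: eq_integralp => x x0; rewrite e1// e2. Qed.

(** Curves that are continuous in norm on [0, oo). *)
Definition Hcurve r u : Prop :=
  (forall t : R, 0 <= t -> in_H r (u t)) /\
  forall t0, 0 <= t0 -> forall e, 0 < e -> exists2 d, 0 < d &
    forall t : R, 0 <= t -> `|t - t0| < d -> sqnorm r (fun x => u t x - u t0 x) <= e.

Lemma HcurveP r u : (forall t : R, 0 <= t -> in_H r (u t)) ->
  (forall t0, 0 <= t0 ->
    H_norm r (u t \- u t0) @[t --> within `[0, +oo[ (nbhs t0)] --> (0 : R)) <->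
  Hcurve r u.
Proof.
move=> uH; split.
- move=> cu; split => // t0 t00 e e0.
  have se : 0 < Num.sqrt e by rewrite sqrtr_gt0.
  have /cvgrPdist_le /(_ _ se) := cu t0 t00.
  rewrite near_withinE => /nbhs_ballP[d /= d0 hd]; exists d => // t tge tt0.
  have := hd t; rewrite /ball/= distrC => /(_ tt0); rewrite in_itv/= andbT => /(_ tge).
  rewrite sub0r normrN ger0_norm ?H_norm_ge0// => h.
  rewrite -[sqnorm _ _](sqr_H_norm r (u t \- u t0)) -[leRHS]sqr_sqrtr ?(ltW e0)//.
  by rewrite lerXn2r ?nnegrE ?H_norm_ge0// ltW.
- move=> [_ cu] t0 t00; apply/cvgrPdist_le => e e0.
  have e20 : 0 < e ^+ 2 by rewrite exprn_gt0.
  have [d d0 hd] := cu t0 t00 _ e20.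
  rewrite near_withinE; apply/nbhs_ballP; exists d => //= t.
  rewrite /ball/= distrC => tt0; rewrite in_itv/= andbT => tge.
  rewrite sub0r normrN ger0_norm ?H_norm_ge0//.
  rewrite -(@ler_pXn2r _ 2) ?nnegrE ?H_norm_ge0 ?(ltW e0)// sqr_H_norm.
  exact: hd.
Qed.

Lemma pair_curve_cont r u psi : 3 < r -> Hcurve r u -> sublinear psi ->
  forall t, {for t, continuous (fun s => pair (u (clamp s)) psi)}.
Proof.
move=> r3 [uH cu] spsi t; have [K K0 hK] := pair_bound r3 spsi.
apply/contP => e e0.
have e1 : 0 < e ^+ 2 / (K + 1) by rewrite divr_gt0 ?exprn_gt0// ltr_wpDl.
have [d d0 hd] := cu (clamp t) (clamp_ge0 t) _ e1; exists d => // s st.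
have hs := uH _ (clamp_ge0 s); have ht := uH _ (clamp_ge0 t).
rewrite -(pairBl r3 hs ht spsi).
have [dH _] := in_HB hs ht.
have := hd _ (clamp_ge0 s) (le_lt_trans (clamp_dist s t) st).
rewrite ler_pdivlMr; last by rewrite ltr_wpDl.
have := hK _ dH; have := sqnorm_ge0 r (fun x => u (clamp s) x - u (clamp t) x).
set q := pair _ _ => n0 h1 h2.
rewrite -(@ler_pXn2r _ 2) ?nnegrE ?(ltW e0)// real_normK ?num_real//.
by nra.
Qed.

(** Norm of a curve is locally bounded. *)
Lemma Hcurve_bounded r u t0 : Hcurve r u -> 0 <= t0 ->
  exists2 d, 0 < d & forall t : R, 0 <= t -> `|t - t0| < d ->
    sqnorm r (u t) <= 2 + 2 * sqnorm r (u t0).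
Proof.
move=> [uH cu] t00; have [d d0 hd] := cu t0 t00 1 ltr01; exists d => // t tge tt0.
have [dH _] := in_HB (uH t tge) (uH t0 t00).
have [_ h2] := in_HD dH (uH t0 t00).
have E (x : R) : 0 < x -> u t x - u t0 x + u t0 x = u t x by move=> _; rewrite subrK.
by rewrite (eq_sqnorm r E) in h2; have := hd t tge tt0; lra.
Qed.

End curves.

Section weak_form.
Context {R : realType} {beta gamma : R} {kappa : R -> R} {k1 k2 : R}.
Hypothesis fk : frag_kernel beta gamma kappa k1 k2.
Variables (mu r : R) (r3 : 3 < r).
Implicit Types (u : R -> R -> R) (phi g : R -> R).
Local Notation adj := (frag_adj beta gamma kappa).

Lemma test_sublinear phi : test_function phi ->
  [/\ sublinear phi, sublinear (fun x => x * derive1 phi x) & sublinear (adj phi)].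
Proof.
move=> /test_functionP[a [b [M tb]]].
have [C C0 hC] := test_lin tb; have [C' C'0 hC'] := frag_adj_dom fk tb.
split; split.
- exact: measurable_phi tb.
- by exists C => // x /hC[].
- exact: measurable_xdphi tb.
- by exists C => // x /hC[].
- exact: measurable_frag_adj fk _ _ _ _ tb.
- by exists C' => // x /hC'[].
Qed.

Definition weak_rhs (c : R) phi h : R :=
  c * pair h (fun x => x * derive1 phi x) - mu * pair h phi + pair h (adj phi).

Lemma weak_rhsE c phi h : in_H r h -> test_function phi ->
  c * \int[@lebesgue_measure R]_(x in `]0, +oo[) (x * h x * derive1 phi x)
  - mu * \int[@lebesgue_measure R]_(x in `]0, +oo[) (h x * phi x)
  + \int[@lebesgue_measure R]_(x in `]0, +oo[) (frag beta gamma kappa h x * phi x) =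
  weak_rhs c phi h.
Proof.
move=> hh /test_functionP[a [b [M tb]]]; rewrite /weak_rhs.
have [_ e] := frag_pairing fk r3 tb hh.
congr (_ * _ - _ + _); last exact: e.
by apply: eq_integralp => x _; ring.
Qed.

Lemma weak_rhs_cont u g phi : Hcurve r u ->
  (forall t : R, {for t, continuous (fun s => g (clamp s))}) -> test_function phi ->
  forall t, {for t, continuous (fun s => weak_rhs (g (clamp s)) phi (u (clamp s)))}.
Proof.
move=> cu cg tphi t; have [s1 s2 s3] := test_sublinear tphi.
apply: continuousD; last exact: pair_curve_cont r3 cu s3 t.
apply: continuousB.
  by apply: continuousM; [exact: cg|exact: pair_curve_cont r3 cu s2 t].
by apply: continuousM; [exact: cst_continuous|exact: pair_curve_cont r3 cu s1 t].
Qed.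

(** The next two lemmas replace the weak formulation, integrated in time, by
    the derivatives of the pairings with test functions: the right-hand side is
    continuous in time, so the integral can be differentiated and conversely.
    Changes of variables are done on derivatives. *)
Lemma weak_derivative u g phi : Hcurve r u ->
  (forall t : R, {for t, continuous (fun s => g (clamp s))}) ->
  growth_frag_solution beta gamma kappa mu r g u -> test_function phi ->
  forall t : R, 0 < t -> is_derive t 1 (fun s => pair (u (clamp s)) phi)
    (weak_rhs (g t) phi (u t)).
Proof.
move=> cu cg [uH _ _ wf] tphi t t0.
have cR := weak_rhs_cont cu cg tphi; have [P [P0 dP IP]] := primitive cR.
have E s : 0 <= s -> pair (u s) phi = pair (u 0) phi + P s.
  move=> s0; apply: (etrans (wf phi tphi s s0)).
  apply: (etrans _ (congr1 (+%R (pair (u 0) phi)) (IP s s0))); apply: (congr1 (+%R _)).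
  apply: eq_Rintegral => x; rewrite inE/= in_itv/= => /andP[x0 xs].
  rewrite clampE//; apply: weak_rhsE => //.
  by have [] := uH x x0.
have t1 : -1 < t by lra.
have := derD (derC (pair (u 0) phi) t) (dP t t1).
rewrite add0r clampE ?(ltW t0)// => h.
have nt : \forall s \near t, 0 < s by exact: lt_nbhsr.
apply: (der_near _ h); apply: filterS nt => s s0.
by rewrite -(E s (ltW s0)) clampE ?(ltW s0).
Qed.

Lemma solution_of_derivative u g : (forall t : R, 0 <= t -> in_Hplus r (u t)) ->
  Hcurve r u -> (forall t : R, 0 <= t -> u t 0 = 0) ->
  (forall t : R, {for t, continuous (fun s => g (clamp s))}) ->
  (forall phi, test_function phi -> forall t : R, 0 < t ->
    is_derive t 1 (fun s => pair (u (clamp s)) phi) (weak_rhs (g t) phi (u t))) ->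
  growth_frag_solution beta gamma kappa mu r g u.
Proof.
move=> uH cu u0 cg du; split => //.
  by apply/HcurveP => // t t0; have [] := uH t t0.
move=> phi tphi t t0; have [s1 s2 s3] := test_sublinear tphi.
have cK := pair_curve_cont r3 cu s1.
have cR := weak_rhs_cont cu cg tphi.
have h := @ftc_cont _ _ (fun s => pair (u (clamp s)) phi) 0 t t0 cR.
have {}h := h _ (fun s _ => cK s).
rewrite -[LHS]/(pair (u t) phi) -[X in _ = X + _]/(pair (u 0) phi).
have e : \int[@lebesgue_measure R]_(s in `[0, t])
    weak_rhs (g (clamp s)) phi (u (clamp s)) = pair (u t) phi - pair (u 0) phi.
  have dh (s : R) : 0 < s < t -> is_derive s 1 (fun s => pair (u (clamp s)) phi)
      (weak_rhs (g (clamp s)) phi (u (clamp s))).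
    by move=> /andP[s0 _]; rewrite (clampE (ltW s0)); exact: du.
  by have := h dh; rewrite (clampE t0) (clampE (lexx 0)).
apply: (etrans (esym (subrKC (pair (u 0) phi) (pair (u t) phi)))).
apply: (etrans (congr1 (+%R (pair (u 0) phi)) (esym e))); apply: (congr1 (+%R _)).
apply: eq_Rintegral => x; rewrite inE/= in_itv/= => /andP[x0 xs].
rewrite clampE//; apply/esym; apply: weak_rhsE => //.
by have [] := uH x x0.
Qed.

End weak_form.

Arguments weak_rhs {R} beta gamma kappa mu c phi h.

(** * Test functions moved by a dilation *)

Section uniform_continuity.
Context {R : realType}.
Implicit Types f c : R -> R.

Lemma unif_cont_segment f (a b e : R) : 0 < e ->
  (forall x : R, a <= x <= b -> {for x, continuous f}) ->
  exists2 d, 0 < d & forall x y : R, a <= x <= b -> `|y - x| < d -> `|f y - f x| <= e.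
Proof.
move=> e0 cf; have /compact_near_coveringP cov := @segment_compact R a b.
pose P (d x : R) := forall y : R, `|y - x| < d -> `|f y - f x| <= e.
have H (x : R) : `[a, b]%classic x -> \forall x' \near x & d \near 0^'+, P d x'.
  rewrite /= in_itv/= => xab; have e20 : 0 < e / 2 by rewrite divr_gt0.
  have [d d0 hd] := (contP f x).1 (cf x xab) _ e20.
  have d20 : 0 < d / 2 by rewrite divr_gt0.
  exists (ball x (d / 2), [set z | z < d / 2]).
    by split; [exact: nbhsx_ballx|exact: nbhs_right_lt].
  move=> [x' z] [/=]; rewrite /ball/= => xx' zd y yx'.
  have h1 : `|y - x| < d.
    have -> : y - x = (y - x') - (x - x') by ring.
    by rewrite (le_lt_trans (ler_normB _ _))//; lra.
  have h2 : `|x' - x| < d by rewrite distrC; lra.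
  have -> : f y - f x' = (f y - f x) - (f x' - f x) by ring.
  rewrite (le_trans (ler_normB _ _))//.
  by have := hd _ h1; have := hd _ h2; lra.
have cov' := cov _ _ _ _ H.
near (0 : R)^'+ => d; exists d; first by near: d; exact: nbhs_right_gt.
have hd : `[a, b]%classic `<=` P d by near: d; exact: cov'.
by move=> x y xab; apply: hd => /=; rewrite in_itv.
Unshelve. all: by end_near. Qed.

Lemma der_ext f c (x a : R) : (forall y, f y = c y) ->
  is_derive x 1 f a -> is_derive x 1 c a.
Proof. by move=> /funext ->. Qed.

Lemma der_small f (x : R) : f x = 0 ->
  (forall e : R, 0 < e -> exists2 d, 0 < d & forall y : R, `|y - x| < d ->
    `|f y| <= e * `|y - x|) -> is_derive x 1 f 0.
Proof.
move=> fx H; apply/derP => e e0; have [d d0 hd] := H e e0; exists d => // y yx.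
by rewrite fx mul0r !subr0; exact: hd.
Qed.

Lemma der_mul_zero f c (x a : R) : f x = 0 -> is_derive x 1 f a ->
  {for x, continuous c} -> is_derive x 1 (fun y => f y * c y) (a * c x).
Proof.
move=> fx df cc; have h1 := derM df (derC (c x) x).
rewrite mulr0 addr0 in h1.
have h2 : is_derive x 1 (fun y => f y * (c y - c x)) 0.
  apply: der_small; first by rewrite fx mul0r.
  move=> e e0; have [d1 d10 h1'] := (derP f x a).1 df 1 ltr01.
  have ea : 0 < e / (`|a| + 1) by rewrite divr_gt0// ltr_wpDl.
  have [d2 d20 h2'] := (contP c x).1 cc _ ea.
  exists (Num.min d1 d2); first by rewrite lt_min d10.
  move=> y; rewrite lt_min => /andP[y1 y2].
  have := h1' y y1; rewrite fx subr0 mul1r => h3; have := h2' y y2 => h4.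
  have h5 : `|f y| <= (`|a| + 1) * `|y - x|.
    have -> : f y = (f y - a * (y - x)) + a * (y - x) by rewrite subrK.
    by rewrite (le_trans (ler_normD _ _))// normrM mulrDl mul1r addrC lerD2l.
  have a0 : 0 < `|a| + 1 by rewrite ltr_wpDl.
  rewrite normrM; rewrite ler_pdivlMr// in h4.
  have := normr_ge0 (c y - c x); have := normr_ge0 (y - x); have := normr_ge0 (f y).
  move=> n1 n2 n3.
  apply: (@le_trans _ _ (((`|a| + 1) * `|y - x|) * `|c y - c x|)).
    by rewrite ler_wpM2r.
  by nra.
have h3 := derD h1 h2; rewrite addr0 in h3.
by apply: (der_ext _ h3) => y; ring.
Qed.

End uniform_continuity.

Section moving_tests.
Context {R : realType}.
Implicit Types (r : R) (u : R -> R -> R) (phi psi h c : R -> R).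
Local Notation D := (`]0, +oo[%classic : set R).

Lemma test_function_scale phi (c : R) : 0 < c -> test_function phi ->
  test_function (fun x => phi (c * x)) /\
  forall x, derive1 (fun x => phi (c * x)) x = c * derive1 phi (c * x).
Proof.
move=> c0 tphi; have [a [b [M tb]]] := test_functionP tphi.
have d (x : R) : is_derive x 1 (fun x => phi (c * x)) (c * derive1 phi (c * x)).
  have h := der_comp (g := fun x => c * x) (tb_der tb (c * x)) (derZ c (derI x)).
  by apply: (derE h); rewrite mulr1 mulrC.
have e (x : R) : derive1 (fun x => phi (c * x)) x = c * derive1 phi (c * x).
  by rewrite derive1E; have [_ ->] := d x.
split => //; split.
- by move=> x; have [] := d x.
- rewrite (_ : derive1 _ = fun x => c * derive1 phi (c * x)); last exact/funext.
  have cd (x : R) : {for x, continuous (fun x => c * derive1 phi (c * x))}.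
    apply: continuousM; first exact: cst_continuous.
    apply: (@continuous_comp _ _ _ (fun x => c * x) (derive1 phi)).
      exact: is_derive_cont (derZ c (derI x)).
    exact: (tb_dcont tb).
  exact: cd.
- exists (a / c), (b / c); split; first by rewrite divr_gt0// (tb_a tb).
  move=> x; have [xab _|xab] := boolP (a <= c * x <= b); last by rewrite (tb_supp tb) ?eqxx.
  by rewrite ler_pdivrMr// ler_pdivlMr// ![x * c]mulrC.
Qed.

(** First-order expansion of a test function under dilation, uniformly on the
    half-line. *)
Lemma scale_test_remainder phi (th0 e : R) : test_function phi -> 0 < th0 -> 0 < e ->
  exists2 d, 0 < d & forall th : R, `|th - th0| < d -> forall x : R, 0 < x ->
  `|phi (th * x) - phi (th0 * x) - (th - th0) * (x * derive1 phi (th0 * x))|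
    <= e * `|th - th0| * x.
Proof.
move=> tphi t0 e0; have [a [b [M tb]]] := test_functionP tphi.
have b0 : 0 < b + 1 by have := tb_a tb; have := tb_ab tb; lra.
have cdphi (x : R) : 0 <= x <= b + 1 -> {for x, continuous (derive1 phi)}.
  by move=> _; exact: (tb_dcont tb).
have [d d0 hd] := unif_cont_segment e0 cdphi.
pose eta := Num.min 1 d * th0 / (b + 1).
have m0 : 0 < Num.min 1 d by rewrite lt_min ltr01.
exists eta; first by rewrite divr_gt0// mulr_gt0.
move=> th hth x x0.
have hth2 : `|th - th0| * (b + 1) < Num.min 1 d * th0 by rewrite -ltr_pdivlMr.
have [xs|xl] := leP (th0 * x) (b + 1); last first.
  have z1 : ~~ (a <= th0 * x <= b) by rewrite negb_and -!ltNge; apply/orP; right; lra.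
  have z2 : ~~ (a <= th * x <= b).
    rewrite negb_and -!ltNge; apply/orP; right.
    have h1 : `|th - th0| * (b + 1) < th0.
      by apply: lt_le_trans hth2 _; rewrite ler_piMl ?(ltW t0)// ge_min lexx.
    have h2 : th0 - th <= `|th - th0| by rewrite distrC ler_norm.
    have h3 : (th0 - th) * (b + 1) < th0 by apply: le_lt_trans h1; rewrite ler_wpM2r// ltW.
    have h4 : th0 * b < th * (b + 1) by lra.
    have b00 : 0 <= b by have := tb_a tb; have := tb_ab tb; lra.
    have h5 : 0 < th by have : 0 < th * (b + 1) by [apply: le_lt_trans h4; rewrite mulr_ge0// ltW]; rewrite pmulr_lgt0.
    have h6 : th0 * b * x < th * (b + 1) * x by rewrite ltr_pM2r.
    have h7 : b * (b + 1) < th0 * x * b \/ b = 0.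
      have [->|bn0] := eqVneq b 0; [by right|left].
      by rewrite mulrC ltr_pM2r// lt_neqAle eq_sym bn0.
    case: h7 => h7; last by rewrite h7 mulr_gt0.
    have : b * (b + 1) < th * x * (b + 1) by lra.
    by rewrite ltr_pM2r.
  rewrite !(tb_supp tb)// (tb_dsupp tb)// !mulr0 !subrr normr0.
  by rewrite !mulr_ge0// ltW.
have dP (z : R) : is_derive z 1 (fun th => phi (th * x)) (x * derive1 phi (z * x)).
  have h := der_comp (g := fun th => th * x) (tb_der tb (z * x)) (derM (derI z) (derC x z)).
  by apply: (derE h); rewrite mul1r mulr0 addr0 mulrC.
have [xi hxi E] : exists2 xi : R, `|xi - th0| <= `|th - th0| &
    phi (th * x) - phi (th0 * x) = x * derive1 phi (xi * x) * (th - th0).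
  have [h|h] := leP th0 th.
    have [xi /andP[x1 x2] E] := MVT_cc h (fun z _ => dP z) (fun z _ => is_derive_cont (dP z)).
    by exists xi => //; rewrite !ger0_norm; lra.
  have [xi /andP[x1 x2] E] := MVT_cc (ltW h) (fun z _ => dP z) (fun z _ => is_derive_cont (dP z)).
  exists xi; first by rewrite !ler0_norm; lra.
  by rewrite -opprB E; ring.
rewrite E; have -> : x * derive1 phi (xi * x) * (th - th0) - (th - th0) * (x * derive1 phi (th0 * x)) =
   (derive1 phi (xi * x) - derive1 phi (th0 * x)) * (th - th0) * x by ring.
rewrite !normrM (gtr0_norm x0) ler_pM2r//; apply: ler_wpM2r => //.
apply: hd; first by rewrite xs andbT mulr_ge0// ltW.
rewrite -mulrBl normrM (gtr0_norm x0).
have h1 : `|xi - th0| * x <= `|th - th0| * x by rewrite ler_pM2r.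
apply: le_lt_trans h1 _.
have h2 : `|th - th0| * (th0 * x) <= `|th - th0| * (b + 1) by apply: ler_wpM2l.
have h3 : Num.min 1 d * th0 <= d * th0 by rewrite ler_pM2r// ge_min lexx orbT.
have : `|th - th0| * x * th0 < d * th0 by lra.
by rewrite ltr_pM2r.
Qed.

Lemma sublinear_scale psi (c : R) : 0 < c -> sublinear psi ->
  sublinear (fun x => psi (c * x)).
Proof.
move=> c0 [mpsi [C C0 hC]]; split; first exact: meas_scale.
exists (C * c); first by rewrite mulr_ge0// ltW.
by move=> x x0; rewrite -mulrA hC// mulr_gt0.
Qed.

Lemma pair_id_bound r : 3 < r -> exists2 K, 0 <= K & forall h psi (C : R), 0 <= C ->
  in_H r h -> measurable_fun D psi -> (forall x : R, 0 < x -> `|psi x| <= C * x) ->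
  `|pair h psi| <= C * Num.sqrt (K * sqnorm r h).
Proof.
move=> r3; have [K K0 hK] := pairing_lin r3; exists K; first exact: ltW.
move=> h psi C C0 hh mpsi hpsi; have [i1 i2] := hK C h psi C0 hh mpsi hpsi.
apply: (le_trans (norm_integralp i1)).
have n0 : 0 <= integralp (fun x => `|h x * psi x|) by exact: integralp_ge0.
have k0 : 0 <= K * sqnorm r h by rewrite mulr_ge0 ?sqnorm_ge0// ltW.
rewrite -(@ler_pXn2r _ 2) ?nnegrE ?mulr_ge0 ?sqrtr_ge0//.
by rewrite exprMn sqr_sqrtr// mulrA.
Qed.

(** The density and the test function move at the same time.  The remainder of
    the expansion of the test function is small compared to x uniformly on the
    half-line, hence small against every density of the space, and so the product
    rule holds. *)
Lemma moving_test r u phi (th : R -> R) (t dth k : R) : 3 < r -> Hcurve r u ->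
  test_function phi -> 0 <= t -> 0 < th t -> is_derive t 1 th dth ->
  is_derive t 1 (fun s => pair (u (clamp s)) (fun x => phi (th t * x))) k ->
  is_derive t 1 (fun s => pair (u (clamp s)) (fun x => phi (th s * x)))
    (k + dth * pair (u t) (fun x => x * derive1 phi (th t * x))).
Proof.
move=> r3 cu tphi t0 tht dthP dK.
have [a [b [M tb]]] := test_functionP tphi.
have [C C0 hC] := test_lin tb.
pose psi x := x * derive1 phi (th t * x).
have spsi : sublinear psi.
  have [tphi' e'] := test_function_scale tht tphi.
  have [a' [b' [M' tb']]] := test_functionP tphi'.
  split; first by apply: measurable_funM => //; apply: (meas_scale tht); exact: cont_meas (tb_dcont tb).
  exists M; first exact: tb_M tb.
  by move=> x x0; rewrite normrM gtr0_norm// mulrC ler_pM2r// (tb_dbound tb).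
have sphi (c : R) : 0 < c -> sublinear (fun x => phi (c * x)).
  move=> c0; apply: (sublinear_scale c0 (psi := phi)); split; first exact: measurable_phi tb.
  by exists C => // x /hC[].
have cpsi : {for t, continuous (fun s => pair (u (clamp s)) psi)}.
  exact: (pair_curve_cont r3 cu spsi).
have h2 : is_derive t 1 (fun s => (th s - th t) * pair (u (clamp s)) psi)
    (dth * pair (u t) psi).
  have h := derB dthP (derC (th t) t); rewrite subr0 in h.
  by have := der_mul_zero (f := fun s => th s - th t) (subrr (th t)) h cpsi; rewrite clampE.
pose rem s := pair (u (clamp s)) (fun x => phi (th s * x)) -
  pair (u (clamp s)) (fun x => phi (th t * x)) - (th s - th t) * pair (u (clamp s)) psi.
have h3 : is_derive t 1 rem 0.
  apply: der_small; first by rewrite /rem !subrr mul0r subr0.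
  move=> e e0.
  have [K K0 hK] := pair_id_bound r3.
  have [d1 d10 hd1] := Hcurve_bounded cu t0.
  pose B := Num.sqrt (K * (2 + 2 * sqnorm r (u t))).
  have B0 : 0 <= B by rewrite sqrtr_ge0.
  pose e1 := e / ((`|dth| + 1) * (B + 1)).
  have q1 : 0 < `|dth| + 1 by rewrite ltr_wpDl.
  have q2 : 0 < B + 1 by rewrite ltr_wpDl.
  have e10 : 0 < e1 by rewrite divr_gt0// mulr_gt0.
  have [d2 d20 hd2] := scale_test_remainder tphi tht e10.
  have [d3 d30 hd3] := (derP th t dth).1 dthP 1 ltr01.
  have m20 : 0 < Num.min d2 (th t) / 2 by rewrite divr_gt0// lt_min d20.
  have [d4 d40 hd4] := (contP th t).1 (is_derive_cont dthP) _ m20.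
  exists (Num.min (Num.min d1 d3) d4); first by rewrite !lt_min d10 d30.
  move=> s; rewrite !lt_min => /andP[/andP[s1 s3] s4].
  have thst := hd4 s s4.
  have m1 : Num.min d2 (th t) <= d2 by rewrite ge_min lexx.
  have m2 : Num.min d2 (th t) <= th t by rewrite ge_min lexx orbT.
  have ths2 : `|th s - th t| < d2 by clear -thst m1 d20; lra.
  have ths0 : 0 < th s by move: thst; rewrite ler_norml => /andP[]; clear -m2 tht; lra.
  have lip : `|th s - th t| <= (`|dth| + 1) * `|s - t|.
    have -> : th s - th t = (th s - th t - dth * (s - t)) + dth * (s - t) by rewrite subrK.
    have := hd3 s s3; rewrite mul1r => h.
    by rewrite (le_trans (ler_normD _ _))// normrM mulrDl mul1r addrC lerD2l.
  have us := cu.1 _ (clamp_ge0 s).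
  have E : rem s = pair (u (clamp s)) (fun x => phi (th s * x) - phi (th t * x) -
      (th s - th t) * psi x).
    rewrite /rem /pair.
    have i1 := pair_int r3 us (sphi _ ths0).
    have i2 := pair_int r3 us (sphi _ tht).
    have i3 := pair_int r3 us spsi.
    rewrite -(integralpZ _ i3) -(integralpB i1 i2) -integralpB; last exact: integrablepZ.
      by apply: eq_integralp => x _; ring.
    exact: integrablepB.
  rewrite E.
  have nb : sqnorm r (u (clamp s)) <= 2 + 2 * sqnorm r (u t).
    apply: hd1; first exact: clamp_ge0.
    by rewrite -[in X in _ - X](clampE t0); exact: le_lt_trans (clamp_dist s t) s1.
  have c1 : 0 <= e1 * `|th s - th t| by rewrite mulr_ge0// ltW.
  apply: (le_trans (hK (u (clamp s)) _ _ c1 us _ (hd2 _ ths2))).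
    apply: measurable_funB.
      by apply: measurable_funB; [exact: (sphi _ ths0).1|exact: (sphi _ tht).1].
    by apply: measurable_funM => //; exact: spsi.1.
  have sB : Num.sqrt (K * sqnorm r (u (clamp s))) <= B + 1.
    apply: (@le_trans _ _ B); last by rewrite lerDl.
    by rewrite ler_wsqrtr// ler_wpM2l.
  apply: (@le_trans _ _ (e1 * ((`|dth| + 1) * `|s - t|) * (B + 1))).
    by apply: ler_pM => //; apply: ler_wpM2l => //; exact: ltW.
  rewrite le_eqVlt; apply/predU1P; left; rewrite /e1; field.
  by rewrite !gt_eqF.
have h4 := derD dK (derD h2 h3); rewrite addr0 in h4.
by apply: (der_ext _ h4) => s; rewrite /rem; ring.
Qed.

(** Rescaling a norm-continuous curve, with continuous amplitude and scale. *)
Lemma Hcurve_rescale r u (c lm : R -> R) : 0 <= r -> Hcurve r u ->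
  (forall t : R, 0 <= t -> [/\ 0 < lm t, {for t, continuous c} & {for t, continuous lm}]) ->
  Hcurve r (fun t x => c t * u t (lm t * x)).
Proof.
move=> r0 [uH cu] hcl.
have wH (t : R) : 0 <= t -> in_H r (fun x => u t (lm t * x)).
  by move=> t0; have [l0 _ _] := hcl t t0; have [] := in_H_scale l0 (uH t t0).
split; first by move=> t t0; apply: in_HZ; exact: wH.
move=> t0 t00 e e0; have [l0 cc cl] := hcl t0 t00.
pose w x := u t0 (lm t0 * x).
pose S := fun s : R => (lm s)^-1 * ((lm s)^-1 + (lm s `^ r)^-1).
have cS : {for t0, continuous S}.
  have cV : {for t0, continuous (fun s => (lm s)^-1)}.
    apply: continuousV => //; exact: lt0r_neq0.
  apply: continuousM => //; apply: continuousD => //.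
  apply: continuousV; first by rewrite lt0r_neq0// powR_gt0.
  apply: (@continuous_comp _ _ _ lm (fun y => y `^ r)) => //.
  exact: is_derive_cont (is_derive1_powR r l0).
pose C := `|c t0| + 1; have C0 : 0 < C by rewrite /C ltr_wpDl.
pose B := S t0 + 1.
have S0 (s : R) : 0 < lm s -> 0 <= S s.
  by move=> ls; rewrite mulr_ge0 ?addr_ge0 ?invr_ge0 ?powR_ge0// ltW.
have B0 : 0 < B by rewrite /B ltr_wpDl// S0.
pose Z := C ^+ 2 * (4 * B + 4) + 2 * (sqnorm r w + 1).
have w0 : 0 <= sqnorm r w by exact: sqnorm_ge0.
have Z0 : 0 < Z.
  by rewrite /Z ltr_wpDl// ?mulr_gt0 ?ltr_wpDl// mulr_ge0 ?sqr_ge0//; lra.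
pose e1 := e / Z; have e10 : 0 < e1 by rewrite divr_gt0.
have se1 : 0 < Num.min 1 e1 by rewrite lt_min ltr01.
have [d1 d10 hd1] := cu t0 t00 e1 e10.
have wHt : in_H r w by exact: wH.
have [d2 d20 hd2] := scale_continuous r0 wHt e10.
have [d3 d30 hd3] := (contP c t0).1 cc _ se1.
have [d4 d40 hd4] := (contP S t0).1 cS 1 ltr01.
have dl0 : 0 < d2 * lm t0 / 2 by rewrite divr_gt0// mulr_gt0.
have [d5 d50 hd5] := (contP lm t0).1 cl _ dl0.
exists (Num.min (Num.min d1 d3) (Num.min d4 d5)).
  by rewrite !lt_min d10 d30 d40.
move=> t tge; rewrite !lt_min => /andP[/andP[t1 t3] /andP[t4 t5]].
have [lt0 _ _] := hcl t tge.
have m1 : Num.min 1 e1 <= 1 by rewrite ge_min lexx.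
have m2 : Num.min 1 e1 <= e1 by rewrite ge_min lexx orbT.
have c3 := hd3 t t3.
have cC : `|c t| <= C.
  have -> : c t = (c t - c t0) + c t0 by rewrite subrK.
  by rewrite (le_trans (ler_normD _ _))// /C; lra.
have SB : S t <= B by have := hd4 t t4; rewrite ler_norml /B => /andP[_]; clear; lra.
have [f1H _] := in_HB (uH t tge) (uH t0 t00).
have [f2H f2n] := in_H_scale lt0 f1H.
have ratio : `|lm t / lm t0 - 1| < d2.
  have -> : lm t / lm t0 - 1 = (lm t - lm t0) / lm t0 by field; rewrite gt_eqF.
  rewrite normrM normfV (gtr0_norm l0) ltr_pdivrMr//.
  apply: le_lt_trans (hd5 t t5) _; rewrite ltr_pdivrMr// ltr_pMr//; first by clear; lra.
  exact: mulr_gt0.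
have [_ g1H g1n] := hd2 _ ratio.
have [kH kn] := in_HD f2H g1H.
have ctH := in_HZ (c t) kH; have cwH := in_HZ (c t - c t0) wHt.
have [fin finn] := in_HD ctH cwH.
have E (x : R) : 0 < x -> c t * (u t (lm t * x) - u t0 (lm t * x) + (w (lm t / lm t0 * x) - w x))
   + (c t - c t0) * w x = c t * u t (lm t * x) - c t0 * u t0 (lm t0 * x).
  move=> x0; rewrite /w; have -> : lm t0 * (lm t / lm t0 * x) = lm t * x.
    by field; rewrite gt_eqF.
  by ring.
rewrite (eq_sqnorm r E) in finn; apply: (le_trans finn).
rewrite (sqnormZ _ kH) (sqnormZ _ wHt).
have n1 := hd1 t tge t1.
have c2 : c t ^+ 2 <= C ^+ 2 by rewrite -(real_normK (num_real (c t))) lerXn2r ?nnegrE// ltW.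
have cc2 : (c t - c t0) ^+ 2 <= e1.
  rewrite -(real_normK (num_real _)) expr2.
  have := normr_ge0 (c t - c t0); move: c3 m1 m2; set n := `|_|; set m := Num.min _ _.
  by clear; nra.
have bound1 : sqnorm r (fun x => u t (lm t * x) - u t0 (lm t * x)) <= B * e1.
  apply: (le_trans f2n); apply: ler_pM => //; first exact: S0.
  exact: sqnorm_ge0.
have -> : e = e1 * Z by rewrite /e1 divfK// gt_eqF.
have k1' : sqnorm r (fun x => u t (lm t * x) - u t0 (lm t * x) + (w (lm t / lm t0 * x) - w x)) <=
  2 * (B * e1) + 2 * e1 by clear -kn g1n bound1; lra.
have k2' := sqnorm_ge0 r (fun x => u t (lm t * x) - u t0 (lm t * x) + (w (lm t / lm t0 * x) - w x)).
have s1 : c t ^+ 2 * sqnorm r (fun x => u t (lm t * x) - u t0 (lm t * x) + (w (lm t / lm t0 * x) - w x))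
   <= C ^+ 2 * (2 * (B * e1) + 2 * e1) by apply: ler_pM => //; exact: sqr_ge0.
have s2 : (c t - c t0) ^+ 2 * sqnorm r w <= e1 * sqnorm r w by rewrite ler_wpM2r.
by rewrite /Z; clear -s1 s2 e10; lra.
Qed.

End moving_tests.

(** * Change of variables to the linear equation *)

Section rescaling.
Context {R : realType} {gamma mu : R}.
Hypothesis gamma0 : 0 < gamma.
Hypothesis mu0 : 0 < mu.
Implicit Types (g ell h a : R -> R).

(** Logarithmic scale [ell], new time [h] and logarithmic amplitude [a] that
    turn the transport rate g into the constant rate mu. *)
Record rescales g ell h a : Prop := Rescales {
  rs_ell0 : ell 0 = 0;
  rs_h0 : h 0 = 0;
  rs_a0 : a 0 = 0;
  rs_ell : forall t : R, 0 <= t -> is_derive t 1 ell (g t - mu * expR (gamma * ell t));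
  rs_h : forall t : R, 0 <= t -> is_derive t 1 h (expR (gamma * ell t));
  rs_a : forall t : R, 0 <= t -> is_derive t 1 a (g t - mu);
  rs_hge : forall t : R, 0 <= t -> ln (1 + gamma * mu * t) / (gamma * mu) <= h t }.

Lemma comp_clamp_cont (f : R -> R) : (forall t : R, 0 <= t -> {for t, continuous f}) ->
  forall t : R, {for t, continuous (fun s => f (clamp s))}.
Proof.
move=> cf t; apply/contP => e e0.
have [d d0 hd] := (contP f (clamp t)).1 (cf _ (clamp_ge0 t)) e e0.
by exists d => // s st; apply: hd; apply: le_lt_trans (clamp_dist s t) st.
Qed.

(** The scale equation is of Bernoulli type, so it has a closed solution: with
    E = exp (gamma int g) and Theta = 1 + gamma mu int E, take
    exp ell = (E / Theta)^(1/gamma) and h = ln Theta / (gamma mu).  As g >= 0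
    makes E >= 1, the new time h tends to infinity. *)
Lemma rescaling_exists g : (forall t : R, {for t, continuous (fun s => g (clamp s))}) ->
  (forall t : R, 0 <= t -> 0 <= g t) -> exists ell h a, rescales g ell h a.
Proof.
move=> cg g0; have [G [G0 dG _]] := primitive cg.
pose E t := expR (gamma * G t).
have dE (t : R) : 0 <= t -> is_derive t 1 E (E t * (gamma * g t)).
  move=> t0; have t1 : -1 < t by lra.
  have h := der_exp (f := fun s => gamma * G s) (derZ gamma (dG t t1)).
  by apply: (derE h); rewrite clampE.
have cE := comp_clamp_cont (fun t t0 => is_derive_cont (dE t t0)).
have [P [P0 dP _]] := primitive cE.
pose Th t := 1 + gamma * mu * P t.
have dTh (t : R) : 0 <= t -> is_derive t 1 Th (gamma * mu * E t).
  move=> t0; have t1 : -1 < t by lra.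
  have h := derD (derC 1 t) (derZ (gamma * mu) (dP t t1)).
  by apply: (derE h); rewrite clampE// add0r.
have Gge (t : R) : 0 <= t -> 0 <= G t.
  move=> t0; have B : - G t - - G 0 <= 0 * (t - 0).
    apply: (@incr_bound _ (fun s => - G s) (fun s => - g (clamp s)) 0 t 0 t0).
    - by move=> x /andP[x0 _]; apply: derN; apply: dG; lra.
    - move=> x /andP[x0 _]; have x1 : -1 < x by lra.
      exact: is_derive_cont (derN (dG x x1)).
    - by move=> x _; rewrite oppr_le0 g0// clamp_ge0.
  by move: B; rewrite G0; lra.
have Ege (t : R) : 0 <= t -> 1 <= E t.
  by move=> t0; rewrite -expR0 ler_expR mulr_ge0 ?Gge// ltW.
have Pge (t : R) : 0 <= t -> t <= P t.
  move=> t0; have B : t - P t - (0 - P 0) <= 0 * (t - 0).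
    apply: (@incr_bound _ (fun s => s - P s) (fun s => 1 - E (clamp s)) 0 t 0 t0).
    - move=> x /andP[x0 _]; have x1 : -1 < x by lra.
      exact: derB (derI x) (dP x x1).
    - move=> x /andP[x0 _]; have x1 : -1 < x by lra.
      exact: is_derive_cont (derB (derI x) (dP x x1)).
    - by move=> x _; rewrite subr_le0 Ege// clamp_ge0.
  by move: B; rewrite P0; lra.
have gm : 0 < gamma * mu by rewrite mulr_gt0.
have Thge (t : R) : 0 <= t -> 1 + gamma * mu * t <= Th t.
  by move=> t0; rewrite lerD2l ler_pM2l// Pge.
have Th0 (t : R) : 0 <= t -> 0 < Th t.
  by move=> t0; apply: lt_le_trans (Thge t t0); rewrite ltr_pwDl// mulr_ge0// ltW.
have dlnTh (t : R) : 0 <= t -> is_derive t 1 (fun s => ln (Th s)) (gamma * mu * E t / Th t).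
  by move=> t0; apply: der_ln; [exact: Th0|exact: dTh].
have EL (t : R) : 0 <= t -> expR (gamma * (G t - ln (Th t) / gamma)) = E t / Th t.
  move=> t0; have -> : gamma * (G t - ln (Th t) / gamma) = gamma * G t - ln (Th t).
    by field; rewrite gt_eqF.
  by rewrite expRD expRN lnK// posrE Th0.
exists (fun t => G t - ln (Th t) / gamma), (fun t => ln (Th t) / (gamma * mu)),
  (fun t => G t - mu * t); split.
- by rewrite G0 /Th P0 mulr0 addr0 ln1 mul0r subr0.
- by rewrite /Th P0 mulr0 addr0 ln1 mul0r.
- by rewrite G0 mulr0 subr0.
- move=> t t0; have t1 : -1 < t by lra.
  have h := derB (dG t t1) (derM (dlnTh t t0) (derC gamma^-1 t)).
  apply: (derE h); rewrite EL// clampE// mulr0 addr0; field.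
  by rewrite !gt_eqF// Th0.
- move=> t t0; have h := derM (dlnTh t t0) (derC (gamma * mu)^-1 t).
  apply: (derE h); rewrite EL// mulr0 addr0; field.
  by rewrite !gt_eqF// Th0.
- move=> t t0; have t1 : -1 < t by lra.
  have h := derB (dG t t1) (derZ mu (derI t)).
  by apply: (derE h); rewrite clampE// mulr1.
- move=> t t0; rewrite ler_pM2r ?invr_gt0// ler_ln ?posrE ?Thge ?Th0//.
  by rewrite ltr_pwDl// mulr_ge0// ltW.
Qed.

Section inverse_time.
Variables (g ell h a : R -> R).
Hypothesis rs : rescales g ell h a.

Lemma rs_cont (t : R) : 0 <= t ->
  [/\ {for t, continuous ell}, {for t, continuous h} & {for t, continuous a}].
Proof.
by move=> t0; split; [exact: is_derive_cont (rs_ell rs t0)|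
  exact: is_derive_cont (rs_h rs t0)|exact: is_derive_cont (rs_a rs t0)].
Qed.

Lemma new_time_incr (s t : R) : 0 <= s -> s < t -> h s < h t.
Proof.
move=> s0 st; have [|//|c /andP[c1 c2] E] := @MVT_lt _ h (fun t => expR (gamma * ell t)) s t st.
- by move=> x /andP[x1 _]; apply: (rs_h rs); lra.
- by move=> x /andP[x1 _]; have [] := rs_cont (le_trans s0 x1).
by rewrite -subr_gt0 E mulr_gt0 ?expR_gt0// subr_gt0.
Qed.

Lemma new_time_le (s t : R) : 0 <= s -> s <= t -> h s <= h t.
Proof.
move=> s0; rewrite le_eqVlt => /predU1P[->//|st].
by rewrite ltW// new_time_incr.
Qed.

Lemma new_time_ge0 (t : R) : 0 <= t -> 0 <= h t.
Proof. by move=> t0; rewrite -(rs_h0 rs) new_time_le. Qed.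

(** Explicit time by which the new time has exceeded tau. *)
Definition late (tau : R) : R := expR (gamma * mu * tau) / (gamma * mu).

Lemma late_ge0 tau : 0 <= late tau.
Proof. by rewrite divr_ge0 ?expR_ge0// mulr_ge0 ?ltW. Qed.

Lemma new_time_late (tau t : R) : late tau <= t -> tau <= h t.
Proof.
have gm : 0 < gamma * mu by rewrite mulr_gt0.
move=> lt; have t0 : 0 <= t by apply: le_trans lt; exact: late_ge0.
apply: le_trans (rs_hge rs t0); rewrite ler_pdivlMr//.
rewrite -[leLHS]expRK mulrC ler_ln ?posrE ?expR_gt0//; last first.
  by rewrite ltr_pwDl// mulr_ge0// ltW.
by move: lt; rewrite /late ler_pdivrMr// mulrC [t * _]mulrC; lra.
Qed.

Lemma new_time_surj (tau : R) : 0 <= tau -> exists2 t, 0 <= t & h t = tau.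
Proof.
move=> tau0; have T0 := late_ge0 tau.
have hT : tau <= h (late tau) by exact: new_time_late.
have ch : {within `[0, late tau], continuous h}.
  by apply: continuous_in_subspaceT => x; rewrite inE/= in_itv/= => /andP[x0 _]; have [] := rs_cont x0.
have [|t] := IVT T0 ch (v := tau); last by rewrite in_itv/= => /andP[t0 _] <-; exists t.
by rewrite (rs_h0 rs) minEle maxEle new_time_ge0// tau0.
Qed.

Definition old_time (tau : R) : R :=
  if pselect (exists2 t, 0 <= t & h t = clamp tau) is left P then s2val (cid2 P) else 0.

Lemma old_timeP (tau : R) : 0 <= tau -> 0 <= old_time tau /\ h (old_time tau) = tau.
Proof.
move=> tau0; rewrite /old_time; case: pselect => [P|]; last first.
  by case; rewrite clampE//; exact: new_time_surj.
by split; [exact: (s2valP (cid2 P))|rewrite (s2valP' (cid2 P)) clampE].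
Qed.

Lemma new_timeK (t : R) : 0 <= t -> old_time (h t) = t.
Proof.
move=> t0; have [k0 kh] := old_timeP (new_time_ge0 t0).
case: (ltgtP (old_time (h t)) t) => // lt.
  by have := new_time_incr k0 lt; rewrite kh ltxx.
by have := new_time_incr t0 lt; rewrite kh ltxx.
Qed.

Lemma old_time0 : old_time 0 = 0.
Proof. by rewrite -[X in old_time X](rs_h0 rs) new_timeK. Qed.

Lemma old_time_gt0 (tau : R) : 0 < tau -> 0 < old_time tau.
Proof.
move=> tau0; have [k0 kh] := old_timeP (ltW tau0).
rewrite lt_neqAle k0 andbT; apply/eqP => o; move: kh; rewrite -o (rs_h0 rs) => t0.
by rewrite -t0 ltxx in tau0.
Qed.

Lemma old_time_lt (s t : R) : 0 <= s -> 0 <= t -> s < h t -> old_time s < t.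
Proof.
move=> s0 t0 st; have [k0 kh] := old_timeP s0; rewrite ltNge; apply/negP => le.
by move: (new_time_le t0 le); rewrite kh leNgt st.
Qed.

Lemma old_time_gt (s t : R) : 0 <= s -> 0 <= t -> h t < s -> t < old_time s.
Proof.
move=> s0 t0 st; have [k0 kh] := old_timeP s0; rewrite ltNge; apply/negP => le.
by move: (new_time_le k0 le); rewrite kh leNgt st.
Qed.

Lemma old_time_cont (tau : R) : 0 <= tau -> forall e : R, 0 < e -> exists2 d, 0 < d &
  forall s : R, 0 <= s -> `|s - tau| < d -> `|old_time s - old_time tau| < e.
Proof.
move=> tau0 e e0; have [k0 kh] := old_timeP tau0; set t := old_time tau in k0 kh *.
have h1 : h t < h (t + e) by apply: new_time_incr => //; rewrite ltrDl.
have [te|te] := leP e t.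
  have te0 : 0 <= t - e by lra.
  have h2 : h (t - e) < h t by apply: new_time_incr => //; lra.
  exists (Num.min (h (t + e) - h t) (h t - h (t - e))).
    by rewrite lt_min !subr_gt0 h1.
  move=> s s0; rewrite lt_min -kh !ltr_norml => /andP[/andP[_ a1] /andP[a2 _]].
  have b1 : old_time s < t + e by apply: old_time_lt => //; lra.
  have b2 : t - e < old_time s by apply: old_time_gt => //; lra.
  by apply/andP; split; lra.
exists (h (t + e) - h t); first by rewrite subr_gt0.
move=> s s0; rewrite -kh !ltr_norml => /andP[_ a1].
have b1 : old_time s < t + e by apply: old_time_lt => //; lra.
have [b2 _] := old_timeP s0.
by apply/andP; split; lra.
Qed.

Lemma old_time_derive (t : R) : 0 < t ->
  is_derive (h t) 1 old_time (expR (gamma * ell t))^-1.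
Proof.
move=> t0; apply: (@is_derive_inverse _ h old_time).
- have nt : \forall s \near t, 0 < s by exact: lt_nbhsr.
  by apply: filterS nt => s s0; rewrite new_timeK// ltW.
- have nt : \forall s \near t, 0 < s by exact: lt_nbhsr.
  by apply: filterS nt => s s0; have [] := rs_cont (ltW s0).
- have t00 := ltW t0; exact: (rs_h rs).
- by rewrite gt_eqF// expR_gt0.
Qed.

End inverse_time.
End rescaling.

Section sublinear_closure.
Context {R : realType}.
Implicit Types psi : R -> R.

Lemma sublinearZ (c : R) psi : sublinear psi -> sublinear (fun x => c * psi x).
Proof.
move=> [mpsi [C C0 hC]]; split; first exact: measurable_funM.
exists (`|c| * C); first by rewrite mulr_ge0.
by move=> x x0; rewrite normrM -mulrA ler_wpM2l ?hC.
Qed.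

Lemma eq_sublinear psi psi' : (forall x : R, 0 < x -> psi x = psi' x) ->
  sublinear psi -> sublinear psi'.
Proof.
move=> e [mpsi [C C0 hC]]; split; first exact: eq_measp e mpsi.
by exists C => // x x0; rewrite -e// hC.
Qed.

End sublinear_closure.

Section to_linear.
Context {R : realType} {beta gamma : R} {kappa : R -> R} {k1 k2 : R}.
Hypothesis fk : frag_kernel beta gamma kappa k1 k2.
Variables (mu r : R) (r3 : 3 < r) (mu0 : 0 < mu).
Implicit Types (u : R -> R -> R) (phi g : R -> R).
Local Notation adj := (frag_adj beta gamma kappa).
Let gamma0 : 0 < gamma. Proof. by have /andP[] := fk_gamma fk. Qed.

(** The fragmentation rate is homogeneous of degree gamma: a dilation only
    changes the speed of fragmentation, which the change of time makes up for. *)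
Lemma frag_adj_scale phi (c y : R) : 0 < c -> 0 < y ->
  adj (fun x => phi (c * x)) y = (c `^ gamma)^-1 * adj phi (c * y).
Proof.
move=> c0 y0; rewrite /frag_adj powRM ?ltW//.
have -> : fragment_mean kappa (fun x => phi (c * x)) y = fragment_mean kappa phi (c * y).
  by apply: eq_integralp => z _; rewrite mulrCA.
by field; rewrite gt_eqF// powR_gt0.
Qed.

Section one_solution.
Variables (g : R -> R) (u : R -> R -> R) (ell h a : R -> R).
Hypothesis rs : @rescales _ gamma mu g ell h a.
Hypothesis cg : forall t : R, {for t, continuous (fun s => g (clamp s))}.
Hypothesis sol : growth_frag_solution beta gamma kappa mu r g u.

(** The rescaled curve, read in the old time variable. *)
Definition rescaled t y : R := expR (2 * ell t - a t) * u t (expR (ell t) * y).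

Definition linearized tau y : R := rescaled (old_time h tau) y.

Let uH t : 0 <= t -> in_Hplus r (u t). Proof. by case: sol => + _ _ _; exact. Qed.
Let cu : Hcurve r u.
Proof.
case: sol => _ c _ _; apply/HcurveP => // t t0; by have [] := uH t0.
Qed.

Let r0 : 0 <= r. Proof. by move: r3; lra. Qed.

Lemma rescaled_curve : Hcurve r rescaled.
Proof.
apply: (Hcurve_rescale (c := fun t => expR (2 * ell t - a t)) (lm := fun t => expR (ell t)) r0 cu).
move=> t t0; split; first exact: expR_gt0.
  exact: is_derive_cont (der_exp (derB (derZ 2 (rs_ell rs t0)) (rs_a rs t0))).
exact: is_derive_cont (der_exp (rs_ell rs t0)).
Qed.

Lemma linearized_curve : Hcurve r linearized.
Proof.
have [wH cw] := rescaled_curve; split.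
  by move=> t t0; apply: wH; have [] := old_timeP gamma0 mu0 rs t0.
move=> t0 t00 e e0; have [k0 _] := old_timeP gamma0 mu0 rs t00.
have [d d0 hd] := cw _ k0 e e0.
have [d' d'0 hd'] := old_time_cont gamma0 mu0 rs t00 d0.
exists d' => // t tge tt0; apply: hd; last exact: hd'.
by have [] := old_timeP gamma0 mu0 rs tge.
Qed.

Lemma rescaled_pair psi (t : R) : 0 <= t -> sublinear psi ->
  pair (rescaled t) psi = expR (ell t - a t) * pair (u t) (fun x => psi (expR (- ell t) * x)).
Proof.
move=> t0 spsi; have l0 := expR_gt0 (ell t); have n0 := expR_gt0 (- ell t).
have [ut _] := uH t0.
have i1 := pair_int r3 ut (sublinear_scale n0 spsi).
have [i2 e2] := integralp_scale l0 i1.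
rewrite /pair -[X in _ * X]mul1r -(mulVf (lt0r_neq0 (expR_gt0 (- ell t)))).
rewrite -expRN opprK -[expR (ell t) * _ * _]mulrA mulrA -expRD.
have -> : ell t - a t + ell t = 2 * ell t - a t by ring.
rewrite -expRN in e2; rewrite -e2 -(integralpZ _ i2); apply: eq_integralp => y y0.
by rewrite /rescaled [expR (- ell t) * _]mulrA -expRD addNr expR0 mul1r mulrA.
Qed.

(** The dilation subtracts ell' from the transport rate, and the amplitude
    exp (2 ell - a) changes the loss rate mu by a' - ell': both become
    mu exp (gamma ell), and fragmentation too is multiplied by exp (gamma ell),
    the derivative of the new time. *)
Lemma rescaled_derive phi (t : R) : test_function phi -> 0 < t ->
  is_derive t 1 (fun s => pair (rescaled (clamp s)) phi)
    (expR (gamma * ell t) * weak_rhs beta gamma kappa mu mu phi (rescaled t)).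
Proof.
move=> tphi t0; have t00 := ltW t0.
have [s1 s2 s3] := test_sublinear fk tphi.
pose th s := expR (- ell s).
have th0 s : 0 < th s by exact: expR_gt0.
have dell := rs_ell rs t00; have da := rs_a rs t00.
set l' := g t - mu * expR (gamma * ell t) in dell.
have dth : is_derive t 1 th (- l' * th t).
  by have h1 := der_exp (f := fun s => - ell s) (derN dell); apply: (derE h1); rewrite mulrC.
have [tphi' dphi'] := test_function_scale (th0 t) tphi.
have dK := weak_derivative fk r3 cu cg sol tphi' t0.
have dG := moving_test r3 cu tphi t00 (th0 t) dth dK.
have dA := der_exp (f := fun s => ell s - a s) (derB dell da).
have dJ := derM (f := fun s => expR (ell s - a s)) dA dG.
have nt : \forall s \near t, 0 < s by exact: lt_nbhsr.
have dJ' : is_derive t 1 (fun s => pair (rescaled (clamp s)) phi)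
   (expR (ell t - a t) * (l' - (g t - mu)) * pair (u (clamp t)) (fun x : R => phi (th t * x)) +
    expR (ell t - a t) *
    (weak_rhs beta gamma kappa mu (g t) (fun x : R => phi (th t * x)) (u t) +
     - l' * th t * pair (u t) (fun x : R => x * derive1 phi (th t * x)))).
  apply: (der_near _ dJ); apply: filterS nt => s s0.
  by rewrite (clampE (ltW s0)) rescaled_pair// ltW.
apply: (derE dJ').
have [ut _] := uH t00.
have sx : sublinear (fun x => x * derive1 phi (th t * x)).
  apply: (eq_sublinear _ (sublinearZ (th t)^-1 (sublinear_scale (th0 t) s2))) => x _.
  by field; rewrite gt_eqF.
have EX : pair (u t) (fun x => x * derive1 (fun x => phi (th t * x)) x) =
    th t * pair (u t) (fun x => x * derive1 phi (th t * x)).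
  by rewrite -(pairZr _ r3 ut sx); apply: eq_pair => // x _; rewrite dphi'; ring.
have EZ : pair (u t) (adj (fun x => phi (th t * x))) =
    expR (gamma * ell t) * pair (u t) (fun x => adj phi (th t * x)).
  rewrite -(pairZr _ r3 ut (sublinear_scale (th0 t) s3)); apply: eq_pair => // x x0.
  rewrite frag_adj_scale//; congr (_ * _).
  rewrite /th -powRN /powR gt_eqF ?expR_gt0// expRK; congr expR; ring.
have EX' : pair (rescaled t) (fun x => x * derive1 phi x) =
    expR (ell t - a t) * (th t * pair (u t) (fun x => x * derive1 phi (th t * x))).
  rewrite (rescaled_pair t00 s2) -(pairZr _ r3 ut sx); congr (_ * _).
  by apply: eq_pair => // x _; rewrite -mulrA.
rewrite /weak_rhs EX EZ EX' (rescaled_pair t00 s1) (rescaled_pair t00 s3) (clampE t00).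
by rewrite /l' /th; ring.
Qed.

Lemma linearized_solution : linear_solution beta gamma kappa mu r linearized.
Proof.
have cl := linearized_curve.
apply: (solution_of_derivative fk r3).
- move=> t t0; have [k0 _] := old_timeP gamma0 mu0 rs t0.
  split; first exact: cl.1.
  have [_ pos] := uH k0.
  apply: ae_pos1 (ae_pos_scale (expR_gt0 (ell (old_time h t))) pos) => x _ ux.
  by rewrite mulr_ge0// expR_ge0.
- exact: cl.
- move=> t t0; rewrite /linearized /rescaled mulr0.
  have [k0 _] := old_timeP gamma0 mu0 rs t0.
  by case: sol => _ _ u0 _; rewrite u0// mulr0.
- by move=> t; exact: cst_continuous.
- move=> phi tphi tau tau0.
  have k0 := old_time_gt0 gamma0 mu0 rs tau0.
  have [k00 kh] := old_timeP gamma0 mu0 rs (ltW tau0).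
  have d1 := rescaled_derive tphi k0.
  have d2 := old_time_derive gamma0 mu0 rs k0.
  rewrite kh in d2.
  have d3 := der_comp (f := fun s => pair (rescaled (clamp s)) phi) (g := old_time h) d1 d2.
  have nt : \forall s \near tau, 0 < s by exact: lt_nbhsr.
  have d4 : is_derive tau 1 (fun s => pair (linearized (clamp s)) phi)
      (expR (gamma * ell (old_time h tau)) *
        weak_rhs beta gamma kappa mu mu phi (rescaled (old_time h tau)) /
        expR (gamma * ell (old_time h tau))).
    apply: (der_near _ d3); apply: filterS nt => s s0.
    have [ks _] := old_timeP gamma0 mu0 rs (ltW s0).
    by rewrite /linearized (clampE (ltW s0)) (clampE ks).
  by apply: (derE d4); rewrite mulrAC mulfV ?mul1r// gt_eqF// expR_gt0.
Qed.

Lemma linearizedE (t y : R) : 0 <= t -> linearized (h t) y = rescaled t y.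
Proof. by move=> t0; rewrite /linearized (new_timeK gamma0 mu0 rs). Qed.

Lemma linearized0 (y : R) : linearized 0 y = u 0 y.
Proof.
rewrite /linearized (old_time0 gamma0 mu0 rs) /rescaled (rs_ell0 rs) (rs_a0 rs).
by rewrite mulr0 subr0 expR0 !mul1r.
Qed.

(** Undoing the change of variables. *)
Lemma unlinearized (t x : R) : 0 <= t ->
  u t x = expR (a t - 2 * ell t) * linearized (h t) (expR (- ell t) * x).
Proof.
move=> t0; rewrite linearizedE// /rescaled mulrA -expRD mulrA -expRD.
by rewrite subrr expR0 mul1r subrKA subrr expR0 mul1r.
Qed.

End one_solution.
End to_linear.

(** * Consequences of the spectral gap *)

Section critical_exponent.
Context {R : realType}.
Local Notation D := (`]0, +oo[%classic : set R).

(** At the exponent 3 the first moment is not defined on the whole cone: the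
    density 1/((1+x)^2 ln(2+x)) belongs to the space, but its first moment
    diverges like ln ln x. *)
Lemma first_moment_exponent3 : exists2 v0 : R -> R, in_Hplus 3 v0 & ~ finite_moment 1 v0.
Proof.
pose l (x : R) := ln (2 + x); pose v0 x := ((1 + x) ^+ 2 * l x)^-1.
have l0 (x : R) : 0 < x -> 0 < l x by move=> x0; apply: ln_gt0; lra.
have dl (x : R) : 0 < x -> is_derive x 1 l (2 + x)^-1.
  move=> x0; have x2 : 0 < 2 + x by lra.
  have h := der_ln (f := fun x => 2 + x) x2 (derD (derC 2 x) (derI x)).
  by apply: (derE h); rewrite add0r mul1r.
have v0pos (x : R) : 0 < x -> 0 < v0 x.
  by move=> x0; rewrite invr_gt0 mulr_gt0 ?l0// exprn_gt0//; lra.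
have v0c (x : R) : 0 < x -> {for x, continuous v0}.
  move=> x0; have h1 := der_sqr (f := fun x => 1 + x) (derD (derC 1 x) (derI x)).
  have h2 := derM (f := fun x => (1 + x) ^+ 2) h1 (dl x x0).
  have nz : (1 + x) ^+ 2 * l x != 0 by rewrite -invr_eq0 gt_eqF// v0pos.
  exact: is_derive_cont (derV (f := fun x => (1 + x) ^+ 2 * l x) nz h2).
have mv0 : measurable_fun D v0.
  apply: open_continuous_measurable_fun; first exact: interval_open.
  by move=> x; rewrite inE => /Dgt0 /v0c.
pose F (x : R) := - (2 / l x).
pose f (x : R) := 2 / ((2 + x) * l x ^+ 2).
have [//| | | |fi _] := @integrablep_primitive R f F (2 / ln 2).
- by move=> x x0; rewrite divr_ge0// mulr_ge0 ?sqr_ge0//; lra.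
- move=> x x0; have x2 : 0 < 2 + x by lra.
  have h1 := derM (f := fun x => 2 + x) (derD (derC 2 x) (derI x)) (der_sqr (dl x x0)).
  have nz : (2 + x) * l x ^+ 2 != 0 by rewrite gt_eqF// mulr_gt0// exprn_gt0// l0.
  have h2 := derM (derC 2 x) (derV (f := fun x => (2 + x) * l x ^+ 2) nz h1).
  exact: is_derive_cont h2.
- move=> x x0; have x2 : 0 < 2 + x by lra.
  have h := derN (derZ 2 (derV (lt0r_neq0 (l0 x x0)) (dl x x0))).
  apply: (derE h); rewrite /f; have := l0 x x0 => lx; field; rewrite !gt_eqF//.
- move=> x y x0 y0; rewrite /F opprK.
  have h1 : 2 / l x <= 2 / ln 2.
    rewrite ler_pM2l// lef_pV2 ?posrE ?l0 ?ln_gt0 ?ltr1n// ler_ln ?posrE//; lra.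
  have h2 : 0 <= 2 / l y by rewrite divr_ge0// ltW// l0.
  by lra.
have v0H : in_Hplus 3 v0.
  split; last first.
    by apply: aeW => x x0; exact/ltW/v0pos.
  split => //; apply: (integrablep_le _ fi).
    apply: measurable_funM; last exact: measurable_weight.
    exact: measurable_funX.
  move=> x x0; rewrite ger0_norm ?sqw_ge0// powR_mulrn ?(ltW x0)//.
  have lx := l0 x x0; rewrite /v0 /f exprVn.
  rewrite ler_pdivlMr ?mulr_gt0 ?exprn_gt0//; last by lra.
  rewrite mulrAC -[leLHS]mulrA mulrC ler_pdivrMr; last first.
    by rewrite exprn_gt0// mulr_gt0 ?exprn_gt0//; lra.
  rewrite exprMn.
  have : (x + x ^+ 3) * (2 + x) <= 2 * ((1 + x) ^+ 2) ^+ 2.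
    have := sqr_ge0 x; have x20 : 0 <= x ^+ 2 by exact: sqr_ge0.
    by rewrite !exprS expr0; nra.
  have : 0 <= l x ^+ 2 by exact: sqr_ge0.
  by nra.
exists v0 => // fin1.
have vi : integrablep (fun x => x * v0 x).
  by apply: eq_integrablep fin1 => x x0; rewrite powRr1// ltW.
pose G (x : R) := ln (l x) / 2; pose q (x : R) := ((2 + x) * l x)^-1 / 2.
have dG (x : R) : 0 < x -> is_derive x 1 G (q x).
  move=> x0; have h := derM (der_ln (l0 x x0) (dl x x0)) (derC 2^-1 x).
  by apply: (derE h); rewrite mulr0 addr0 /q invfM.
have cq (x : R) : 0 < x -> {for x, continuous q}.
  move=> x0; have x2 : 0 < 2 + x by lra.
  have h1 := derM (f := fun x => 2 + x) (derD (derC 2 x) (derI x)) (dl x x0).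
  have nz : (2 + x) * l x != 0 by rewrite gt_eqF// mulr_gt0// l0.
  exact: is_derive_cont (derM (derV (f := fun x => (2 + x) * l x) nz h1) (derC 2^-1 x)).
have bound (n : R) : 1 < n -> G n - G 1 <= integralp (fun x => x * v0 x).
  move=> n1.
  have dG1 (x : R) : 1 <= x <= n -> is_derive x 1 G (q x) by move=> /andP[x1 _]; apply: dG; lra.
  have cq1 (x : R) : 1 <= x <= n -> {for x, continuous q} by move=> /andP[x1 _]; apply: cq; lra.
  have E := ftc2 n1 dG1 cq1.
  have mI : measurable (`[1, n]%classic : set (measurableTypeR R)) by exact: measurable_itv.
  have ID : `[1, n]%classic `<=` D by move=> x; rewrite /= in_itv/= => /andP[x1 _]; apply: gt0D; lra.
  rewrite -lee_fin -E -(integralpE vi).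
  apply: (@le_trans _ _ (\int[@lebesgue_measure R]_(x in `[1%R, n]) (x * v0 x)%:E)%E).
    apply: ge0_le_integral => //.
    - move=> x; rewrite /= in_itv/= => /andP[x1 _]; rewrite lee_fin divr_ge0// invr_ge0.
      by rewrite mulr_ge0 ?ltW ?l0//; lra.
    - apply/measurable_EFinP; apply: subspace_continuous_measurable_fun => //.
      by apply: continuous_in_subspaceT => x; rewrite inE/= in_itv/=; exact: cq1.
    - by apply/measurable_EFinP; apply: (measurable_funS mD ID); exact: integrablep_meas vi.
    - move=> x; rewrite /= in_itv/= => /andP[x1 _]; rewrite lee_fin /q /v0.
      have x0 : 0 < x by lra.
      have lx := l0 x x0; rewrite ler_pdivrMr//.
      have -> : x * ((1 + x) ^+ 2 * l x)^-1 * 2 = (2 * x / (1 + x) ^+ 2) * (l x)^-1.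
        by field; rewrite !gt_eqF//; lra.
      rewrite invfM ler_pM2r ?invr_gt0// ler_pdivlMr ?exprn_gt0//; last by lra.
      rewrite ler_pdivrMl; last by lra.
      by rewrite expr2; nra.
  apply: ge0_subset_integral => //.
  - by apply/measurable_EFinP; exact: integrablep_meas vi.
  - by move=> x /Dgt0 x0; rewrite lee_fin mulr_ge0 ?ltW ?v0pos.
pose M := integralp (fun x => x * v0 x).
pose n := expR (expR (2 * (Num.max M 0 + 1 + `|G 1|) + 1)).
have e1 : 1 < expR (2 * (Num.max M 0 + 1 + `|G 1|) + 1).
  rewrite -[X in X < _]expR0 ltr_expR; have := normr_ge0 (G 1); have : 0 <= Num.max M 0 by rewrite le_max lexx orbT.
  by lra.
have n1 : 1 < n by rewrite /n -[X in X < _]expR0 ltr_expR; lra.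
have := bound n n1; rewrite -/M.
have : Num.max M 0 + 1 + `|G 1| <= G n.
  rewrite /G ler_pdivlMr//; apply: (@le_trans _ _ (ln (ln n))).
    by rewrite /n !expRK; lra.
  have ln0 : 0 < ln n by rewrite /n expRK; lra.
  rewrite ler_ln ?posrE//; last by apply: l0; lra.
  by rewrite /l ler_ln ?posrE//; lra.
have := ler_norm (G 1); have : M <= Num.max M 0 by rewrite le_max lexx.
by lra.
Qed.

End critical_exponent.

Section spectral_gap_consequences.
Context {R : realType} {beta gamma : R} {kappa : R -> R} {k1 k2 : R}.
Hypothesis fk : frag_kernel beta gamma kappa k1 k2.
Variables (mu r rbar : R) (U : R -> R).
Hypotheses (r3 : 3 < r) (mu0 : 0 < mu) (rbar_le : rbar <= r).
Hypothesis hU : stationary_profile beta gamma kappa mu rbar U.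
Hypothesis hgap : spectral_gap beta gamma kappa mu r U.
Implicit Types (v : R -> R -> R) (h psi : R -> R).
Local Notation D := (`]0, +oo[%classic : set R).

Definition mass h : R := pair h (fun x => x).

Lemma sublinear_id : sublinear (fun x : R => x).
Proof.
split => //; exists 1 => // x x0.
by rewrite mul1r gtr0_norm.
Qed.

Lemma moment1E h : moment 1 h = mass h.
Proof. by apply: eq_integralp => x x0; rewrite powRr1 ?ltW// mulrC. Qed.

(** Densities are nonnegative only almost everywhere; absolute values make them
    nonnegative everywhere, with the same pairings. *)
Lemma abs_pair h psi : measurable_fun D h -> measurable_fun D psi ->
  ae_pos (fun x => 0 <= h x) -> pair h psi = pair (fun x => `|h x|) psi.
Proof.
move=> mh mpsi h0; apply: ae_integralp.
- exact: measurable_funM.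
- by apply: measurable_funM => //; exact: measurableT_comp.
- by apply: ae_pos1 h0 => x _ hx; rewrite ger0_norm.
Qed.

Lemma abs_in_H r' h : in_H r' h ->
  in_H r' (fun x => `|h x|) /\ sqnorm r' (fun x => `|h x|) = sqnorm r' h.
Proof.
move=> hh; have mh : measurable_fun D (fun x => `|h x|) by apply: measurableT_comp => //; exact: in_H_meas hh.
have [|i1 _] := in_H_le mh hh; first by move=> x _; rewrite normr_id.
by split => //; apply: eq_integralp => x _; rewrite real_normK ?num_real.
Qed.

Lemma mass_ge0 h : in_Hplus r h -> 0 <= mass h.
Proof.
move=> [hh h0]; rewrite /mass (abs_pair (in_H_meas hh) _ h0)//.
by apply: integralp_ge0 => x x0; rewrite mulr_ge0// ltW.
Qed.

Lemma mass_gt0 h : in_Hplus r h -> nontrivial h -> 0 < mass h.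
Proof.
move=> [hh h0] nt; rewrite lt_neqAle mass_ge0// andbT eq_sym; apply/eqP => m0.
apply: nt; have [ah _] := abs_in_H hh.
rewrite /mass (abs_pair (in_H_meas hh) _ h0)// in m0.
have := integralp_eq0 (pair_int r3 ah sublinear_id) _ m0.
have pos (x : R) : 0 < x -> 0 <= `|h x| * x by move=> x0; rewrite mulr_ge0// ltW.
move=> /(_ pos); apply: ae_pos1 => x x0 /eqP.
by rewrite mulf_eq0 normr_eq0 => /orP[/eqP //|]; rewrite gt_eqF.
Qed.

(** The spectral gap can be applied from any time at which the mass is not 0. *)
Lemma massless_trivial h : in_H r h -> mass h != 0 -> nontrivial h.
Proof.
move=> hh m0 triv; move/eqP: m0; apply; apply: ae_integralp_eq0.
  by apply: ae_pos1 triv => x _ ->; rewrite mul0r.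
exact: integrablep_meas (pair_int r3 hh sublinear_id).
Qed.

Lemma profile_in_H s : rbar <= s -> in_Hplus s U.
Proof. by move=> rs; case: hU => _ _ _ /(_ s rs) [+ _ _ _] => /(_ 0 (lexx 0)). Qed.

Lemma profile_nontrivial : nontrivial U.
Proof.
case: hU => _ Ui U1 _ triv; have := ae_integralp_eq0 triv (integrablep_meas Ui).
by rewrite /integralp U1 => /eqP; rewrite oner_eq0.
Qed.

Lemma profile_mass_gt0 : 0 < mass U.
Proof. exact: mass_gt0 (profile_in_H rbar_le) profile_nontrivial. Qed.

Lemma rho0E h : rho0 U h = mass h / mass U.
Proof. by rewrite /rho0 !moment1E. Qed.

Lemma rho0_gt0 h : in_Hplus r h -> nontrivial h -> 0 < rho0 U h.
Proof.
by move=> hh nt; rewrite rho0E; apply: divr_gt0; [exact: mass_gt0|exact: profile_mass_gt0].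
Qed.

Lemma solution_in_H g v : growth_frag_solution beta gamma kappa mu r g v ->
  forall t, 0 <= t -> in_Hplus r (v t).
Proof. by case=> + _ _ _; exact. Qed.

Lemma solution_curve g v : growth_frag_solution beta gamma kappa mu r g v ->
  Hcurve r v.
Proof. by move=> [vH cv _ _]; apply/HcurveP => // t /vH[]. Qed.

Definition defect v t : R -> R := fun x => (rho0 U (v 0))^-1 * v t x - U x.

Lemma defect_in_H v t : linear_solution beta gamma kappa mu r v -> 0 <= t ->
  in_H r (defect v t).
Proof.
move=> sv t0; have [vt _] := solution_in_H sv t0; have [uH _] := profile_in_H rbar_le.
by have [] := in_HB (in_HZ (rho0 U (v 0))^-1 vt) uH.
Qed.

Lemma gap_decay : exists a C : R, [/\ 0 < a, 0 <= C &
  forall v, linear_solution beta gamma kappa mu r v -> nontrivial (v 0) ->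
  forall t, 0 <= t -> sqnorm r (defect v t) <= C * sqnorm r (defect v 0) * expR (- a * t)].
Proof.
case: hgap => _ [a [C [a0 C0 hC]]]; exists a, (C ^+ 2 + 1).
split => //; first by rewrite addr_ge0// sqr_ge0.
move=> v sv nt t; have n0 := sqnorm_ge0 r (defect v 0).
rewrite le_eqVlt => /predU1P[<-|t0].
  by rewrite mulr0 expR0 mulr1 mulrDl mul1r lerDr mulr_ge0// sqr_ge0.
have := hC v sv nt t t0; rewrite -/(defect v t) -/(defect v 0) => h.
rewrite -(sqr_H_norm r (defect v t)).
have e1 : expR (- a * t) <= 1 by rewrite -expR0 ler_expR mulNr oppr_le0 mulr_ge0// ltW.
have e0 := expR_gt0 (- a * t).
apply: (@le_trans _ _ ((C * H_norm r (defect v 0) * expR (- a * t)) ^+ 2)).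
  by rewrite lerXn2r ?nnegrE ?H_norm_ge0// !mulr_ge0 ?H_norm_ge0 ?ltW.
rewrite !exprMn sqr_H_norm.
have p0 : 0 <= C ^+ 2 * sqnorm r (defect v 0) by rewrite mulr_ge0// sqr_ge0.
apply: (@le_trans _ _ (C ^+ 2 * sqnorm r (defect v 0) * expR (- a * t))).
  by rewrite ler_wpM2l// expr2 ler_piMl// ltW.
by rewrite ler_wpM2r ?(ltW e0)// ler_wpM2r// lerDl.
Qed.

(** Hence the defect is eventually small. *)
Lemma gap_limit v (e : R) : linear_solution beta gamma kappa mu r v ->
  nontrivial (v 0) -> 0 < e -> exists2 T, 0 <= T &
  forall t, T <= t -> sqnorm r (defect v t) <= e.
Proof.
move=> sv nt e0; have [a [C [a0 C0 hC]]] := gap_decay.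
pose B := C * sqnorm r (defect v 0) + 1.
have B0 : 0 < B by rewrite /B ltr_wpDl// mulr_ge0// sqnorm_ge0.
exists (Num.max 0 (ln (B / e) / a)); first by rewrite le_max lexx.
move=> t; rewrite ge_max => /andP[t0 ht]; apply: (le_trans (hC v sv nt t t0)).
apply: (@le_trans _ _ (B * expR (- a * t))).
  by rewrite ler_wpM2r ?expR_ge0// /B lerDl.
rewrite mulNr expRN ler_pdivrMr ?expR_gt0// -ler_pdivrMl//.
have Be : 0 < B / e by rewrite divr_gt0.
rewrite mulrC -[leLHS](lnK) ?posrE// ler_expR; move: ht.
by rewrite ler_pdivrMr// [t * a]mulrC.
Qed.

Lemma shift_solution v s : linear_solution beta gamma kappa mu r v -> 0 <= s ->
  linear_solution beta gamma kappa mu r (fun t => v (s + t)).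
Proof.
move=> sv s0; have cv := solution_curve sv.
have cmu (t : R) : {for t, continuous (fun s : R => (fun=> mu) (clamp s))} by exact: cst_continuous.
apply: (solution_of_derivative fk r3).
- by move=> t t0; apply: (solution_in_H sv); rewrite addr_ge0.
- split.
    by move=> t t0; apply: cv.1; rewrite addr_ge0.
  move=> t0 t00 e e0; have [|d d0 hd] := cv.2 (s + t0) _ e e0; first by rewrite addr_ge0.
  exists d => // t t1 tt; apply: hd; first by rewrite addr_ge0.
  by rewrite opprD addrACA subrr add0r.
- by move=> t t0; case: sv => _ _ + _; apply; rewrite addr_ge0.
- exact: cmu.
- move=> phi tphi t t0.
  have st0 : 0 < s + t by rewrite ltr_wpDl.
  have d1 := weak_derivative fk r3 cv cmu sv tphi st0.
  have d2 := der_comp (f := fun x => pair (v (clamp x)) phi) (g := fun x => s + x) d1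
    (derD (derC s t) (derI t)).
  rewrite add0r mulr1 in d2.
  apply: (der_near _ d2).
  have nt : \forall x \near t, 0 < x by exact: lt_nbhsr.
  apply: filterS nt => x x0; rewrite !clampE//; [exact: ltW|].
  by rewrite addr_ge0// ltW.
Qed.

Lemma mass_defect v t : linear_solution beta gamma kappa mu r v -> 0 <= t ->
  nontrivial (v 0) ->
  mass (v t) - mass (v 0) = rho0 U (v 0) * mass (defect v t).
Proof.
move=> sv t0 nt; have [vt _] := solution_in_H sv t0; have [uH _] := profile_in_H rbar_le.
have v0H := solution_in_H sv (lexx 0).
rewrite /mass /defect (pairBl r3 (in_HZ _ vt) uH sublinear_id) (pairZl _ r3 vt sublinear_id).
rewrite -!/(mass _) mulrBr mulrA mulfV ?mul1r ?gt_eqF ?rho0_gt0// rho0E divfK//.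
by rewrite gt_eqF// profile_mass_gt0.
Qed.

Lemma mass_limit v (e : R) : linear_solution beta gamma kappa mu r v ->
  nontrivial (v 0) -> 0 < e -> exists2 T, 0 <= T &
  forall t, T <= t -> `|mass (v t) - mass (v 0)| <= e.
Proof.
move=> sv nt e0; have [K K0 hK] := pair_bound r3 sublinear_id.
have rho := rho0_gt0 (solution_in_H sv (lexx 0)) nt.
pose e1 := (e / rho0 U (v 0)) ^+ 2 / (K + 1).
have K1 : 0 < K + 1 by rewrite ltr_wpDl.
have e10 : 0 < e1 by rewrite divr_gt0// exprn_gt0// divr_gt0.
have [T T0 hT] := gap_limit sv nt e10; exists T => // t Tt.
have t0 : 0 <= t by apply: le_trans Tt.
rewrite mass_defect// normrM gtr0_norm// -ler_pdivlMl// mulrC.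
have dH := defect_in_H sv t0.
have q0 : 0 <= e / rho0 U (v 0) by rewrite ltW// divr_gt0.
rewrite -(@ler_pXn2r _ 2) ?nnegrE//.
rewrite real_normK ?num_real//; apply: (le_trans (hK _ dH)).
have := hT t Tt; rewrite /e1 ler_pdivlMr// => h; have := sqnorm_ge0 r (defect v t).
by nra.
Qed.

(** Mass is conserved.  Test functions do not see mass escaping at infinity,
    but the convergence to the profile holds from every starting time with the
    mass of that time: so at each time the mass is either 0 or the initial
    mass, and it is continuous. *)
Lemma mass_conserved v t : linear_solution beta gamma kappa mu r v ->
  nontrivial (v 0) -> 0 <= t -> mass (v t) = mass (v 0).
Proof.
move=> sv nt; have v0H := solution_in_H sv (lexx 0); have m0 := mass_gt0 v0H nt.
(* Both are the limit of the mass at infinity, one for the solution restarted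
   at time s. *)
have dich s : 0 <= s -> mass (v s) != 0 -> mass (v s) = mass (v 0).
  move=> s0 ms; have [vs _] := solution_in_H sv s0.
  have nts : nontrivial (v (s + 0)) by rewrite addr0; exact: massless_trivial.
  have svs := shift_solution sv s0.
  apply/eqP; rewrite -subr_eq0 -normr_le0; apply/ler_addgt0Pl => e e0; rewrite addr0.
  have e20 : 0 < e / 2 by rewrite divr_gt0.
  have [T T0 hT] := mass_limit sv nt e20; have [T' T'0 hT'] := mass_limit svs nts e20.
  have := hT (s + (T + T')) ltac:(lra); have := hT' (T + T') ltac:(lra); rewrite addr0.
  set z := mass (v (s + _)) => h1 h2.
  have -> : mass (v s) - mass (v 0) = (z - mass (v 0)) - (z - mass (v s)) by ring.
  by rewrite (le_trans (ler_normB _ _))//; lra.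
move=> t0; have [mt|] := eqVneq (mass (v t)) 0; last exact: dich.
pose m s := mass (v (clamp s)).
have cm : {within `[0, t], continuous m}.
  apply: continuous_subspaceT => s.
  exact: (pair_curve_cont r3 (solution_curve sv) sublinear_id).
have [|c] := IVT t0 cm (v := mass (v 0) / 2).
  rewrite /m (clampE t0) (clampE (lexx 0)) mt min_r ?max_l ?(ltW m0)//.
  by rewrite divr_ge0 ?(ltW m0)//= ler_pdivrMr// ler_peMr ?(ltW m0)// ler1n.
rewrite in_itv/= /m => /andP[c0 _]; rewrite (clampE c0) => mc.
have : mass (v c) = mass (v 0) by apply: dich => //; rewrite mc mulf_neq0 ?gt_eqF// invr_gt0.
by rewrite mc; lra.
Qed.

Lemma shift_defect v s t : linear_solution beta gamma kappa mu r v ->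
  nontrivial (v 0) -> 0 <= s -> defect (fun t => v (s + t)) t = defect v (s + t).
Proof.
move=> sv nt s0; apply/funext => x; rewrite /defect addr0 !rho0E.
by rewrite (mass_conserved sv nt s0).
Qed.

Lemma solution_nontrivial v t : linear_solution beta gamma kappa mu r v ->
  nontrivial (v 0) -> 0 <= t -> nontrivial (v t).
Proof.
move=> sv nt t0; have [vt _] := solution_in_H sv t0; apply: massless_trivial => //.
by rewrite (mass_conserved sv nt t0) gt_eqF// (mass_gt0 (solution_in_H sv (lexx 0)) nt).
Qed.

End spectral_gap_consequences.

(** * Scalar comparison and smooth ramps *)

Section scalar_comparison.
Context {R : realType}.
Implicit Types y dy : R -> R.

Lemma last_time_below y (a t T : R) : (forall x : R, T <= x -> {for x, continuous y}) ->
  T <= t -> y T <= a -> a < y t ->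
  exists2 s, T <= s < t & y s <= a /\ forall x : R, s < x <= t -> a < y x.
Proof.
move=> cy Tt yT yt; pose A := [set s | T <= s <= t /\ y s <= a].
have AT : A T by rewrite /A/= lexx Tt.
have hA : has_sup A by split; [exists T|exists t => s [/andP[]]].
pose s := sup A.
have Ts : T <= s by by apply: ub_le_sup => //; exact: hA.2.
have st : s <= t by apply: ge_sup; [exists T|move=> x [/andP[]]].
have ys : y s <= a.
  rewrite leNgt; apply/negP => sa.
  have e0 : 0 < (y s - a) / 2 by lra.
  have [d d0 hd] := (contP y s).1 (cy s Ts) _ e0.
  have [x [/andP[x1 x2] yx] xs] := sup_adherent d0 hA.
  have xle : x <= s by apply: ub_le_sup; [exact: hA.2|split=> //; rewrite x1].
  rewrite -/s in xs; have := hd x; rewrite distrC ger0_norm ?subr_ge0// => /(_ ltac:(lra)).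
  by rewrite ler_norml => /andP[h1 h2]; lra.
exists s.
  rewrite Ts lt_neqAle st andbT; apply/eqP => E; move: ys; rewrite E; lra.
split=> // x /andP[sx xt]; rewrite ltNge; apply/negP => yx.
have : x <= s by apply: ub_le_sup; [exact: hA.2|split=> //; rewrite xt (le_trans Ts (ltW sx))].
by lra.
Qed.

(** A level above which the function decreases cannot be crossed upwards. *)
Lemma stays_below y dy (a T : R) : (forall x : R, T <= x -> {for x, continuous y}) ->
  (forall t : R, T < t -> is_derive t 1 y (dy t)) ->
  (forall t : R, T < t -> a <= y t -> dy t <= 0) -> y T <= a ->
  forall t, T <= t -> y t <= a.
Proof.
move=> cy der neg yT t Tt; rewrite leNgt; apply/negP => yt.
have [s /andP[Ts st] [ys above]] := last_time_below cy Tt yT yt.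
have := @incr_bound _ y dy s t 0 (ltW st).
have d1 (x : R) : s < x < t -> is_derive x 1 y (dy x).
  by move=> /andP[sx xt]; apply: der; lra.
have c1 (x : R) : s <= x <= t -> {for x, continuous y}.
  by move=> /andP[sx xt]; apply: cy; lra.
move=> /(_ d1 c1); rewrite mul0r.
have : forall x : R, s < x < t -> dy x <= 0.
  by move=> x /andP[sx xt]; apply: neg; [lra|apply/ltW/above; rewrite sx ltW].
by move=> h /(_ h); lra.
Qed.

(** The same, when the derivative is only known to be negative in a band
    above the level. *)
Lemma stays_below_band y dy (a a' T : R) : a < a' ->
  (forall x : R, T <= x -> {for x, continuous y}) ->
  (forall t : R, T < t -> is_derive t 1 y (dy t)) ->
  (forall t : R, T < t -> a <= y t -> y t <= a' -> dy t <= 0) -> y T <= a ->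
  forall t, T <= t -> y t <= a.
Proof.
move=> aa cy der neg yT t Tt; rewrite leNgt; apply/negP => yt.
have [s /andP[Ts st] [ys above]] := last_time_below cy Tt yT yt.
have e0 : 0 < a' - a by lra.
have [d d0 hd] := (contP y s).1 (cy s Ts) _ e0.
pose t' := Num.min t (s + d / 2).
have st' : s < t' by rewrite lt_min st/=; lra.
have t't : t' <= t by rewrite ge_min lexx.
have t'd : t' <= s + d / 2 by rewrite ge_min lexx orbT.
have d1 (x : R) : s < x < t' -> is_derive x 1 y (dy x).
  by move=> /andP[sx xt]; apply: der; lra.
have c1 (x : R) : s <= x <= t' -> {for x, continuous y}.
  by move=> /andP[sx xt]; apply: cy; lra.
have h (x : R) : s < x < t' -> dy x <= 0.
  move=> /andP[sx xt]; apply: neg; [lra|by apply/ltW/above; rewrite sx; lra|].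
  have := hd x; rewrite ger0_norm; last by lra.
  by move=> /(_ ltac:(lra)); rewrite ler_norml => /andP[_]; lra.
have := incr_bound (ltW st') d1 c1 h; rewrite mul0r.
by have := above t'; rewrite st' t't => /(_ isT); lra.
Qed.

Lemma eventually_below y dy (a c T : R) : 0 < c ->
  (forall x : R, T <= x -> {for x, continuous y}) ->
  (forall t : R, T < t -> is_derive t 1 y (dy t)) ->
  (forall t : R, T < t -> a <= y t -> dy t <= - c) ->
  exists2 T', T <= T' & forall t, T' <= t -> y t <= a.
Proof.
move=> c0 cy der neg; have [yT|yT] := leP (y T) a.
  exists T => // t Tt; apply: (stays_below cy der _ yT Tt) => s Ts /(neg s Ts); lra.
pose T1 := T + (y T - a) / c.
have T1T : T <= T1 by rewrite /T1 lerDl divr_ge0 ?(ltW c0)//; lra.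
have [s /andP[Ts sT1] ys] : exists2 s, T <= s <= T1 & y s <= a.
  apply: contrapT => none.
  have above (x : R) : T <= x <= T1 -> a < y x.
    by move=> xT; rewrite ltNge; apply/negP => yx; apply: none; exists x.
  have := @incr_bound _ y dy T T1 (- c) T1T.
  have d1 (x : R) : T < x < T1 -> is_derive x 1 y (dy x) by move=> /andP[h _]; exact: der.
  have c1 (x : R) : T <= x <= T1 -> {for x, continuous y} by move=> /andP[h _]; exact: cy.
  move=> /(_ d1 c1).
  have h : forall x : R, T < x < T1 -> dy x <= - c.
    by move=> x /andP[Tx xT]; apply: neg => //; apply/ltW/above; rewrite !ltW.
  move=> /(_ h); have := above T1; rewrite lexx T1T => /(_ isT).
  have -> : - c * (T1 - T) = - (y T - a) by rewrite /T1; field; rewrite gt_eqF.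
  by lra.
exists s => // t st.
have der' (x : R) : s < x -> is_derive x 1 y (dy x) by move=> sx; apply: der; lra.
have cy' (x : R) : s <= x -> {for x, continuous y} by move=> sx; apply: cy; lra.
apply: (stays_below cy' der' _ ys st) => x sx /(neg x); have Tx : T < x by lra.
by move=> /(_ Tx); lra.
Qed.

(** Quadratic absorption forgets the initial value: as long as y >= a, its
    inverse grows at least at the rate C. *)
Lemma quadratic_absorption y dy (a C : R) : 0 < a -> 0 < C ->
  (forall x : R, 0 <= x -> {for x, continuous y}) ->
  (forall t : R, 0 < t -> is_derive t 1 y (dy t)) ->
  (forall t : R, 0 < t -> a <= y t -> dy t <= - C * y t ^+ 2) ->
  forall t, 0 < t -> 1 <= a * (C * t) -> y t <= a.
Proof.
move=> a0 C0 cy der neg t t0 aCt; rewrite leNgt; apply/negP => yt.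
have above (x : R) : 0 <= x <= t -> a < y x.
  move=> /andP[x0 xt]; rewrite ltNge; apply/negP => yx.
  have der' (s : R) : x < s -> is_derive s 1 y (dy s) by move=> sx; apply: der; lra.
  have cy' (s : R) : x <= s -> {for s, continuous y} by move=> sx; apply: cy; lra.
  have := stays_below cy' der' _ yx xt => h.
  suff : y t <= a by lra.
  apply: h => s xs /(neg s); have s0 : 0 < s by lra.
  by move=> /(_ s0) /le_trans; apply; rewrite mulNr oppr_le0 mulr_ge0 ?(ltW C0)// sqr_ge0.
have pos (x : R) : 0 <= x <= t -> 0 < y x by move=> /above; lra.
have := @incr_bound _ (fun x => - (y x)^-1) (fun x => dy x / y x ^+ 2) 0 t (- C) (ltW t0).
have d1 (x : R) : 0 < x < t -> is_derive x 1 (fun x => - (y x)^-1) (dy x / y x ^+ 2).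
  move=> /andP[x0 xt]; have yx : 0 < y x by apply: pos; rewrite !ltW.
  by have h := derN (derV (lt0r_neq0 yx) (der x x0)); apply: (derE h); rewrite mulNr opprK.
have c1 (x : R) : 0 <= x <= t -> {for x, continuous (fun x => - (y x)^-1)}.
  move=> xt; have yx := pos x xt.
  by apply: continuousN; apply: continuousV; [exact: lt0r_neq0|apply: cy; case/andP: xt].
have h (x : R) : 0 < x < t -> dy x / y x ^+ 2 <= - C.
  move=> /andP[x0 xt]; have yx : a < y x by apply: above; rewrite !ltW.
  by rewrite ler_pdivrMr ?exprn_gt0//; [apply: neg => //; exact: ltW|lra].
move=> /(_ d1 c1 h); rewrite opprK subr0.
have y0 : 0 < y 0 by apply: pos; rewrite lexx ltW.
have : 0 < (y 0)^-1 by rewrite invr_gt0.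
have : (y t)^-1 < a^-1 by rewrite ltf_pV2 ?posrE//; lra.
have : a^-1 <= C * t by rewrite -[leLHS]mulr1 ler_pdivrMl.
by lra.
Qed.

End scalar_comparison.

Section ramps.
Context {R : realType}.
Implicit Types s n : R.

Definition clip s : R := Num.max s 0 - Num.max (s - 1) 0.

Definition ramp s : R := Num.max s 0 ^+ 2 / 2 - Num.max (s - 1) 0 ^+ 2 / 2.

Lemma der_pos_sqr s : is_derive s 1 (fun x : R => Num.max x 0 ^+ 2 / 2) (Num.max s 0).
Proof.
apply/derP => e e0; exists e => // y ys.
have -> : Num.max y 0 ^+ 2 / 2 - Num.max s 0 ^+ 2 / 2 - Num.max s 0 * (y - s) =
  (Num.max y 0 - Num.max s 0) ^+ 2 / 2 + Num.max s 0 * (Num.max y 0 - y - (Num.max s 0 - s)).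
  by field.
have [s0|s0] := leP s 0; have [y0|y0] := leP y 0.
- by rewrite !subrr expr2 !mul0r addr0 normr0 mulr_ge0// ltW.
- rewrite subr0 mul0r addr0 ger0_norm; last by rewrite divr_ge0// sqr_ge0.
  rewrite ger0_norm in ys *; try lra.
  by rewrite expr2; nra.
- rewrite subrr subr0 sub0r sqrrN ler0_norm in ys *; try lra.
  rewrite ger0_norm; first by rewrite expr2; nra.
  by rewrite expr2; nra.
- rewrite !subrr mulr0 addr0 ger0_norm; last by rewrite divr_ge0// sqr_ge0.
  rewrite -(real_normK (num_real (y - s))).
  by have := normr_ge0 (y - s); rewrite !expr2; nra.
Qed.

Lemma der_ramp s : is_derive s 1 ramp (clip s).
Proof.
have d1 : is_derive s 1 (fun x : R => x - 1) 1.
  by apply: (derE (derB (derI s) (derC 1 s))); rewrite subr0.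
have h := der_comp (f := fun x : R => Num.max x 0 ^+ 2 / 2) (g := fun x => x - 1)
  (der_pos_sqr (s - 1)) d1.
by apply: (derE (derB (der_pos_sqr s) h)); rewrite mulr1.
Qed.

Lemma clip_cont s : {for s, continuous clip}.
Proof.
apply/contP => e e0; exists (e / 2); first by lra.
move=> y ys; rewrite /clip.
have h (x z : R) : `|Num.max x 0 - Num.max z 0| <= `|x - z| by exact: clamp_dist.
have -> : Num.max y 0 - Num.max (y - 1) 0 - (Num.max s 0 - Num.max (s - 1) 0) =
  (Num.max y 0 - Num.max s 0) - (Num.max (y - 1) 0 - Num.max (s - 1) 0) by ring.
have h1 := h y s; have := h (y - 1) (s - 1).
have -> : y - 1 - (s - 1) = y - s by ring.
by move=> h2; rewrite (le_trans (ler_normB _ _))//; lra.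
Qed.

Lemma clip_bounds s : 0 <= clip s <= 1.
Proof. by rewrite /clip; case: (leP s 0); case: (leP (s - 1) 0); lra. Qed.

Lemma clip_incr s s' : s <= s' -> clip s <= clip s'.
Proof.
by rewrite /clip; case: (leP s 0); case: (leP (s - 1) 0); case: (leP s' 0);
  case: (leP (s' - 1) 0); lra.
Qed.

Lemma clip0 s : s <= 0 -> clip s = 0.
Proof. by rewrite /clip; case: (leP s 0); case: (leP (s - 1) 0); lra. Qed.

Lemma clip1 s : 1 <= s -> clip s = 1.
Proof. by rewrite /clip; case: (leP s 0); case: (leP (s - 1) 0); lra. Qed.

Lemma ramp0 s : s <= 0 -> ramp s = 0.
Proof.
by move=> s0; rewrite /ramp !max_r ?expr0n ?mul0r ?subrr//; lra.
Qed.

Lemma ramp_lin s : 1 <= s -> ramp s = s - 1 / 2.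
Proof. by move=> s1; rewrite /ramp !max_l; [field|lra|lra]. Qed.

Lemma ramp_bounds s : Num.max (s - 1 / 2) 0 <= ramp s <= Num.max s 0.
Proof.
by rewrite /ramp; case: (leP s 0); case: (leP (s - 1) 0); case: (leP (s - 1 / 2) 0);
  rewrite ?expr2; nra.
Qed.

Lemma ramp_incr s s' : s <= s' -> ramp s <= ramp s'.
Proof.
move=> ss; rewrite -subr_ge0 -oppr_le0 opprB.
have d (x : R) : s < x < s' -> is_derive x 1 (fun x => - ramp x) (- clip x).
  by move=> _; exact: derN (der_ramp x).
have c (x : R) : s <= x <= s' -> {for x, continuous (fun x => - ramp x)}.
  by move=> _; exact: is_derive_cont (derN (der_ramp x)).
have := @incr_bound _ (fun x => - ramp x) (fun x => - clip x) s s' 0 ss d c.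
rewrite mul0r; have h (x : R) : s < x < s' -> - clip x <= 0.
  by move=> _; have /andP[] := clip_bounds x; lra.
by move=> /(_ h); lra.
Qed.

(** A smooth unit step, and the identity shifted by one and made constant
    beyond [n]. *)
Definition step s : R := ramp s - ramp (s - 1).
Definition plateau n s : R := ramp (s - 1) - ramp (s - n).

Lemma der_shifted c s : is_derive s 1 (fun x => ramp (x - c)) (clip (s - c)).
Proof.
have d1 : is_derive s 1 (fun x : R => x - c) 1.
  by apply: (derE (derB (derI s) (derC c s))); rewrite subr0.
by apply: (derE (der_comp (f := ramp) (g := fun x => x - c) (der_ramp _) d1)); rewrite mulr1.
Qed.

Lemma der_step s : is_derive s 1 step (clip s - clip (s - 1)).
Proof. exact: derB (der_ramp s) (der_shifted 1 s). Qed.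

Lemma der_plateau n s : is_derive s 1 (plateau n) (clip (s - 1) - clip (s - n)).
Proof. exact: derB (der_shifted 1 s) (der_shifted n s). Qed.

Lemma step_bounds s : 0 <= step s <= 1.
Proof.
rewrite /step subr_ge0 ramp_incr ?gerBl//=.
have /andP[h1 h2] := ramp_bounds s; have /andP[h3 h4] := ramp_bounds (s - 1).
have [s1|s1] := leP 1 s; last first.
  by rewrite [ramp (s - 1)]ramp0; [move: h2; case: (leP s 0); lra|lra].
rewrite ramp_lin//; have [s2|s2] := leP 2 s; first by rewrite ramp_lin; lra.
have -> : ramp (s - 1) = (s - 1) ^+ 2 / 2.
  rewrite /ramp max_l; last by lra.
  by rewrite max_r ?expr0n/= ?mul0r ?subr0//; lra.
by rewrite expr2; nra.
Qed.

Lemma step0 s : s <= 0 -> step s = 0.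
Proof. by move=> s0; rewrite /step !ramp0 ?subrr//; lra. Qed.

Lemma step1 s : 2 <= s -> step s = 1.
Proof. by move=> s2; rewrite /step !ramp_lin; lra. Qed.

Lemma plateau0 n s : 1 <= n -> s <= 1 -> plateau n s = 0.
Proof. by move=> n1 s0; rewrite /plateau !ramp0 ?subrr//; lra. Qed.

Lemma plateau_max n s : 1 <= n -> n + 1 <= s -> plateau n s = n - 1.
Proof. by move=> n1 s2; rewrite /plateau !ramp_lin; lra. Qed.

Lemma plateau_incr n s s' : 1 <= n -> s <= s' -> plateau n s <= plateau n s'.
Proof.
move=> n1 ss; rewrite -subr_ge0 -oppr_le0 opprB.
have dN (x : R) : is_derive x 1 (fun x => - plateau n x) (- (clip (x - 1) - clip (x - n))).
  exact: derN (der_plateau n x).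
have := @incr_bound _ (fun x => - plateau n x) (fun x => - (clip (x - 1) - clip (x - n)))
  s s' 0 ss (fun x _ => dN x) (fun x _ => is_derive_cont (dN x)).
rewrite mul0r; have h (x : R) : s < x < s' -> - (clip (x - 1) - clip (x - n)) <= 0.
  by move=> _; rewrite oppr_le0 subr_ge0 clip_incr//; lra.
by move=> /(_ h); lra.
Qed.

Lemma plateau_ge0 n s : 1 <= n -> 0 <= plateau n s.
Proof.
move=> n1; have [s1|s1] := leP s 1; first by rewrite plateau0.
by rewrite -(plateau0 n1 (lexx 1)) plateau_incr// ltW.
Qed.

Lemma plateau_leB n s : 1 <= n -> plateau n s <= Num.max (s - 1) 0.
Proof.
move=> n1; have /andP[_ h1] := ramp_bounds (s - 1); have /andP[h2 _] := ramp_bounds (s - n).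
have : 0 <= Num.max (s - n - 1 / 2) 0 by rewrite le_max lexx orbT.
by rewrite /plateau; lra.
Qed.

Lemma plateau_le n s : 1 <= n -> plateau n s <= n - 1.
Proof.
move=> n1; have [s1|s1] := leP (n + 1) s; first by rewrite plateau_max.
by rewrite -(plateau_max n1 (lexx (n + 1))) plateau_incr// ltW.
Qed.

Lemma plateau_ge n s : 1 <= n -> s <= n -> s - 3 / 2 <= plateau n s.
Proof.
move=> n1 sn; rewrite /plateau [ramp (s - n)]ramp0; last by lra.
have /andP[h1 _] := ramp_bounds (s - 1).
have : s - 1 - 1 / 2 <= Num.max (s - 1 - 1 / 2) 0 by rewrite le_max lexx.
by lra.
Qed.

Lemma dplateau_bounds n s : 1 <= n -> 0 <= clip (s - 1) - clip (s - n) <= 1.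
Proof.
move=> n1; have := @clip_incr (s - n) (s - 1).
have /andP[h1 h2] := clip_bounds (s - 1); have /andP[h3 h4] := clip_bounds (s - n).
by move=> /(_ ltac:(lra)); lra.
Qed.

Lemma dplateau0 n s : 1 <= n -> ~~ (1 <= s <= n + 1) -> clip (s - 1) - clip (s - n) = 0.
Proof.
move=> n1; rewrite negb_and -!ltNge => /orP[s1|sn].
  by rewrite !clip0 ?subrr//; lra.
by rewrite !clip1 ?subrr//; lra.
Qed.

End ramps.

Section test_criterion.
Context {R : realType}.

(** Powers are singular at 0, so differentiability is asked on the open
    half-line; near 0 the function vanishes. *)
Lemma test_function_intro (phi dphi : R -> R) (e b : R) : 0 < e ->
  (forall x : R, 0 < x -> is_derive x 1 phi (dphi x)) ->
  (forall x : R, 0 < x -> {for x, continuous dphi}) ->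
  (forall x : R, x < e -> phi x = 0) -> (forall x : R, b < x -> phi x = 0) ->
  test_function phi /\ forall x : R, 0 < x -> derive1 phi x = dphi x.
Proof.
move=> e0 d1 c1 z0 zb.
have near0 (x : R) : x < e -> \forall y \near x, y < e by exact: lt_nbhsl.
have dz (x : R) : x < e -> is_derive x 1 phi 0.
  move=> xe; apply: (der_near _ (derC 0 x)).
  by apply: filterS (near0 x xe) => y ye; rewrite z0.
have val (x : R) : 0 < x -> derive1 phi x = dphi x.
  by move=> x0; rewrite derive1E; apply: derive_val; exact: d1.
have val0 (x : R) : x < e -> derive1 phi x = 0.
  by move=> x0; rewrite derive1E; apply: derive_val; exact: dz.
split=> //; split.
- move=> x; have [x0|x0] := ltP 0 x; first by have [] := d1 x x0.
  by have [] := dz x (le_lt_trans x0 e0).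
- move=> x; have [x0|x0] := ltP 0 x.
    have nt : \forall s \near x, 0 < s by exact: lt_nbhsr.
    have h : \forall s \near x, dphi s = derive1 phi s by apply: filterS nt => s s0; rewrite val.
    by rewrite /continuous_at val//; exact: cvg_trans (near_eq_cvg h) (c1 x x0).
  have xe := le_lt_trans x0 e0.
  have h : \forall s \near x, (fun=> 0 : R) s = derive1 phi s.
    by apply: filterS (near0 x xe) => s s0; rewrite val0.
  by rewrite /continuous_at val0//; apply: cvg_trans (near_eq_cvg h) _; exact: cvg_cst.
- exists e, b; split=> // x; apply: contraNT; rewrite negb_and -!ltNge => /orP[/z0 ->//|/zb ->//].
Qed.

End test_criterion.

(** * A test function for the tail *)

Section indicators.
Context {R : realType}.
Local Notation D := (`]0, +oo[%classic : set R).
Implicit Types f : R -> R.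

Lemma one_powR (c : R) : 1 `^ c = 1 :> R.
Proof. by rewrite powR1. Qed.

Lemma powR_le (c x y : R) : 0 <= c -> 0 <= x -> x <= y -> x `^ c <= y `^ c.
Proof. by move=> c0 x0 xy; apply: ge0_ler_powR; rewrite ?nnegrE// (le_trans x0). Qed.

Lemma measurable_ind_ge X f : measurable_fun D f ->
  measurable_fun D (fun x => (X <= f x)%R%:R : R).
Proof.
move=> mf; have -> : (fun x => (X <= f x)%R%:R : R) = \1_(`[X, +oo[%classic) \o f.
  by apply/funext => x /=; rewrite indicE mem_setE in_itv/= andbT.
by apply: measurableT_comp => //; exact: measurable_indic.
Qed.

Lemma measurable_ind_le X f : measurable_fun D f ->
  measurable_fun D (fun x => (f x <= X)%R%:R : R).
Proof.
move=> mf; have -> : (fun x => (f x <= X)%R%:R : R) = \1_(`]-oo, X]%classic) \o f.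
  by apply/funext => x /=; rewrite indicE mem_setE in_itv/=.
by apply: measurableT_comp => //; exact: measurable_indic.
Qed.

Lemma integralp_interval (a b : R) : 0 <= a -> a <= b ->
  integrablep (fun z => ((a <= z) && (z <= b))%:R) /\
  integralp (fun z => ((a <= z) && (z <= b))%:R) = b - a.
Proof.
move=> a0 ab; have E : (fun z => ((a <= z) && (z <= b))%:R : R) = \1_(`[a, b]%classic).
  by apply/funext => x /=; rewrite indicE mem_setE in_itv/=.
have mI : measurable (`[a, b]%classic : set (measurableTypeR R)) by exact: measurable_itv.
split.
  apply: (@integrablep_bounded_support _ _ 1 b) => //; first exact: le_trans ab.
  - by rewrite E; exact: measurable_funTS (measurable_indic mI).
  - by move=> x x0; rewrite normr_nat lern1 leq_b1.
  - by move=> x bx; rewrite [x <= b]leNgt bx andbF.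
rewrite E /integralp /Rintegral (integral_indic _ (mD (R := R)) mI).
have [->|an0] := eqVneq a 0.
  have -> : `[0, b]%classic `&` D = `]0, b]%classic.
    apply/seteqP; split=> x /=; rewrite !in_itv/= ?andbT.
      by move=> [/andP[_ ->] ->].
    by move=> /andP[x0 ->]; rewrite x0 ltW.
  have := @lebesgue_measure_itv R `]0, b]; rewrite /= lte_fin => ->; case: ltP => //= b0.
  by rewrite subr0; apply/eqP; rewrite eq_sym eq_le b0/=; exact: le_trans ab.
have -> : `[a, b]%classic `&` D = `[a, b]%classic.
  apply/seteqP; split=> x /=; first by move=> [].
  rewrite !in_itv/= andbT => /andP[ax ->]; rewrite ax; split=> //.
  by apply: lt_le_trans ax; rewrite lt_neqAle eq_sym an0.
have := @lebesgue_measure_itv R `[a, b]; rewrite /= lte_fin => ->; case: ltP => //= b0.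
by apply/eqP; rewrite eq_sym subr_eq0 eq_le b0 ab.
Qed.

End indicators.

Section small_fragments.
Context {R : realType} {beta gamma : R} {kappa : R -> R} {k1 k2 : R}.
Hypothesis fk : frag_kernel beta gamma kappa k1 k2.
Local Notation D := (`]0, +oo[%classic : set R).

Lemma integrable_kap_id : integrablep (fun z => kap kappa z * z).
Proof.
apply: (integrable_kapM fk ler01) => // z /andP[z0 z1].
by rewrite ger0_norm ltW.
Qed.

Lemma measurable_id_le (s : R) : measurable_fun D (fun z => z * (z <= s)%R%:R : R).
Proof. by apply: measurable_funM => //; exact: measurable_ind_le. Qed.

Lemma integrable_small s : integrablep (fun z => kap kappa z * (z * (z <= s)%R%:R)).
Proof.
apply: (integrable_kapM fk ler01); first exact: measurable_id_le.
move=> z /andP[z0 z1]; rewrite normrM normr_nat ger0_norm ?(ltW z0)//.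
by case: (z <= s); rewrite ?mulr1 ?mulr0// ltW.
Qed.

(** The mass carried by the fragments smaller than a fraction s of their
    parent is O(s^2), hence O(s^gamma). *)
Lemma small_fragments (s : R) : 0 < s ->
  integralp (fun z => kap kappa z * (z * (z <= s)%R%:R)) <= (1 + k2) * s `^ gamma.
Proof.
move=> s0; have k20 := fk_k2 fk; have /andP[g0 g2] := fk_gamma fk.
have sg0 : 0 <= s `^ gamma by exact: powR_ge0.
have [s1|s1] := leP 1 s.
  apply: (@le_trans _ _ (integralp (fun z => kap kappa z * z))).
    apply: le_integralp; [exact: integrable_small|exact: integrable_kap_id|].
    move=> z z0; rewrite ler_wpM2l ?(kap_ge0 fk)//.
    by case: (z <= s); rewrite ?mulr1 ?mulr0// ltW.
  rewrite (kap_mass fk); have : 1 <= s `^ gamma.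
    by rewrite -[leLHS](one_powR gamma); apply: ge0_ler_powR; rewrite ?nnegrE// ltW.
  by nra.
have [i1 e1] := integralp_interval (lexx 0) (ltW s0).
apply: (@le_trans _ _ (k2 * s * s)).
  rewrite -[X in _ * X]subr0 -e1 -(integralpZ _ i1).
  apply: le_integralp; [exact: integrable_small|exact: integrablepZ|].
  move=> z z0; rewrite (ltW z0)/=; case: (leP z s) => zs; rewrite ?mulr0// !mulr1.
  by apply: ler_pM; rewrite ?(kap_ge0 fk) ?(kap_le fk)// ltW.
have : s * s <= s `^ gamma.
  have -> : s * s = s `^ 2 by rewrite powR_mulrn ?(ltW s0)// expr2.
  by apply: ger_powR => //; rewrite s0 ltW.
by nra.
Qed.

Definition half_fragments : R :=
  integralp (fun z => kap kappa z * (z * (z <= 2^-1)%R%:R)).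

(** The lower bound on the kernel makes a definite part of the mass go to
    fragments of at most half the size: this is what drives the tail down. *)
Lemma half_fragments_gt0 : 0 < half_fragments.
Proof.
have k10 := fk_k1 fk.
have [i1 e1] := @integralp_interval R 4^-1 2^-1 ltac:(lra) ltac:(lra).
apply: (@lt_le_trans _ _ (k1 / 4 * (2^-1 - 4^-1))); first by rewrite mulr_gt0 ?divr_gt0//; lra.
rewrite -e1 -(integralpZ _ i1); apply: le_integralp; [exact: integrablepZ|exact: integrable_small|].
move=> z z0; case: (leP z 2^-1) => z2; rewrite ?andbF ?mulr0// andbT mulr1.
case: (leP 4^-1 z) => z4; rewrite ?mulr0 ?mulr1; last by rewrite mulr_ge0 ?(kap_ge0 fk)// ltW.
have := @kap_lb _ _ _ _ _ _ fk z; rewrite z0/= => /(_ ltac:(lra)).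
by nra.
Qed.

End small_fragments.

Arguments half_fragments {R} kappa.

Section tail_test.
Context {R : realType} {beta gamma : R} {kappa : R -> R} {k1 k2 : R}.
Hypothesis fk : frag_kernel beta gamma kappa k1 k2.
Variables (q a n eps : R).
Hypotheses (q0 : 0 < q) (a1 : 1 <= a) (eps0 : 0 < eps) (eps3 : 3 * eps <= 1).

Definition halving_ratio : R := 2^-1 `^ q.
(** From this multiple of a on, halving a size x lowers the plateau at x^q/a by
    at least half of the change of x^q/a itself. *)
Definition low_cut : R := 3 / (1 - halving_ratio).
Hypothesis nN : low_cut <= n.
Local Notation D := (`]0, +oo[%classic : set R).
Local Notation theta := halving_ratio.
Local Notation N := low_cut.

Lemma halving_ratio_bounds : 0 < theta < 1.
Proof.
rewrite powR_gt0 ?invr_gt0//=; rewrite /theta -{2}[1](one_powR q).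
by apply: gt0_ltr_powR; rewrite ?nnegrE ?invr_ge0// invf_lt1// ltr1n.
Qed.

Lemma low_cut_ge3 : 3 <= N.
Proof.
have /andP[h1 h2] := halving_ratio_bounds.
by rewrite /low_cut ler_pdivlMr; lra.
Qed.

Let a0 : 0 < a. Proof. exact: lt_le_trans ltr01 a1. Qed.
Let n3 : 3 <= n. Proof. exact: le_trans low_cut_ge3 nN. Qed.
Let n1 : 1 <= n. Proof. by have := n3; lra. Qed.

Definition top_level : R := a * (n - 1).
Local Notation k := top_level.

Definition tail_slope (x : R) : R :=
  k * step (x / eps - 1) - a * plateau n (x `^ q / a).

(** The test function behind the moment of order q + 1 of the tail: up to the
    multiple k of the mass, it is roughly minus x^{q+1}, cut off below a^{1/q}
    and made linear beyond (n a)^{1/q}; near the origin it is bent to have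
    compact support. *)
Definition tail_test (x : R) : R := x * tail_slope x.

Let dslope (x : R) : R :=
  k / eps * (clip (x / eps - 1) - clip (x / eps - 2)) -
  q * x `^ (q - 1) * (clip (x `^ q / a - 1) - clip (x `^ q / a - n)).

Lemma der_tail_slope (x : R) : 0 < x -> is_derive x 1 tail_slope (dslope x).
Proof.
move=> x0; have d1 : is_derive x 1 (fun x => x / eps - 1) eps^-1.
  apply: (derE (derB (derM (derI x) (derC eps^-1 x)) (derC 1 x))).
  by rewrite mul1r mulr0 addr0 subr0.
have d2 : is_derive x 1 (fun x => x `^ q / a) (q * x `^ (q - 1) / a).
  apply: (derE (derM (der_pow (f := fun x => x) q x0 (derI x)) (derC a^-1 x))).
  by rewrite mulr1 mulr0 addr0.
have h1 := derZ k (der_comp (f := step) (g := fun x => x / eps - 1) (der_step _) d1).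
have h2 := derZ a (der_comp (f := plateau n) (g := fun x => x `^ q / a) (der_plateau n _) d2).
apply: (derE (derB h1 h2)); rewrite /dslope.
have -> : x / eps - 1 - 1 = x / eps - 2 by ring.
by field; rewrite !gt_eqF.
Qed.

Lemma tail_slope_small (x : R) : x < eps -> tail_slope x = 0.
Proof.
move=> xe; rewrite /tail_slope step0; last by rewrite subr_le0 ler_pdivrMr// mul1r ltW.
rewrite plateau0// ?mulr0 ?subr0// ler_pdivrMr// mul1r (le_trans _ a1)//.
have [x0|x0] := leP 0 x.
  by rewrite -[leRHS](one_powR q); apply: powR_le => //; [exact: ltW|have := eps3; lra].
by rewrite /powR lt_eqF// ln0 ?(ltW x0)// mulr0 expR0.
Qed.

Lemma tail_slope_large (x : R) : Num.max 1 (((n + 1) * a) `^ q^-1) < x -> tail_slope x = 0.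
Proof.
rewrite gt_max => /andP[x1 xn]; have x0 : 0 < x by lra.
have na : 0 <= (n + 1) * a by rewrite mulr_ge0 ?(ltW a0)//; have := n1; lra.
rewrite /tail_slope step1; last first.
  rewrite lerBrDr ler_pdivlMr//; have := eps3; lra.
rewrite plateau_max//; first by rewrite mulr1 subrr.
rewrite ler_pdivlMr// -[leLHS](powRr1 na) -[X in _ `^ X <= _](@mulVf _ q) ?gt_eqF// powRrM.
by apply: powR_le; [exact: ltW|exact: powR_ge0|exact: ltW].
Qed.

Lemma tail_testP : test_function tail_test /\
  forall x : R, 0 < x -> derive1 tail_test x = tail_slope x + x * dslope x.
Proof.
apply: (@test_function_intro R tail_test (fun x => tail_slope x + x * dslope x) eps
  (Num.max 1 (((n + 1) * a) `^ q^-1)) eps0).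
- move=> x x0; apply: (derE (derM (derI x) (der_tail_slope x0))); by rewrite mul1r.
- move=> x x0; have cpow (c : R) : {for x, continuous (fun y : R => y `^ c)}.
    exact: is_derive_cont (der_pow (f := fun x => x) c x0 (derI x)).
  have cclip (f : R -> R) : {for x, continuous f} -> {for x, continuous (fun y => clip (f y))}.
    by move=> cf; apply: (continuous_comp (f := f) cf); exact: clip_cont.
  have clin c : {for x, continuous (fun y : R => y / eps - c)}.
    apply: continuousB; last exact: cst_continuous.
    by apply: continuousM; [exact: cvg_id|exact: cst_continuous].
  have cs c : {for x, continuous (fun y : R => y `^ q / a - c)}.
    apply: continuousB; last exact: cst_continuous.
    by apply: continuousM; [exact: cpow|exact: cst_continuous].
  apply: continuousD; first exact: is_derive_cont (der_tail_slope x0).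
  apply: continuousM; first exact: cvg_id.
  apply: continuousB.
    apply: continuousM; first exact: cst_continuous.
    by apply: continuousB; apply: cclip.
  apply: continuousM; last by apply: continuousB; apply: cclip.
  by apply: continuousM; [exact: cst_continuous|exact: cpow].
- by move=> x xe; rewrite /tail_test tail_slope_small ?mulr0.
- by move=> x xe; rewrite /tail_test tail_slope_large ?mulr0.
Qed.

(** Indicator of the middle range of sizes, and the weights X x on the sizes
    beyond X^{1/q}, which the distance in H controls uniformly in X. *)
Definition middle (x : R) : R := (N * a <= x `^ q)%R%:R * (x `^ q <= n * a)%R%:R.
Definition tail_weight (X x : R) : R := X * (x * (X <= x `^ q)%R%:R).

Lemma middleP (x : R) : (middle x = 1 /\ N * a <= x `^ q <= n * a) \/
  (middle x = 0 /\ ~~ (N * a <= x `^ q <= n * a)).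
Proof.
rewrite /middle; case: (N * a <= _); case: (_ <= n * a); rewrite ?mulr1 ?mulr0;
  by [left|right].
Qed.

Lemma pow_split (x : R) : 0 < x -> x `^ (q + 1) = x * x `^ q.
Proof.
by move=> x0; rewrite addrC powRD ?(gt_eqF x0) ?implybT// powRr1// ltW.
Qed.

Lemma tail_weight_ge0 (X x : R) : 0 <= X -> 0 < x -> 0 <= tail_weight X x.
Proof. by move=> X0 x0; rewrite !mulr_ge0// ltW. Qed.

Lemma outside_middle (x : R) : 0 < x -> a <= x `^ q <= (n + 1) * a ->
  x `^ (q + 1) <= x `^ (q + 1) * middle x + (N * tail_weight a x + 2 * tail_weight (n * a) x).
Proof.
move=> x0 /andP[sa sn]; have w1 := tail_weight_ge0 (ltW a0) x0.
have na0 : 0 <= n * a by rewrite mulr_ge0 ?(ltW a0)//; have := n1; lra.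
have w2 := tail_weight_ge0 na0 x0; have N3 := low_cut_ge3.
have Nw1 : 0 <= N * tail_weight a x by rewrite mulr_ge0//; lra.
case: (middleP x) => [[-> _]|[-> /negP h]].
  by rewrite mulr1 lerDl addr_ge0// mulr_ge0.
rewrite mulr0 add0r pow_split//.
have [sN|sN] := leP (x `^ q) (N * a).
  apply: (@le_trans _ _ (N * tail_weight a x)); last by rewrite lerDl mulr_ge0.
  by rewrite /tail_weight sa mulr1 mulrA [leRHS]mulrC ler_pM2l.
apply: (@le_trans _ _ (2 * tail_weight (n * a) x)); last by rewrite lerDr.
have nx : n * a <= x `^ q by rewrite leNgt; apply/negP => xn; apply: h; rewrite !ltW.
rewrite /tail_weight nx mulr1 mulrA [leRHS]mulrC ler_pM2l// (le_trans sn)//.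
by rewrite mulrA ler_pM2r//; have := n1; lra.
Qed.

(** Transport moves the tail weight by at most q times itself. *)
Lemma tail_transport (x : R) : 0 < x ->
  - (x * derive1 tail_test x - tail_test x) <=
  q * (x `^ (q + 1) * middle x + (N * tail_weight a x + 2 * tail_weight (n * a) x)).
Proof.
move=> x0; rewrite (tail_testP.2 x x0) /tail_test.
have -> : - (x * (tail_slope x + x * dslope x) - x * tail_slope x) = - (x ^+ 2 * dslope x) by ring.
rewrite /dslope; set s := x `^ q / a.
have k0 : 0 <= k / eps by rewrite divr_ge0 ?(ltW eps0)// mulr_ge0 ?(ltW a0)//; have := n1; lra.
have st0 : 0 <= clip (x / eps - 1) - clip (x / eps - 2) by rewrite subr_ge0 clip_incr//; lra.
have /andP[d0 d1] := dplateau_bounds s n1.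
set dp := clip (s - 1) - clip (s - n) in d0 d1 *.
have E : x ^+ 2 * (q * x `^ (q - 1) * dp) = q * (x `^ (q + 1) * dp).
  have -> : x `^ (q + 1) = x ^+ 2 * x `^ (q - 1).
    by rewrite -powR_mulrn ?(ltW x0)// -powRD ?(gt_eqF x0) ?implybT//; congr (_ `^ _); ring.
  by ring.
rewrite mulrBr E; have : 0 <= x ^+ 2 * (k / eps * (clip (x / eps - 1) - clip (x / eps - 2))).
  by rewrite mulr_ge0 ?sqr_ge0// mulr_ge0.
set z := x ^+ 2 * _ => z0.
suff : q * (x `^ (q + 1) * dp) <=
  q * (x `^ (q + 1) * middle x + (N * tail_weight a x + 2 * tail_weight (n * a) x)) by lra.
rewrite ler_pM2l//; have [hs|hs] := boolP (1 <= s <= n + 1); last first.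
  rewrite /dp dplateau0// mulr0 addr_ge0 ?mulr_ge0 ?powR_ge0//.
  have na0 : 0 <= n * a by rewrite mulr_ge0 ?(ltW a0)//; have := n1; lra.
  have w1 := tail_weight_ge0 (ltW a0) x0; have w2 := tail_weight_ge0 na0 x0.
  by have N3 := low_cut_ge3; rewrite addr_ge0// mulr_ge0//; lra.
apply: (@le_trans _ _ (x `^ (q + 1))); first by rewrite ler_piMr ?powR_ge0.
by apply: outside_middle => //; move: hs; rewrite /s ler_pdivlMr// ler_pdivrMr// mul1r.
Qed.

(** The slope is nonincreasing apart from the bend at the origin, which is only
    seen by fragments smaller than 3 eps; and on the middle range, fragments of
    at most half the size have a slope larger by a definite part of x^q. *)
Lemma slope_gap (x z : R) : 0 < x -> 0 < z < 1 ->
  tail_slope x - tail_slope (z * x) <= k * (z <= 3 * eps / x)%R%:R -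
    (1 - theta) / 2 * (x `^ q * middle x) * (z <= 2^-1)%R%:R.
Proof.
move=> x0 /andP[z0 z1]; have zx0 : 0 < z * x by rewrite mulr_gt0.
have k0 : 0 <= k by rewrite mulr_ge0 ?(ltW a0)//; have := n1; lra.
have h1 : k * step (x / eps - 1) - k * step (z * x / eps - 1) <= k * (z <= 3 * eps / x)%R%:R.
  rewrite -mulrBr; apply: ler_wpM2l => //.
  have /andP[s1 s2] := step_bounds (x / eps - 1); have /andP[s3 s4] := step_bounds (z * x / eps - 1).
  case: (leP z (3 * eps / x)) => hz; rewrite ?mulr1n ?mulr0n; first by lra.
  rewrite [step (z * x / eps - 1)]step1; first by lra.
  by rewrite lerBrDr ler_pdivlMr//; move: hz; rewrite ltr_pdivrMr//; lra.
suff h2 : (1 - theta) / 2 * (x `^ q * middle x) * (z <= 2^-1)%R%:R <=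
    a * plateau n (x `^ q / a) - a * plateau n ((z * x) `^ q / a).
  by rewrite /tail_slope; lra.
rewrite -mulrBr powRM ?(ltW z0) ?(ltW x0)//.
have zq : z `^ q <= 1.
  by rewrite -[leRHS](one_powR q); apply: ge0_ler_powR; rewrite ?nnegrE ?(ltW q0) ?(ltW z0) ?(ltW z1).
have xq : 0 <= x `^ q / a by rewrite divr_ge0 ?powR_ge0// ltW.
have mono : 0 <= a * (plateau n (x `^ q / a) - plateau n (z `^ q * x `^ q / a)).
  by rewrite mulr_ge0 ?(ltW a0)// subr_ge0 plateau_incr// -mulrA ler_piMl.
case: (middleP x) => [[-> /andP[xN xn]]|[-> _]]; last by rewrite !mulr0 mul0r.
case: (leP z 2^-1) => hz; rewrite ?mulr0// !mulr1.
have zt : z `^ q <= theta.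
  by apply: ge0_ler_powR; rewrite ?nnegrE ?(ltW q0) ?(ltW z0) ?invr_ge0.
have /andP[t0 t1] := halving_ratio_bounds.
have xs : x `^ q = a * (x `^ q / a) by field; rewrite gt_eqF.
have sN : N <= x `^ q / a by rewrite ler_pdivlMr.
have sn : x `^ q / a <= n by rewrite ler_pdivrMr.
rewrite -[z `^ q * x `^ q / a]mulrA; set s := x `^ q / a in xs xq sN sn *.
rewrite xs [leLHS]mulrCA ler_pM2l//.
have p1 := plateau_ge n1 sn.
have p2 : plateau n (z `^ q * s) <= plateau n (theta * s).
  by rewrite plateau_incr// ler_wpM2r.
have := plateau_leB (theta * s) n1.
have : 3 <= s * (1 - theta) by move: sN; rewrite /low_cut ler_pdivrMr; lra.
have := low_cut_ge3; rewrite mulrC; case: (leP (theta * s - 1) 0) => h; nra.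
Qed.

Lemma kap_slope_integrable (x : R) : 0 < x ->
  integrablep (fun z => kap kappa z * (z * x * tail_slope (z * x))).
Proof.
move=> x0; have [a' [b' [M tb]]] := test_functionP tail_testP.1.
have := kap_phi_integrable fk tb x0.
by apply: eq_integrablep => z _.
Qed.

(** The mass of the fragments is the mass of their parent, so only the
    differences of the slope are left. *)
Lemma tail_adjE (x : R) : 0 < x -> frag_adj beta gamma kappa tail_test x =
  - (beta * x `^ gamma * integralp (fun z => kap kappa z * (z * x * (tail_slope x - tail_slope (z * x))))).
Proof.
move=> x0; rewrite /frag_adj -[RHS]mulrN; congr (_ * _).
have i1 := kap_slope_integrable x0.
have i2 := integrablepZ (x * tail_slope x) (integrable_kap_id fk).
have -> : tail_test x = integralp (fun z => x * tail_slope x * (kap kappa z * z)).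
  by rewrite (integralpZ _ (integrable_kap_id fk)) (kap_mass fk) mulr1.
rewrite /fragment_mean -(integralpB i1 i2) -mulN1r -integralpZ; last first.
  by apply: eq_integrablep (integrablepB i2 i1) => z z0; ring.
by apply: eq_integralp => z z0; rewrite /tail_test; ring.
Qed.

(** Rate at which fragmentation removes the tail, from [half_fragments_gt0] and
    the gain in slope of [slope_gap]. *)
Definition loss_rate : R := beta * half_fragments kappa * ((1 - theta) / 2).

Lemma loss_rate_gt0 : 0 < loss_rate.
Proof.
have /andP[t0 t1] := halving_ratio_bounds.
by rewrite !mulr_gt0 ?(fk_beta fk) ?(half_fragments_gt0 fk)//; lra.
Qed.

Lemma tail_adj_bound (x : R) : 0 < x ->
  - frag_adj beta gamma kappa tail_test x <=
  beta * k * (1 + k2) * (3 * eps) `^ gamma * x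
  - loss_rate * (x `^ gamma * (x `^ (q + 1) * middle x)).
Proof.
move=> x0; rewrite tail_adjE// opprK; set c := (1 - theta) / 2.
pose u z := x * k * (kap kappa z * (z * (z <= 3 * eps / x)%R%:R)) -
  x * (c * (x `^ q * middle x)) * (kap kappa z * (z * (z <= 2^-1)%R%:R)).
have j1 := integrablepZ (x * k) (integrable_small fk (3 * eps / x)).
have j2 := integrablepZ (x * (c * (x `^ q * middle x))) (integrable_small fk 2^-1).
have h : integralp (fun z => kap kappa z * (z * x * (tail_slope x - tail_slope (z * x)))) <=
    x * k * ((1 + k2) * (3 * eps / x) `^ gamma) - x * (c * (x `^ q * middle x)) * half_fragments kappa.
  apply: (@le_trans _ _ (integralp u)); last first.
    rewrite (integralpB j1 j2) (integralpZ _ (integrable_small fk _)).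
    rewrite (integralpZ _ (integrable_small fk _)) lerD2r ler_wpM2l//.
      by rewrite mulr_ge0 ?(ltW x0)// mulr_ge0 ?(ltW a0)//; have := n1; lra.
    by apply: (small_fragments fk); rewrite divr_gt0// mulr_gt0.
  apply: le_integralp; last move=> z z0.
  - have i1 := kap_slope_integrable x0.
    have i2 := integrablepZ (x * tail_slope x) (integrable_kap_id fk).
    by apply: eq_integrablep (integrablepB i2 i1) => z z0; ring.
  - exact: integrablepB.
  have [z1|z1] := leP 1 z; first by rewrite /u kap0// !mul0r !mulr0 subrr.
  have := slope_gap x0 (introT andP (conj z0 z1)); rewrite -/c => hg.
  rewrite /u; set kz := kap kappa z; have kz0 : 0 <= kz * z * x.
    by rewrite !mulr_ge0 ?(kap_ge0 fk)// ltW.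
  have := ler_wpM2l kz0 hg; set i3 := (_ <= _)%R%:R; set i4 := (_ <= _)%R%:R; set m := x `^ q * _.
  by rewrite -!(mulrA kz); move=> hh; apply: (le_trans hh); rewrite le_eqVlt; apply/orP; left; apply/eqP; ring.
have bx : 0 <= beta * x `^ gamma by rewrite mulr_ge0 ?powR_ge0// ltW// (fk_beta fk).
apply: (le_trans (ler_wpM2l bx h)); rewrite le_eqVlt; apply/orP; left; apply/eqP.
rewrite /loss_rate -/c pow_split//.
have -> : (3 * eps / x) `^ gamma = (3 * eps) `^ gamma / x `^ gamma.
  by rewrite powRM ?invr_ge0 ?mulr_ge0 ?(ltW eps0) ?(ltW x0)// -powRN -powR_inv1 ?(ltW x0)// -powRrM mulN1r.
by field; rewrite gt_eqF// powR_gt0.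
Qed.

End tail_test.

(** * Absorption of the tail by fragmentation *)

Section tail_bounds.
Context {R : realType} {beta gamma : R} {kappa : R -> R} {k1 k2 : R}.
Hypothesis fk : frag_kernel beta gamma kappa k1 k2.
Variables (mu r q a n eps : R).
Hypotheses (mu0 : 0 < mu) (r3 : 3 < r).
Hypotheses (q0 : 0 < q) (a1 : 1 <= a) (eps0 : 0 < eps) (eps3 : 3 * eps <= 1).
Hypothesis nN : low_cut q <= n.
Local Notation D := (`]0, +oo[%classic : set R).
Local Notation N := (low_cut q).
Local Notation k := (top_level a n).
Local Notation phi := (tail_test q a n eps).
Local Notation mid := (middle q a n).
Local Notation T := (tail_weight q).
Local Notation adj := (frag_adj beta gamma kappa).
Local Notation c := (@loss_rate R beta kappa q).

Let a0 : 0 < a. Proof. exact: lt_le_trans ltr01 a1. Qed.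
Let n1 : 1 <= n. Proof. by have := low_cut_ge3 q0; have := nN; lra. Qed.
Let k0 : 0 <= k. Proof. by rewrite mulr_ge0 ?(ltW a0)//; have := n1; lra. Qed.
Let tt := tail_testP q0 a1 eps0 eps3 nN.

Definition error_rate : R := beta * k * (1 + k2) * (3 * eps) `^ gamma.

Lemma mid01 x : 0 <= mid x <= 1.
Proof. by case: (middleP q a n x) => [[-> _]|[-> _]]; rewrite lexx ler01. Qed.

(** On the middle range fragmentation absorbs the transport and more: the loss
    x^gamma x^{q+1} dominates any multiple l of x^{q+1}, up to a weight of lower
    order, by Young's inequality. *)
Lemma tail_rhs_bound (b l x : R) : 0 < x -> 0 <= b -> 0 <= l ->
  (forall x : R, 0 < x -> a <= x `^ q -> 2 * (mu * q) / c <= x `^ gamma /\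
    x `^ (- (gamma / 2)) <= b) ->
  - (mu * (x * derive1 phi x - phi x) + adj phi x) <=
  - (c * l) * (x `^ (q + 1) * mid x) +
  (c / 2 * l ^+ 2 * b) * x `^ (q + 1 - gamma / 2) +
  (mu * q * N) * T a x + (mu * q * 2) * T (n * a) x + error_rate * x.
Proof.
move=> x0 b0 l0 hb; have := tail_transport q0 a1 eps0 eps3 nN x0.
have := tail_adj_bound fk q0 a1 eps0 eps3 nN x0; rewrite -/error_rate.
have c0 := loss_rate_gt0 fk q0; set P := x `^ (q + 1); set d := x * derive1 phi x - phi x.
move=> h2 h1; have {h1} := ler_wpM2l (ltW mu0) h1.
suff : mu * q * (P * mid x) - c * (x `^ gamma * (P * mid x)) <=
    - (c * l) * (P * mid x) + (c / 2 * l ^+ 2 * b) * x `^ (q + 1 - gamma / 2) by lra.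
have P0 : 0 <= P by exact: powR_ge0.
have Q0 : 0 <= x `^ (q + 1 - gamma / 2) by exact: powR_ge0.
rewrite /P in P0 *; case: (middleP q a n x) => [[-> /andP[xN _]]|[-> _]]; last first.
  by rewrite !mulr0 subr0 add0r mulr_ge0// mulr_ge0// mulr_ge0 ?sqr_ge0// divr_ge0// ltW.
have ax : a <= x `^ q.
  by apply: le_trans xN; rewrite ler_peMl ?(ltW a0)//; have := low_cut_ge3 q0; lra.
have [g1 g2] := hb x x0 ax; rewrite !mulr1.
have w0 : 0 < x `^ gamma by exact: powR_gt0.
rewrite -/P in P0 *; have E : P = x `^ gamma * (x `^ (q + 1 - gamma / 2) * x `^ (- (gamma / 2))).
  by rewrite -!powRD ?(gt_eqF x0) ?implybT//; congr (_ `^ _); field.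
have {g1} : mu * q <= c / 2 * x `^ gamma.
  by move: g1; rewrite ler_pdivrMr//; lra.
have u0' : 0 <= x `^ (- (gamma / 2)) by exact: powR_ge0.
move: (x `^ gamma) (x `^ (- (gamma / 2))) (x `^ (q + 1 - gamma / 2)) E g2 w0 Q0 u0' => w u Q -> ub w0 Q0 u0' g1.
have wQ : 0 <= w * (Q * u) -> mu * q * (w * (Q * u)) <= c / 2 * w * (w * (Q * u)).
  by move=> h; exact: ler_wpM2r.
have cl : 0 <= c / 2 * l ^+ 2 * Q by rewrite mulr_ge0// mulr_ge0 ?sqr_ge0// divr_ge0// ltW.
have h3 : c / 2 * l ^+ 2 * Q * u <= c / 2 * l ^+ 2 * Q * b by exact: ler_wpM2l.
have u0 : 0 <= Q * u by exact: mulr_ge0.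
have h4 : 0 <= c / 2 * ((w - l) ^+ 2 * (Q * u)).
  by rewrite mulr_ge0 ?divr_ge0 ?(ltW c0)// mulr_ge0 ?sqr_ge0.
have := wQ (mulr_ge0 (ltW w0) u0); move: h3 h4; rewrite !expr2; lra.
Qed.

(** The next two lemmas compare the moment of the tail with the quantity
    k x - phi x that the equation controls. *)
Lemma tail_mass_bound (x : R) : 0 < x ->
  k * x - phi x <= x `^ (q + 1) * mid x + N * T a x + 2 * T (n * a) x +
    k * (x * (x <= 3 * eps)%R%:R).
Proof.
move=> x0; have w1 := tail_weight_ge0 q (ltW a0) x0.
have na0 : 0 <= n * a by rewrite mulr_ge0 ?(ltW a0)//; have := n1; lra.
have w2 := tail_weight_ge0 q na0 x0; have N3 := low_cut_ge3 q0.
have -> : k * x - phi x = k * (x * (1 - step (x / eps - 1))) + x * (a * plateau n (x `^ q / a)).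
  by rewrite /tail_test /tail_slope; ring.
have h1 : k * (x * (1 - step (x / eps - 1))) <= k * (x * (x <= 3 * eps)%R%:R).
  rewrite ler_wpM2l// ler_pM2l//; case: (leP x (3 * eps)) => hx.
    by have /andP[] := step_bounds (x / eps - 1); rewrite mulr1n; lra.
  by rewrite step1 ?subrr// lerBrDr ler_pdivlMr//; move: hx; lra.
suff : x * (a * plateau n (x `^ q / a)) <= x `^ (q + 1) * mid x + N * T a x + 2 * T (n * a) x.
  by lra.
have m0 : 0 <= x `^ (q + 1) * mid x by rewrite mulr_ge0 ?powR_ge0//; have /andP[] := mid01 x.
have Nw : 0 <= N * T a x by rewrite mulr_ge0//; lra.
have [sa|sa] := leP (x `^ q) a.
  rewrite plateau0//; first by rewrite !mulr0; lra.
  by rewrite ler_pdivrMr// mul1r.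
have s0 : 0 <= x `^ q / a by rewrite divr_ge0 ?powR_ge0// ltW.
have [sn|sn] := leP (x `^ q) (n * a); last first.
  rewrite -[leLHS]add0r; apply: lerD; first exact: addr_ge0.
  apply: (@le_trans _ _ (T (n * a) x)); last by lra.
  rewrite /tail_weight (ltW sn) mulr1 [leRHS]mulrC ler_pM2l// mulrC ler_pM2r//.
  by have := plateau_le (x `^ q / a) n1; lra.
have sn' : x `^ q <= (n + 1) * a by apply: le_trans sn _; rewrite ler_pM2r//; lra.
have := outside_middle q0 a1 nN x0 (introT andP (conj (ltW sa) sn')); rewrite addrA; apply: le_trans.
rewrite pow_split// ler_pM2l// mulrC -ler_pdivlMr//.
apply: (le_trans (plateau_leB _ n1)); rewrite ge_max s0 andbT.
by rewrite gerBl.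
Qed.

Lemma middle_le_tail (x : R) : 0 < x -> x `^ (q + 1) * mid x <= 2 * (k * x - phi x).
Proof.
move=> x0; have N3 := low_cut_ge3 q0.
have -> : k * x - phi x = x * (k * (1 - step (x / eps - 1)) + a * plateau n (x `^ q / a)).
  by rewrite /tail_test /tail_slope; ring.
have h1 : 0 <= k * (1 - step (x / eps - 1)).
  by rewrite mulr_ge0//; have /andP[] := step_bounds (x / eps - 1); lra.
have h2 : 0 <= a * plateau n (x `^ q / a) by rewrite mulr_ge0 ?(ltW a0)// plateau_ge0.
case: (middleP q a n x) => [[-> /andP[xN xn]]|[-> _]]; last first.
  by rewrite mulr0 mulr_ge0// mulr_ge0 ?(ltW x0)// addr_ge0.
rewrite mulr1 pow_split// mulrCA ler_pM2l//.
have xs : x `^ q = a * (x `^ q / a) by field; rewrite gt_eqF.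
have sN : N <= x `^ q / a by rewrite ler_pdivlMr.
have sn : x `^ q / a <= n by rewrite ler_pdivrMr.
have p1 := plateau_ge n1 sn; rewrite xs; set s := x `^ q / a in xs sN sn h2 p1 *.
rewrite -xs -/s; suff : a * s <= 2 * (a * plateau n s) by lra.
have := ler_wpM2l (ltW a0) p1.
have : a * 3 <= a * s by rewrite ler_wpM2l ?(ltW a0)//; lra.
by lra.
Qed.

Lemma sublinear_tail_weight X : 0 <= X -> sublinear (T X).
Proof.
move=> X0; split.
  apply: measurable_funM => //; apply: measurable_funM => //.
  by apply: measurable_ind_ge; exact: measurable_powRD.
exists X => // x x0; rewrite ger0_norm; last exact: tail_weight_ge0.
by rewrite ler_wpM2l// ler_piMr ?(ltW x0)// lern1 leq_b1.
Qed.

Lemma measurable_mid : measurable_fun D mid.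
Proof.
apply: measurable_funM.
  by apply: measurable_ind_ge; exact: measurable_powRD.
by apply: measurable_ind_le; exact: measurable_powRD.
Qed.

Lemma sublinear_middle : sublinear (fun x => x `^ (q + 1) * mid x).
Proof.
split.
  by apply: measurable_funM; [exact: measurable_powRD|exact: measurable_mid].
have na0 : 0 <= n * a by rewrite mulr_ge0 ?(ltW a0)//; have := n1; lra.
exists (n * a) => // x x0; rewrite ger0_norm; last first.
  by rewrite mulr_ge0 ?powR_ge0//; have /andP[] := mid01 x.
case: (middleP q a n x) => [[-> /andP[_ xn]]|[-> _]]; last by rewrite mulr0 mulr_ge0// ltW.
by rewrite mulr1 pow_split// mulrC ler_pM2r.
Qed.

Lemma sublinear_low : sublinear (fun x => x * (x <= 3 * eps)%R%:R).
Proof.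
split; first by apply: measurable_funM => //; exact: measurable_ind_le.
exists 1 => // x x0; rewrite mul1r normrM gtr0_norm// ler_piMr ?(ltW x0)//.
by rewrite normr_nat lern1 leq_b1.
Qed.

(** The moment of the tail satisfies y' <= - C y^2, up to terms that are small
    when the density is close to the profile: so it becomes small in a time
    that does not depend on the cut at n, however large it was. *)
Lemma tail_absorption v (e eta b BB m tau : R) :
  linear_solution beta gamma kappa mu r v ->
  (forall t, 0 <= t -> mass (v t) = m) ->
  0 < e -> 0 < eta -> 0 <= b -> 0 < tau ->
  (forall x : R, 0 < x -> a <= x `^ q -> 2 * (mu * q) / c <= x `^ gamma /\ x `^ (- (gamma / 2)) <= b) ->
  16 * (b * BB) <= e * (c * tau) ->
  (N + 3) * eta <= e / 2 -> (mu * q * (N + 2) + 1) * eta * tau <= e ->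
  (forall t, 0 <= t -> integrablep (fun x => `|v t x| * x `^ (q + 1 - gamma / 2)) /\
    pair (fun x => `|v t x|) (fun x => x `^ (q + 1 - gamma / 2)) <= BB) ->
  (forall t, 0 <= t -> pair (fun x => `|v t x|) (T a) <= eta) ->
  (forall t, 0 <= t -> pair (fun x => `|v t x|) (T (n * a)) <= eta) ->
  (forall t, 0 <= t -> k * pair (fun x => `|v t x|) (fun x => x * (x <= 3 * eps)%R%:R) <= eta) ->
  error_rate * m <= eta ->
  forall t, tau <= t -> pair (fun x => `|v t x|) (fun x => x `^ (q + 1) * mid x) <= 2 * e.
Proof.
move=> sv vm e0 eta0 b0 tau0 hb smallb small1 small2 hB hS1 hS2 hW hE t ht.
have c0 := loss_rate_gt0 fk q0; have N3 := low_cut_ge3 q0.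
have na0 : 0 <= n * a by rewrite mulr_ge0 ?(ltW a0)//; have := n1; lra.
have cv := solution_curve sv; have [s1 s2 s3] := test_sublinear fk tt.1.
have A s : 0 <= s -> in_H r (fun x => `|v s x|).
  by move=> s0; have [] := abs_in_H (solution_in_H sv s0).1.
have absp s psi : 0 <= s -> measurable_fun D psi -> pair (v s) psi = pair (fun x => `|v s x|) psi.
  by move=> s0 mpsi; have [vs v0] := solution_in_H sv s0; apply: abs_pair => //; exact: in_H_meas vs.
pose y s := k * m - pair (v (clamp s)) phi.
pose dy s := - weak_rhs beta gamma kappa mu mu phi (v s).
have cmu : forall t : R, {for t, continuous (fun s : R => (fun=> mu) (clamp s))}.
  by move=> s; exact: cst_continuous.
have dery (s : R) : 0 < s -> is_derive s 1 y (dy s).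
  move=> s0; have h := derB (derC (k * m) s) (weak_derivative fk r3 cv cmu sv tt.1 s0).
  by apply: (derE h); rewrite sub0r.
have cy (s : R) : {for s, continuous y}.
  by apply: continuousB; [exact: cst_continuous|exact: (pair_curve_cont r3 cv s1)].
have yE s : 0 <= s -> y s = pair (fun x => `|v s x|) (fun x => k * x - phi x).
  move=> s0; rewrite /y clampE// -(vm s s0) /mass -(pairZr k r3 (solution_in_H sv s0).1 (sublinear_id)).
  rewrite (absp _ _ s0 (sublinearZ k sublinear_id).1) (absp _ _ s0 s1.1).
  have i1 := pair_int r3 (A s s0) (sublinearZ k sublinear_id); have i2 := pair_int r3 (A s s0) s1.
  by rewrite /pair -(integralpB i1 i2); apply: eq_integralp => x x0; rewrite mulrBr.
pose Z s := pair (fun x => `|v s x|) (fun x => x `^ (q + 1) * mid x).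
have phiI s : 0 <= s -> integrablep (fun x => `|v s x| * (k * x - phi x)).
  move=> s0; have i1 := pair_int r3 (A s s0) (sublinearZ k sublinear_id).
  have i2 := pair_int r3 (A s s0) s1.
  by apply: eq_integrablep (integrablepB i1 i2) => x x0; rewrite mulrBr.
have sT1 := sublinear_tail_weight (ltW a0); have sT2 := sublinear_tail_weight na0.
have Zy s : 0 <= s -> Z s <= 2 * y s.
  move=> s0; rewrite yE// /Z /pair -(integralpZ 2 (phiI s s0)).
  apply: le_integralp; [exact: pair_int r3 (A s s0) sublinear_middle|exact: integrablepZ (phiI s s0)|].
  by move=> x x0; rewrite [leRHS]mulrCA ler_wpM2l// middle_le_tail.
have yZ s : 0 <= s -> y s <= Z s + (N + 3) * eta.
  move=> s0; rewrite yE//; have i1 := pair_int r3 (A s s0) sublinear_middle.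
  have i2 := integrablepZ N (pair_int r3 (A s s0) sT1).
  have i3 := integrablepZ 2 (pair_int r3 (A s s0) sT2).
  have i4 := integrablepZ k (pair_int r3 (A s s0) sublinear_low).
  apply: (@le_trans _ _ (Z s + N * pair (fun x => `|v s x|) (T a) +
      2 * pair (fun x => `|v s x|) (T (n * a)) +
      k * pair (fun x => `|v s x|) (fun x => x * (x <= 3 * eps)%R%:R))); last first.
    have := hS1 s s0; have := hS2 s s0; have := hW s s0 => h1 h2 h3.
    have : N * pair (fun x => `|v s x|) (T a) <= N * eta by rewrite ler_wpM2l//; lra.
    by lra.
  rewrite /Z /pair -(integralpZ _ (pair_int r3 (A s s0) sT1)) -(integralpZ _ (pair_int r3 (A s s0) sT2)).
  rewrite -(integralpZ _ (pair_int r3 (A s s0) sublinear_low)) -(integralpD i1 i2) -(integralpD (integrablepD i1 i2) i3).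
  rewrite -(integralpD (integrablepD (integrablepD i1 i2) i3) i4).
  apply: le_integralp; [exact: phiI|exact: integrablepD (integrablepD (integrablepD i1 i2) i3) i4|].
  move=> x x0; have := ler_wpM2l (normr_ge0 (v s x)) (tail_mass_bound x0).
  by move=> h; apply: (le_trans h); rewrite le_eqVlt; apply/orP; left; apply/eqP; ring.
have dyle s l : 0 <= s -> 0 <= l ->
    dy s <= - (c * l) * Z s + c / 2 * l ^+ 2 * b * BB + (mu * q * (N + 2) + 1) * eta.
  move=> s0 l0; pose G x := - (mu * (x * derive1 phi x - phi x) + adj phi x).
  have -> : dy s = pair (fun x => `|v s x|) G.
    rewrite /dy /weak_rhs (absp _ _ s0 s1.1) (absp _ _ s0 s2.1) (absp _ _ s0 s3.1).
    have i1 := integrablepZ mu (pair_int r3 (A s s0) s1).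
    have i2 := integrablepZ mu (pair_int r3 (A s s0) s2).
    have i3 := pair_int r3 (A s s0) s3.
    rewrite /pair -(integralpZ mu (pair_int r3 (A s s0) s2)) -(integralpZ mu (pair_int r3 (A s s0) s1)).
    rewrite -(integralpB i2 i1) -(integralpD (integrablepB i2 i1) i3) -mulN1r.
    rewrite -integralpZ; last exact: integrablepD (integrablepB i2 i1) i3.
    by apply: eq_integralp => x _; rewrite /G; ring.
  have [iB leB] := hB s s0.
  have i1 := integrablepZ (- (c * l)) (pair_int r3 (A s s0) sublinear_middle).
  have i2 := integrablepZ (c / 2 * l ^+ 2 * b) iB.
  have i3 := integrablepZ (mu * q * N) (pair_int r3 (A s s0) sT1).
  have i4 := integrablepZ (mu * q * 2) (pair_int r3 (A s s0) sT2).
  have i5 := integrablepZ error_rate (pair_int r3 (A s s0) sublinear_id).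
  apply: (@le_trans _ _ (- (c * l) * Z s +
      c / 2 * l ^+ 2 * b * pair (fun x => `|v s x|) (fun x => x `^ (q + 1 - gamma / 2)) +
      mu * q * N * pair (fun x => `|v s x|) (T a) +
      mu * q * 2 * pair (fun x => `|v s x|) (T (n * a)) +
      error_rate * pair (fun x => `|v s x|) (fun x => x))); last first.
    have -> : pair (fun x => `|v s x|) (fun x => x) = m.
      by rewrite -(absp s (fun x => x) s0 sublinear_id.1); exact: vm.
    have mq : 0 <= mu * q by rewrite mulr_ge0 ?(ltW mu0)// ltW.
    have mN : 0 <= mu * q * N by rewrite mulr_ge0//; lra.
    have h1 : mu * q * N * pair (fun x => `|v s x|) (T a) <= mu * q * N * eta.
      by rewrite ler_wpM2l// hS1.
    have h2 : mu * q * 2 * pair (fun x => `|v s x|) (T (n * a)) <= mu * q * 2 * eta.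
      by rewrite ler_wpM2l ?hS2// mulr_ge0.
    have cl : 0 <= c / 2 * l ^+ 2 * b by rewrite mulr_ge0// mulr_ge0 ?sqr_ge0// divr_ge0// ltW.
    have h3 := ler_wpM2l cl leB.
    by move: hE h1 h2 h3; lra.
  rewrite /Z /pair -(integralpZ _ (pair_int r3 (A s s0) sublinear_middle)) -(integralpZ _ iB).
  rewrite -(integralpZ _ (pair_int r3 (A s s0) sT1)) -(integralpZ _ (pair_int r3 (A s s0) sT2)).
  rewrite -(integralpZ _ (pair_int r3 (A s s0) sublinear_id)) -(integralpD i1 i2) -(integralpD (integrablepD i1 i2) i3).
  rewrite -(integralpD (integrablepD (integrablepD i1 i2) i3) i4).
  rewrite -(integralpD (integrablepD (integrablepD (integrablepD i1 i2) i3) i4) i5).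
  apply: le_integralp.
  - have j1 := integrablepZ (- mu) (integrablepB (pair_int r3 (A s s0) s2) (pair_int r3 (A s s0) s1)).
    by apply: eq_integrablep (integrablepB j1 (pair_int r3 (A s s0) s3)) => x _; rewrite /G; ring.
  - exact: integrablepD (integrablepD (integrablepD (integrablepD i1 i2) i3) i4) i5.
  move=> x x0; have := ler_wpM2l (normr_ge0 (v s x)) (tail_rhs_bound x0 b0 l0 hb).
  by move=> h; apply: (le_trans h); rewrite le_eqVlt; apply/orP; left; apply/eqP; ring.
have t0 : 0 < t by lra.
apply: (le_trans (Zy t (ltW t0))); rewrite ler_pM2l//.
suff : forall s, 0 < s -> e <= y s -> dy s <= - (e^-1 * tau^-1) * y s ^+ 2.
  move=> h; apply: (quadratic_absorption e0 _ (fun s _ => cy s) dery h t0).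
    by rewrite mulr_gt0 ?invr_gt0.
  by rewrite mulrA mulrA mulfV ?gt_eqF// mul1r mulrC ler_pdivlMr// mul1r.
move=> s s0 ey; set Y := y s in ey *; have Y0 : 0 < Y by lra.
have := yZ s (ltW s0); rewrite -/Y => hZ.
pose l := 8 * Y / (e * (c * tau)).
have ect : 0 < e * (c * tau) := mulr_gt0 e0 (mulr_gt0 c0 tau0).
have l0 : 0 <= l by rewrite divr_ge0 ?(ltW ect)// mulr_ge0// ltW.
have := dyle s l (ltW s0) l0.
have Z2 : Y / 2 <= Z s by lra.
have h1 : c * l * (Y / 2) <= c * l * Z s by rewrite ler_wpM2l// mulr_ge0// ltW.
have h2 : c / 2 * l ^+ 2 * b * BB <= c / 2 * l ^+ 2 * (e * (c * tau) / 16).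
  by rewrite -mulrA; apply: ler_wpM2l; [rewrite mulr_ge0 ?sqr_ge0// divr_ge0// ltW|rewrite ler_pdivlMr//; lra].
set W := (mu * q * (N + 2) + 1) * eta in small2 *.
have h3 : W <= e^-1 * tau^-1 * Y ^+ 2.
  apply: (@le_trans _ _ (e^-1 * tau^-1 * e ^+ 2)).
    have -> : e^-1 * tau^-1 * e ^+ 2 = e / tau by field; rewrite !gt_eqF.
    by rewrite ler_pdivlMr.
  rewrite ler_wpM2l ?mulr_ge0 ?invr_ge0 ?(ltW e0) ?(ltW tau0)//.
  by rewrite lerXn2r ?nnegrE ?(ltW e0) ?(ltW Y0).
have E1 : c * l * (Y / 2) = 4 * (e^-1 * tau^-1 * Y ^+ 2).
  by rewrite /l; field; rewrite !gt_eqF.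
have E2 : c / 2 * l ^+ 2 * (e * (c * tau) / 16) = 2 * (e^-1 * tau^-1 * Y ^+ 2).
  by rewrite /l; field; rewrite !gt_eqF.
by move: h1 h2 h3; rewrite E1 E2; lra.
Qed.

End tail_bounds.

(** * Moments of densities close to the profile *)

Section power_thresholds.
Context {R : realType}.

Lemma small_pow (c eta : R) : 0 < c -> 0 < eta ->
  exists2 s, 0 < s <= 1 & s `^ c <= eta.
Proof.
move=> c0 eta0; exists (Num.min 1 (eta `^ c^-1)).
  by rewrite lt_min ltr01 powR_gt0//= ge_min lexx.
apply: (@le_trans _ _ ((eta `^ c^-1) `^ c)).
  apply: powR_le; [exact: ltW|by rewrite le_min ler01 powR_ge0|].
  by rewrite ge_min lexx orbT.
by rewrite -powRrM mulVf ?gt_eqF// powRr1// ltW.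
Qed.

Lemma large_pow (c M : R) : 0 < c ->
  exists2 s, 1 <= s & forall x : R, s <= x -> M <= x `^ c.
Proof.
move=> c0; pose B := Num.max 1 M; have B1 : 1 <= B by rewrite le_max lexx.
exists (B `^ c^-1).
  by rewrite -[leLHS](one_powR c^-1); apply: powR_le; rewrite ?invr_ge0 ?(ltW c0).
move=> x sx; apply: (@le_trans _ _ ((B `^ c^-1) `^ c)); last first.
  by apply: powR_le => //; [exact: ltW|exact: powR_ge0].
have B0 : 0 <= B by lra.
by rewrite -powRrM mulVf ?gt_eqF// powRr1// le_max lexx orbT.
Qed.

Lemma le_of_sqr (x B : R) : 0 <= B -> x ^+ 2 <= B -> x <= 1 + B.
Proof. by rewrite expr2 => B0 h; nra. Qed.

Lemma le_of_sqr2 (x B : R) : 0 <= B -> x ^+ 2 <= B ^+ 2 -> x <= B.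
Proof. by rewrite !expr2 => B0 h; nra. Qed.

(** The weights X x on x^q >= X are controlled by the norm uniformly in X as
    soon as x^(2q+3) is integrable against the square: this is where the bound
    2p+1 <= r on the order of the space enters. *)
Lemma tail_weight_pairing (r q X : R) h : 3 < r -> 0 < q -> 2 * q + 3 <= r -> 1 <= X ->
  in_H r h -> integrablep (fun x => h x * tail_weight q X x) /\
  integralp (fun x => `|h x * tail_weight q X x|) ^+ 2 <= 4 / (r - 3) * sqnorm r h.
Proof.
move=> r3 q0 qr X1 hh; have X0 : 0 < X by lra.
apply: (@pairing_dkern R r (r - 3) (X `^ q^-1) 4) => //.
- lra.
- exact: powR_gt0.
- by have [] := sublinear_tail_weight q (ltW X0).
move=> x x0; rewrite /dkern; set t := (x / X `^ q^-1) `^ (r - 3).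
have b0 : 0 < X `^ q^-1 by exact: powR_gt0.
have t0 : 0 < t by rewrite powR_gt0// divr_gt0.
have w0 := weight_ge0 r x0.
rewrite /tail_weight; case: (leP X (x `^ q)) => hX; last first.
  rewrite !mulr0 expr0n/=; apply: mulr_ge0; first by rewrite mulr_ge0.
  by apply: mulr_ge0; [rewrite invr_ge0 ltW|apply: divr_ge0; [exact: ltW|exact: sqr_ge0]].
have xb : 1 <= x / X `^ q^-1.
  rewrite ler_pdivlMr// mul1r; have -> : x = (x `^ q) `^ q^-1.
    by rewrite -powRrM mulfV ?gt_eqF// powRr1// ltW.
  by apply: powR_le; rewrite ?invr_ge0 ?(ltW q0) ?(ltW X0).
have t1 : 1 <= t.
  by rewrite -[leLHS](one_powR (r - 3)); apply: powR_le => //; lra.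
have b2 : X ^+ 2 <= (X `^ q^-1) `^ (r - 3).
  rewrite -powRrM -(powR_mulrn 2 (ltW X0)); apply: ler_powR => //.
  by rewrite mulrC ler_pdivlMr//; lra.
have xr : x `^ r = x ^+ 3 * x `^ (r - 3).
  rewrite -(powR_mulrn 3 (ltW x0)) -powRD ?(gt_eqF x0) ?implybT//; congr (_ `^ _); ring.
have te : x `^ (r - 3) = (X `^ q^-1) `^ (r - 3) * t.
  rewrite /t -powRM ?(ltW b0)//; last by lra.
  by congr (_ `^ _); field; rewrite gt_eqF.
have tt : 4^-1 <= t * (t / (1 + t) ^+ 2).
  by rewrite mulrA ler_pdivlMr ?exprn_gt0//; [rewrite expr2; nra|lra].
rewrite mulr1 exprMn; apply: (@le_trans _ _ (4 * (x ^+ 3 * (X ^+ 2 * t)) * (x^-1 * (t / (1 + t) ^+ 2)))).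
  have -> : 4 * (x ^+ 3 * (X ^+ 2 * t)) * (x^-1 * (t / (1 + t) ^+ 2)) =
    (X ^+ 2 * x ^+ 2) * (4 * (t * (t / (1 + t) ^+ 2))).
    by field; rewrite gt_eqF//=; lra.
  by rewrite ler_peMr ?mulr_ge0 ?sqr_ge0//; lra.
rewrite ler_wpM2r//.
  by rewrite mulr_ge0 ?invr_ge0 ?(ltW x0)// divr_ge0 ?(ltW t0)// sqr_ge0.
rewrite ler_pM2l//; apply: (@le_trans _ _ (x `^ r)); last by rewrite lerDr ltW.
rewrite xr te ler_pM2l ?exprn_gt0// ler_pM2r//.
Qed.

End power_thresholds.

Section moment_stability.
Context {R : realType} {beta gamma : R} {kappa : R -> R} {k1 k2 : R}.
Hypothesis fk : frag_kernel beta gamma kappa k1 k2.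
Variables (mu r rbar : R) (U : R -> R).
Hypotheses (r3 : 3 < r) (mu0 : 0 < mu) (rbar_le : rbar <= r).
Hypothesis hU : stationary_profile beta gamma kappa mu rbar U.
Hypothesis hgap : spectral_gap beta gamma kappa mu r U.
Implicit Types (v : R -> R -> R) (h psi g : R -> R).
Local Notation D := (`]0, +oo[%classic : set R).

Lemma scale_solution v g A : 0 <= A ->
  (forall t : R, {for t, continuous (fun s => g (clamp s))}) ->
  growth_frag_solution beta gamma kappa mu r g v ->
  growth_frag_solution beta gamma kappa mu r g (fun t x => A * v t x).
Proof.
move=> A0 cg sv; have cv := solution_curve sv.
have vH t (t0 : 0 <= t) := (solution_in_H sv t0).1.
apply: (solution_of_derivative fk r3) => //.
- move=> t t0; have [vt vt0] := solution_in_H sv t0; split; first exact: in_HZ.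
  by apply: ae_pos1 vt0 => x _ vx; rewrite mulr_ge0.
- split; first by move=> t t0; apply: in_HZ; exact: vH.
  move=> t0 t00 e e0; have e1 : 0 < e / (A ^+ 2 + 1) by rewrite divr_gt0// ltr_wpDl// sqr_ge0.
  have [d d0 hd] := cv.2 t0 t00 _ e1; exists d => // t t1 tt.
  have [dH _] := in_HB (vH t t1) (vH t0 t00).
  have -> : sqnorm r (fun x => A * v t x - A * v t0 x) = sqnorm r (fun x => A * (v t x - v t0 x)).
    by apply: eq_sqnorm => x _; rewrite mulrBr.
  rewrite sqnormZ//; have := hd t t1 tt; rewrite ler_pdivlMr; last by rewrite ltr_wpDl// sqr_ge0.
  by have := sqnorm_ge0 r (fun x => v t x - v t0 x); nra.
- by move=> t t0; case: sv => _ _ + _ => /(_ t t0) ->; rewrite mulr0.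
- move=> phi tphi t t0; have [s1 s2 s3] := test_sublinear fk tphi.
  have h := derZ A (weak_derivative fk r3 cv cg sv tphi t0).
  have tv := vH t (ltW t0).
  have E : A * weak_rhs beta gamma kappa mu (g t) phi (v t) =
      weak_rhs beta gamma kappa mu (g t) phi (fun x => A * v t x).
    by rewrite /weak_rhs (pairZl A r3 tv s1) (pairZl A r3 tv s2) (pairZl A r3 tv s3); ring.
  rewrite -E; apply: (der_ext _ h) => s.
  by rewrite (pairZl A r3 (vH _ (clamp_ge0 s)) s1).
Qed.

Let rbar1 : rbar <= r + 1. Proof. by have := rbar_le; lra. Qed.

(** The profile lies in the space with the exponent r + 1 as well, and there
    the order p is not borderline. *)
Lemma profile_moment p : 0 < p -> 2 * p + 1 <= r -> integrablep (fun x => x `^ p * U x).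
Proof.
move=> p0 pr; have [uH _] := profile_in_H hU rbar1.
have h1 : 2 * p < r + 1 - 1 by lra.
have [K K0 hK] := pairing_pow p0 h1.
have [//| | |i _] := hK 1 U (fun x => x `^ p) _ uH.
- exact: measurable_powRD.
- by move=> x x0; rewrite mul1r ger0_norm// powR_ge0.
by apply: eq_integrablep i => x _; rewrite mulrC.
Qed.

Definition tail_moment q X h : R :=
  integralp (fun x => `|h x| * (x `^ (q + 1) * (X <= x `^ q)%R%:R)).

Lemma tail_moment_integrable q X h : measurable_fun D h -> finite_moment (q + 1) h ->
  integrablep (fun x => `|h x| * (x `^ (q + 1) * (X <= x `^ q)%R%:R)).
Proof.
move=> mh fh; apply: (integrablep_le _ (integrablep_norm fh)).
  apply: measurable_funM; first exact: measurableT_comp.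
  apply: measurable_funM; first exact: measurable_powRD.
  by apply: measurable_ind_ge; exact: measurable_powRD.
move=> x x0; rewrite !normrM normr_id normr_nat [leRHS]mulrC ler_wpM2l//.
by rewrite ler_piMr// lern1 leq_b1.
Qed.

(** A little more than the order q + 1 is available for the profile, again from
    the exponent r + 1. *)
Lemma profile_tail q eta : 0 < q -> 2 * q + 3 <= r -> 0 < eta ->
  exists2 a, 1 <= a & forall X, a <= X -> tail_moment q X U <= eta.
Proof.
move=> q0 qr eta0; have [uH _] := profile_in_H hU rbar1.
have p0 : 0 < q + 1 + 4^-1 by lra.
have h1 : 2 * (q + 1 + 4^-1) < r + 1 - 1 by lra.
have [K K0 hK] := pairing_pow p0 h1.
have [//| | |i le] := hK 1 U (fun x => x `^ (q + 1 + 4^-1)) _ uH.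
- exact: measurable_powRD.
- by move=> x x0; rewrite mul1r ger0_norm// powR_ge0.
set I := integralp _ in le; have c0 : 0 < 4^-1 / q by rewrite divr_gt0.
have [a a1 ha] := large_pow (I / eta) c0; exists a => // X aX.
have X0 : 0 < X by lra.
have ta := ha X aX; have Xc : 0 < X `^ (4^-1 / q) by exact: powR_gt0.
have ti := tail_moment_integrable X (in_H_meas uH) (profile_moment (p := q + 1) ltac:(lra) ltac:(lra)).
rewrite -(ler_pM2l Xc) -(integralpZ _ ti).
apply: (@le_trans _ _ I); last by move: ta; rewrite ler_pdivrMr.
apply: le_integralp; [exact: integrablepZ|exact: integrablep_norm|].
move=> x x0; rewrite mulrCA normrM ler_wpM2l// ger0_norm ?powR_ge0//.
case: (leP X (x `^ q)) => hX; last by rewrite !mulr0 powR_ge0.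
rewrite mulr1 [leRHS]powRD ?(gt_eqF x0) ?implybT// mulrC ler_wpM2l ?powR_ge0//.
have -> : x `^ 4^-1 = (x `^ q) `^ (4^-1 / q).
  by rewrite -powRrM; congr (_ `^ _); field; rewrite gt_eqF.
by apply: powR_le => //; exact: ltW.
Qed.

(** The moment is split at x^q = N a.  Below, x^(q+1) is at most a multiple of x
    and the moment is continuous in norm.  Above, tail absorption bounds the part
    cut at n a uniformly in n, and n tends to infinity.  The order of the choices
    matters: first the small eta, then a large level a, then the distance d, and
    only at the end the cut n and the bend at the origin, which d must not depend
    on. *)
Lemma normalized_moment q e tau : 0 < q -> 2 * q + 3 <= r -> 0 < e -> 0 < tau ->
  exists2 d, 0 < d & forall v, linear_solution beta gamma kappa mu r v ->
    (forall t : R, 0 <= t -> mass (v t) = mass U) ->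
    (forall t : R, 0 <= t -> finite_moment (q + 1) (v t)) ->
    (forall t : R, 0 <= t -> sqnorm r (fun x => v t x - U x) <= d) ->
    forall t, tau <= t -> `|moment (q + 1) (v t) - moment (q + 1) U| <= e.
Proof.
move=> q0 qr e0 tau0; have [uH _] := profile_in_H hU rbar_le.
have b0 := fk_beta fk; have k20 := fk_k2 fk; have /andP[g0 g2] := fk_gamma fk.
have pU : integrablep (fun x => x `^ (q + 1) * U x) by apply: profile_moment; lra.
have ler13 : 1 <= 3 :> R by rewrite ler1n.
have splitr1 : 1 = 2^-1 + 2^-1 :> R by field.
have k21 : 0 <= 1 + k2 by rewrite addr_ge0// ltW.
have N3 := low_cut_ge3 q0; set N := low_cut q in N3.
have c0 := loss_rate_gt0 fk q0; set c := @loss_rate R beta kappa q in c0.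
have m0 := profile_mass_gt0 r3 rbar_le hU.
pose e1 := e / 4; have e10 : 0 < e1 by rewrite divr_gt0.
pose M1 := mu * q * (N + 2) + 1; have M10 : 0 < M1.
  by rewrite ltr_wpDl// mulr_ge0 ?mulr_ge0 ?(ltW mu0) ?(ltW q0)//; lra.
pose eta := Num.min (e1 / (2 * (N + 3))) (e1 / (M1 * tau)).
have N30 : 0 < 2 * (N + 3) by lra.
have M1t : 0 < M1 * tau by rewrite mulr_gt0.
have eta0 : 0 < eta by rewrite lt_min !divr_gt0.
have small1 : (N + 3) * eta <= e1 / 2.
  have : eta <= e1 / (2 * (N + 3)) by rewrite ge_min lexx.
  by rewrite ler_pdivlMr//; lra.
have eta_e1 : eta / 2 <= e1.
  have : 0 <= (N + 2) * eta by rewrite mulr_ge0 ?(ltW eta0)//; lra.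
  by move: small1; lra.
have small2 : M1 * eta * tau <= e1.
  have : eta <= e1 / (M1 * tau) by rewrite ge_min lexx orbT.
  by rewrite ler_pdivlMr// mulrC mulrAC.
have p1 : 0 < q + 1 - gamma / 2 by lra.
have p2 : 2 * (q + 1 - gamma / 2) < r - 1 by lra.
have [K K0 hK] := pairing_pow p1 p2.
have h1 : 0 < (2^-1 : R) by lra.
have h2 : 2 * 2^-1 < r - 1 by lra.
have [K' K'0 hK'] := pairing_pow h1 h2.
have [K1 K10 hK1] := pairing_lin r3.
pose S := 2 + 2 * sqnorm r U.
have S0 : 0 <= S by rewrite addr_ge0// mulr_ge0// sqnorm_ge0.
pose BB := 1 + K * S; pose WB := 1 + K' * S.
have BB0 : 0 < BB by rewrite ltr_pwDl// mulr_ge0// ltW.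
have WB0 : 0 < WB by rewrite ltr_pwDl// mulr_ge0// ltW.
have s0 : 0 < gamma / (2 * q) by rewrite divr_gt0// mulr_gt0.
have eta20 : 0 < eta / 2 by rewrite divr_gt0.
have [a1 a11 ha1] := profile_tail q0 qr eta20.
pose L := Num.max (Num.max 1 (16 * BB / (e1 * (c * tau)))) (2 * (mu * q) / c).
have [a2 a21 ha2] := large_pow L s0.
pose a := Num.max a1 a2.
have aa1 : a1 <= a by rewrite le_max lexx.
have age1 : 1 <= a by exact: le_trans aa1.
have ap : 0 < a := lt_le_trans ltr01 age1.
have aL : L <= a `^ (gamma / (2 * q)) by apply: ha2; rewrite le_max lexx orbT.
pose b := (a `^ (gamma / (2 * q)))^-1.
have B0 : 0 < a `^ (gamma / (2 * q)) by exact: powR_gt0.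
have ect : 0 < e1 * (c * tau) := mulr_gt0 e10 (mulr_gt0 c0 tau0).
have L1 : 1 <= L by rewrite !le_max lexx.
have hb (x : R) : 0 < x -> a <= x `^ q -> 2 * (mu * q) / c <= x `^ gamma /\
    x `^ (- (gamma / 2)) <= b.
  move=> x0 ax; have xq : x `^ (gamma / 2) = (x `^ q) `^ (gamma / (2 * q)).
    by rewrite -powRrM; congr (_ `^ _); field; rewrite gt_eqF.
  have ge : a `^ (gamma / (2 * q)) <= x `^ (gamma / 2).
    by rewrite xq; apply: powR_le => //; exact: ltW.
  split; last by rewrite powRN lef_pV2 ?posrE ?powR_gt0.
  have -> : gamma = gamma / 2 + gamma / 2 by field.
  rewrite powRD ?(gt_eqF x0) ?implybT//.
  have Lx := le_trans aL ge; have y1 := le_trans L1 Lx.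
  apply: (@le_trans _ _ L); first by rewrite le_max lexx orbT.
  by apply: (le_trans Lx); rewrite ler_peMr// (le_trans ler01).
have smallb : 16 * (b * BB) <= e1 * (c * tau).
  rewrite /b mulrCA ler_pdivrMl// mulrC -ler_pdivrMr// [BB * _]mulrC.
  by apply: le_trans aL; rewrite !le_max lexx orbT.
pose r' := r - 3; have r'0 : 0 < r' by rewrite subr_gt0.
have Na0 : 0 < N * a := mulr_gt0 (lt_le_trans ltr01 (le_trans ler13 N3)) ap.
pose d := Num.min 1 (Num.min ((eta / 2) ^+ 2 / (4 / r')) (e1 ^+ 2 / ((N * a) ^+ 2 * K1))).
have d0 : 0 < d.
  have Na2 : 0 < (N * a) ^+ 2 * K1 := mulr_gt0 (exprn_gt0 2 Na0) K10.
  have h3 : 0 < (eta / 2) ^+ 2 / (4 / r') by apply: divr_gt0; [exact: exprn_gt0|exact: divr_gt0].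
  have h4 : 0 < e1 ^+ 2 / ((N * a) ^+ 2 * K1) := divr_gt0 (exprn_gt0 2 e10) Na2.
  by rewrite /d !lt_min ltr01 h3 h4.
exists d => // v sv mv fv dv t tt.
have vH s (s0 : 0 <= s) := (solution_in_H sv s0).1.
have hH s : 0 <= s -> in_H r (fun x => v s x - U x) by move=> s0'; have [] := in_HB (vH s s0') uH.
have vS s : 0 <= s -> sqnorm r (v s) <= S.
  move=> s0'; have [_ le] := in_HD (hH s s0') uH.
  have E : sqnorm r (fun x => v s x - U x + U x) = sqnorm r (v s) by apply: eq_sqnorm => x _; rewrite subrK.
  rewrite E in le; apply: (le_trans le); rewrite lerD2r -[leRHS]mulr1 ler_pM2l//.
  by apply: (le_trans (dv s s0')); rewrite ge_min lexx.
have absI s psi : integralp (fun x => `|v s x * psi x|) = pair (fun x => `|v s x|) (fun x => `|psi x|).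
  by apply: eq_integralp => x _; rewrite normrM.
have hB s : 0 <= s -> integrablep (fun x => `|v s x| * x `^ (q + 1 - gamma / 2)) /\
    pair (fun x => `|v s x|) (fun x => x `^ (q + 1 - gamma / 2)) <= BB.
  move=> s0'; have [//| | |i le] := hK 1 (v s) (fun x => x `^ (q + 1 - gamma / 2)) _ (vH s s0').
  - exact: measurable_powRD.
  - by move=> x x0; rewrite mul1r ger0_norm// powR_ge0.
  have E (x : R) : 0 < x -> `|v s x * x `^ (q + 1 - gamma / 2)| = `|v s x| * x `^ (q + 1 - gamma / 2).
    by move=> x0; rewrite normrM [X in _ * X]ger0_norm// powR_ge0.
  split; first by apply: eq_integrablep (integrablep_norm i).
  rewrite /pair -(eq_integralp E); apply: le_of_sqr; first by rewrite mulr_ge0// ltW.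
  by apply: (le_trans le); rewrite expr1n mul1r ler_wpM2l ?vS// ltW.
have hW s : 0 <= s -> pair (fun x => `|v s x|) (fun x => x `^ 2^-1) <= WB /\
    integrablep (fun x => `|v s x| * x `^ 2^-1).
  move=> s0'; have [//| | |i le] := hK' 1 (v s) (fun x => x `^ 2^-1) _ (vH s s0').
  - exact: measurable_powRD.
  - by move=> x x0; rewrite mul1r ger0_norm// powR_ge0.
  have E (x : R) : 0 < x -> `|v s x * x `^ 2^-1| = `|v s x| * x `^ 2^-1.
    by move=> x0; rewrite normrM [X in _ * X]ger0_norm// powR_ge0.
  split; last by apply: eq_integrablep (integrablep_norm i).
  rewrite /pair -(eq_integralp E); apply: le_of_sqr; first by rewrite mulr_ge0// ltW.
  by apply: (le_trans le); rewrite expr1n mul1r ler_wpM2l ?vS// ltW.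
(* The tail of v is that of the profile plus that of the difference; the
   latter is bounded uniformly in X. *)
have hS X s : a <= X -> 0 <= s -> pair (fun x => `|v s x|) (tail_weight q X) <= eta.
  move=> aX s0'; have X1 : 1 <= X := le_trans age1 aX.
  have X0 : 0 <= X := le_trans ler01 X1; have sT := sublinear_tail_weight q X0.
  have [ah _] := abs_in_H (vH s s0'); have [aU _] := abs_in_H uH.
  have [i le] := tail_weight_pairing r3 q0 qr X1 (hH s s0').
  have E (x : R) : 0 < x -> `|(v s x - U x) * tail_weight q X x| = `|v s x - U x| * tail_weight q X x.
    by move=> x0; rewrite normrM [X in _ * X]ger0_norm// tail_weight_ge0.
  have le1 : integralp (fun x => `|v s x - U x| * tail_weight q X x) <= eta / 2.
    rewrite -(eq_integralp E); apply: le_of_sqr2; first exact: ltW.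
    apply: (le_trans le); rewrite mulrC -ler_pdivlMr ?divr_gt0//.
    by apply: (le_trans (dv s s0')); rewrite !ge_min lexx orbT.
  have i1 := eq_integrablep E (integrablep_norm i).
  have i2 := pair_int r3 aU sT.
  have i3 := tail_moment_integrable a (in_H_meas uH) pU.
  have le2 : pair (fun x => `|U x|) (tail_weight q X) <= eta / 2.
    apply: le_trans (ha1 a aa1); apply: le_integralp => // x x0; rewrite ler_wpM2l//.
    rewrite /tail_weight; case: (leP X (x `^ q)) => hX; last by rewrite !mulr0 mulr_ge0 ?powR_ge0.
    rewrite (le_trans aX hX) !mulr1 pow_split// mulrC ler_pM2l//.
  rewrite (splitr eta); apply: le_trans (lerD le1 le2); rewrite /pair -(integralpD i1 i2).
  apply: le_integralp; [exact: pair_int r3 ah sT|exact: integrablepD|] => x x0.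
  rewrite -mulrDl ler_wpM2r//; first exact: tail_weight_ge0.
  by rewrite -[in leLHS](subrK (U x) (v s x)) ler_normD.
(* The bend at the origin is taken at z / 3, depending on n. *)
have key n : N <= n -> pair (fun x => `|v t x|) (fun x => x `^ (q + 1) * middle q a n x) <= 2 * e1.
  move=> nN; have n1 : 1 <= n := le_trans (le_trans ler13 N3) nN.
  pose k := top_level a n; have k0 : 0 <= k by rewrite mulr_ge0 ?(ltW ap)// subr_ge0.
  pose CE := beta * k * (1 + k2) * mass U + 1.
  have CE0 : 0 < CE.
    by apply: ltr_wpDl => //; apply: mulr_ge0 (mulr_ge0 (mulr_ge0 (ltW b0) k0) k21) (ltW m0).
  have CW0 : 0 < k * WB + 1 by rewrite ltr_wpDl// mulr_ge0// ltW.
  have [z1 /andP[z10 z11] hz1] := small_pow g0 (divr_gt0 eta0 CE0).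
  have [z2 /andP[z20 z21] hz2] := small_pow h1 (divr_gt0 eta0 CW0).
  pose z := Num.min z1 z2; have z0 : 0 < z by rewrite lt_min z10.
  have zz1 : z <= z1 by rewrite ge_min lexx.
  have zz2 : z <= z2 by rewrite ge_min lexx orbT.
  have ze : 3 * (z / 3) = z by field.
  have eps0 : 0 < z / 3 by rewrite divr_gt0.
  have eps3 : 3 * (z / 3) <= 1 by rewrite ze (le_trans zz1).
  apply: (tail_absorption fk mu0 r3 q0 age1 eps0 eps3 nN (b := b) sv mv e10 eta0 _ tau0 hb smallb small1 small2 hB) => //.
  - by rewrite invr_ge0 powR_ge0.
  - by move=> s s0'; exact: hS.
  - by move=> s s0'; apply: hS => //; rewrite ler_peMl ?(ltW ap).
  - move=> s s0'; have [w1 w2] := hW s s0'; have [ah _] := abs_in_H (vH s s0').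
    rewrite ze; have sl : sublinear (fun x : R => x * (x <= z)%R%:R).
      by have := sublinear_low (z / 3); rewrite ze.
    have : pair (fun x => `|v s x|) (fun x => x * (x <= z)%R%:R) <= z2 `^ 2^-1 * WB.
      apply: (@le_trans _ _ (z2 `^ 2^-1 * pair (fun x => `|v s x|) (fun x => x `^ 2^-1))).
        rewrite /pair -(integralpZ _ w2); apply: le_integralp; [exact: pair_int r3 ah sl|exact: integrablepZ|].
        move=> x x0; rewrite [leRHS]mulrCA ler_wpM2l//; case: (leP x z) => xz; last first.
          by rewrite mulr0 mulr_ge0 ?powR_ge0.
        have -> : x * true%:R = x `^ 2^-1 * x `^ 2^-1.
          by rewrite -powRD ?(gt_eqF x0) ?implybT// mulr1 -splitr1 powRr1// ltW.
        rewrite ler_wpM2r ?powR_ge0//.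
        by apply: powR_le; [exact: ltW|exact: ltW|exact: le_trans zz2].
      by rewrite ler_wpM2l ?powR_ge0.
    move: hz2; rewrite ler_pdivlMr// => hz2 h.
    apply: (le_trans (ler_wpM2l k0 h)); apply: le_trans hz2.
    by rewrite mulrCA ler_wpM2l ?powR_ge0// lerDl.
  - rewrite /error_rate ze -/k.
    have h : z `^ gamma <= z1 `^ gamma by apply: powR_le => //; exact: ltW.
    move: hz1; rewrite ler_pdivlMr//; apply: le_trans.
    have C0 : 0 <= beta * k * (1 + k2) * mass U.
      exact: mulr_ge0 (mulr_ge0 (mulr_ge0 (ltW b0) k0) k21) (ltW m0).
    rewrite mulrAC [leRHS]mulrC; apply: ler_pM => //; first exact: powR_ge0.
    by rewrite /CE lerDl.
have t0 : 0 <= t := le_trans (ltW tau0) tt.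
have i3 := tail_moment_integrable (N * a) (in_H_meas (vH t t0)) (fv t t0).
have tailv : tail_moment q (N * a) (v t) <= 2 * e1.
  pose f_ (j : nat) x := `|v t x| * (x `^ (q + 1) * (N * a <= x `^ q)%R%:R) -
    `|v t x| * (x `^ (q + 1) * middle q a (N + j%:R) x).
  have [ah _] := abs_in_H (vH t t0).
  have Nj (j : nat) : N <= N + j%:R by rewrite lerDl ler0n.
  have im (j : nat) := pair_int r3 ah (sublinear_middle (n := N + j%:R) q0 age1 (Nj j)).
  have cvg0 : integralp (f_ j) @[j --> \oo] --> (0 : R).
    apply: (integralp_dominated_cvg _ i3).
    - by move=> j; exact: integrablep_meas (integrablepB i3 (im j)).
    - move=> j x x0; rewrite /f_ /middle -mulrBr -mulrBr normrM normr_id normrM.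
      rewrite (ger0_norm (powR_ge0 _ _)) ler_wpM2l// ler_wpM2l ?powR_ge0//.
      case: (N * a <= _); rewrite ?mul0r ?subrr ?normr0// mul1r.
      by case: (_ <= (N + _) * a); rewrite ?subrr ?subr0 ?normr0 ?normr1.
    - move=> x x0; apply: cvg_near_cst; exists (Num.truncn (x `^ q / a)).+1 => // j /= hj.
      rewrite /f_ /middle; have -> : x `^ q <= (N + j%:R) * a.
        rewrite -ler_pdivrMr//; apply: (@le_trans _ _ j%:R); last by rewrite lerDr (le_trans _ N3).
        apply/ltW; apply: (@lt_le_trans _ _ (Num.truncn (x `^ q / a)).+1%:R); last by rewrite ler_nat.
        exact: truncnS_gt.
      by rewrite mulr1 subrr.
  apply/ler_addgt0Pr => z z0; move/cvgrPdist_le: cvg0 => /(_ z z0) [j _ /(_ j (leqnn j))] /=.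
  rewrite sub0r normrN /f_ (integralpB i3 (im j)) => /(le_trans (ler_norm _)).
  by rewrite lerBlDr => h; apply: (le_trans h); rewrite addrC lerD2r; exact: key (N + j%:R) (Nj j).
have tailU : tail_moment q (N * a) U <= e1.
  have h3 : a1 <= N * a by apply: (le_trans aa1); rewrite ler_peMl ?(ltW ap)// (le_trans ler13).
  by apply: (le_trans (ha1 _ h3)); exact: eta_e1.
have i4 := tail_moment_integrable (N * a) (in_H_meas uH) pU.
have [ahh _] := abs_in_H (hH t t0).
have [| | |i5 le5] := hK1 (N * a) (fun x => v t x - U x) (fun x => N * a * x) _ (hH t t0).
- exact: ltW.
- exact: measurable_funM.
- by move=> x x0; rewrite ger0_norm// mulr_ge0 ?ltW.
have lin : integralp (fun x => `|(v t x - U x) * (N * a * x)|) <= e1.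
  apply: le_of_sqr2; first exact: ltW.
  apply: (le_trans le5); rewrite mulrC -ler_pdivlMr; last exact: mulr_gt0 (exprn_gt0 2 Na0) K10.
  by apply: (le_trans (dv t t0)); rewrite !ge_min lexx !orbT.
rewrite /moment -!/(integralp _) -(integralpB (fv t t0) pU).
have i6 := integrablepD (integrablep_norm i5) (integrablepD i3 i4).
apply: (@le_trans _ _ (integralp (fun x => `|(v t x - U x) * (N * a * x)| +
  (`|v t x| * (x `^ (q + 1) * (N * a <= x `^ q)%R%:R) + `|U x| * (x `^ (q + 1) * (N * a <= x `^ q)%R%:R))))).
  apply: norm_integralp_le => //; first exact: integrablep_meas (integrablepB (fv t t0) pU).
  move=> x x0; rewrite -mulrBr normrM (ger0_norm (powR_ge0 _ _)).
  rewrite -mulrDl; case: (leP (N * a) (x `^ q)) => hx.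
    rewrite mulr1 -[leLHS]add0r; apply: lerD => //.
    by rewrite mulrC ler_wpM2r ?powR_ge0// ler_normB.
  rewrite !mulr0 addr0 normrM mulrC ler_wpM2l// ger0_norm; last by rewrite mulr_ge0 ?ltW.
  by rewrite pow_split// mulrC ler_pM2r// ltW.
rewrite (integralpD (integrablep_norm i5) (integrablepD i3 i4)) (integralpD i3 i4).
have E4 : e = e1 + (2 * e1 + e1) by rewrite /e1; field.
by rewrite E4; apply: lerD => //; apply: lerD.
Qed.

(** For p <= 1 the moment of order p is continuous in norm. *)
Lemma low_moment p e : 0 < p <= 1 -> 2 * p + 1 <= r -> 0 < e ->
  exists2 d, 0 < d & forall h, in_H r h -> finite_moment p h ->
    sqnorm r (fun x => h x - U x) <= d -> `|moment p h - moment p U| <= e.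
Proof.
move=> /andP[p0 p1] pr e0; have pr' : 2 * p < r - 1 by have := r3; lra.
have [K K0 hK] := pairing_pow p0 pr'; have [uH _] := profile_in_H hU rbar_le.
exists (e ^+ 2 / K) => [|h hh fh hd]; first by rewrite divr_gt0 ?exprn_gt0.
have [dH _] := in_HB hh uH.
have [//| | |i le] := hK 1 (fun x => h x - U x) (fun x => x `^ p) _ dH.
- exact: measurable_powRD.
- by move=> x x0; rewrite mul1r ger0_norm// powR_ge0.
rewrite /moment -!/(integralp _) -(integralpB fh (profile_moment p0 pr)).
apply: (@le_trans _ _ (integralp (fun x => `|(h x - U x) * x `^ p|))).
  apply: norm_integralp_le; [|exact: integrablep_norm|].
    exact: integrablep_meas (integrablepB fh (profile_moment p0 pr)).
  by move=> x x0; rewrite -mulrBr mulrC.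
apply: le_of_sqr2; first exact: ltW.
apply: (le_trans le); rewrite expr1n mul1r mulrC -ler_pdivlMr//.
Qed.

(** Close to the profile in H, the moment of order p is close to that of the
    profile as well: at once if p <= 1, after an arbitrarily short time if
    p > 1, where H may fail to control this moment. *)
Lemma moment_close p e tau : 0 < p -> 2 * p + 1 <= r -> 0 < e -> 0 < tau ->
  exists2 d, 0 < d & forall v, linear_solution beta gamma kappa mu r v ->
    nontrivial (v 0) -> (forall t : R, 0 <= t -> finite_moment p (v t)) ->
    (forall t : R, 0 <= t -> sqnorm r (defect U v t) <= d) ->
    forall t, tau <= t ->
    `|moment p (v t) - rho0 U (v 0) * moment p U| <= e * rho0 U (v 0).
Proof.
move=> p0 pr e0 tau0.
have [d d0 hd] : exists2 d, 0 < d & forall v, linear_solution beta gamma kappa mu r v ->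
    (forall t : R, 0 <= t -> mass (v t) = mass U) ->
    (forall t : R, 0 <= t -> finite_moment p (v t)) ->
    (forall t : R, 0 <= t -> sqnorm r (fun x => v t x - U x) <= d) ->
    forall t, tau <= t -> `|moment p (v t) - moment p U| <= e.
  have [p1|p1] := leP p 1.
    have [|d d0 hd] := low_moment _ pr e0; first by rewrite p0.
    exists d => // v sv _ fv dv t tt; have t0 : 0 <= t by lra.
    exact: hd (solution_in_H sv t0).1 (fv t t0) (dv t t0).
  have q0 : 0 < p - 1 by lra.
  have qr : 2 * (p - 1) + 3 <= r by lra.
  by have := normalized_moment q0 qr e0 tau0; rewrite subrK.
exists d => // v sv nt fv dv t tt.
have rho := rho0_gt0 r3 rbar_le hU (solution_in_H sv (lexx 0)) nt.
set A := rho0 U (v 0) in rho *; have A0 : 0 <= A^-1 by rewrite invr_ge0 ltW.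
have cmu (z : R) : {for z, continuous (fun s : R => (fun=> mu) (clamp s))} by exact: cst_continuous.
have sw := scale_solution A0 cmu sv.
have mw s : 0 <= s -> mass (fun x => A^-1 * v s x) = mass U.
  move=> s0; rewrite /mass (pairZl _ r3 (solution_in_H sv s0).1 sublinear_id) -/(mass _).
  have m0 := mass_gt0 r3 (solution_in_H sv (lexx 0)) nt.
  rewrite (mass_conserved fk r3 rbar_le hU hgap sv nt s0) /A rho0E.
  by rewrite invf_div divfK// gt_eqF.
have E s (x : R) : x `^ p * (A^-1 * v s x) = A^-1 * (x `^ p * v s x) by rewrite mulrCA.
have fw s : 0 <= s -> finite_moment p (fun x => A^-1 * v s x).
  by move=> s0; apply: (eq_integrablep _ (integrablepZ A^-1 (fv s s0))) => x _; rewrite E.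
have t0 : 0 <= t by lra.
have := hd _ sw mw fw dv t tt.
have -> : moment p (fun x => A^-1 * v t x) = A^-1 * moment p (v t).
  by rewrite /moment -(integralpZ A^-1 (fv t t0)); apply: eq_integralp => x _; rewrite E.
have -> : A^-1 * moment p (v t) - moment p U = A^-1 * (moment p (v t) - A * moment p U).
  by field; rewrite gt_eqF.
by rewrite normrM (ger0_norm A0) ler_pdivrMl// [A * e]mulrC.
Qed.

End moment_stability.

(** * Dynamics of the dilation *)

Section global_primitive.
Context {R : realType}.

Lemma primitive_line (c : R -> R) : (forall t : R, {for t, continuous c}) ->
  exists2 P : R -> R, P 0 = 0 & forall t : R, is_derive t 1 P (c t).
Proof.
move=> cc; have ex (n : nat) : exists Q : R -> R, Q 0 = 0 /\
    forall t : R, - n.+1%:R < t -> is_derive t 1 Q (c t).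
  have cs (t : R) : {for t, continuous (fun t : R => c (t - n%:R))}.
    apply: (continuous_comp (f := fun t : R => t - n%:R)); last exact: cc.
    by apply: continuousB; [exact: cvg_id|exact: cst_continuous].
  have [P [_ dP _]] := primitive cs.
  exists (fun t => P (t + n%:R) - P n%:R); split; first by rewrite add0r subrr.
  move=> t tn; have tn1 : -1 < t + n%:R by move: tn; rewrite -natr1; lra.
  have h := derB (der_comp (f := P) (g := fun t => t + n%:R) (dP _ tn1)
    (derD (derI t) (derC n%:R t))) (derC (P n%:R) t).
  by apply: (derE h); rewrite addrK addr0 mulr1 subr0.
pose Q n := projT1 (cid (ex n)).
have Q0 n : Q n 0 = 0 by rewrite /Q; case: cid => Q' [].
have dQ n (t : R) : - n.+1%:R < t -> is_derive t 1 (Q n) (c t).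
  by rewrite /Q; case: cid => Q' [_ /=]; exact.
have agree n m (t : R) : (n <= m)%N -> - n.+1%:R < t -> Q m t = Q n t.
  move=> nm tn; pose G s := Q m s - Q n s.
  have dG (s : R) : - n.+1%:R < s -> is_derive s 1 G 0.
    move=> sn; have sm : - m.+1%:R < s by apply: le_lt_trans sn; rewrite lerN2 ler_nat.
    by apply: (derE (derB (dQ m s sm) (dQ n s sn))); rewrite subrr.
  have nn : - n.+1%:R < 0 :> R by rewrite oppr_lt0 ltr0n.
  have eG : G t = G 0.
    have [t0|t0] := leP 0 t.
      apply: zero_der_const t0 _ _ => s /andP[s1 s2]; last apply: is_derive_cont; apply: dG; lra.
    apply/esym; apply: zero_der_const (ltW t0) _ _ => s /andP[s1 s2]; last apply: is_derive_cont; apply: dG; lra.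
  by apply/eqP; rewrite -subr_eq0 -/(G t) eG /G !Q0 subrr.
pose N (t : R) := Num.truncn `|t|; exists (fun t => Q (N t) t); first exact: Q0.
have inN (s : R) n : (N s <= n)%N -> - n.+1%:R < s.
  move=> sn; have h := truncnS_gt `|s|; rewrite -/(N s) in h.
  have : (N s).+1%:R <= n.+1%:R :> R by rewrite ler_nat.
  by have := ler_norm (- s); rewrite normrN; lra.
move=> t; apply: (der_near (f := Q (N t).+1)); last by apply: dQ; exact: inN.
have nt : \forall s \near t, `|t - s| < 1 by exact: nbhsx_ballx.
apply: filterS nt => s ts; have Ns : (N s <= (N t).+1)%N.
  rewrite -ltnS -(ltr_nat R); apply: (@le_lt_trans _ _ `|s|).
    by have /andP[] := truncn_itv (normr_ge0 s).
  have h := truncnS_gt `|t|; have := ler_normB t (t - s).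
  by rewrite subKr -[(N t).+2]addn1 natrD -/(N t) in h *; move=> h1; rewrite /N; lra.
have sN : - (N s).+1%:R < s by exact: inN.
by rewrite (agree _ _ _ Ns sN).
Qed.

End global_primitive.

Section potential_well.
Context {R : realType}.

(** Bounded away from 0 outside every neighbourhood of z0, infinity included. *)
Definition separated (z0 : R) (g : R -> R) : Prop :=
  forall r : R, 0 < r -> exists2 c : R, 0 < c & forall z : R, r <= `|z - z0| -> c <= `|g z|.

(** A primitive of a function with the sign of z - z0 has its minimum at z0,
    and its sublevel sets shrink to z0. *)
Lemma well_ge0 (G g : R -> R) (z0 z : R) : (forall t : R, is_derive t 1 G (g t)) ->
  G z0 = 0 -> (forall t : R, 0 <= (t - z0) * g t) -> 0 <= G z.
Proof.
move=> dG G0 sg; have cG (t : R) : {for t, continuous G} by exact: is_derive_cont (dG t).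
have [zz|zz] := leP z0 z.
  have := @incr_bound _ (fun t => - G t) (fun t => - g t) z0 z 0 zz
    (fun t _ => derN (dG t)) (fun t _ => is_derive_cont (derN (dG t))).
  rewrite mul0r G0; have h (t : R) : z0 < t < z -> - g t <= 0.
    by move=> /andP[t1 _]; have := sg t; rewrite pmulr_rge0; lra.
  by move=> /(_ h); lra.
have := incr_bound (ltW zz) (fun t _ => dG t) (fun t _ => cG t).
move=> /(_ 0); rewrite mul0r G0; have h (t : R) : z < t < z0 -> g t <= 0.
  by move=> /andP[_ t1]; have := sg t; rewrite nmulr_rge0; lra.
by move=> /(_ h); lra.
Qed.

Lemma well_small (G g : R -> R) (z0 e : R) : (forall t : R, is_derive t 1 G (g t)) ->
  G z0 = 0 -> (forall t : R, 0 <= (t - z0) * g t) -> separated z0 g -> 0 < e ->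
  exists2 al, 0 < al & forall z : R, G z <= al -> `|z - z0| <= e.
Proof.
move=> dG G0 sg sep e0; have e20 : 0 < e / 2 by lra.
have [c c0 hc] := sep _ e20; exists (c * (e / 4)); first by rewrite mulr_gt0//; lra.
move=> z Gz; rewrite leNgt; apply/negP => ez.
have ce : 0 < c * e by rewrite mulr_gt0.
have [zz|zz] := leP z0 z.
  rewrite ger0_norm in ez; last by lra.
  have z1z : z0 + e / 2 <= z by lra.
  have := @incr_bound _ (fun t => - G t) (fun t => - g t) (z0 + e / 2) z (- c) z1z
    (fun t _ => derN (dG t)) (fun t _ => is_derive_cont (derN (dG t))).
  have h (t : R) : z0 + e / 2 < t < z -> - g t <= - c.
    move=> /andP[t1 _]; have g0 : 0 <= g t by have := sg t; rewrite pmulr_rge0; lra.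
    by have := hc t; rewrite !ger0_norm//; lra.
  move=> /(_ h); have := well_ge0 (z0 + e / 2) dG G0 sg.
  have : c * (e / 2) <= c * (z - (z0 + e / 2)) by rewrite ler_pM2l//; lra.
  by lra.
rewrite ltr0_norm in ez; last by lra.
have zz1 : z <= z0 - e / 2 by lra.
have h (t : R) : z < t < z0 - e / 2 -> g t <= - c.
  move=> /andP[_ t1]; have g0 : g t <= 0 by have := sg t; rewrite nmulr_rge0; lra.
  by have := hc t; rewrite !ler0_norm//; lra.
have := incr_bound zz1 (fun t _ => dG t) (fun t _ => is_derive_cont (dG t)) h.
have := well_ge0 (z0 - e / 2) dG G0 sg.
have : c * (e / 2) <= c * (z0 - e / 2 - z) by rewrite ler_pM2l//; lra.
by lra.
Qed.

End potential_well.

(** The long-time dynamics seen by the dilation: q is the logarithm of the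
    moment of order p, ell that of the length scale, psi the excess of the
    growth rate over mu, which is nearly phi(q). *)
Section dilation_dynamics.
Context {R : realType}.
Variables (mu gamma p q0 B : R) (phi : R -> R).
Hypotheses (mu0 : 0 < mu) (gamma0 : 0 < gamma) (p0 : 0 < p).
Hypothesis cphi : forall t : R, {for t, continuous phi}.
Hypothesis phi_sign : forall s : R, (s - q0) * phi s <= 0.
Hypothesis phi_sep : separated q0 phi.
Hypothesis phi_bound : forall s : R, `|phi s| <= B.
Hypothesis phi_unif : forall Q e : R, 0 < e -> exists2 d : R, 0 < d &
  forall q s : R, q <= Q -> `|s - q| <= d -> `|phi s - phi q| <= e.
Implicit Types q ell psi : R -> R.

(** Relaxation of the length scale: ell' = psi - drift ell. *)
Definition drift (l : R) : R := mu * (expR (gamma * l) - 1).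

Record trajectory q ell psi : Prop := Trajectory {
  tj_ell : forall t : R, 0 <= t -> is_derive t 1 ell (psi t - drift (ell t));
  tj_q : forall t : R, 0 <= t ->
    is_derive t 1 q (p * psi t - (p - 1) * drift (ell t)) }.

(** The growth rate is phi at a point close to q, rather than close to phi q:
    in this form no bound on q is required beforehand. *)
Definition tracks q psi (d T : R) : Prop :=
  forall t : R, T <= t -> exists2 s, `|s - q t| <= d & psi t = phi s.

Lemma drift_incr l l' : l <= l' -> drift l <= drift l'.
Proof.
by move=> ll; rewrite ler_pM2l// lerD2r ler_expR ler_pM2l.
Qed.

Lemma drift0 : drift 0 = 0.
Proof. by rewrite /drift mulr0 expR0 subrr mulr0. Qed.

Lemma drift_sign l : 0 <= l * drift l.
Proof.
have [l0|l0] := leP 0 l.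
  by rewrite mulr_ge0// -drift0 drift_incr.
by rewrite mulr_le0// ?(ltW l0)// -drift0 drift_incr// ltW.
Qed.

Lemma drift_sep : separated 0 drift.
Proof.
move=> r r0; have gr : 0 < gamma * r by rewrite mulr_gt0.
have h1 : 1 < expR (gamma * r) by rewrite -[X in X < _]expR0 ltr_expR.
have h2 : expR (- (gamma * r)) < 1 by rewrite -[X in _ < X]expR0 ltr_expR oppr_lt0.
exists (Num.min (mu * (expR (gamma * r) - 1)) (mu * (1 - expR (- (gamma * r))))).
  by rewrite lt_min !mulr_gt0//; lra.
move=> z; rewrite subr0; have [z0|z0] := leP 0 z.
  rewrite ger0_norm// => rz; have dz := drift_incr rz; rewrite ge_min; apply/orP; left.
  by apply: (le_trans dz); exact: ler_norm.
rewrite ltr0_norm// => rz; have dz : drift z <= drift (- r) by apply: drift_incr; lra.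
rewrite ge_min; apply/orP; right; rewrite -normrN; apply: le_trans (ler_norm _).
by move: dz; rewrite {2}/drift mulrN; lra.
Qed.

Lemma drift_large M : exists2 L, 0 <= L & forall l, L <= l -> M <= drift l.
Proof.
have h : 1 <= 1 + `|M| / mu by rewrite lerDl divr_ge0// ltW.
exists (ln (1 + `|M| / mu) / gamma); first by rewrite divr_ge0 ?ln_ge0 ?(ltW gamma0).
move=> l /drift_incr; apply: le_trans; rewrite /drift mulrC [gamma * _]mulrC divfK ?gt_eqF//.
rewrite lnK ?posrE; last by lra.
by rewrite [1 + _]addrC addrK divfK ?gt_eqF// ler_norm.
Qed.

Lemma B_ge0 : 0 <= B.
Proof. exact: le_trans (normr_ge0 _) (phi_bound 0). Qed.

Section one_trajectory.
Variables (q ell psi : R -> R).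
Hypothesis tj : trajectory q ell psi.

Lemma tj_ell_cont t : 0 <= t -> {for t, continuous ell}.
Proof. by move=> t0; exact: is_derive_cont (tj_ell tj t0). Qed.

Lemma psi_bound d T t : tracks q psi d T -> T <= t -> `|psi t| <= B.
Proof. by move=> tr /tr[s _ ->]. Qed.

Lemma ell_above T : 0 <= T -> tracks q psi 1 T ->
  exists2 L, 0 <= L & exists2 T', T <= T' & forall t, T' <= t -> ell t <= L.
Proof.
move=> T0 tr; have [L L0 hL] := drift_large (B + 1); exists L => //.
apply: (@eventually_below _ ell (fun t => psi t - drift (ell t)) L 1 T) => //.
- by move=> t Tt; apply: tj_ell_cont; lra.
- by move=> t Tt; apply: (tj_ell tj); lra.
- move=> t Tt /hL; have := psi_bound tr (ltW Tt); rewrite ler_norml => /andP[_]; lra.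
Qed.

Lemma psi_high T : tracks q psi 1 T -> exists2 c, 0 < c & forall t, T <= t ->
  2 <= `|q t - q0| -> (q t - q0) * psi t <= - c.
Proof.
move=> tr; have [c c0 hc] := phi_sep ltr01; exists c => // t Tt qt.
have [s sq ->] := tr t Tt; have := hc s; have := phi_sign s.
move: sq; rewrite ler_norml => /andP[s1 s2].
have [h|h] := leP q0 (q t).
  rewrite ger0_norm in qt; last by lra.
  rewrite pmulr_rle0; last by lra.
  move=> ps; rewrite ger0_norm; last by lra.
  by rewrite ler0_norm// => /(_ ltac:(lra)) cs; nra.
rewrite ltr0_norm in qt; last by lra.
rewrite nmulr_rle0; last by lra.
move=> ps; rewrite ltr0_norm; last by lra.
by rewrite ger0_norm// => /(_ ltac:(lra)) cs; nra.
Qed.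

Lemma psi_above T : tracks q psi 1 T -> exists2 c, 0 < c & forall t, T <= t ->
  q0 + 2 <= q t -> psi t <= - c.
Proof.
move=> tr; have [c c0 hc] := phi_sep ltr01; exists c => // t Tt qt.
have [s sq ->] := tr t Tt; have := hc s; have := phi_sign s.
move: sq; rewrite ler_norml => /andP[s1 s2].
rewrite pmulr_rle0; last by lra.
move=> ps; rewrite ger0_norm; last by lra.
by rewrite ler0_norm// => /(_ ltac:(lra)); lra.
Qed.

(** The moment stays bounded.  If p <= 1, the length scale is bounded above
    and the drift is compensated by a bounded function of it; if p > 1, by a
    quadratic energy. *)
Lemma q_bounded_low T : p <= 1 -> 0 <= T -> tracks q psi 1 T ->
  exists Q, exists2 T', T <= T' & forall t, T' <= t -> q t <= Q.
Proof.
move=> p1 T0 tr; have [L L0 [T1 TT1 hL]] := ell_above T0 tr.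
have [c c0 hc] := psi_above tr.
(* The ramp has slope 1 where ell >= 0, so that the drift cancels there, and
   where ell < 0 all terms have the favourable sign. *)
pose W t := q t + (1 - p) * ramp (ell t + 1).
pose al := q0 + 2 + (1 - p) * (L + 1).
pose dW t := p * psi t - (p - 1) * drift (ell t) +
  (1 - p) * (clip (ell t + 1) * (psi t - drift (ell t))).
have dWP (t : R) : 0 <= t -> is_derive t 1 W (dW t).
  move=> t0; have h1 : is_derive t 1 (fun s => ell s + 1) (psi t - drift (ell t)).
    by apply: (derE (derD (tj_ell tj t0) (derC 1 t))); rewrite addr0.
  exact: derD (tj_q tj t0) (derZ (1 - p) (der_comp (f := ramp) (g := fun s => ell s + 1) (der_ramp _) h1)).
have cWP (t : R) : 0 <= t -> {for t, continuous W} by move=> t0; exact: is_derive_cont (dWP t t0).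
have pc : 0 < p * c by rewrite mulr_gt0.
have [| | |T' T1T' hT'] := @eventually_below _ W dW al (p * c) T1 pc.
- by move=> t Tt; apply: cWP; lra.
- by move=> t Tt; apply: dWP; lra.
- move=> t Tt; rewrite /W /al => hW.
  have /andP[r0 r1] := ramp_bounds (ell t + 1).
  have el := hL t (ltW Tt).
  have rL : ramp (ell t + 1) <= L + 1.
    by apply: (le_trans r1); rewrite ge_max; apply/andP; split; lra.
  have qt : q0 + 2 <= q t.
    have : (1 - p) * ramp (ell t + 1) <= (1 - p) * (L + 1) by rewrite ler_wpM2l//; lra.
    by lra.
  have ps := hc t (le_trans TT1 (ltW Tt)) qt.
  rewrite /dW; have /andP[k0 k1] := clip_bounds (ell t + 1); have sg := drift_sign (ell t).
  suff h : (1 - p) * (drift (ell t) + clip (ell t + 1) * (psi t - drift (ell t))) <= 0.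
    have : p * psi t <= p * - c by rewrite ler_pM2l.
    by move: h; set u := clip _ * _; lra.
  apply: mulr_ge0_le0; first by lra.
  have [e0|e0] := leP 0 (ell t).
    by rewrite clip1; lra.
  have d0 : drift (ell t) <= 0 by rewrite -drift0 drift_incr// ltW.
  by nra.
exists al, T'; first exact: le_trans TT1 T1T'.
move=> t Tt; have := hT' t Tt; rewrite /W.
have /andP[r0 _] := ramp_bounds (ell t + 1).
have : 0 <= ramp (ell t + 1) by apply: le_trans r0; rewrite le_max lexx orbT.
move=> h; have : 0 <= (1 - p) * ramp (ell t + 1) by rewrite mulr_ge0//; lra.
by lra.
Qed.

Lemma q_bounded_high T : 1 < p -> 0 <= T -> tracks q psi 1 T ->
  exists Q, exists2 T', T <= T' & forall t, T' <= t -> q t <= Q.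
Proof.
move=> p1 T0 tr; have [c c0 hc] := psi_high tr.
have [c2 c20 hc2] := drift_sep ltr01; have B0 := B_ge0; have p10 : 0 < p - 1 by lra.
(* This combination has the derivative psi: the drift cancels. *)
pose a t := q t - q0 - (p - 1) * ell t.
pose V t := a t ^+ 2 / 2 + (p - 1) * (ell t ^+ 2 / 2).
pose dV t := (q t - q0) * psi t - (p - 1) * (ell t * drift (ell t)).
have dVP (t : R) : 0 <= t -> is_derive t 1 V (dV t).
  move=> t0; have h1 := tj_ell tj t0.
  have h2 := derB (derB (tj_q tj t0) (derC q0 t)) (derZ (p - 1) h1).
  have h3 := derD (derM (der_sqr h2) (derC 2^-1 t))
    (derZ (p - 1) (derM (der_sqr h1) (derC 2^-1 t))).
  by apply: (derE h3); rewrite /dV; field.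
pose M := 1 + (2 * B + 1) / (p - 1) / c2.
have M1 : 1 <= M by rewrite lerDl !divr_ge0 ?(ltW c20) ?(ltW p10)//; lra.
pose al := (2 + (p - 1) * M) ^+ 2 / 2 + (p - 1) * (M ^+ 2 / 2).
pose c' := Num.min 1 c; have c'0 : 0 < c' by rewrite lt_min ltr01.
have [| | |T' TT' hT'] := @eventually_below _ V dV al c' T c'0.
- by move=> t Tt; apply: is_derive_cont (dVP t _); lra.
- by move=> t Tt; apply: dVP; lra.
- move=> t Tt; have ct := hc t (ltW Tt); have := psi_bound tr (ltW Tt).
  have sg := drift_sign (ell t); have pd : 0 <= (p - 1) * (ell t * drift (ell t)) by rewrite mulr_ge0// ltW.
  have [q2|q2] := leP 2 `|q t - q0|.
    move=> _ _; have := ct q2; have : c' <= c by rewrite ge_min lexx orbT.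
    by rewrite /dV; lra.
  move=> pb; have [eM|eM] := leP M `|ell t|.
    move=> _; have h1 : (q t - q0) * psi t <= 2 * B.
      apply: (le_trans (ler_norm _)); rewrite normrM; apply: ler_pM => //; exact: ltW.
    have h2 : ell t * drift (ell t) = `|ell t| * `|drift (ell t)| by rewrite -normrM ger0_norm.
    have h3 := hc2 (ell t); rewrite subr0 in h3; have {h3} := h3 (le_trans M1 eM) => h3.
    have h4 : (2 * B + 1) / (p - 1) / c2 * c2 <= `|ell t| * `|drift (ell t)|.
      by apply: ler_pM => //; [rewrite !divr_ge0 ?(ltW c20) ?(ltW p10)//; lra|exact: ltW|move: eM; rewrite /M; lra].
    rewrite divfK ?gt_eqF// -h2 ler_pdivrMr// in h4.
    have : c' <= 1 by rewrite ge_min lexx.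
    by rewrite /dV; lra.
  move=> hV; exfalso; move: hV; apply/negP; rewrite -ltNge /V /al.
  apply: ltrD.
    rewrite ltr_pM2r// -(real_normK (num_real (a t))) ltrXn2r ?nnegrE//.
    apply: (le_lt_trans (ler_normB _ _)); apply: ltrD => //.
    by rewrite normrM gtr0_norm// ltr_pM2l.
  rewrite ltr_pM2l// ltr_pM2r// -(real_normK (num_real (ell t))) ltrXn2r ?nnegrE//; lra.
exists (q0 + (1 + 2 * al) + (p - 1) * (1 + al) + al), T' => // t Tt.
have := hT' t Tt; rewrite /V => h.
have h1 : 0 <= (p - 1) * (ell t ^+ 2 / 2) by rewrite mulr_ge0 ?(ltW p10)// divr_ge0// sqr_ge0.
have h2 : 0 <= a t ^+ 2 / 2 by rewrite divr_ge0// sqr_ge0.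
have h3 : a t <= 1 + 2 * al by rewrite expr2 in h h2; nra.
have h4 : ell t <= 1 + ell t ^+ 2 / 2 by rewrite expr2; have := sqr_ge0 (ell t - 1); rewrite expr2; lra.
have h5 : (p - 1) * ell t <= (p - 1) * (1 + ell t ^+ 2 / 2) by rewrite ler_pM2l.
have al0 : 0 <= al by lra.
have h6 : 0 <= (p - 1) * al by rewrite mulr_ge0 ?(ltW p10).
by rewrite /a in h3; lra.
Qed.

Lemma q_bounded T : 0 <= T -> tracks q psi 1 T ->
  exists Q, exists2 T', T <= T' & forall t, T' <= t -> q t <= Q.
Proof. by have [p1|p1] := leP p 1; [exact: q_bounded_low|exact: q_bounded_high]. Qed.

End one_trajectory.

Definition dissipation (q l : R) : R := p * (phi q - drift l) ^+ 2 + drift l ^+ 2.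

Lemma dissipation_away r : 0 < r -> exists2 c, 0 < c & forall q l : R,
  ~ (`|q - q0| <= r /\ `|l| <= r) -> c <= dissipation q l.
Proof.
move=> r0; have [c1 c10 h1] := phi_sep r0; have [c2 c20 h2] := drift_sep r0.
pose m := Num.min 1 p; have m0 : 0 < m by rewrite lt_min ltr01.
have m1 : m <= 1 by rewrite ge_min lexx.
have mp : m <= p by rewrite ge_min lexx orbT.
exists (Num.min (c2 ^+ 2) (m * (c1 ^+ 2 / 4))).
  by rewrite lt_min exprn_gt0// mulr_gt0// divr_gt0// exprn_gt0.
move=> q l away; rewrite /dissipation; set F := phi q; set x := drift l.
have px : 0 <= p * (F - x) ^+ 2 by rewrite mulr_ge0 ?sqr_ge0// ltW.
have [lr|lr] := leP `|l| r; last first.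
  rewrite ge_min; apply/orP; left; have := h2 l; rewrite subr0 => /(_ (ltW lr)).
  rewrite -/x => cx; have : c2 ^+ 2 <= x ^+ 2.
    by rewrite -(real_normK (num_real x)) lerXn2r ?nnegrE// ltW.
  by lra.
have qr : r <= `|q - q0| by rewrite leNgt; apply/negP => qr; apply: away; split => //; exact: ltW.
rewrite ge_min; apply/orP; right; have := h1 q qr; rewrite -/F => cF.
have cF2 : c1 ^+ 2 <= F ^+ 2 by rewrite -(real_normK (num_real F)) lerXn2r ?nnegrE// ltW.
have h3 : m * ((F - x) ^+ 2 + x ^+ 2) <= p * (F - x) ^+ 2 + x ^+ 2.
  rewrite mulrDr; apply: lerD; first by rewrite ler_wpM2r ?sqr_ge0.
  by rewrite ler_piMl ?sqr_ge0.
apply: le_trans h3; rewrite ler_pM2l//.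
by have := sqr_ge0 (F - 2 * x); have := sqr_ge0 F; move: cF2; rewrite !expr2; lra.
Qed.

(** The Lyapunov function V(q, ell) = -int phi + (p+1) int drift: along a
    trajectory with psi = phi(q), V' = -p (phi(q) - drift)^2 - drift^2. *)
Section lyapunov.
Variables (P X : R -> R).
Hypotheses (P0 : P q0 = 0) (X0 : X 0 = 0).
Hypothesis dP : forall t : R, is_derive t 1 P (- phi t).
Hypothesis dX : forall t : R, is_derive t 1 X (drift t).

Definition lyap (q l : R) : R := P q + (p + 1) * X l.

Let sgP (t : R) : 0 <= (t - q0) * (- phi t).
Proof. by rewrite mulrN oppr_ge0. Qed.

Let sgX (t : R) : 0 <= (t - 0) * drift t.
Proof. by rewrite subr0; exact: drift_sign. Qed.

Let sepP : separated q0 (fun t => - phi t).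
Proof.
by move=> r r0; have [c c0 hc] := phi_sep r0; exists c => // z /hc; rewrite normrN.
Qed.

Lemma lyap_small e : 0 < e -> exists2 al, 0 < al & forall q l : R, lyap q l <= al ->
  `|q - q0| <= e /\ `|l| <= e.
Proof.
move=> e0; have [a1 a10 h1] := well_small dP P0 sgP sepP e0.
have [a2 a20 h2] := well_small dX X0 sgX drift_sep e0.
exists (Num.min a1 a2); first by rewrite lt_min a10.
move=> q l; rewrite le_min => /andP[l1 l2].
have w1 := well_ge0 q dP P0 sgP; have w2 := well_ge0 l dX X0 sgX.
have w3 : X l <= (p + 1) * X l by rewrite ler_peMl// lerDr ltW.
split; first by apply: h1; move: l1; rewrite /lyap; lra.
by rewrite -[l]subr0; apply: h2; move: l2; rewrite /lyap; lra.
Qed.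

Lemma lyap_near al : 0 < al -> exists2 r, 0 < r & forall q l : R, `|q - q0| <= r ->
  `|l| <= r -> lyap q l < al.
Proof.
move=> al0; have e1 : 0 < al / 4 by lra.
have p1 : 0 < p + 1 by rewrite addr_gt0.
have e2 : 0 < al / 4 / (p + 1) by rewrite divr_gt0.
have [d1 d10 h1] := (contP P q0).1 (is_derive_cont (dP q0)) _ e1.
have [d2 d20 h2] := (contP X 0).1 (is_derive_cont (dX 0)) _ e2.
exists (Num.min d1 d2 / 2); first by rewrite divr_gt0// lt_min d10.
have m0 : 0 < Num.min d1 d2 by rewrite lt_min d10.
have m1 : Num.min d1 d2 <= d1 by rewrite ge_min lexx.
have m2 : Num.min d1 d2 <= d2 by rewrite ge_min lexx orbT.
move=> q l qr lr; have := h1 q ltac:(lra); rewrite P0 subr0 ler_norml => /andP[_ k1].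
have lr' : `|l - 0| < d2 by rewrite subr0; lra.
have := h2 l lr'; rewrite X0 subr0 ler_norml => /andP[_]; rewrite ler_pdivlMr//.
by rewrite /lyap; lra.
Qed.

Section along.
Variables (q ell psi : R -> R).
Hypothesis tj : trajectory q ell psi.

Definition dlyap (t : R) : R :=
  - phi (q t) * (p * psi t - (p - 1) * drift (ell t)) +
  (p + 1) * (drift (ell t) * (psi t - drift (ell t))).

Lemma der_lyap (t : R) : 0 <= t -> is_derive t 1 (fun s => lyap (q s) (ell s)) (dlyap t).
Proof.
move=> t0; have h1 := der_comp (f := P) (g := q) (dP _) (tj_q tj t0).
have h2 := der_comp (f := X) (g := ell) (dX _) (tj_ell tj t0).
exact: derD h1 (derZ (p + 1) h2).
Qed.

(** When psi = phi q this is an equality without the last term and without the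
    factor 1/2, which pays for the difference by completing squares. *)
Lemma dlyap_le (t eta : R) : `|psi t - phi (q t)| <= eta ->
  dlyap t <= - (dissipation (q t) (ell t) / 2) + (p + 1) / 2 * eta ^+ 2.
Proof.
move=> h; have eta0 : 0 <= eta by exact: le_trans h.
have {h} : (psi t - phi (q t)) ^+ 2 <= eta ^+ 2.
  by rewrite -(real_normK (num_real (psi t - _))) lerXn2r ?nnegrE.
rewrite /dlyap /dissipation; set F := phi (q t); set x := drift (ell t); set S := psi t => h.
have h1 : (p + 1) / 2 * (S - F) ^+ 2 <= (p + 1) / 2 * eta ^+ 2 by rewrite ler_wpM2l// divr_ge0// addr_ge0// ltW.
have h2 : 0 <= p / 2 * ((F - x) + (S - F)) ^+ 2 by rewrite mulr_ge0 ?sqr_ge0// divr_ge0// ltW.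
have h3 : 0 <= (x - (S - F)) ^+ 2 / 2 by rewrite divr_ge0// sqr_ge0.
by move: h1 h2 h3; rewrite !expr2; lra.
Qed.

End along.
End lyapunov.

Lemma small_shift (c : R) : 0 < c -> exists2 eta, 0 < eta & (p + 1) / 2 * eta ^+ 2 <= c / 8.
Proof.
move=> c0; pose eta := Num.min 1 (c / (4 * (p + 1))).
have p2 : 0 < p + 1 by rewrite addr_gt0.
have p1 : 0 < 4 * (p + 1) by rewrite mulr_gt0.
have eta0 : 0 < eta by rewrite lt_min ltr01 divr_gt0.
exists eta => //.
have h1 : eta <= 1 by rewrite ge_min lexx.
have h2 : eta <= c / (4 * (p + 1)) by rewrite ge_min lexx orbT.
rewrite ler_pdivlMr// in h2; have h3 : eta ^+ 2 <= eta by rewrite expr2 ler_piMl// ltW.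
have : (p + 1) / 2 * eta ^+ 2 <= (p + 1) / 2 * eta by rewrite ler_wpM2l// divr_ge0// ltW.
by lra.
Qed.

Lemma lyapunov_pair : exists P X : R -> R, [/\ P q0 = 0, X 0 = 0,
  forall t : R, is_derive t 1 P (- phi t) & forall t : R, is_derive t 1 X (drift t)].
Proof.
have [P P0 dP] := primitive_line cphi.
have cd (t : R) : {for t, continuous drift}.
  have h := derZ mu (derB (der_exp (derZ gamma (derI t))) (derC 1 t)).
  exact: is_derive_cont h.
have [X X0 dX] := primitive_line cd.
exists (fun t => P q0 - P t), X; split=> //; first by rewrite subrr.
by move=> t; apply: (derE (derB (derC (P q0) t) (dP t))); rewrite sub0r.
Qed.

(** Once q is bounded above, phi is uniformly continuous on its range, so the
    shift by which psi differs from phi q only adds a vanishing error to the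
    derivative of the Lyapunov function: outside any neighbourhood of the
    equilibrium it decreases at a definite rate. *)
Theorem dilation_converges q ell psi e : trajectory q ell psi ->
  (forall d, 0 < d -> exists2 T, 0 <= T & tracks q psi d T) -> 0 < e ->
  exists2 T, 0 <= T & forall t, T <= t -> `|q t - q0| <= e /\ `|ell t| <= e.
Proof.
move=> tj tr e0; have [P [X [P0 X0 dP dX]]] := lyapunov_pair.
have [T1 T10 tr1] := tr 1 ltr01; have [Q [T2 T12 hQ]] := q_bounded tj T10 tr1.
have [al al0 hal] := lyap_small P0 X0 dP dX e0.
have [r r0 hr] := lyap_near P0 X0 dP dX al0.
have [c c0 hc] := dissipation_away r0.
have [eta eta0 eta2] := small_shift c0.
have [d d0 hd] := phi_unif Q eta0.
have [T3 T30 tr3] := tr d d0.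
pose T := Num.max T2 T3; have TT2 : T2 <= T by rewrite le_max lexx.
have TT3 : T3 <= T by rewrite le_max lexx orbT.
have c4 : 0 < c / 4 by lra.
have [| | |T' TT' hT'] := @eventually_below _ (fun s => lyap P X (q s) (ell s))
  (dlyap q ell psi) al (c / 4) T c4.
- by move=> t Tt; apply: is_derive_cont (der_lyap dP dX tj _); lra.
- by move=> t Tt; apply: (der_lyap dP dX tj); lra.
- move=> t Tt alV; have [s sq ps] := tr3 t (le_trans TT3 (ltW Tt)).
  have := hd (q t) s (hQ t (le_trans TT2 (ltW Tt))) sq; rewrite -ps => /dlyap_le h.
  apply: (le_trans (h ell)).
  have : c <= dissipation (q t) (ell t).
    by apply: hc => -[h1 h2]; have := lt_le_trans (hr _ _ h1 h2) alV; rewrite ltxx.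
  by lra.
exists T'; first by lra.
by move=> t Tt; apply: hal; exact: hT'.
Qed.

(** Near the equilibrium the Lyapunov function itself bounds q, and so gives the
    uniform continuity needed to keep it below its level. *)
Theorem dilation_stable e : 0 < e -> exists2 d, 0 < d & forall q ell psi T,
  trajectory q ell psi -> 0 <= T -> tracks q psi d T ->
  `|q T - q0| <= d -> `|ell T| <= d ->
  forall t, T <= t -> `|q t - q0| <= e /\ `|ell t| <= e.
Proof.
move=> e0; have [P [X [P0 X0 dP dX]]] := lyapunov_pair.
have e10 : 0 < Num.min e 1 by rewrite lt_min e0 ltr01.
have ee : Num.min e 1 <= e by rewrite ge_min lexx.
have e1 : Num.min e 1 <= 1 by rewrite ge_min lexx orbT.
have [al al0 hal] := lyap_small P0 X0 dP dX e10.
have al20 : 0 < al / 2 by lra.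
have [r r0 hr] := lyap_near P0 X0 dP dX al20.
have [c c0 hc] := dissipation_away r0.
have [eta eta0 eta2] := small_shift c0.
have [d d0 hd] := phi_unif (q0 + 1) eta0.
exists (Num.min d r); first by rewrite lt_min d0.
have dd : Num.min d r <= d by rewrite ge_min lexx.
have dr : Num.min d r <= r by rewrite ge_min lexx orbT.
move=> q ell psi T tj T0 tr qT lT t Tt.
have aa : al / 2 < al by lra.
have VT : lyap P X (q T) (ell T) <= al / 2.
  by apply/ltW/hr; [exact: le_trans dr|exact: le_trans dr].
have cV (s : R) : T <= s -> {for s, continuous (fun s => lyap P X (q s) (ell s))}.
  by move=> Ts; apply: is_derive_cont (der_lyap dP dX tj _); lra.
have dV (s : R) : T < s -> is_derive s 1 (fun s => lyap P X (q s) (ell s)) (dlyap q ell psi s).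
  by move=> Ts; apply: (der_lyap dP dX tj); lra.
have neg (s : R) : T < s -> al / 2 <= lyap P X (q s) (ell s) ->
    lyap P X (q s) (ell s) <= al -> dlyap q ell psi s <= 0.
  move=> Ts h1 h2; have [z zq ps] := tr s (ltW Ts).
  have [hq _] := hal _ _ h2; have qs : q s <= q0 + 1.
    by move: hq; rewrite ler_norml => /andP[_]; lra.
  have := hd (q s) z qs (le_trans zq dd); rewrite -ps => /dlyap_le h.
  apply: (le_trans (h ell)).
  have : c <= dissipation (q s) (ell s).
    by apply: hc => -[k1 k2]; have := lt_le_trans (hr _ _ k1 k2) h1; rewrite ltxx.
  by lra.
have := stays_below_band aa cV dV neg VT Tt => h.
have [h1 h2] := hal _ _ (le_trans h (ltW aa)).
by split; [exact: le_trans ee|exact: le_trans ee].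
Qed.

End dilation_dynamics.

(** * The growth law *)

(** The excess growth rate, as a function of the logarithm of the moment. *)
Section growth_law.
Context {R : realType}.
Variables (f : R -> R) (mu I0 : R).
Hypotheses (mu0 : 0 < mu) (I00 : 0 < I0).
Hypothesis f_ge0 : forall I : R, 0 <= I -> 0 <= f I.
Hypothesis f_C1 : C1_Rplus f.
Hypothesis f_limsup : (limf_esup (fun I => (f I)%:E) (pinfty_nbhs R) < mu%:E)%E.
Hypothesis f_level : forall I : R, 0 <= I -> f I = mu -> I = I0.
Hypothesis f_I0 : f I0 = mu.

Lemma C1_quotient : exists df : R -> R, forall x e : R, 0 <= x -> 0 < e ->
  exists2 d, 0 < d & forall y : R, 0 <= y -> `|y - x| < d ->
    `|f y - f x - df x * (y - x)| <= e * `|y - x|.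
Proof.
have [df [_ h]] := f_C1; exists df => x e x0 e0.
have /cvgrPdist_le /(_ e e0) := h x x0.
rewrite /= /within/= /dnbhs /within/= => /nbhs_ballP[d /= d0 hd].
exists d => // y y0 yx; have [->|ne] := eqVneq y x; first by rewrite !subrr mulr0 subrr normr0 mulr0.
have yb : ball x d y by rewrite /ball/= distrC.
have nz : y - x != 0 by rewrite subr_eq0.
have := hd y yb ne; rewrite in_itv/= y0 => /(_ isT).
have -> : f y - f x - df x * (y - x) = - ((df x - (f y - f x) / (y - x)) * (y - x)) by field.
by rewrite normrN normrM => q; rewrite ler_wpM2r.
Qed.

Lemma f_cont (x e : R) : 0 <= x -> 0 < e -> exists2 d, 0 < d &
  forall y : R, 0 <= y -> `|y - x| < d -> `|f y - f x| <= e.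
Proof.
have [df h] := C1_quotient => x0 e0; have [d d0 hd] := h x 1 x0 ltr01.
have m0 : 0 < 1 + `|df x| by rewrite ltr_pwDl.
exists (Num.min d (e / (1 + `|df x|))); first by rewrite lt_min d0 divr_gt0.
move=> y y0; rewrite lt_min => /andP[y1 y2]; have := hd y y0 y1.
rewrite mul1r ltr_pdivlMr// in y2 * => q.
have -> : f y - f x = (f y - f x - df x * (y - x)) + df x * (y - x) by ring.
by rewrite (le_trans (ler_normD _ _))// normrM; lra.
Qed.

Lemma fclamp_cont (x : R) : {for x, continuous (fun s => f (clamp s))}.
Proof.
apply/contP => e e0; have [d d0 hd] := f_cont (clamp_ge0 x) e0.
exists d => // y yx; apply: hd; first exact: clamp_ge0.
by apply: le_lt_trans yx; exact: clamp_dist.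
Qed.

Lemma fclamp_within a b : {within `[a, b], continuous (fun s => f (clamp s))}.
Proof. by apply: continuous_subspaceT => s; exact: fclamp_cont. Qed.

Lemma f_eventually : exists2 c, 0 < c & exists2 I1, 0 <= I1 &
  forall I : R, I1 <= I -> f I <= mu - c.
Proof.
move: f_limsup; rewrite limf_esupE => /ereal_inf_lt[_ [V [M [_ hM]] <-]] sup_lt.
pose N := Num.max 0 M; have ub (I : R) : M < I -> ((f I)%:E <= ereal_sup [set (f x)%:E | x in V])%E.
  by move=> MI; apply: ereal_sup_ubound; exists I => //; exact: hM.
have := ub (N + 1); have MN : M < N + 1 by rewrite ltr_pwDr// le_max lexx orbT.
case: (ereal_sup _) sup_lt ub => [s| |] //; last by move=> _ _ /(_ MN).
rewrite lte_fin => smu ub _; exists (mu - s); first by lra.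
exists (N + 1); first by rewrite addr_ge0// le_max lexx.
move=> I NI; have : M < I by exact: lt_le_trans NI.
by move=> /ub; rewrite lee_fin; lra.
Qed.

(** Intermediate values: f can pass the level mu only at I0. *)
Lemma above_level_side (I J : R) : 0 <= I -> 0 <= J -> mu < f I -> f J < mu ->
  Num.min I J <= I0 <= Num.max I J.
Proof.
move=> I_0 J_0 fI fJ; have mm : Num.min I J <= Num.max I J.
  by rewrite ge_min; apply/orP; left; rewrite le_max lexx.
have m0 : 0 <= Num.min I J by rewrite le_min I_0.
have [|c] := IVT mm (@fclamp_within (Num.min I J) (Num.max I J)) (v := mu).
  have [IJ|JI] := leP I J; rewrite !clampE ?I_0 ?J_0//; case: (leP (f I) (f J)) => h; lra.
rewrite in_itv/= => /andP[c1 c2]; have c0 : 0 <= c := le_trans m0 c1.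
by rewrite clampE// => /(f_level c0) <-; rewrite c1.
Qed.

(** Beyond I0 the sign of f - mu is that at infinity. *)
Lemma below_above (I : R) : I0 < I -> f I < mu.
Proof.
move=> II; have I_0 : 0 <= I by apply: le_trans (ltW II); exact: ltW.
have [c c0 [I1 I10 h1]] := f_eventually; pose J := Num.max I1 I.
have fJ : f J <= mu - c by apply: h1; rewrite le_max lexx.
have J0 : 0 <= J by rewrite le_max I10.
have IJ : I <= J by rewrite le_max lexx orbT.
rewrite ltNge le_eqVlt; apply/negP => /orP[/eqP/esym/(f_level I_0) E|fI].
  by rewrite E ltxx in II.
have := above_level_side I_0 J0 fI ltac:(lra); rewrite (min_idPl IJ) => /andP[h _].
lra.
Qed.

Hypothesis f_der : derive1 f I0 < 0.

(** Below I0 the sign of f - mu is that just before I0, given by the derivative. *)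
Lemma above_below (I : R) : 0 <= I -> I < I0 -> mu < f I.
Proof.
have [df h] := C1_quotient.
have dI0 : is_derive I0 1 f (df I0).
  apply/derP => e e0; have [d d0 hd] := h I0 e (ltW I00) e0.
  exists (Num.min d I0); first by rewrite lt_min d0.
  move=> y; rewrite lt_min => /andP[y1 y2]; apply: hd => //.
  by move: y2; rewrite ltr_norml => /andP[]; rewrite ltrBrDl subrr => /ltW.
have df0 : df I0 < 0 by move: f_der; rewrite derive1E (@derive_val _ _ _ _ _ _ _ dI0).
have e0 : 0 < - df I0 / 2 by lra.
have [d d0 hd] := h I0 _ (ltW I00) e0.
move=> I_0 II; pose J := Num.max I (Num.max (I0 / 2) (I0 - d / 2)).
have J1 : J < I0 by rewrite !gt_max II; apply/andP; split; have := I00; lra.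
have J0 : 0 <= J by rewrite le_max I_0.
have J2 : I0 - d / 2 <= J by rewrite !le_max lexx !orbT.
have fJ : mu < f J.
  have := hd J J0; rewrite ltr0_norm; last by lra.
  move=> /(_ ltac:(lra)); rewrite f_I0 ler_norml => /andP[q _].
  have : 0 < - df I0 * (I0 - J) by rewrite mulr_gt0//; lra.
  by lra.
have IJ : I <= J by rewrite le_max lexx.
rewrite ltNge le_eqVlt; apply/negP => /orP[/eqP/(f_level I_0) E|fI].
  by rewrite E ltxx in II.
have := above_level_side J0 I_0 fJ fI; rewrite (max_idPl IJ) => /andP[_ ?].
lra.
Qed.

Definition excess (q : R) : R := f (expR q) - mu.

Let excessE q : excess q = f (clamp (expR q)) - mu.
Proof. by rewrite clampE ?expR_ge0. Qed.

Lemma excess_cont (t : R) : {for t, continuous excess}.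
Proof.
have -> : excess = fun q => f (clamp (expR q)) - mu by apply/funext => q; exact: excessE.
apply: continuousB; last exact: cst_continuous.
apply: (continuous_comp (f := expR) (g := fun s => f (clamp s))).
  exact: continuous_expR.
exact: fclamp_cont.
Qed.

Lemma excess_sign (s : R) : (s - ln I0) * excess s <= 0.
Proof.
have e0 := expR_gt0 s; rewrite /excess.
have [h|h|h] := ltgtP s (ln I0).
- have es : expR s < I0 by rewrite -[X in _ < X](lnK (x := I0)) ?posrE// ltr_expR.
  by have := above_below (ltW e0) es => k; rewrite mulr_le0_ge0//; lra.
- have es : I0 < expR s by rewrite -[X in X < _](lnK (x := I0)) ?posrE// ltr_expR.
  by have := below_above es => k; rewrite mulr_ge0_le0//; lra.
- by rewrite h subrr mul0r.
Qed.

(** Compactness on both sides: on [0, I0 exp (- r)] the value at 0 is included,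
    although no logarithm reaches it, and near infinity the upper limit of f
    separates it from mu. *)
Lemma excess_sep : separated (ln I0) excess.
Proof.
move=> r r0; have [c c0 [I1 I10 h1]] := f_eventually.
have lo0 : 0 <= I0 * expR (- r) by rewrite mulr_ge0 ?expR_ge0// ltW.
have lo1 : I0 * expR (- r) < I0.
  by rewrite gtr_pMr// -[X in _ < X]expR0 ltr_expR oppr_lt0.
have hi1 : I0 < I0 * expR r by rewrite ltr_pMr// -[X in X < _]expR0 ltr_expR.
have [m mi hm] := EVT_min lo0 (@fclamp_within 0 (I0 * expR (- r))).
have hi2 : I0 * expR r <= Num.max I1 (I0 * expR r) by rewrite le_max lexx orbT.
have [M Mi hM] := EVT_max hi2 (@fclamp_within (I0 * expR r) (Num.max I1 (I0 * expR r))).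
move: mi Mi; rewrite !in_itv/= => /andP[m0 m1] /andP[M0 M1].
have fm : mu < f m by apply: above_below => //; lra.
have fM : f M < mu by apply: below_above; lra.
exists (Num.min (f m - mu) (Num.min c (mu - f M))).
  by rewrite !lt_min c0/=; apply/andP; split; lra.
have i00 := I00; have M00 : 0 <= M by lra.
move=> z; have [zz|zz] := leP (ln I0) z.
  rewrite ger0_norm ?subr_ge0// => rz.
  have ez : I0 * expR r <= expR z.
    by rewrite -[X in X * _](lnK (x := I0)) ?posrE// -expRD ler_expR; lra.
  have fz : f (expR z) - mu <= - Num.min c (mu - f M).
    have [k|k] := leP I1 (expR z).
      by have := h1 _ k; have : Num.min c (mu - f M) <= c; [rewrite ge_min lexx|lra].
    have := hM (expR z); rewrite in_itv/= ez le_max (ltW k) => /(_ isT).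
    rewrite !clampE ?expR_ge0//; have : Num.min c (mu - f M) <= mu - f M by rewrite ge_min lexx orbT.
    lra.
  rewrite ge_min; apply/orP; right; rewrite -normrN; apply: le_trans (ler_norm _).
  by rewrite /excess; lra.
rewrite ltr0_norm ?subr_lt0// => rz.
have ez : expR z <= I0 * expR (- r).
  by rewrite -[X in _ <= X * _](lnK (x := I0)) ?posrE// -expRD ler_expR; lra.
rewrite ge_min; apply/orP; left; apply: le_trans (ler_norm _); rewrite /excess lerD2r.
have := hm (expR z); rewrite in_itv/= ez expR_ge0 => /(_ isT).
by rewrite !clampE ?expR_ge0.
Qed.

Lemma excess_bound : exists B : R, forall s : R, `|excess s| <= B.
Proof.
have [c c0 [I1 I10 h1]] := f_eventually.
have [M Mi hM] := EVT_max I10 (@fclamp_within 0 I1).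
move: Mi; rewrite in_itv/= => /andP[M0 M1]; have fM := f_ge0 M0.
exists (f M + mu) => s; have e0 := expR_ge0 s; have fs := f_ge0 e0.
rewrite /excess ler_norml; apply/andP; split; first by lra.
have [k|k] := leP I1 (expR s); first by have := h1 _ k; have := mu0; lra.
have := hM (expR s); rewrite in_itv/= e0 (ltW k) => /(_ isT).
by have := mu0; rewrite !clampE//; lra.
Qed.

(** A bounded shift of the logarithm multiplies the moment, so below any level
    f is only evaluated on a compact interval. *)
Lemma excess_unif (Q e : R) : 0 < e -> exists2 d, 0 < d &
  forall q s : R, q <= Q -> `|s - q| <= d -> `|excess s - excess q| <= e.
Proof.
move=> e0; have [d d0 hd] := unif_cont_segment (a := 0) (b := expR Q) e0 (fun x _ => @fclamp_cont x).
have k0 : 0 < 1 + d / expR Q / 2 by rewrite ltr_pwDl// !divr_ge0 ?expR_ge0// ltW.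
have k1 : 1 < 1 + d / expR Q / 2 by rewrite ltrDl !divr_gt0 ?expR_gt0.
exists (ln (1 + d / expR Q / 2)); first exact: ln_gt0.
move=> q s qQ sq; have eQ : expR q <= expR Q by rewrite ler_expR.
rewrite !excessE opprB addrA subrK; apply: hd; first by rewrite expR_ge0.
have eq0 := expR_gt0 q.
have es : expR s = expR q * expR (s - q) by rewrite -expRD; congr expR; ring.
have kE : 1 + d / expR Q / 2 = expR (ln (1 + d / expR Q / 2)) by rewrite lnK// posrE.
have up : expR (s - q) <= 1 + d / expR Q / 2.
  by rewrite {1}kE ler_expR (le_trans (ler_norm _)).
have dn : 1 - d / expR Q / 2 <= expR (s - q).
  have h : (1 + d / expR Q / 2)^-1 <= expR (s - q).
    rewrite {1}kE -[X in X <= _]expRN ler_expR.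
    by move: sq; rewrite ler_norml => /andP[].
  apply: le_trans h; rewrite -[leRHS]mul1r ler_pdivlMr//.
  by have := sqr_ge0 (d / expR Q / 2); rewrite expr2; lra.
rewrite es -[X in _ - X]mulr1 -mulrBr normrM gtr0_norm//.
apply: (@le_lt_trans _ _ (expR Q * (d / expR Q / 2))).
  apply: ler_pM; [exact: ltW|exact: normr_ge0|exact: eQ|].
  by rewrite ler_norml; apply/andP; split; lra.
have -> : expR Q * (d / expR Q / 2) = d / 2 by field; rewrite gt_eqF// expR_gt0.
by lra.
Qed.

End growth_law.

(** * Equilibrium, attraction and stability *)

Section nonlinear_equation.
Context {R : realType} {beta gamma : R} {kappa : R -> R} {k1 k2 : R}.
Hypothesis fk : frag_kernel beta gamma kappa k1 k2.
Variables (mu r rbar p : R) (U : R -> R).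
Hypotheses (r3 : 3 < r) (mu0 : 0 < mu) (rbar_le : rbar <= r).
Hypotheses (p0 : 0 < p) (pr : 2 * p + 1 <= r).
Hypothesis hU : stationary_profile beta gamma kappa mu rbar U.
Hypothesis hgap : spectral_gap beta gamma kappa mu r U.
Variables (f : R -> R) (I0 : R).
Hypothesis I00 : 0 < I0.
Hypothesis f_ge0 : forall I : R, 0 <= I -> 0 <= f I.
Hypothesis f_C1 : C1_Rplus f.
Hypothesis f_limsup : (limf_esup (fun I => (f I)%:E) (pinfty_nbhs R) < mu%:E)%E.
Hypothesis f_level : forall I : R, 0 <= I -> f I = mu -> I = I0.
Hypothesis f_I0 : f I0 = mu.
Implicit Types (u v : R -> R -> R) (h w : R -> R).
Local Notation D := (`]0, +oo[%classic : set R).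
Local Notation nonlinear := (nonlinear_solution beta gamma kappa mu r p f).
Local Notation linear := (linear_solution beta gamma kappa mu r).

Let gamma0 : 0 < gamma. Proof. by have /andP[] := fk_gamma fk. Qed.
Let UH : in_Hplus r U. Proof. exact (profile_in_H hU rbar_le). Qed.
Let r0 : 0 <= r. Proof. by have := r3; lra. Qed.

Lemma moment_abs h : measurable_fun D h -> ae_pos (fun x => 0 <= h x) ->
  moment p h = integralp (fun x => x `^ p * `|h x|).
Proof.
move=> mh h0; apply: ae_integralp.
- by apply: measurable_funM => //; exact: measurable_powRD.
- by apply: measurable_funM; [exact: measurable_powRD|exact: measurableT_comp].
- by apply: ae_pos1 h0 => x _ hx; rewrite ger0_norm.
Qed.

Lemma moment_ge0 h : measurable_fun D h -> ae_pos (fun x => 0 <= h x) -> 0 <= moment p h.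
Proof.
move=> mh h0; rewrite moment_abs//.
by apply: integralp_ge0 => x x0; rewrite mulr_ge0 ?powR_ge0.
Qed.

Lemma moment_gt0 h : measurable_fun D h -> ae_pos (fun x => 0 <= h x) ->
  finite_moment p h -> nontrivial h -> 0 < moment p h.
Proof.
move=> mh h0 fh nt; rewrite lt_neqAle moment_ge0// andbT eq_sym; apply/eqP => m0.
apply: nt; rewrite moment_abs// in m0.
have fa : integrablep (fun x => x `^ p * `|h x|).
  apply: eq_integrablep (integrablep_norm fh) => x x0.
  by rewrite normrM ger0_norm ?powR_ge0.
have := integralp_eq0 fa _ m0.
have pos (x : R) : 0 < x -> 0 <= x `^ p * `|h x| by move=> x0; rewrite mulr_ge0 ?powR_ge0.
move=> /(_ pos); apply: ae_pos1 => x x0 /eqP.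
by rewrite mulf_eq0 normr_eq0 gt_eqF ?powR_gt0//= => /eqP.
Qed.

Local Notation MU := (moment p U).

Lemma profile_moment_gt0 : 0 < MU.
Proof.
apply: moment_gt0; [exact: in_H_meas UH.1|exact: UH.2|exact (profile_moment rbar_le hU p0 pr)|].
exact: profile_nontrivial hU.
Qed.

Definition equilibrium (x : R) : R := I0 / MU * U x.
Local Notation uinf := equilibrium.

Let B00 : 0 < I0 / MU. Proof. exact: divr_gt0 I00 profile_moment_gt0. Qed.

Lemma equilibrium_moment : moment p uinf = I0.
Proof.
rewrite /moment; have E (x : R) : 0 < x -> x `^ p * uinf x = I0 / MU * (x `^ p * U x).
  by move=> _; rewrite /equilibrium; ring.
rewrite -!/(integralp _) (eq_integralp E) (integralpZ _ (profile_moment rbar_le hU p0 pr)).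
by rewrite -/(moment p U) divfK// gt_eqF// profile_moment_gt0.
Qed.

Lemma equilibrium_steady : steady_state beta gamma kappa mu r p f uinf.
Proof.
split.
- move=> t _; apply: (eq_integrablep _ (integrablepZ (I0 / MU) (profile_moment rbar_le hU p0 pr))).
  by move=> x _; rewrite /equilibrium; ring.
- exact: cst_continuous.
- rewrite equilibrium_moment f_I0.
  have cmu (z : R) : {for z, continuous (fun s : R => (fun=> mu) (clamp s))} by exact: cst_continuous.
  have hs : linear (fun=> U) by case: hU => _ _ _; exact.
  exact (scale_solution fk r3 (ltW B00) cmu hs).
Qed.

Lemma equilibrium_nontrivial : nontrivial uinf.
Proof.
move=> triv; apply: (profile_nontrivial hU); apply: ae_pos1 triv => x _ /eqP.
by rewrite mulf_eq0 gt_eqF//= => /eqP.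
Qed.

Lemma nonlinear_rate u : nonlinear u ->
  (forall t : R, 0 <= t -> 0 <= moment p (u t)) /\
  forall t : R, {for t, continuous (fun s => f (moment p (u (clamp s))))}.
Proof.
move=> [fu cu su]; have m0 (t : R) : 0 <= t -> 0 <= moment p (u t).
  by move=> t0; have [ut uge] := solution_in_H su t0; apply: moment_ge0 => //; exact: in_H_meas ut.
split=> // t; apply/contP => e e0.
have [d d0 hd] := f_cont f_C1 (m0 _ (clamp_ge0 t)) e0.
have t0 := clamp_ge0 t.
have /subspace_continuousP /(_ (clamp t)) := cu.
rewrite /= in_itv/= andbT => /(_ t0) /cvgrPdist_lt /(_ d d0).
rewrite /within/= => /nbhs_ballP[d' /= d'0 hd'].
exists d' => // s st; apply: hd; first exact: m0 (clamp_ge0 s).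
rewrite distrC; apply: hd'; last by rewrite in_itv/= andbT clamp_ge0.
by rewrite /ball/= distrC; apply: le_lt_trans st; exact: clamp_dist.
Qed.

(** Every solution is a time-dependent dilation of a solution of the linear
    equation with the same initial distribution. *)
Record dilation u v (ell h a : R -> R) : Prop := Dilation {
  dl_lin : linear v;
  dl_0 : forall x : R, v 0 x = u 0 x;
  dl_rs : @rescales _ gamma mu (fun t => f (moment p (u t))) ell h a;
  dl_u : forall t x : R, 0 <= t ->
    u t x = expR (a t - 2 * ell t) * v (h t) (expR (- ell t) * x);
  dl_fin : forall t : R, 0 <= t -> finite_moment p (v t);
  dl_moment : forall t : R, 0 <= t ->
    moment p (u t) = expR (a t + (p - 1) * ell t) * moment p (v (h t)) }.

Lemma dilation_exists u : nonlinear u -> exists v ell h a, dilation u v ell h a.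
Proof.
move=> nu; have [m0 cg] := nonlinear_rate nu; have [fu cu su] := nu.
pose g t := f (moment p (u t)).
have g0 (t : R) : 0 <= t -> 0 <= g t by move=> t0; apply: f_ge0; exact: m0.
have [ell [h [a rs]]] := rescaling_exists gamma0 mu0 (g := g) cg g0.
pose v := linearized u ell h a; exists v, ell, h, a.
have scaled (t : R) : 0 <= t -> integrablep (fun x => x `^ p * v (h t) x) /\
    moment p (v (h t)) = expR ((1 - p) * ell t - a t) * moment p (u t).
  move=> t0; have e0 := expR_gt0 (ell t).
  have E (x : R) : 0 < x -> expR ((2 - p) * ell t - a t) *
      ((expR (ell t) * x) `^ p * u t (expR (ell t) * x)) = x `^ p * v (h t) x.
    move=> x0; rewrite /v (linearizedE fk mu0 u rs)// /rescaled powRM ?expR_ge0 ?(ltW x0)//.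
    have -> : expR (2 * ell t - a t) = expR ((2 - p) * ell t - a t) * expR (ell t) `^ p.
      by rewrite -expRM -expRD; congr expR; ring.
    by ring.
  have [i1 e1] := integralp_scale e0 (fu t t0).
  split; first exact: eq_integrablep E (integrablepZ _ i1).
  rewrite /moment -!/(integralp _) -(eq_integralp E) (integralpZ _ i1) e1 mulrA -expRN -expRD.
  by congr (expR _ * _); ring.
split.
- exact (linearized_solution fk r3 mu0 rs cg su).
- by move=> x; exact (linearized0 fk mu0 u rs x).
- exact: rs.
- by move=> t x t0; exact (unlinearized fk mu0 u rs x t0).
- move=> t t0; have [k0 kh] := old_timeP gamma0 mu0 rs t0.
  by have [] := scaled _ k0; rewrite kh.
- move=> t t0; have [_ ->] := scaled t t0; rewrite mulrA -expRD.
  by rewrite (_ : _ + _ = 0) ?expR0 ?mul1r//; ring.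
Qed.
Section one_solution.
Variables (u v : R -> R -> R) (ell h a : R -> R).
Hypotheses (dl : dilation u v ell h a) (nt : nontrivial (u 0)).
Local Notation rho := (rho0 U (u 0)).

Lemma dl_v0 : v 0 = u 0.
Proof. by apply/funext => x; exact: (dl_0 dl). Qed.

Lemma dl_nontrivial : nontrivial (v 0).
Proof. by rewrite dl_v0. Qed.

Lemma dl_rho_gt0 : 0 < rho.
Proof.
have sv := dl_lin dl; have v0H := solution_in_H sv (lexx 0).
by rewrite -dl_v0; exact (rho0_gt0 r3 rbar_le hU v0H dl_nontrivial).
Qed.

(** The logarithm that the moment would have if the linear solution had the
    shape of the profile; it obeys an exact differential equation. *)
Definition log_moment (t : R) : R := a t + (p - 1) * ell t + ln (rho * MU).
Definition excess_rate (t : R) : R := f (moment p (u t)) - mu.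

Lemma dl_trajectory : trajectory mu gamma p log_moment ell excess_rate.
Proof.
have rs := dl_rs dl; split=> t t0.
  by apply: (derE (rs_ell rs t0)); rewrite /excess_rate /drift; ring.
have h1 := derD (derD (rs_a rs t0) (derZ (p - 1) (rs_ell rs t0))) (derC (ln (rho * MU)) t).
by apply: (derE h1); rewrite /excess_rate /drift; ring.
Qed.

Lemma dl_moment_gt0 t : 0 <= t -> 0 < moment p (v t).
Proof.
move=> t0; have [vt vge] := solution_in_H (dl_lin dl) t0.
apply: moment_gt0 => //; [exact: in_H_meas vt|exact: dl_fin dl t t0|].
exact (solution_nontrivial fk r3 rbar_le hU hgap (dl_lin dl) dl_nontrivial t0).
Qed.

Lemma exp_log_moment t : expR (log_moment t) = expR (a t + (p - 1) * ell t) * (rho * MU).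
Proof.
by rewrite /log_moment expRD lnK// posrE mulr_gt0 ?dl_rho_gt0// profile_moment_gt0.
Qed.

Lemma excess_rate_bound B t : (forall s, `|excess f mu s| <= B) -> 0 <= t ->
  `|excess_rate t| <= B.
Proof.
move=> hB t0; have m0 : 0 < moment p (u t).
  by rewrite (dl_moment dl t0) mulr_gt0 ?expR_gt0// dl_moment_gt0// (new_time_ge0 (dl_rs dl) t0).
by have := hB (ln (moment p (u t))); rewrite /excess lnK ?posrE.
Qed.

(** The profile shape of the linear solution makes the growth rate a function
    of the logarithm of the moment, up to a small shift. *)
Lemma dl_tracks d t : 0 < d -> 0 <= t ->
  `|moment p (v (h t)) - rho * MU| <= (1 - expR (- d)) * MU * rho ->
  exists2 s, `|s - log_moment t| <= d & excess_rate t = excess f mu s.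
Proof.
move=> d0 t0 close; have rM : 0 < rho * MU by rewrite mulr_gt0 ?dl_rho_gt0// profile_moment_gt0.
pose th := moment p (v (h t)) / (rho * MU).
have th0 : 0 < th by rewrite divr_gt0// dl_moment_gt0// (new_time_ge0 (dl_rs dl) t0).
exists (log_moment t + ln th); last first.
  rewrite /excess_rate /excess expRD exp_log_moment lnK ?posrE// (dl_moment dl t0).
  by rewrite -mulrA /th [_ * (_ / _)]mulrC divfK// gt_eqF.
rewrite addrC addKr.
have th1 : `|th - 1| <= 1 - expR (- d).
  have -> : th - 1 = (moment p (v (h t)) - rho * MU) / (rho * MU).
    by rewrite /th mulrBl divff// gt_eqF.
  rewrite normrM normfV (gtr0_norm rM) ler_pdivrMr//.
  by apply: (le_trans close); rewrite -mulrA [MU * _]mulrC.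
have e0 := expR_gt0 (- d); move: th1; rewrite ler_norml => /andP[t1 t2].
have ed : expR (- d) * expR d = 1 by rewrite -expRD addNr expR0.
have t3 : th <= expR d.
  apply: (@le_trans _ _ (2 - expR (- d))); first by lra.
  have := sqr_ge0 (expR d - 1); rewrite expr2 => sq.
  by rewrite -(ler_pM2l e0) ed; nra.
rewrite ler_norml; apply/andP; split.
  by rewrite -[leLHS]expRK ler_ln ?posrE//; lra.
by rewrite -[leRHS]expRK ler_ln ?posrE// expR_gt0.
Qed.

Lemma dl_difference t x : 0 <= t -> u t x - uinf x =
  expR (log_moment t - (p + 1) * ell t) / MU *
    (defect U v (h t) (expR (- ell t) * x) + U (expR (- ell t) * x)) - uinf x.
Proof.
move=> t0; congr (_ - _); rewrite (dl_u dl)// /defect dl_v0 subrK.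
rewrite [expR (log_moment t - _)]expRD exp_log_moment.
have -> : expR (a t - 2 * ell t) = expR (a t + (p - 1) * ell t) * expR (- ((p + 1) * ell t)).
  by rewrite -expRD; congr expR; ring.
have := lt0r_neq0 dl_rho_gt0; have := lt0r_neq0 profile_moment_gt0.
move: MU rho (expR _) (expR _) (v _ _) => M s A B w M0 s0; field.
by rewrite s0 M0.
Qed.

(** The closeness of moments, for the linear solution restarted at the time T
    from which it is close to the profile. *)
Lemma shifted_moment d T (e tau : R) : 0 <= T -> 0 < d ->
  (forall v, linear v -> nontrivial (v 0) ->
    (forall t : R, 0 <= t -> finite_moment p (v t)) ->
    (forall t : R, 0 <= t -> sqnorm r (defect U v t) <= d) ->
    forall t, tau <= t -> `|moment p (v t) - rho0 U (v 0) * MU| <= e * rho0 U (v 0)) ->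
  (forall t, T <= t -> sqnorm r (defect U v t) <= d) ->
  0 <= tau -> forall t, T + tau <= t -> `|moment p (v t) - rho * MU| <= e * rho.
Proof.
move=> T0 d0 hd small tau0 t Tt; have sv := dl_lin dl.
have sw := shift_solution fk r3 sv T0.
have nw : nontrivial (v (T + 0)).
  by rewrite addr0; exact (solution_nontrivial fk r3 rbar_le hU hgap sv dl_nontrivial T0).
have rw : rho0 U (v (T + 0)) = rho.
  by rewrite addr0 !rho0E (mass_conserved fk r3 rbar_le hU hgap sv dl_nontrivial T0) dl_v0.
have := hd _ sw nw _ _ (t - T); rewrite rw subrKC; apply; last by lra.
- by move=> s s0; apply: (dl_fin dl); lra.
- move=> s s0; rewrite (shift_defect fk r3 rbar_le hU hgap s sv dl_nontrivial T0).
  by apply: small; lra.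
Qed.

End one_solution.

Lemma half_lt (x : R) : 0 < x -> x / 2 < x.
Proof. by move=> x0; rewrite ltr_pdivrMr// ltr_pMr// ltr1n. Qed.

Lemma four_share (x y z w e : R) : x <= e / 4 -> y <= e / 16 -> z <= e / 16 ->
  w <= 2 * y + 2 * z -> 2 * x + 2 * w <= e.
Proof. by lra. Qed.

(** Undoing the dilation: the solution is close to the equilibrium when its
    moment and scale are close to their limits and the linear solution is close
    to the profile. *)
Lemma undilate_close e : 0 < e -> exists2 d, 0 < d & forall (q l : R) w,
  `|q - ln I0| <= d -> `|l| <= d -> in_H r w -> sqnorm r w <= d ->
  sqnorm r (fun x => expR (q - (p + 1) * l) / MU *
    (w (expR (- l) * x) + U (expR (- l) * x)) - uinf x) <= e.
Proof.
move=> e0; have M0 := profile_moment_gt0; have [uH _] := UH.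
pose B1 := I0 / MU + 1; have B10 : 0 < B1 by rewrite addr_gt0.
pose K := expR 1 * (expR 1 + expR r).
have K0 : 0 < K by rewrite mulr_gt0 ?addr_gt0 ?expR_gt0.
have e1 : 0 < e / (16 * B1 ^+ 2) by rewrite divr_gt0// mulr_gt0// exprn_gt0.
have [d1 d10 h1] := scale_continuous r0 uH e1.
pose e2 := Num.min 1 (e / (16 * (sqnorm r U + 1))).
have S0 := sqnorm_ge0 r U.
have e20 : 0 < e2 by rewrite lt_min ltr01 divr_gt0//; lra.
have [d2 d20 h2] := (contP (fun s => expR s) 0).1 (@continuous_expR R 0) (d1 / 2) ltac:(lra).
have e3 : 0 < e2 * MU by rewrite mulr_gt0.
have [d3 d30 h3] := (contP (fun s => expR s) (ln I0)).1 (@continuous_expR R (ln I0)) _ e3.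
pose d := Num.min (Num.min 1 (d2 / 2)) (Num.min (d3 / (2 * (p + 2))) (e / (4 * B1 ^+ 2 * K + 1))).
have p2 : 0 < 2 * (p + 2) by rewrite mulr_gt0// addr_gt0.
have BK : 0 < 4 * B1 ^+ 2 * K + 1 by rewrite addr_gt0// !mulr_gt0// exprn_gt0.
exists d; first by rewrite !lt_min ltr01 !divr_gt0.
move=> q l w qd ld wH ws.
have dd1 : d <= 1 by rewrite !ge_min lexx.
have dd2 : d <= d2 / 2 by rewrite !ge_min lexx !orbT.
have dd3 : d <= d3 / (2 * (p + 2)) by rewrite !ge_min lexx !orbT.
have dd4 : d <= e / (4 * B1 ^+ 2 * K + 1) by rewrite !ge_min lexx !orbT.
have c0 := expR_gt0 (- l); set c := expR (- l) in c0 *.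
set B := expR (q - (p + 1) * l) / MU.
have B0 : 0 <= B by rewrite divr_ge0 ?expR_ge0// ltW.
have Bd : `|B - I0 / MU| <= e2.
  rewrite /B -mulrBl normrM normfV (gtr0_norm M0) ler_pdivrMr//.
  rewrite -[X in _ - X](lnK (x := I0)) ?posrE//; apply: h3.
  have -> : q - (p + 1) * l - ln I0 = (q - ln I0) - (p + 1) * l by ring.
  apply: (le_lt_trans (ler_normB _ _)); rewrite normrM gtr0_norm ?addr_gt0//.
  rewrite ler_pdivlMr// in dd3.
  have : (p + 1) * `|l| <= (p + 1) * d by rewrite ler_wpM2l// addr_ge0// ltW.
  by have := d30; lra.
have e21 : e2 <= 1 by rewrite ge_min lexx.
have e2S : e2 <= e / (16 * (sqnorm r U + 1)) by rewrite ge_min lexx orbT.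
have BB : B <= B1.
  by move: Bd; rewrite ler_norml /B1 => /andP[_]; lra.
have cd : `|c - 1| < d1.
  have := h2 (- l); rewrite subr0 normrN expR0 => /(_ (le_lt_trans (le_trans ld dd2) (half_lt d20))).
  by move=> h; apply: (le_lt_trans h); exact: half_lt.
have [_ i1 le1] := h1 c cd.
have [i2 le2] := in_H_scale c0 wH.
have cK : c^-1 * (c^-1 + (c `^ r)^-1) <= K.
  have l1 : l <= 1 := le_trans (ler_norm _) (le_trans ld dd1).
  have ci : c^-1 <= expR 1 by rewrite /c expRN invrK ler_expR.
  have cr : (c `^ r)^-1 <= expR r.
    rewrite /c -expRM -expRN ler_expR mulNr opprK.
    by rewrite -[leRHS]mul1r ler_wpM2r.
  apply: ler_pM; rewrite ?invr_ge0 ?(ltW c0)//.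
    by rewrite addr_ge0// invr_ge0 ?powR_ge0// ltW.
  exact: lerD.
have [i12 le12] := in_HD (in_HZ B i1) (in_HZ (B - I0 / MU) uH).
have [_ le] := in_HD (in_HZ B i2) i12.
have E : sqnorm r (fun x => B * (w (c * x) + U (c * x)) - uinf x) =
    sqnorm r (fun x => B * w (c * x) + (B * (U (c * x) - U x) + (B - I0 / MU) * U x)).
  by apply: eq_sqnorm => x _; rewrite /equilibrium; ring.
rewrite E; apply: (le_trans le).
rewrite !(sqnormZ B)// in le12 *; rewrite (sqnormZ _ uH) in le12.
have B2 : B ^+ 2 <= B1 ^+ 2 by rewrite lerXn2r ?nnegrE// ltW.
have t1 : B ^+ 2 * sqnorm r (fun x => w (c * x)) <= B1 ^+ 2 * K * d.
  rewrite -mulrA; apply: ler_pM; rewrite ?sqr_ge0 ?sqnorm_ge0//.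
  apply: (le_trans le2); apply: ler_pM => //; rewrite ?sqnorm_ge0//.
  by rewrite mulr_ge0 ?addr_ge0 ?invr_ge0 ?powR_ge0// ltW.
have t2 : B ^+ 2 * sqnorm r (fun x => U (c * x) - U x) <= B1 ^+ 2 * (e / (16 * B1 ^+ 2)).
  by apply: ler_pM; rewrite ?sqr_ge0 ?sqnorm_ge0.
have t3 : (B - I0 / MU) ^+ 2 * sqnorm r U <= e / 16.
  have b2 : (B - I0 / MU) ^+ 2 <= e2.
    rewrite -(real_normK (num_real (B - _))) expr2; have := normr_ge0 (B - I0 / MU).
    by move=> n0; apply: (le_trans (ler_pM n0 n0 Bd Bd)); rewrite ler_piMr// ltW.
  apply: (@le_trans _ _ (e2 * sqnorm r U)); first by rewrite ler_wpM2r.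
  rewrite ler_pdivlMr in e2S; last by rewrite mulr_gt0// ltr_wpDl.
  rewrite ler_pdivlMr//; apply: le_trans e2S.
  by rewrite -mulrA ler_pM2l// mulrC ler_pM2l// lerDl.
have t2' : B1 ^+ 2 * (e / (16 * B1 ^+ 2)) = e / 16 by field; rewrite gt_eqF.
have t1' : B1 ^+ 2 * K * d <= e / 4.
  have d0 : 0 <= d by apply: le_trans qd.
  rewrite ler_pdivlMr// in dd4; rewrite ler_pdivlMr//; apply: le_trans dd4.
  rewrite [leRHS]mulrDr mulr1; apply: ler_wpDr => //.
  by rewrite le_eqVlt; apply/predU1P; left; ring.
rewrite t2' in t2; exact: four_share (le_trans t1 t1') t2 t3 le12.
Qed.

(** The linear solution conserves mass, so only the amplitude matters. *)
Lemma dl_mass u v ell h a t : dilation u v ell h a -> nontrivial (u 0) -> 0 <= t ->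
  mass (u t) = expR (a t) * mass (u 0).
Proof.
move=> dl nt t0; have sv := dl_lin dl; have ht := new_time_ge0 (dl_rs dl) t0.
rewrite -(dl_v0 dl) -(mass_conserved fk r3 rbar_le hU hgap sv (dl_nontrivial dl nt) ht).
have vH := (solution_in_H sv ht).1.
have i0 := pair_int r3 vH sublinear_id.
have [i1 e1] := integralp_scale (expR_gt0 (- ell t)) i0.
rewrite /mass /pair -[integralp (fun x => v (h t) x * x)]mul1r.
have E (x : R) : 0 < x -> expR (a t - ell t) * (v (h t) (expR (- ell t) * x) * (expR (- ell t) * x)) = u t x * x.
  move=> x0; rewrite (dl_u dl)//.
  have -> : expR (a t - ell t) = expR (a t - 2 * ell t) * expR (ell t) by rewrite -expRD; congr expR; ring.
  have e2 : expR (ell t) * expR (- ell t) = 1 by rewrite -expRD subrr expR0.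
  rewrite [RHS](_ : _ = expR (a t - 2 * ell t) * (expR (ell t) * expR (- ell t)) * (v (h t) (expR (- ell t) * x) * x)); last first.
    by rewrite e2; ring.
  by ring.
rewrite -(eq_integralp E) (integralpZ _ i1) e1 -expRN opprK mul1r mulrA -expRD subrK.
by [].
Qed.

(** The mass of a steady state does not change, so its growth rate is mu and its
    moment is I0.  It is then a steady state of the linear equation, and the
    spectral gap makes it a multiple of the profile. *)
Theorem steady_unique w : steady_state beta gamma kappa mu r p f w -> nontrivial w ->
  ae_pos (fun x => w x = uinf x).
Proof.
move=> sw nt; have [v [ell [h [a dl]]]] := dilation_exists sw; have [fw _ gw] := sw.
have wH := solution_in_H gw (lexx 0).
have m0 := mass_gt0 r3 wH nt.
have a1 : a 1 = 0.
  have := dl_mass dl nt ler01 => /= E.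
  have e1 : expR (a 1) = 1 by apply: (mulIf (lt0r_neq0 m0)); rewrite mul1r -E.
  by rewrite -[LHS]expRK e1 ln1.
have rs := dl_rs dl.
have fI : f (moment p w) = mu.
  have [||c _] := @MVT_cc _ a (fun=> f (moment p w) - mu) 0 1 ler01.
  - by move=> x /andP[x0 _]; apply: (rs_a rs); exact: ltW.
  - by move=> x /andP[x0 _]; have [] := rs_cont rs x0.
  by rewrite a1 (rs_a0 rs) !subr0 mulr1 => /esym/eqP; rewrite subr_eq0 => /eqP.
have mw : moment p w = I0.
  by apply: f_level => //; apply: moment_ge0 => //; [exact: in_H_meas wH.1|exact: wH.2].
have lw : linear (fun=> w) by move: gw; rewrite /linear_solution fI.
have dw := defect_in_H rbar_le hU lw (lexx 0).
have s0 : sqnorm r (defect U (fun=> w) 0) = 0.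
  apply/eqP; rewrite eq_le sqnorm_ge0 andbT; apply/ler_addgt0Pr => e e0; rewrite add0r.
  by have [T T0 hT] := gap_limit hgap lw nt e0; have := hT T (lexx T).
have rho := rho0_gt0 r3 rbar_le hU wH nt.
have ae1 : ae_pos (fun x => w x = rho0 U w * U x).
  apply: ae_pos1 (sqnorm_eq0 dw s0) => x _; rewrite /defect => /eqP.
  by rewrite subr_eq0 => /eqP <-; rewrite mulrA divff ?mul1r// gt_eqF.
have rE : rho0 U w = I0 / MU.
  have M0 := profile_moment_gt0; apply: (mulIf (lt0r_neq0 M0)).
  apply: (etrans _ (esym (divfK (lt0r_neq0 M0) I0))); rewrite -mw.
  have fU := profile_moment rbar_le hU p0 pr.
  rewrite /moment -!/(integralp _) -(integralpZ (rho0 U w) fU); apply: ae_integralp.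
  - exact: integrablep_meas (integrablepZ _ fU).
  - exact: integrablep_meas (fw 0 (lexx 0)).
  - by apply: ae_pos1 ae1 => x _ ->; ring.
by apply: ae_pos1 ae1 => x _ ->; rewrite rE.
Qed.

Hypothesis f_der : derive1 f I0 < 0.

Let ex_cont : forall t : R, {for t, continuous (excess f mu)} := @excess_cont R f mu f_C1.
Let ex_sign := excess_sign I00 f_C1 f_limsup f_level f_I0 f_der.
Let ex_sep := excess_sep I00 f_C1 f_limsup f_level f_I0 f_der.

Lemma shape_tolerance d : 0 < d -> 0 < (1 - expR (- d)) * MU.
Proof.
move=> d0; rewrite mulr_gt0 ?profile_moment_gt0// subr_gt0.
by rewrite -[X in _ < X]expR0 ltr_expR oppr_lt0.
Qed.

Theorem attraction u e : nonlinear u -> nontrivial (u 0) -> 0 < e ->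
  exists2 T, 0 <= T & forall t, T <= t -> sqnorm r (fun x => u t x - uinf x) <= e.
Proof.
move=> nu nt e0; have [v [ell [h [a dl]]]] := dilation_exists nu.
have rs := dl_rs dl; have sv := dl_lin dl; have ntv := dl_nontrivial dl nt.
have [B hB] := excess_bound mu0 f_ge0 f_C1 f_limsup.
have [d d0 hd] := undilate_close e0.
have tj := dl_trajectory dl.
have tr d' : 0 < d' -> exists2 T, 0 <= T &
    tracks (excess f mu) (log_moment u ell a) (excess_rate u) d' T.
  move=> d'0; have tol := shape_tolerance d'0.
  have [dd dd0 hdd] := moment_close fk r3 mu0 rbar_le hU hgap p0 pr tol ltr01.
  have [T T0 hT] := gap_limit hgap sv ntv dd0.
  exists (@late R gamma mu (T + 1)); first exact: late_ge0.
  move=> t lt; have t0 : 0 <= t by apply: le_trans lt; exact: late_ge0.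
  apply: (dl_tracks dl nt d'0 t0).
  exact: (shifted_moment dl nt T0 dd0 hdd hT ler01 (new_time_late gamma0 mu0 rs lt)).
have [T1 T10 h1] := dilation_converges mu0 gamma0 p0 ex_cont ex_sign ex_sep hB
  (excess_unif mu f_C1) tj tr d0.
have [T2 T20 h2] := gap_limit hgap sv ntv d0.
exists (Num.max T1 (@late R gamma mu T2)); first by rewrite le_max T10.
move=> t; rewrite ge_max => /andP[t1 t2]; have t0 : 0 <= t by apply: le_trans t1.
have [qd ld] := h1 t t1; have ht := new_time_late gamma0 mu0 rs t2.
have ht0 := new_time_ge0 rs t0.
have := hd _ _ _ qd ld (defect_in_H rbar_le hU sv ht0) (h2 _ ht).
by congr (_ <= _); apply: eq_sqnorm => x _; rewrite (dl_difference dl nt x t0).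
Qed.

(** The mass is continuous in norm, so a small perturbation of the equilibrium
    has nearly its mass, hence the multiple of the profile that it tends to under
    the linear equation is nearly the equilibrium. *)
Lemma initial_close eta : 0 < eta -> exists2 d, 0 < d & forall h0, in_Hplus r h0 ->
  nontrivial h0 -> sqnorm r (fun x => h0 x - uinf x) <= d ->
  `|ln (rho0 U h0 * MU) - ln I0| <= eta /\
  sqnorm r (fun x => (rho0 U h0)^-1 * h0 x - U x) <= eta.
Proof.
move=> eta0; have M0 := profile_moment_gt0; have [uH _] := UH.
have mU := profile_mass_gt0 r3 rbar_le hU; have S0 := sqnorm_ge0 r U.
have [K K0 hK] := pair_bound r3 (@sublinear_id R).
set b := I0 / MU; have b0 : 0 < b := B00.
have [z z0 hz] := (contP (@ln R) I0).1 (continuous_ln I00) _ eta0.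
pose y := Num.min (b / 2) (z / (2 * MU)).
have y0 : 0 < y by rewrite lt_min !divr_gt0// mulr_gt0.
pose C := 8 / b ^+ 2 * (1 + K / mass U ^+ 2 * sqnorm r U) + 1.
have b2 : 0 < b ^+ 2 by rewrite exprn_gt0.
have m2 : 0 < mass U ^+ 2 by rewrite exprn_gt0.
have Km : 0 <= K / mass U ^+ 2 by rewrite divr_ge0// ltW.
have C0 : 0 < C.
  by rewrite /C ltr_wpDl// mulr_ge0 ?divr_ge0 ?(ltW b2)// addr_ge0// mulr_ge0.
have K1 : 0 < K / mass U ^+ 2 + 1 by rewrite ltr_wpDl.
exists (Num.min (y ^+ 2 / (K / mass U ^+ 2 + 1)) (eta / C)).
  by rewrite lt_min !divr_gt0// exprn_gt0.
move=> h0 hp nt; rewrite le_min => /andP[n1 n2]; have [hh _] := hp.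
set n := sqnorm r _ in n1 n2; have n0 : 0 <= n := sqnorm_ge0 _ _.
have rho := rho0_gt0 r3 rbar_le hU hp nt; set A := rho0 U h0 in rho *.
have infH : in_H r uinf by exact: in_HZ.
have [dH _] := in_HB hh infH.
have dm : A - b = mass (fun x => h0 x - uinf x) / mass U.
  rewrite /mass (pairBl r3 hh infH sublinear_id) (pairZl _ r3 uH sublinear_id) -!/(mass _).
  by rewrite /A rho0E mulrBl mulfK// gt_eqF.
have E : sqnorm r (fun x => A^-1 * h0 x - U x) =
    sqnorm r (fun x => A^-1 * (h0 x - uinf x) + (b - A) / A * U x).
  by apply: eq_sqnorm => x _; rewrite /equilibrium -/b; field; rewrite gt_eqF.
have bM : b * MU = I0 by exact: (divfK (lt0r_neq0 M0)).
clearbody b A; have AI : A * MU - I0 = (A - b) * MU by rewrite mulrBl bM.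
have b20 : 0 <= b / 2 by rewrite divr_ge0// ltW.
have Ab2 : (A - b) ^+ 2 <= K / mass U ^+ 2 * n.
  by rewrite dm exprMn exprVn [leRHS]mulrAC ler_pM2r ?invr_gt0//; exact: hK.
have Aby : `|A - b| <= y.
  apply: le_of_sqr2; first exact: ltW.
  rewrite real_normK ?num_real//; apply: (le_trans Ab2).
  by move: n1; rewrite ler_pdivlMr//; lra.
have yb : y <= b / 2 by rewrite ge_min lexx.
have yz : y <= z / (2 * MU) by rewrite ge_min lexx orbT.
have Ab : b / 2 <= A by move: Aby; rewrite ler_norml => /andP[]; lra.
split.
  apply: hz; rewrite AI.
  rewrite normrM (gtr0_norm M0); apply: (@le_lt_trans _ _ (y * MU)); first by rewrite ler_wpM2r// ltW.
  rewrite ler_pdivlMr ?mulr_gt0// in yz; lra.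
have [_ le] := in_HD (in_HZ A^-1 dH) (in_HZ ((b - A) / A) uH).
rewrite E; apply: (le_trans le); rewrite (sqnormZ _ dH) (sqnormZ _ uH) -/n.
have Ai : A^-1 ^+ 2 <= 4 / b ^+ 2.
  have -> : 4 / b ^+ 2 = ((b / 2) ^+ 2)^-1 by field; rewrite gt_eqF.
  have h2 : 0 < b / 2 by rewrite divr_gt0.
  rewrite exprVn lef_pV2 ?posrE ?exprn_gt0//.
  by apply: lerXn2r; rewrite ?nnegrE// ltW.
have t1 : A^-1 ^+ 2 * n <= 4 / b ^+ 2 * n by rewrite ler_wpM2r.
have t2 : ((b - A) / A) ^+ 2 * sqnorm r U <= 4 / b ^+ 2 * (K / mass U ^+ 2 * n) * sqnorm r U.
  rewrite ler_wpM2r// exprMn mulrC; apply: ler_pM; rewrite ?sqr_ge0//.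
  by rewrite -sqrrN opprB.
move: n2; rewrite ler_pdivlMr// => n2; apply: le_trans n2.
apply: (@le_trans _ _ (2 * (4 / b ^+ 2 * n) + 2 * (4 / b ^+ 2 * (K / mass U ^+ 2 * n) * sqnorm r U))).
  by apply: lerD; rewrite ler_pM2l.
have -> : n * C = 2 * (4 / b ^+ 2 * n) + 2 * (4 / b ^+ 2 * (K / mass U ^+ 2 * n) * sqnorm r U) + n.
  by rewrite /C; ring.
by rewrite lerDl.
Qed.

(** The drift brings ell back to 0, so only the growth rate can push it away. *)
Lemma dl_early u v ell h a B t : dilation u v ell h a -> nontrivial (u 0) ->
  (forall s, `|excess f mu s| <= B) -> 0 <= t -> `|ell t| <= B * t.
Proof.
move=> dl nt hB t0; have tj := dl_trajectory dl; have rs := dl_rs dl.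
have dBt (s : R) : is_derive s 1 (fun t => B * t) B.
  by apply: (derE (derZ B (derI s))); rewrite mulr1.
have B0 : 0 <= B by exact: le_trans (normr_ge0 _) (hB 0).
have eb s : 0 <= s -> `|excess_rate u s| <= B by move=> s0; exact: (excess_rate_bound dl nt hB s0).
rewrite ler_norml; apply/andP; split.
  have d1 (s : R) : 0 <= s -> is_derive s 1 (fun t => - ell t - B * t)
      (- (excess_rate u s - drift mu gamma (ell s)) - B).
    by move=> s0; exact: derB (derN (tj_ell tj s0)) (dBt s).
  have := @stays_below _ (fun t => - ell t - B * t) (fun s => - (excess_rate u s - drift mu gamma (ell s)) - B) 0 0.
  have c1 (s : R) : 0 <= s -> {for s, continuous (fun t => - ell t - B * t)} by move=> s0; exact: is_derive_cont (d1 s s0).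
  move=> /(_ c1 (fun s s0 => d1 s (ltW s0))) H.
  suff : - ell t - B * t <= 0 by lra.
  apply: H => //; last by rewrite (rs_ell0 rs) mulr0 subr0 oppr0.
  move=> s s0 hs; have := eb s (ltW s0); rewrite ler_norml => /andP[e1 e2].
  have l0 : ell s <= 0 by have : 0 <= B * s; [rewrite mulr_ge0// ltW|lra].
  have : drift mu gamma (ell s) <= 0 by rewrite -(drift0 mu gamma); exact: (drift_incr mu0 gamma0 l0).
  by lra.
have d1 (s : R) : 0 <= s -> is_derive s 1 (fun t => ell t - B * t)
    (excess_rate u s - drift mu gamma (ell s) - B).
  by move=> s0; exact: derB (tj_ell tj s0) (dBt s).
have := @stays_below _ (fun t => ell t - B * t) (fun s => excess_rate u s - drift mu gamma (ell s) - B) 0 0.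
have c1 (s : R) : 0 <= s -> {for s, continuous (fun t => ell t - B * t)} by move=> s0; exact: is_derive_cont (d1 s s0).
move=> /(_ c1 (fun s s0 => d1 s (ltW s0))) H.
suff : ell t - B * t <= 0 by lra.
apply: H => //; last by rewrite (rs_ell0 rs) mulr0 subr0.
move=> s s0 hs; have := eb s (ltW s0); rewrite ler_norml => /andP[e1 e2].
have l0 : 0 <= ell s by have : 0 <= B * s; [rewrite mulr_ge0// ltW|lra].
have : 0 <= drift mu gamma (ell s) by rewrite -(drift0 mu gamma); exact: (drift_incr mu0 gamma0 l0).
by lra.
Qed.

Lemma dl_early_moment u v ell h a B t : dilation u v ell h a -> nontrivial (u 0) ->
  (forall s, `|excess f mu s| <= B) -> 0 <= t -> B * t <= 1 ->
  `|log_moment u ell a t - log_moment u ell a 0| <=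
  (p * B + `|p - 1| * (drift mu gamma 1 + mu)) * t.
Proof.
move=> dl nt hB t0 Bt; have tj := dl_trajectory dl.
have B0 : 0 <= B by exact: le_trans (normr_ge0 _) (hB 0).
set K := p * B + _; pose dq s := p * excess_rate u s - (p - 1) * drift mu gamma (ell s).
have dqK s : 0 <= s -> s <= t -> `|dq s| <= K.
  move=> s0 st; have ls : `|ell s| <= 1.
    by apply: (le_trans (dl_early dl nt hB s0)); apply: le_trans Bt; rewrite ler_wpM2l.
  apply: (le_trans (ler_normB _ _)); rewrite (normrM p) (normrM (p - 1)) (gtr0_norm p0); apply: lerD.
    by rewrite ler_pM2l//; exact: (excess_rate_bound dl nt hB s0).
  rewrite ler_wpM2l//; move: ls; rewrite ler_norml => /andP[l1 l2].
  have := drift_incr mu0 gamma0 l2.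
  have : - mu <= drift mu gamma (ell s).
    by rewrite /drift mulrBr mulr1 lerBrDr addNr mulr_ge0 ?expR_ge0// ltW.
  have d10 : 0 <= drift mu gamma 1 by rewrite -(drift0 mu gamma); exact: (drift_incr mu0 gamma0 ler01).
  by have := mu0 => m0 h1 h2; rewrite ler_norml; apply/andP; split; lra.
have d1 (s : R) : 0 < s < t -> is_derive s 1 (log_moment u ell a) (dq s).
  by move=> /andP[s0 _]; apply: (tj_q tj); exact: ltW.
have c1 (s : R) : 0 <= s <= t -> {for s, continuous (log_moment u ell a)}.
  by move=> /andP[s0 _]; exact: is_derive_cont (tj_q tj s0).
have up (s : R) : 0 < s < t -> dq s <= K.
  by move=> /andP[s0 st]; apply: (le_trans (ler_norm _)); apply: dqK; exact: ltW.
have dn (s : R) : 0 < s < t -> - dq s <= K.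
  by move=> /andP[s0 st]; apply: (le_trans (ler_norm _)); rewrite normrN; apply: dqK; exact: ltW.
have h1 := incr_bound t0 d1 c1 up.
have h2 := @incr_bound _ (fun s => - log_moment u ell a s) (fun s => - dq s) 0 t K t0
  (fun s hs => derN (d1 s hs)) (fun s hs => continuousN (c1 s hs)) dn.
by rewrite subr0 in h1 h2; rewrite ler_norml; apply/andP; split; lra.
Qed.

(** The norm may not control the moment of the initial density, so nothing is
    known of the growth rate during a short time t1; but meanwhile the scale and
    the logarithm of the moment move at bounded speed.  After t1 the linear
    solution has run for a positive time tau, and its moment is close to that of
    the profile. *)
Theorem stability e : 0 < e -> exists2 d, 0 < d & forall u, nonlinear u ->
  nontrivial (u 0) -> sqnorm r (fun x => u 0 x - uinf x) <= d ->
  forall t, 0 <= t -> sqnorm r (fun x => u t x - uinf x) <= e.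
Proof.
move=> e0; have [d1 d10 h1] := undilate_close e0.
have [B0 hB0] := excess_bound mu0 f_ge0 f_C1 f_limsup.
pose B := Num.max 1 B0; have hB s : `|excess f mu s| <= B by rewrite le_max hB0 orbT.
have B1 : 1 <= B by rewrite le_max lexx.
have [d2 d20 h2] := dilation_stable mu0 gamma0 p0 ex_cont ex_sign ex_sep (excess_unif mu f_C1) d10.
pose d3 := Num.min (Num.min d1 d2) 1; have d30 : 0 < d3 by rewrite !lt_min d10 d20 ltr01.
have d31 : d3 <= d1 by rewrite !ge_min lexx.
have d32 : d3 <= d2 by rewrite !ge_min lexx !orbT.
have d33 : d3 <= 1 by rewrite ge_min lexx orbT.
pose K := p * B + `|p - 1| * (drift mu gamma 1 + mu).
have D1 : 0 <= drift mu gamma 1 by rewrite -(drift0 mu gamma); exact: (drift_incr mu0 gamma0 ler01).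
have Bp : 0 < B by lra.
have K0 : 0 < K.
  by rewrite ltr_pwDl ?mulr_gt0// mulr_ge0// addr_ge0// ltW.
pose t1 := Num.min (d3 / B) (d3 / (2 * K)).
have t10 : 0 < t1 by rewrite lt_min !divr_gt0// mulr_gt0.
have Bt1 : B * t1 <= d3.
  have : t1 <= d3 / B by rewrite ge_min lexx.
  by rewrite ler_pdivlMr// mulrC.
have Kt1 : K * t1 <= d3 / 2.
  have : t1 <= d3 / (2 * K) by rewrite ge_min lexx orbT.
  by rewrite ler_pdivlMr ?mulr_gt0//; lra.
have gm : 0 < gamma * mu by rewrite mulr_gt0.
pose tau := ln (1 + gamma * mu * t1) / (gamma * mu).
have tau0 : 0 < tau by rewrite divr_gt0// ln_gt0// ltrDl mulr_gt0.
have tol := shape_tolerance d20.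
have [dd dd0 hdd] := moment_close fk r3 mu0 rbar_le hU hgap p0 pr tol tau0.
have [al [C [al0 C0 hC]]] := gap_decay hgap.
pose eta := Num.min (d3 / 2) (Num.min dd d1 / (C + 1)).
have C1 : 0 < C + 1 by rewrite ltr_wpDl.
have eta0 : 0 < eta by rewrite lt_min !divr_gt0// lt_min dd0.
have eta3 : eta <= d3 / 2 by rewrite ge_min lexx.
have etaC : C * eta <= Num.min dd d1.
  have : eta <= Num.min dd d1 / (C + 1) by rewrite ge_min lexx orbT.
  by rewrite ler_pdivlMr//; lra.
have [d d0 hd] := initial_close eta0; exists d => // u nu nt ud t t0.
have [v [ell [h [a dl]]]] := dilation_exists nu.
have rs := dl_rs dl; have sv := dl_lin dl; have ntv := dl_nontrivial dl nt; have tj := dl_trajectory dl.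
have uH : in_Hplus r (u 0) by rewrite -(dl_v0 dl); exact (solution_in_H sv (lexx 0)).
have [q00 def0] := hd _ uH nt ud.
have defE : defect U v 0 = fun x => (rho0 U (u 0))^-1 * u 0 x - U x.
  by apply/funext => x; rewrite /defect (dl_v0 dl).
have def s : 0 <= s -> sqnorm r (defect U v s) <= Num.min dd d1.
  move=> s0; apply: (le_trans (hC v sv ntv s s0)); apply: le_trans etaC; rewrite defE.
  have e1 : expR (- al * s) <= 1 by rewrite -expR0 ler_expR mulNr oppr_le0 mulr_ge0// ltW.
  have Cn : C * sqnorm r (fun x => (rho0 U (u 0))^-1 * u 0 x - U x) <= C * eta by rewrite ler_wpM2l.
  by apply: le_trans Cn; apply: ler_piMr => //; apply: mulr_ge0 => //; exact: sqnorm_ge0.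
have defd1 s : 0 <= s -> sqnorm r (defect U v s) <= d1.
  by move=> s0; apply: (le_trans (def s s0)); rewrite ge_min lexx orbT.
have defdd s : 0 <= s -> sqnorm r (defect U v s) <= dd.
  by move=> s0; apply: (le_trans (def s s0)); rewrite ge_min lexx.
have q0E : log_moment u ell a 0 = ln (rho0 U (u 0) * MU).
  by rewrite /log_moment (rs_a0 rs) (rs_ell0 rs) mulr0 !add0r.
have early s : 0 <= s -> s <= t1 -> `|log_moment u ell a s - ln I0| <= d3 /\ `|ell s| <= d3.
  move=> s0 st; have Bs : B * s <= d3 by apply: le_trans Bt1; rewrite ler_pM2l.
  split; last by apply: le_trans Bs; exact: (dl_early dl nt hB s0).
  have := dl_early_moment dl nt hB s0 (le_trans Bs d33); rewrite -/K => h3.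
  have h4 : K * s <= d3 / 2 by apply: le_trans Kt1; rewrite ler_pM2l.
  rewrite -[_ - ln I0](subrKA (log_moment u ell a 0)).
  apply: (le_trans (ler_normD _ _)); rewrite q0E in h3 *; rewrite [d3]splitr.
  by apply: lerD; [exact: le_trans h4|exact: le_trans eta3].
have close : `|log_moment u ell a t - ln I0| <= d1 /\ `|ell t| <= d1.
  have [tt|tt] := leP t t1.
    by have [m1 m2] := early t t0 tt; split; exact: le_trans d31.
  have [m1 m2] := early t1 (ltW t10) (lexx t1).
  apply: (h2 _ _ _ t1 tj (ltW t10)); [|exact: le_trans d32|exact: le_trans d32|exact: ltW].
  move=> s ts; have s0 : 0 <= s := le_trans (ltW t10) ts.
  apply: (dl_tracks dl nt d20 s0).
  have hs : 0 + tau <= h s.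
    rewrite add0r; apply: le_trans (rs_hge rs s0).
    rewrite ler_pM2r ?invr_gt0// ler_ln ?posrE ?lerD2l ?ler_pM2l//.
      by rewrite addr_gt0// mulr_gt0.
    by rewrite addr_gt0// mulr_gt0// (lt_le_trans t10).
  exact: (shifted_moment dl nt (lexx 0) dd0 hdd defdd (ltW tau0) hs).
have ht0 := new_time_ge0 rs t0.
have := h1 _ _ _ close.1 close.2 (defect_in_H rbar_le hU sv ht0) (defd1 _ ht0).
by congr (_ <= _); apply: eq_sqnorm => x _; rewrite (dl_difference dl nt x t0).
Qed.

End nonlinear_equation.

(** * Existence, uniqueness and global stability of the steady state *)

Unset Implicit Arguments.

Theorem corollary1p3 (R : realType)
  (beta mu p gamma : R)
  (hbeta : 0 < beta) (hmu : 0 < mu) (hp : 0 < p) (hgamma : 0 < gamma <= 2)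
  (kappa : R -> R)
  (hkappa_meas : measurable_fun (`[0, 1] : set R) kappa)
  (hkappa_bound : exists k1 k2 : R, [/\ 0 < k1, 0 < k2 &
     forall z, 0 <= z <= 1 -> k1 <= kappa z <= k2])
  (hkappa_mass : \int[@lebesgue_measure R]_(z in `[0, 1]) (z * kappa z) = 1)
  (rbar : R) (hrbar : 3 <= rbar)
  (U : R -> R)
  (hU : stationary_profile beta gamma kappa mu rbar U)
  (hgap : forall s, rbar <= s -> spectral_gap beta gamma kappa mu s U)
  (r : R) (hr : Num.max rbar (2 * p + 1) <= r)
  (f : R -> R)
  (hf_nonneg : forall I, 0 <= I -> 0 <= f I)
  (hf_C1 : C1_Rplus f)
  (hf_limsup : (limf_esup (fun I => (f I)%:E) (pinfty_nbhs R) < mu%:E)%E)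
  (hN : exists2 I0 : R, 0 < I0 & [set I : R | 0 <= I /\ f I = mu] = [set I0]) :
  exists uinf : R -> R,
    [/\ steady_state beta gamma kappa mu r p f uinf,
        nontrivial uinf,
        (forall w, steady_state beta gamma kappa mu r p f w -> nontrivial w ->
           ae_pos (fun x => w x = uinf x)) &
        (derive1 f (moment p uinf) < 0 ->
           globally_asymptotically_stable beta gamma kappa mu r p f uinf)].
Proof.
have [k1 [k2 [k10 k20 kb]]] := hkappa_bound.
have fk := FragKernel hbeta hgamma hkappa_meas k10 k20 kb hkappa_mass.
move: hr; rewrite ge_max => /andP[rbar_le pr].
have gap := hgap r rbar_le.
(* The exponent 3 is excluded by the finiteness of the first moment on the
   whole cone. *)
have r3 : 3 < r.
  rewrite lt_neqAle (le_trans hrbar rbar_le) andbT; apply/eqP => r_3.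
  have [v0 v0H inf] := @first_moment_exponent3 R.
  have rb3 : rbar <= 3 by rewrite r_3.
  by apply: inf; exact: (hgap 3 rb3).1 v0H.
have [I0 I00 level] := hN.
have [_ fI0] : 0 <= I0 /\ f I0 = mu.
  have : [set I : R | 0 <= I /\ f I = mu] I0 by rewrite level.
  by [].
have f_level (I : R) : 0 <= I -> f I = mu -> I = I0.
  move=> I_0 fI; have : [set I : R | 0 <= I /\ f I = mu] I by split.
  by rewrite level.
pose uinf := equilibrium p U I0; exists uinf.
have eqm : moment p uinf = I0 := equilibrium_moment rbar_le hp pr hU I0.
have sqH u (t : R) : H_norm r (u t \- uinf) ^+ 2 = sqnorm r (fun x => u t x - uinf x).
  by rewrite sqr_H_norm.
split.
- exact (equilibrium_steady fk r3 rbar_le hp pr hU I00 fI0).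
- exact (equilibrium_nontrivial rbar_le hp pr hU I00).
- move=> w sw nt.
  exact (steady_unique fk r3 hmu rbar_le hp pr hU gap hf_nonneg hf_C1 f_level sw nt).
rewrite eqm => f_der; split.
- move=> eps eps0; have e0 : 0 < eps ^+ 2 / 2 by rewrite divr_gt0// exprn_gt0.
  have [d d0 hd] := stability fk r3 hmu rbar_le hp pr hU gap I00 hf_nonneg hf_C1
    hf_limsup f_level fI0 f_der e0.
  exists (Num.min 1 d); first by rewrite lt_min ltr01.
  move=> u nu nt close t t0; have n0 := H_norm_ge0 r (u 0 \- uinf).
  have ud : sqnorm r (fun x => u 0 x - uinf x) <= d.
    rewrite -(sqH u 0); move: close; rewrite lt_min => /andP[c1 cd].
    by rewrite expr2; nra.
  have := hd u nu nt ud t t0; rewrite -(sqH u t) => h.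
  have nt0 := H_norm_ge0 r (u t \- uinf).
  rewrite -(@ltr_pXn2r _ 2) ?nnegrE// ?(ltW eps0)//; apply: (le_lt_trans h).
  by rewrite ltr_pdivrMr// ltr_pMr ?exprn_gt0// ltr1n.
- move=> u nu nt; apply/cvgrPdist_le => e e0.
  have e2 : 0 < e ^+ 2 by rewrite exprn_gt0.
  have [T T0 hT] := attraction fk r3 hmu rbar_le hp pr hU gap I00 hf_nonneg hf_C1
    hf_limsup f_level fI0 f_der nu nt e2.
  exists T; split; first exact: num_real.
  move=> t Tt; have := hT t (ltW Tt); rewrite -(sqH u t) => h.
  have nt0 := H_norm_ge0 r (u t \- uinf).
  rewrite sub0r normrN ger0_norm//.
  by rewrite -(@ler_pXn2r _ 2) ?nnegrE// ltW.
Qed.
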